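(* Let $p\in\Gamma_{cl}^{0}(\mathbb{R}^{n},\mathcal{B}(\mathbb{C}^{q}))$ be such that $op(p)op(p)=op(p)$. Then $\mathrm{Res}(p)=0$.
   Context: $\Gamma_{cl}^{m}(\mathbb{R}^{n},\mathcal{B}(\mathbb{C}^q))$, $m\in\mathbb{Z}$: smooth $q\times q$-matrix-valued $a$ on $\mathbb{R}^{2n}$ with $\Vert\partial_x^\beta\partial_\xi^\alpha a\Vert\le C_{\alpha\beta}[(x,\xi)]^{m-|\alpha|-|\beta|}$ ($[y]$ a fixed smooth positive function equal to $|y|$ for $|y|\ge 1$), admitting homogeneous terms $a_{(m-j)}$ (smooth on $\mathbb{R}^{2n}\setminus\{0\}$, positively homogeneous of degree $m-j$) with $a-\sum_{j<N}\chi a_{(m-j)}$ of order $m-N$ for every $N$ and every zero excision function $\chi$. $op(a)u(x)=(2\pi)^{-n}\int e^{ix\cdot\xi}a(x,\xi)\hat u(\xi)d\xi$. Wodzicki trace: $\mathrm{Res}(a)=(2\pi)^{-n}\int_{S^{2n-1}}\mathrm{Tr}\,a_{(-2n)}(x,\xi)\,d\theta$, where $a_{(-2n)}$ is the degree $-2n$ term of the expansion, $\mathrm{Tr}$ the matrix trace and $d\theta$ the surface measure on the unit sphere $S^{2n-1}\subset\mathbb{R}^{2n}$; $\mathrm{Res}$ is a trace on $\bigcup_{m\in\mathbb{Z}}\Gamma^m_{cl}$ modulo $\Gamma^{-\infty}$. *)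

(* Defs.v *)
From Stdlib Require Import Reals.
From Coquelicot Require Import Coquelicot.
From mathcomp Require Import ssreflect ssrfun ssrbool eqtype ssrnat seq fintype bigop.
Set Implicit Arguments. Unset Strict Implicit.
Local Open Scope R_scope.

Definition Pt (N : nat) := 'I_N -> R.

Definition Mat (q : nat) := 'I_q -> 'I_q -> C.

Definition upd {N} (y : Pt N) (i : 'I_N) (t : R) : Pt N :=
  fun j => if j == i then t else y j.

Definition sumR {N} (f : 'I_N -> R) : R := \big[Rplus/0]_(j < N) f j.
Definition sumC {N} (f : 'I_N -> C) : C := \big[Cplus/RtoC 0]_(j < N) f j.

Definition enorm {N} (y : Pt N) : R := sqrt (sumR (fun j => y j ^ 2)).
Definition dotR {N} (x y : Pt N) : R := sumR (fun j => x j * y j).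
Definition vsub {N} (y z : Pt N) : Pt N := fun j => y j - z j.
Definition vscale {N} (t : R) (y : Pt N) : Pt N := fun j => t * y j.

Definition join {n} (x xi : Pt n) : Pt (n + n) :=
  fun j => match split j with inl a => x a | inr b => xi b end.

Definition cis (th : R) : C := (cos th, sin th).

Definition Cderiv (g : R -> C) (t : R) : C :=
  (Derive (fun s => fst (g s)) t, Derive (fun s => snd (g s)) t).
Definition Cex_deriv (g : R -> C) (t : R) : Prop :=
  ex_derive (fun s => fst (g s)) t /\ ex_derive (fun s => snd (g s)) t.

Definition partial {N} (i : 'I_N) (F : Pt N -> C) : Pt N -> C :=
  fun y => Cderiv (fun t => F (upd y i t)) (y i).

Fixpoint dpar {N} (ds : seq 'I_N) (F : Pt N -> C) : Pt N -> C :=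
  match ds with
  | [::] => F
  | i :: ds' => partial i (dpar ds' F)
  end.

Definition cont_at {N} (G : Pt N -> C) (y : Pt N) : Prop :=
  forall eps, 0 < eps -> exists del, 0 < del /\
    forall z, enorm (vsub z y) < del -> Cmod (Cminus (G z) (G y)) < eps.

Definition smooth_on {N} (U : Pt N -> Prop) (F : Pt N -> C) : Prop :=
  forall ds : seq 'I_N,
    (forall y, U y -> cont_at (dpar ds F) y) /\
    (forall (i : 'I_N) y, U y -> Cex_deriv (fun t => dpar ds F (upd y i t)) (y i)).

Definition smooth {N} (F : Pt N -> C) : Prop := smooth_on (fun _ => True) F.

Definition bracket_fn {N} (br : Pt N -> R) : Prop :=
  smooth (fun y => RtoC (br y)) /\ (forall y, 0 < br y) /\
  (forall y, 1 <= enorm y -> br y = enorm y).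

(** Symbol estimates of order m for a scalar function (the matrix estimates
    are imposed entrywise, equivalent to operator-norm estimates). *)
Definition sym_est {N} (br : Pt N -> R) (m : Z) (F : Pt N -> C) : Prop :=
  forall ds : seq 'I_N, exists Cst : R, forall y,
    Cmod (dpar ds F y) <= Cst * powerRZ (br y) (m - Z.of_nat (size ds))%Z.

Definition GammaM {N q} (br : Pt N -> R) (m : Z) (a : Pt N -> Mat q) : Prop :=
  forall i j : 'I_q, smooth (fun y => a y i j) /\ sym_est br m (fun y => a y i j).

Definition nonzero {N} (y : Pt N) : Prop := enorm y <> 0.

Definition homog {N q} (d : Z) (h : Pt N -> Mat q) : Prop :=
  forall (t : R) (y : Pt N) (i j : 'I_q), 0 < t -> nonzero y ->
    h (vscale t y) i j = Cmult (RtoC (powerRZ t d)) (h y i j).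

Definition zero_excision {N} (chi : Pt N -> R) : Prop :=
  smooth (fun y => RtoC (chi y)) /\
  (exists r, 0 < r /\ forall y, enorm y < r -> chi y = 0) /\
  (exists R0, forall y, R0 < enorm y -> chi y = 1).

Definition classical_with {N q} (br : Pt N -> R) (m : Z) (a : Pt N -> Mat q)
    (h : nat -> Pt N -> Mat q) : Prop :=
  GammaM br m a /\
  (forall k : nat, (forall i j : 'I_q, smooth_on nonzero (fun y => h k y i j)) /\
                   homog (m - Z.of_nat k)%Z (h k)) /\
  (forall (Nn : nat) (chi : Pt N -> R), zero_excision chi ->
     GammaM br (m - Z.of_nat Nn)%Z
       (fun y i j => Cminus (a y i j)
          (\big[Cplus/RtoC 0]_(k < Nn) Cmult (RtoC (chi y)) (h k y i j)))).

(** Integration over R^N (N = number of coordinates), as iterated improper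
    integrals over R (Coquelicot RInt_gen); for the absolutely integrable
    integrands occurring below this is the Lebesgue integral (Fubini). *)
Definition ext {k} (y : Pt k) (t : R) : Pt k.+1 :=
  fun j => match unlift ord_max j with Some j' => y j' | None => t end.

Fixpoint intRN (N : nat) : (Pt N -> C) -> C :=
  match N return (Pt N -> C) -> C with
  | 0 => fun F => F (fun _ => 0)
  | k.+1 => fun F =>
      @RInt_gen C_R_CompleteNormedModule (fun t => @intRN k (fun y => F (ext y t)))
               (Rbar_locally m_infty) (Rbar_locally p_infty)
  end.

(** Surface integral over the unit sphere S^{N-1} of R^N, via the standard
    cone formula for the surface measure:
    int_{S^{N-1}} g dtheta = N * int_{|y| <= 1} g(y/|y|) dy. *)
Definition sphere_int {N} (g : Pt N -> C) : C :=
  Cmult (RtoC (INR N))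
    (@intRN N (fun y => if Rle_dec (enorm y) 1
                       then g (vscale (/ enorm y) y) else RtoC 0)).

Definition schwartz {n q} (u : Pt n -> 'I_q -> C) : Prop :=
  forall i : 'I_q, smooth (fun x => u x i) /\
    forall (ds : seq 'I_n) (k : nat), exists Cst : R, forall x,
      (1 + enorm x) ^ k * Cmod (dpar ds (fun z => u z i) x) <= Cst.

Definition fourier {n q} (u : Pt n -> 'I_q -> C) : Pt n -> 'I_q -> C :=
  fun xi i => @intRN n (fun x => Cmult (cis (- dotR x xi)) (u x i)).

Definition op {n q} (a : Pt (n + n) -> Mat q) (u : Pt n -> 'I_q -> C)
    : Pt n -> 'I_q -> C :=
  fun x i => Cmult (RtoC (/ (2 * PI) ^ n))
    (@intRN n (fun xi => Cmult (cis (dotR x xi))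
       (sumC (fun k => Cmult (a (join x xi) i k) (fourier u xi k))))).

(** Wodzicki residue of a symbol in Gamma^0_cl(R^n) whose homogeneous terms
    are h j = a_(-j); the degree -2n term is h (2n). *)
Definition Res {n q} (h : nat -> Pt (n + n) -> Mat q) : C :=
  Cmult (RtoC (/ (2 * PI) ^ n))
    (sphere_int (fun th => sumC (fun i => h (n + n)%nat th i i))).

(* Main.v *)
(** Testing [op(p)op(p) = op(p)] on phase-space translates of a fixed Schwartz
    function that equals 1 to high order at the origin, and letting the translation tend to
    infinity along a ray, gives [h * h = h] for the sequence [h] of homogeneous
    terms and the formal star product. In the star algebra let [p = h],
    [q = 1 - p], and split the canonical coordinates [Z_a] into the part [A_a]
    commuting with [p] and the part [B_a] exchanging [p] and [q]. The relation
    [[Z_a, Z_b] = omega_ab kappa] becomes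
    [[B_a, B_b] = omega_ab kappa - [A_a, A_b]] and [[A_a, B_b] = [A_b, B_a]].
    Hence, modulo traces of commutators, which are divergences of homogeneous
    functions, the trace of [(p - q) kappa^n] is a nonzero multiple of the
    alternating sum over all permutations of [(p - q) B_1 ... B_(2n)]. The
    leading terms of the [B_a] are proportional to the first derivatives of the
    degree 0 symbol, which are linearly dependent by Euler's identity, so the
    alternating sum has no term of degree [-2n]. Thus the trace of the degree
    [-2n] term of [p] is a divergence of functions homogeneous of degree
    [1 - 2n], and its integral over the sphere vanishes. *)

Require Import Defs.
From HB Require Import structures.
From mathcomp Require Import boolp ssrint zify.
From Stdlib Require Import Reals Lra Classical ClassicalEpsilon FunctionalExtensionality ZArith.
From Coquelicot Require Import Coquelicot.
From mathcomp Require Import ssreflect ssrfun ssrbool eqtype ssrnat seq choice fintype finset bigop tuple binomial fingroup perm ssralg.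
From mathcomp Require path.
Import Defs.
Set Implicit Arguments. Unset Strict Implicit. Unset Printing Implicit Defensive.

Local Open Scope R_scope.

(** * Smooth functions *)

(** The symbol identity is extracted from operators by exact covariance: on a phase-space translate,
    [op p] acts as the quantization of the translated symbol, whose derivatives at the new centre
    decay like powers of [/ br]. Taylor remainders are thus uniformly small, and the value at the
    centre isolates the star product.

    Formal series are graded so that the deformation parameter has index 2. Then [kappa] has index
    2, each [B_a] starts at index 2, and the product of all 2n of them starts at index 4n, the very
    index at which [kappa^n] exhibits the degree -2n term. So only leading coefficients matter. They
    are matrices that need not commute, but the coefficients in Euler's identity are scalar
    coordinates, so the determinant argument survives up to a coordinate factor, which cancels off
    the origin.

    The integrand of [sphere_int] jumps on the unit sphere and at the origin, and its integral is an
    iterated Riemann integral. The divergence theorem is therefore proved with tangential fields and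
    radial cutoffs, compared with the integrand after integration in one variable. *)

HB.instance Definition _ := Monoid.isComLaw.Build R 0 Rplus
  (fun x y z => esym (Rplus_assoc x y z)) Rplus_comm Rplus_0_l.
HB.instance Definition _ := Monoid.isComLaw.Build R 1 Rmult
  (fun x y z => esym (Rmult_assoc x y z)) Rmult_comm Rmult_1_l.
HB.instance Definition _ := Monoid.isComLaw.Build C (RtoC 0) Cplus
  Cplus_assoc Cplus_comm Cplus_0_l.

Lemma sumR_le N (f g : 'I_N -> R) : (forall i, f i <= g i) -> sumR f <= sumR g.
Proof.
move=> H; apply: (big_ind2 (fun x y => x <= y)); [lra | move=> *; lra | by move=> i _; apply H].
Qed.

Lemma sumR_ge0 N (f : 'I_N -> R) : (forall i, 0 <= f i) -> 0 <= sumR f.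
Proof. by move=> H; apply: (big_ind (fun x => 0 <= x)); [lra | move=> *; lra | move=> i _; apply H]. Qed.

Lemma sumR_ge1 N (f : 'I_N -> R) j : (forall i, 0 <= f i) -> f j <= sumR f.
Proof.
move=> H; rewrite /sumR (bigD1 j) //=.
rewrite -{1}(Rplus_0_r (f j)); apply: Rplus_le_compat_l.
by apply: (big_ind (fun x => 0 <= x)); [lra | move=> *; lra | move=> i _; apply H].
Qed.

Lemma sumR_const N c : sumR (fun _ : 'I_N => c) = INR N * c.
Proof.
rewrite /sumR big_const card_ord; elim: N => [|N IH]; first by rewrite /=; lra.
by rewrite iterS IH S_INR; lra.
Qed.

Lemma sumR_scal N c (f : 'I_N -> R) : sumR (fun i => c * f i) = c * sumR f.
Proof. by rewrite /sumR; apply: (big_rec2 (fun x y => x = c * y)) => [|i x y _ ->]; lra. Qed.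

Lemma sumR_plus N (f g : 'I_N -> R) : sumR (fun i => f i + g i) = sumR f + sumR g.
Proof. by rewrite /sumR big_split. Qed.

Lemma sumR_ext N (f g : 'I_N -> R) : (forall i, f i = g i) -> sumR f = sumR g.
Proof. by move=> H; apply: eq_bigr. Qed.

Lemma sumC_ext N (f g : 'I_N -> C) : (forall i, f i = g i) -> sumC f = sumC g.
Proof. by move=> H; apply: eq_bigr. Qed.

Lemma sumC_plus N (f g : 'I_N -> C) : sumC (fun i => Cplus (f i) (g i)) = Cplus (sumC f) (sumC g).
Proof. by rewrite /sumC big_split. Qed.

Lemma sumC_scal N c (f : 'I_N -> C) : sumC (fun i => Cmult c (f i)) = Cmult c (sumC f).
Proof.
rewrite /sumC; apply: (big_rec2 (fun x y => x = Cmult c y)) => [|i x y _ ->]; first by rewrite Cmult_0_r.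
by rewrite Cmult_plus_distr_l.
Qed.

Lemma Cmod_sumC N (f : 'I_N -> C) : Cmod (sumC f) <= sumR (fun i => Cmod (f i)).
Proof.
rewrite /sumC /sumR; apply: (big_rec2 (fun x y => Cmod x <= y)) => [|i x y _ H].
  by rewrite Cmod_0; lra.
by apply: Rle_trans (Cmod_triangle _ _) _; lra.
Qed.

Lemma Cmod_fst (z : C) : Rabs z.1 <= Cmod z.
Proof. exact: Rle_trans (Rmax_l _ _) (Rmax_Cmod z). Qed.
Lemma Cmod_snd (z : C) : Rabs z.2 <= Cmod z.
Proof. exact: Rle_trans (Rmax_r _ _) (Rmax_Cmod z). Qed.
Lemma Cmod_sum (z : C) : Cmod z <= Rabs z.1 + Rabs z.2.
Proof.
rewrite -[z in Cmod z]/(z) {1}(surjective_pairing z).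
have -> : (z.1, z.2) = Cplus (RtoC z.1) (Cmult Ci (RtoC z.2)).
  by apply: injective_projections; rewrite /=; ring.
apply: Rle_trans (Cmod_triangle _ _) _; rewrite Cmod_mult !Cmod_R.
have -> : Cmod Ci = 1 by rewrite /Cmod /= -[RHS]sqrt_1; f_equal; ring.
lra.
Qed.

Lemma Cmod_cis t : Cmod (cis t) = 1.
Proof.
rewrite /Cmod /cis /= -[RHS]sqrt_1; f_equal.
by have := sin2_cos2 t; rewrite /Rsqr; lra.
Qed.

Lemma cis_add a b : cis (a + b) = Cmult (cis a) (cis b).
Proof. by rewrite /cis cos_plus sin_plus; apply: injective_projections; rewrite /=; ring. Qed.

Lemma cis0 : cis 0 = RtoC 1. Proof. by rewrite /cis cos_0 sin_0. Qed.

Lemma is_derive_mult_R (f g : R -> R) x a b :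
  is_derive f x a -> is_derive g x b ->
  is_derive (fun t => f t * g t) x (a * g x + f x * b).
Proof. by move=> /is_derive_Reals Hf /is_derive_Reals Hg; apply/is_derive_Reals; apply: derivable_pt_lim_mult. Qed.

Lemma is_derive_plus_R (f g : R -> R) x a b :
  is_derive f x a -> is_derive g x b -> is_derive (fun t => f t + g t) x (a + b).
Proof. by move=> Hf Hg; apply: is_derive_plus. Qed.

Lemma is_derive_minus_R (f g : R -> R) x a b :
  is_derive f x a -> is_derive g x b -> is_derive (fun t => f t - g t) x (a - b).
Proof. by move=> Hf Hg; apply: is_derive_minus. Qed.

(** Existence and value in one relation. [Cderiv] is total, with an arbitrary value where no
    derivative exists, so computations are done with this relation and transferred by
    [Cderiv_unique]. *)
Definition is_Cderiv (g : R -> C) (t : R) (l : C) :=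
  is_derive (fun s => (g s).1) t l.1 /\ is_derive (fun s => (g s).2) t l.2.

Lemma Cderiv_unique g t l : is_Cderiv g t l -> Cderiv g t = l.
Proof. by move=> [H1 H2]; rewrite /Cderiv (is_derive_unique _ _ _ H1) (is_derive_unique _ _ _ H2); case: l {H1 H2}. Qed.

Lemma is_Cderiv_ex g t l : is_Cderiv g t l -> Cex_deriv g t.
Proof. by move=> [H1 H2]; split; eexists; [exact: H1 | exact: H2]. Qed.

Lemma Cderiv_correct g t : Cex_deriv g t -> is_Cderiv g t (Cderiv g t).
Proof. by move=> [H1 H2]; split; apply: Derive_correct. Qed.

Lemma is_Cderiv_plus f g t a b : is_Cderiv f t a -> is_Cderiv g t b ->
  is_Cderiv (fun s => Cplus (f s) (g s)) t (Cplus a b).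
Proof. by move=> [? ?] [? ?]; split; apply: is_derive_plus_R. Qed.

Lemma is_Cderiv_mult f g t a b : is_Cderiv f t a -> is_Cderiv g t b ->
  is_Cderiv (fun s => Cmult (f s) (g s)) t (Cplus (Cmult a (g t)) (Cmult (f t) b)).
Proof.
move=> [Ha1 Ha2] [Hb1 Hb2]; split; rewrite /=.
  set l := (X in is_derive _ _ X).
  have -> : l = (a.1 * (g t).1 + (f t).1 * b.1) - (a.2 * (g t).2 + (f t).2 * b.2) by rewrite /l; ring.
  by apply: is_derive_minus_R; apply: is_derive_mult_R.
set l := (X in is_derive _ _ X).
have -> : l = (a.1 * (g t).2 + (f t).1 * b.2) + (a.2 * (g t).1 + (f t).2 * b.1) by rewrite /l; ring.
by apply: is_derive_plus_R; apply: is_derive_mult_R.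
Qed.

Lemma is_Cderiv_const c t : is_Cderiv (fun _ => c) t (RtoC 0).
Proof. by split; apply: is_derive_const. Qed.

Lemma is_Cderiv_scal c f t a : is_Cderiv f t a -> is_Cderiv (fun s => Cmult c (f s)) t (Cmult c a).
Proof.
move=> H; have := is_Cderiv_mult (is_Cderiv_const c t) H.
by congr is_Cderiv; ring.
Qed.

Lemma is_Cderiv_RtoC (f : R -> R) t a : is_derive f t a -> is_Cderiv (fun s => RtoC (f s)) t (RtoC a).
Proof. by move=> H; split=> //=; apply: is_derive_const. Qed.

Lemma is_Cderiv_cis (f : R -> R) t a : is_derive f t a ->
  is_Cderiv (fun s => cis (f s)) t (Cmult (Cmult Ci (RtoC a)) (cis (f t))).
Proof.
move=> H; split; rewrite /=.
  have -> : (0 * a - 1 * 0) * cos (f t) - (0 * 0 + 1 * a) * sin (f t) = a * (- sin (f t)) by ring.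
  exact: (is_derive_comp cos f t _ _ (is_derive_cos _) H).
have -> : (0 * a - 1 * 0) * sin (f t) + (0 * 0 + 1 * a) * cos (f t) = a * cos (f t) by ring.
exact: (is_derive_comp sin f t _ _ (is_derive_sin _) H).
Qed.

Lemma is_Cderiv_ext_loc f g t l d : 0 < d -> (forall s, Rabs (s - t) < d -> f s = g s) ->
  is_Cderiv f t l -> is_Cderiv g t l.
Proof.
move=> Hd E [H1 H2]; split.
  by apply: is_derive_ext_loc H1; exists (mkposreal d Hd) => s Hs; rewrite E.
by apply: is_derive_ext_loc H2; exists (mkposreal d Hd) => s Hs; rewrite E.
Qed.

Lemma is_Cderiv_sum n (f : 'I_n -> R -> C) (l : 'I_n -> C) t :
  (forall i, is_Cderiv (f i) t (l i)) ->
  is_Cderiv (fun s => sumC (fun i => f i s)) t (sumC l).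
Proof.
move=> H; rewrite /sumC; elim: (index_enum _) => [|i r IH].
  have -> : (fun s => \big[Cplus/RtoC 0]_(j <- [::]) f j s) = fun _ => RtoC 0.
    by apply: functional_extensionality => s; rewrite big_nil.
  by rewrite big_nil; apply: is_Cderiv_const.
have -> : (fun s => \big[Cplus/RtoC 0]_(j <- i :: r) f j s) = fun s => Cplus (f i s) (\big[Cplus/RtoC 0]_(j <- r) f j s).
  by apply: functional_extensionality => s; rewrite big_cons.
by rewrite big_cons; apply: is_Cderiv_plus.
Qed.

(** The mean value theorem fails for complex values; it is applied to the real and imaginary parts
    separately, which costs the factor 2. *)
Lemma Cderiv_bound (g g' : R -> C) a b K :
  (forall t, Rmin a b <= t <= Rmax a b -> is_Cderiv g t (g' t) /\ Cmod (g' t) <= K) ->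
  Cmod (Cminus (g b) (g a)) <= 2 * K * Rabs (b - a).
Proof.
move=> H.
have cont (f df : R -> R) : (forall t, Rmin a b <= t <= Rmax a b -> is_derive f t (df t)) ->
  (forall t, Rmin a b <= t <= Rmax a b -> Rabs (df t) <= K) -> Rabs (f b - f a) <= K * Rabs (b - a).
  move=> Hd Hb.
  have [|x Hx|c [Hc ->]] := @MVT_gen f a b df.
  - by move=> x Hx; apply: Hd; lra.
  - by apply/derivable_continuous_pt/ex_derive_Reals_0; eexists; apply: Hd.
  - by rewrite Rabs_mult; apply: Rmult_le_compat_r (Rabs_pos _) _; apply: Hb.
apply: Rle_trans (Cmod_sum _) _.
have H1 := cont (fun t => (g t).1) (fun t => (g' t).1).
have H2 := cont (fun t => (g t).2) (fun t => (g' t).2).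
have [A B] : Rabs ((g b).1 - (g a).1) <= K * Rabs (b - a) /\ Rabs ((g b).2 - (g a).2) <= K * Rabs (b - a); last first.
  by change (Rabs ((g b).1 - (g a).1) + Rabs ((g b).2 - (g a).2) <= 2 * K * Rabs (b - a)); lra.
split; [apply: H1 | apply: H2] => t /H [[A B] D] //.
  exact: Rle_trans (Cmod_fst _) D.
exact: Rle_trans (Cmod_snd _) D.
Qed.

Section Points.
Variable N : nat.
Implicit Types (y z w : Pt N) (U : Pt N -> Prop) (F G : Pt N -> C) (i j : 'I_N).

Lemma upd_id y i : upd y i (y i) = y.
Proof. by apply: functional_extensionality => j; rewrite /upd; case: eqP => [->|]. Qed.
Lemma upd_upd y i a b : upd (upd y i a) i b = upd y i b.
Proof. by apply: functional_extensionality => j; rewrite /upd; case: eqP. Qed.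
Lemma upd_eq y i a : upd y i a i = a.
Proof. by rewrite /upd eqxx. Qed.
Lemma upd_neq y i j a : j != i -> upd y i a j = y j.
Proof. by rewrite /upd => /negbTE ->. Qed.
Lemma upd_comm y i j a b : i != j -> upd (upd y i a) j b = upd (upd y j b) i a.
Proof.
move=> H; apply: functional_extensionality => k; rewrite /upd.
by case: (k =P j) => [->|//]; rewrite eq_sym (negbTE H).
Qed.

(** Open cubes rather than Euclidean balls, because cubes fit arguments that move one coordinate at
    a time. The two topologies agree by [cont_at_near]. *)
Definition near d y z := forall j, Rabs (z j - y j) < d.

Lemma near_upd d y i t : 0 < d -> Rabs (t - y i) < d -> near d y (upd y i t).
Proof.
move=> Hd H j; rewrite /upd; case: eqP => [->//|_].
by rewrite Rminus_diag_eq // Rabs_R0.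
Qed.

Lemma enorm_ge0 y : 0 <= enorm y. Proof. exact: sqrt_pos. Qed.

Lemma enorm_sq y : enorm y ^ 2 = sumR (fun j => y j ^ 2).
Proof. by rewrite /enorm pow2_sqrt //; apply: sumR_ge0 => j; apply: pow2_ge_0. Qed.

Lemma coord_le_enorm y j : Rabs (y j) <= enorm y.
Proof.
apply: Rsqr_incr_0_var (enorm_ge0 y).
rewrite !Rsqr_pow2 enorm_sq pow2_abs.
by apply: (@sumR_ge1 _ (fun k => y k ^ 2)) => k; apply: pow2_ge_0.
Qed.

Lemma enorm_le_sum y : enorm y <= sumR (fun j => Rabs (y j)).
Proof.
have P : 0 <= sumR (fun j => Rabs (y j)) by apply: sumR_ge0 => j; apply: Rabs_pos.
apply: Rsqr_incr_0_var P; rewrite !Rsqr_pow2 enorm_sq /sumR.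
suff [] : 0 <= \big[Rplus/0]_(j < N) Rabs (y j) /\ \big[Rplus/0]_(j < N) y j ^ 2 <= (\big[Rplus/0]_(j < N) Rabs (y j)) ^ 2 by [].
apply: (big_ind2 (fun a b => 0 <= b /\ a <= b ^ 2)); [split; lra | |].
  by move=> a b c d [? ?] [? ?]; split; nra.
by move=> j _; split; [apply: Rabs_pos | rewrite pow2_abs; lra].
Qed.

Lemma enorm_near d y z : near d y z -> enorm (vsub z y) <= INR N * d.
Proof.
move=> H; apply: Rle_trans (enorm_le_sum _) _; rewrite -sumR_const.
by apply: sumR_le => j; have := H j; rewrite /vsub; lra.
Qed.

Lemma near_enorm d y z : enorm (vsub z y) < d -> near d y z.
Proof. by move=> H j; apply: Rle_lt_trans H; apply: (coord_le_enorm (vsub z y)). Qed.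

Lemma cont_at_near G y : cont_at G y <->
  forall eps, 0 < eps -> exists d, 0 < d /\ forall z, near d y z -> Cmod (Cminus (G z) (G y)) < eps.
Proof.
split=> H eps He; have [d [Hd H']] := H _ He.
  have HN : 0 < INR N + 1 by have := pos_INR N; lra.
  exists (d / (INR N + 1)); split; first exact: Rdiv_lt_0_compat.
  move=> z Hz; apply: H'; apply: Rle_lt_trans (enorm_near Hz) _.
  have -> : INR N * (d / (INR N + 1)) = d - d / (INR N + 1) by field; lra.
  by have := Rdiv_lt_0_compat _ _ Hd HN; lra.
by exists d; split=> // z /near_enorm; apply: H'.
Qed.

Definition opn U := forall y, U y -> exists d, 0 < d /\ forall z, near d y z -> U z.

Lemma opn_true : opn (fun _ => True). Proof. by move=> y _; exists 1; split=> //; lra. Qed.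

Lemma nonzeroP y : nonzero y <-> exists j, y j <> 0.
Proof.
split=> [H|[j Hj] E]; last first.
  by apply: Hj; have := coord_le_enorm y j; have := Rabs_pos (y j); rewrite E => ? ?; apply: NNPP => /Rabs_no_R0; lra.
apply: NNPP => H'; apply: H; rewrite /enorm /sumR big1 ?sqrt_0 // => j _.
have -> : y j = 0 by apply: NNPP => E; apply: H'; exists j.
by rewrite /=; ring.
Qed.

Lemma opn_nonzero : opn (@nonzero N).
Proof.
move=> y /nonzeroP [j Hj]; exists (Rabs (y j)); split; first exact: Rabs_pos_lt.
move=> z Hz; apply/nonzeroP; exists j => E; have := Hz j.
by rewrite E -Rabs_Ropp Ropp_minus_distr Rminus_0_r; lra.
Qed.

(** Easier to check than continuity. In a class closed under partial derivatives it makes all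
    members continuous, by [cont_of_partials]. *)
Definition lbd F y := exists d, 0 < d /\ exists M, forall z, near d y z -> Cmod (F z) <= M.

Definition is_partial i F y l := is_Cderiv (fun t => F (upd y i t)) (y i) l.

Lemma is_partial_unique i F y l : is_partial i F y l -> partial i F y = l.
Proof. exact: Cderiv_unique. Qed.

Lemma is_partial_ext i F G y l d : 0 < d -> (forall z, near d y z -> F z = G z) ->
  is_partial i F y l -> is_partial i G y l.
Proof.
move=> Hd E; apply: (@is_Cderiv_ext_loc _ _ _ _ d) => // s Hs.
by apply: E; apply: near_upd.
Qed.

Lemma is_partial_extU U i F G y l : opn U -> U y -> (forall z, U z -> F z = G z) ->
  is_partial i F y l -> is_partial i G y l.
Proof. by move=> HU /HU [d [Hd Hz]] E; apply: (@is_partial_ext _ _ _ _ _ d) => // z /Hz /E. Qed.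

(** Telescopes along the path from [y] to [z] that changes one coordinate at a time, with
    [Cderiv_bound] on each edge. All points visited lie in the coordinate box spanned by [y] and
    [z], which is why the hypothesis speaks of that box. *)
Lemma path_bound F (D : 'I_N -> Pt N -> C) y z (K : 'I_N -> R) :
  (forall i w, (forall j, Rmin (y j) (z j) <= w j <= Rmax (y j) (z j)) ->
     is_partial i F w (D i w) /\ Cmod (D i w) <= K i) ->
  Cmod (Cminus (F z) (F y)) <= sumR (fun i => 2 * K i * Rabs (z i - y i)).
Proof.
move=> H.
pose mid k : Pt N := fun j => if (j < k)%N then z j else y j.
have step k (Hk : (k < N)%N) : Cmod (Cminus (F (mid k.+1)) (F (mid k))) <=
    2 * K (Ordinal Hk) * Rabs (z (Ordinal Hk) - y (Ordinal Hk)).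
  set i := Ordinal Hk.
  have E1 : mid k.+1 = upd (mid k) i (z i).
    apply: functional_extensionality => j; rewrite /mid /upd ltnS leq_eqVlt.
    by case: (j =P i) => [->|/eqP/negbTE]; rewrite ?eqxx //= -val_eqE /= => ->.
  have E0 : mid k = upd (mid k) i (y i) by rewrite -{1}(upd_id (mid k) i) /mid ltnn.
  rewrite E1 {2}E0; apply: (@Cderiv_bound (fun t => F (upd (mid k) i t)) (fun t => D i (upd (mid k) i t))) => t Ht.
  have /H : forall j, Rmin (y j) (z j) <= upd (mid k) i t j <= Rmax (y j) (z j).
    move=> j; rewrite /upd; case: eqP => [->//|_]; rewrite /mid.
    by case: (j < k)%N; [split; [apply: Rmin_r | apply: Rmax_r] | split; [apply: Rmin_l | apply: Rmax_l]].
  move=> /(_ i) [A B]; split=> //; move: A; rewrite /is_partial upd_eq.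
  by congr is_Cderiv; apply: functional_extensionality => s; rewrite upd_upd.
have ind k : (k <= N)%N -> Cmod (Cminus (F (mid k)) (F y)) <=
    sumR (fun i : 'I_N => if (i < k)%N then 2 * K i * Rabs (z i - y i) else 0).
  elim: k => [_|k IH Hk].
    have -> : mid 0%N = y by [].
    rewrite /Cminus Cplus_opp_r Cmod_0 /sumR big1 //; lra.
  have -> : sumR (fun i : 'I_N => if (i < k.+1)%N then 2 * K i * Rabs (z i - y i) else 0)
    = 2 * K (Ordinal Hk) * Rabs (z (Ordinal Hk) - y (Ordinal Hk)) +
      sumR (fun i : 'I_N => if (i < k)%N then 2 * K i * Rabs (z i - y i) else 0).
    rewrite /sumR (bigD1 (Ordinal Hk)) //= ltnSn [in RHS](bigD1 (Ordinal Hk)) //= ltnn.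
    rewrite Rplus_0_l; congr (_ + _); apply: eq_bigr => i /negbTE Hi.
    by rewrite ltnS leq_eqVlt; move: Hi; rewrite -val_eqE /= => ->.
  have -> : Cminus (F (mid k.+1)) (F y) = Cplus (Cminus (F (mid k.+1)) (F (mid k))) (Cminus (F (mid k)) (F y)) by ring.
  apply: Rle_trans (Cmod_triangle _ _) _.
  by have := step k Hk; have := IH (ltnW Hk); lra.
have := ind N (leqnn N).
have -> : mid N = z by apply: functional_extensionality => j; rewrite /mid ltn_ord.
by move/Rle_trans; apply; apply: sumR_le => i; rewrite ltn_ord; lra.
Qed.

(** Bounded partial derivatives make [F] Lipschitz at [y], by [path_bound]. *)
Lemma cont_of_partials F (D : 'I_N -> Pt N -> C) y d M : 0 < d ->
  (forall i w, near d y w -> is_partial i F w (D i w) /\ Cmod (D i w) <= M) -> cont_at F y.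
Proof.
move=> Hd H; apply/cont_at_near => eps He.
have HM : 0 <= Rabs M by apply: Rabs_pos.
have HN := pos_INR N.
pose q := INR N * (2 * (Rabs M + 1)).
have Hq : 0 <= q by rewrite /q; nra.
pose e := Rmin d (eps / (q + 1)).
have He' : 0 < e by apply: Rmin_pos => //; apply: Rdiv_lt_0_compat; lra.
exists e; split=> // z Hz.
have Hz' := enorm_near Hz.
apply: (Rle_lt_trans _ (INR N * (2 * (Rabs M + 1) * e))).
  apply: Rle_trans (path_bound (K := fun _ => Rabs M + 1) (D := D) _) _.
    move=> i w Hw; have [|A B] := H i w; last by split=> //; have := Rle_abs M; lra.
    move=> j; apply: Rle_lt_trans (Rlt_le_trans _ _ _ (Hz j) (Rmin_l _ _)).
    move: (Hw j); rewrite /Rmin /Rmax /Rabs; case: Rle_dec => ? ?; do 2 case: Rcase_abs => ?; lra.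
  rewrite -sumR_const; apply: sumR_le => i.
  by apply: Rmult_le_compat_l; [lra | have := Hz i; lra].
have : e <= eps / (q + 1) by apply: Rmin_r.
have -> : INR N * (2 * (Rabs M + 1) * e) = q * e by rewrite /q; ring.
move=> H1; apply: Rle_lt_trans (_ : q * (eps / (q + 1)) < _); first exact: Rmult_le_compat_l.
have -> : q * (eps / (q + 1)) = eps - eps / (q + 1) by field; lra.
by have := Rdiv_lt_0_compat _ (q + 1) He; lra.
Qed.

(** A coinduction principle: the class [K] consists of functions locally bounded on [U] and is
    closed under partial derivatives up to equality on [U]. Continuity of each member follows from
    local boundedness of its partial derivatives. The second conclusion keeps the iterated
    derivatives inside [K], from which bounds on them are read off. *)
Lemma smooth_intro_dpar U (K : (Pt N -> C) -> Prop) : opn U ->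
  (forall f, K f -> (forall y, U y -> lbd f y) /\
     forall i, exists g, K g /\ forall y, U y -> is_partial i f y (g y)) ->
  forall f, K f -> smooth_on U f /\ forall ds, exists g, K g /\ forall y, U y -> dpar ds f y = g y.
Proof.
move=> HU H f Kf.
have S1 ds : exists g, K g /\ forall y, U y -> dpar ds f y = g y.
  elim: ds => [|i ds [g [Kg Eg]]]; first by exists f.
  have [_ /(_ i) [g' [Kg' Hg']]] := H _ Kg.
  exists g'; split=> // y Uy; apply: is_partial_unique.
  by apply: (is_partial_extU HU Uy _ (Hg' _ Uy)) => z /Eg.
split=> // ds; have [g [Kg Eg]] := S1 ds.
have [Lg Hg] := H _ Kg; split=> [y Uy|i y Uy]; last first.
  have [g' [Kg' Hg']] := Hg i.
  apply: is_Cderiv_ex; apply: (is_partial_extU HU Uy _ (Hg' _ Uy)) => z Uz; symmetry; exact: Eg.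
have HD : exists D : 'I_N -> Pt N -> C, forall i, K (D i) /\ forall y, U y -> is_partial i g y (D i y).
  exact: (fin_all_exists (P := fun i (Di : Pt N -> C) => K Di /\ forall y, U y -> is_partial i g y (Di y))).
have [D HD'] := HD.
have [d1 [Hd1 HU1]] := HU _ Uy.
have [d [Hd [M HM]]] : exists d, 0 < d /\ exists M : 'I_N -> R, forall i z, near d y z -> Cmod (D i z) <= M i.
  have H2 : forall i, exists p : R * R, 0 < p.1 /\ forall z, near p.1 y z -> Cmod (D i z) <= p.2.
    by move=> i; have [/H [/(_ _ Uy) [d [Hd [M HM]]] _] _] := HD' i; exists (d, M).
  have [p Hp] := fin_all_exists H2.
  exists (\big[Rmin/1]_(i < N) (p i).1); split.
    by apply: (big_ind (fun x => 0 < x)); [lra | exact: Rmin_pos | move=> i _; case: (Hp i)].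
  exists (fun i => (p i).2) => i z Hz; apply: (proj2 (Hp i)) => j; apply: Rlt_le_trans (Hz j) _.
  have : (i \in index_enum 'I_N) by rewrite mem_index_enum.
  elim: (index_enum _) => [//|k r IH]; rewrite big_cons in_cons => /orP [/eqP <-|/IH IH'].
    exact: Rmin_l.
  exact: Rle_trans (Rmin_r _ _) IH'.
have cg : cont_at g y.
  apply: (@cont_of_partials g D y (Rmin d d1) (sumR (fun i => Rabs (M i)))); first exact: Rmin_pos.
  move=> i w Hw; split.
    by apply: (proj2 (HD' i)); apply: HU1 => j; apply: Rlt_le_trans (Hw j) (Rmin_r _ _).
  apply: Rle_trans (_ : Rabs (M i) <= _).
    apply: Rle_trans (Rle_abs _); apply: HM => j; apply: Rlt_le_trans (Hw j) (Rmin_l _ _).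
  by apply: (@sumR_ge1 _ (fun i => Rabs (M i))) => k; apply: Rabs_pos.
apply/cont_at_near => eps He; move/cont_at_near: cg => /(_ _ He) [d2 [Hd2 H2]].
exists (Rmin d2 d1); split; first exact: Rmin_pos.
move=> z Hz; rewrite !Eg //; last by apply: HU1 => j; apply: Rlt_le_trans (Hz j) (Rmin_r _ _).
by apply: H2 => j; apply: Rlt_le_trans (Hz j) (Rmin_l _ _).
Qed.

Lemma smooth_intro U (K : (Pt N -> C) -> Prop) : opn U ->
  (forall f, K f -> (forall y, U y -> lbd f y) /\
     forall i, exists g, K g /\ forall y, U y -> is_partial i f y (g y)) ->
  forall f, K f -> smooth_on U f.
Proof. by move=> HU H f Kf; case: (smooth_intro_dpar HU H Kf). Qed.

Lemma dpar_cat a b F : dpar (a ++ b) F = dpar a (dpar b F).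
Proof. by elim: a => //= i a ->. Qed.

(** The head of the list is the outermost derivative, so facts about derivatives of [partial i F]
    come from lists that end in [i]. *)
Lemma dpar_rcons a i F : dpar (rcons a i) F = dpar a (partial i F).
Proof. by rewrite -cats1 dpar_cat. Qed.

Lemma smooth_partial U i F : smooth_on U F -> smooth_on U (partial i F).
Proof. by move=> H ds; have := H (rcons ds i); rewrite dpar_rcons. Qed.

Lemma smooth_dpar U ds F : smooth_on U F -> smooth_on U (dpar ds F).
Proof. by elim: ds => //= i ds IH /IH; apply: smooth_partial. Qed.

Lemma smooth_is_partial U i F y : smooth_on U F -> U y -> is_partial i F y (partial i F y).
Proof. by move=> /(_ [::]) [_ H] Uy; apply: Cderiv_correct; apply: H. Qed.

Lemma cont_lbd F y : cont_at F y -> lbd F y.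
Proof.
move=> /cont_at_near /(_ 1 Rlt_0_1) [d [Hd H]]; exists d; split=> //; exists (Cmod (F y) + 1) => z /H.
have -> : F z = Cplus (Cminus (F z) (F y)) (F y) by ring.
move=> H1; apply: Rle_trans (Cmod_triangle _ _) _.
have E : Cminus (Cplus (Cminus (F z) (F y)) (F y)) (F y) = Cminus (F z) (F y) by ring.
by rewrite E in H1; lra.
Qed.

Lemma smooth_lbd U F y : smooth_on U F -> U y -> lbd F y.
Proof. by move=> /(_ [::]) [H _] Uy; apply: cont_lbd; apply: H. Qed.

Lemma lbd_plus F G y : lbd F y -> lbd G y -> lbd (fun z => Cplus (F z) (G z)) y.
Proof.
move=> [d [Hd [M H]]] [d' [Hd' [M' H']]]; exists (Rmin d d'); split; first exact: Rmin_pos.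
exists (M + M') => z Hz; apply: Rle_trans (Cmod_triangle _ _) _.
apply: Rplus_le_compat; [apply: H | apply: H'] => j; apply: Rlt_le_trans (Hz j) _; [exact: Rmin_l | exact: Rmin_r].
Qed.

Lemma lbd_mult F G y : lbd F y -> lbd G y -> lbd (fun z => Cmult (F z) (G z)) y.
Proof.
move=> [d [Hd [M H]]] [d' [Hd' [M' H']]]; exists (Rmin d d'); split; first exact: Rmin_pos.
exists (M * M') => z Hz; rewrite Cmod_mult.
apply: Rmult_le_compat; rewrite ?Cmod_mult; try exact: Cmod_ge_0.
  apply: H => j; apply: Rlt_le_trans (Hz j) _; exact: Rmin_l.
apply: H' => j; apply: Rlt_le_trans (Hz j) _; exact: Rmin_r.
Qed.

Lemma is_partial_plus i F G y a b : is_partial i F y a -> is_partial i G y b ->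
  is_partial i (fun z => Cplus (F z) (G z)) y (Cplus a b).
Proof. exact: is_Cderiv_plus. Qed.

Lemma is_partial_mult i F G y a b : is_partial i F y a -> is_partial i G y b ->
  is_partial i (fun z => Cmult (F z) (G z)) y (Cplus (Cmult a (G y)) (Cmult (F y) b)).
Proof. by move=> H1 H2; have := is_Cderiv_mult H1 H2; rewrite !upd_id. Qed.

Lemma is_partial_const i c y : is_partial i (fun _ => c) y (RtoC 0).
Proof. exact: is_Cderiv_const. Qed.

Lemma is_partial_scal i c F y a : is_partial i F y a -> is_partial i (fun z => Cmult c (F z)) y (Cmult c a).
Proof. exact: is_Cderiv_scal. Qed.

Lemma is_partial_sum i m (F : 'I_m -> Pt N -> C) y (l : 'I_m -> C) :
  (forall k, is_partial i (F k) y (l k)) -> is_partial i (fun z => sumC (fun k => F k z)) y (sumC l).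
Proof. by move=> H; apply: is_Cderiv_sum. Qed.

Lemma is_partial_coord i j y : is_partial i (fun z => RtoC (z j)) y (RtoC (if j == i then 1 else 0)).
Proof.
apply: is_Cderiv_RtoC; rewrite /upd; case: (j == i); [exact: is_derive_id | exact: is_derive_const].
Qed.

Lemma smooth_ext U F G : opn U -> (forall y, U y -> F y = G y) -> smooth_on U F -> smooth_on U G.
Proof.
move=> HU E HF.
apply: (@smooth_intro U (fun f => smooth_on U f \/ exists g, smooth_on U g /\ forall y, U y -> f y = g y)) => //.
  move=> f Hf; have {Hf} [g [Sg Eg]] : exists g, smooth_on U g /\ forall y, U y -> f y = g y.
    by case: Hf => [Hf|//]; exists f.
  split=> [y Uy|i].
    have [d [Hd [M H]]] := smooth_lbd Sg Uy; have [d' [Hd' HU']] := HU _ Uy.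
    exists (Rmin d d'); split; first exact: Rmin_pos.
    exists M => z Hz; rewrite Eg; first by apply: H => j; apply: Rlt_le_trans (Hz j) (Rmin_l _ _).
    by apply: HU' => j; apply: Rlt_le_trans (Hz j) (Rmin_r _ _).
  exists (partial i g); split; first by left; apply: smooth_partial.
  move=> y Uy; apply: (is_partial_extU HU Uy _ (smooth_is_partial i Sg Uy)) => z /Eg //.
by right; exists F; split=> // y /E.
Qed.

Lemma smooth_const U c : opn U -> smooth_on U (fun _ => c).
Proof.
move=> HU; apply: (@smooth_intro U (fun f => exists c, f = fun _ => c)) => //; last by exists c.
move=> f [k ->]; split=> [y _|i].
  by exists 1; split; [lra | exists (Cmod k) => z _; lra].
exists (fun _ => RtoC 0); split; first by exists (RtoC 0).
by move=> y _; apply: is_partial_const.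
Qed.

Lemma smooth_plus U F G : opn U -> smooth_on U F -> smooth_on U G -> smooth_on U (fun z => Cplus (F z) (G z)).
Proof.
move=> HU HF HG.
apply: (@smooth_intro U (fun h => exists f g, smooth_on U f /\ smooth_on U g /\ h = fun z => Cplus (f z) (g z))) => //; last by exists F, G.
move=> h [f [g [Hf [Hg ->]]]]; split=> [y Uy|i]; first by apply: lbd_plus; [apply: smooth_lbd Hf Uy | apply: smooth_lbd Hg Uy].
exists (fun z => Cplus (partial i f z) (partial i g z)); split.
  by exists (partial i f), (partial i g); split; [|split=> //]; apply: smooth_partial.
by move=> y Uy; apply: is_partial_plus; apply: smooth_is_partial Uy.
Qed.

(** Single products are not closed under derivatives; finite sums of products are, by the Leibniz
    rule. *)
Inductive prodK U : (Pt N -> C) -> Prop :=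
| prodK_base f g : smooth_on U f -> smooth_on U g -> prodK U (fun z => Cmult (f z) (g z))
| prodK_plus f g : prodK U f -> prodK U g -> prodK U (fun z => Cplus (f z) (g z)).

Lemma smooth_mult U F G : opn U -> smooth_on U F -> smooth_on U G -> smooth_on U (fun z => Cmult (F z) (G z)).
Proof.
move=> HU HF HG; apply: (@smooth_intro U (prodK U)) => //; last exact: prodK_base.
move=> h; elim=> {h} [f g Hf Hg|f g Kf [Lf Pf] Kg [Lg Pg]]; split=> [y Uy|i].
- by apply: lbd_mult; [apply: smooth_lbd Hf Uy | apply: smooth_lbd Hg Uy].
- exists (fun z => Cplus (Cmult (partial i f z) (g z)) (Cmult (f z) (partial i g z))); split.
    by apply: prodK_plus; apply: prodK_base => //; apply: smooth_partial.
  by move=> y Uy; apply: is_partial_mult; apply: smooth_is_partial Uy.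
- by apply: lbd_plus; auto.
- have [f' [Kf' Hf']] := Pf i; have [g' [Kg' Hg']] := Pg i.
  exists (fun z => Cplus (f' z) (g' z)); split; first exact: prodK_plus.
  by move=> y Uy; apply: is_partial_plus; auto.
Qed.

Lemma smooth_scal U c F : opn U -> smooth_on U F -> smooth_on U (fun z => Cmult c (F z)).
Proof. by move=> HU HF; apply: (@smooth_mult U (fun _ => c)) => //; apply: smooth_const. Qed.

Lemma smooth_sum U m (F : 'I_m -> Pt N -> C) : opn U -> (forall k, smooth_on U (F k)) ->
  smooth_on U (fun z => sumC (fun k => F k z)).
Proof.
move=> HU H; rewrite /sumC; elim: (index_enum _) => [|i r IH].
  apply: (smooth_ext HU _ (smooth_const (RtoC 0) HU)) => z _; by rewrite big_nil.
apply: (smooth_ext HU _ (smooth_plus HU (H i) IH)) => z _; by rewrite big_cons.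
Qed.

Lemma smooth_coord U j : opn U -> smooth_on U (fun z => RtoC (z j)).
Proof.
move=> HU; apply: (@smooth_intro U (fun h => h = (fun z => RtoC (z j)) \/ smooth_on U h)) => //; last by left.
move=> h [->|Sh]; split=> [y Uy|i].
- exists 1; split; [lra | exists (Rabs (y j) + 1) => z /(_ j) Hz]; rewrite Cmod_R.
  have := Rabs_triang (z j - y j) (y j); have -> : z j - y j + y j = z j by ring.
  lra.
- exists (fun _ => RtoC (if j == i then 1 else 0)); split; first by right; apply: smooth_const.
  by move=> y Uy; apply: is_partial_coord.
- exact: smooth_lbd Uy.
- exists (partial i h); split; first by right; apply: smooth_partial.
  by move=> y Uy; apply: smooth_is_partial Uy.
Qed.

Lemma partial_plus U i F G y : smooth_on U F -> smooth_on U G -> U y ->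
  partial i (fun z => Cplus (F z) (G z)) y = Cplus (partial i F y) (partial i G y).
Proof. by move=> HF HG Uy; apply: is_partial_unique; apply: is_partial_plus; apply: smooth_is_partial Uy. Qed.

Lemma partial_scal U i c F y : smooth_on U F -> U y ->
  partial i (fun z => Cmult c (F z)) y = Cmult c (partial i F y).
Proof. by move=> HF Uy; apply: is_partial_unique; apply: is_partial_scal; apply: smooth_is_partial Uy. Qed.

Lemma partial_extU U i F G y : opn U -> U y -> (forall z, U z -> F z = G z) ->
  partial i F y = partial i G y.
Proof.
move=> HU Uy E; have [d [Hd Hz]] := HU _ Uy.
have L : forall s, Rabs (s - y i) < d -> F (upd y i s) = G (upd y i s).
  by move=> s Hs; apply: E; apply: Hz; apply: near_upd.
by rewrite /partial /Cderiv; f_equal; apply: Derive_ext_loc; exists (mkposreal d Hd) => s Hs; rewrite L.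
Qed.

Lemma dpar_extU U ds F G y : opn U -> U y -> (forall z, U z -> F z = G z) ->
  dpar ds F y = dpar ds G y.
Proof.
move=> HU Uy E; elim: ds y Uy => [|i ds IH] y Uy; first exact: E.
by apply: (partial_extU i HU Uy) => z; apply: IH.
Qed.

(** The terms of the Leibniz rule: all ways to hand each index of [ds] to the first or the second
    factor, with multiplicity. *)
Fixpoint splits (ds : seq 'I_N) : seq (seq 'I_N * seq 'I_N) :=
  match ds with
  | [::] => [:: ([::], [::])]
  | i :: ds' => [seq (i :: p.1, p.2) | p <- splits ds'] ++ [seq (p.1, i :: p.2) | p <- splits ds']
  end.

Definition lsum (T : Type) (s : seq T) (f : T -> C) : C := foldr (fun x a => Cplus (f x) a) (RtoC 0) s.

Lemma lsum_cat T (s t : seq T) f : lsum (s ++ t) f = Cplus (lsum s f) (lsum t f).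
Proof. by elim: s => [|x s IH] /=; rewrite ?IH; ring. Qed.
Lemma lsum_map T T' (g : T -> T') s f : lsum (map g s) f = lsum s (f \o g).
Proof. by elim: s => //= x s ->. Qed.
Lemma lsum_plus T (s : seq T) f g : lsum s (fun x => Cplus (f x) (g x)) = Cplus (lsum s f) (lsum s g).
Proof. by elim: s => [|x s IH] /=; rewrite ?IH; ring. Qed.
Lemma is_partial_lsum T (s : seq T) i (F l : T -> Pt N -> C) y :
  (forall x, is_partial i (F x) y (l x y)) -> is_partial i (fun z => lsum s (F^~ z)) y (lsum s (l^~ y)).
Proof.
move=> H; elim: s => [|x s IH] /=; first exact: is_partial_const.
exact: is_partial_plus.
Qed.

Lemma dpar_mult U ds F G y : opn U -> smooth_on U F -> smooth_on U G -> U y ->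
  dpar ds (fun z => Cmult (F z) (G z)) y =
  lsum (splits ds) (fun p => Cmult (dpar p.1 F y) (dpar p.2 G y)).
Proof.
move=> HU SF SG; elim: ds y => [|i ds IH] y Uy; first by rewrite /=; ring.
rewrite /= (partial_extU i HU Uy IH) lsum_cat !lsum_map -lsum_plus.
apply: is_partial_unique.
apply: (@is_partial_lsum _ _ _ (fun p y => Cmult (dpar p.1 F y) (dpar p.2 G y)) (fun p y => Cplus (Cmult (dpar (i :: p.1) F y) (dpar p.2 G y)) (Cmult (dpar p.1 F y) (dpar (i :: p.2) G y)))) => p.
by apply: is_partial_mult; apply: (smooth_is_partial (U := U)) => //; apply: smooth_dpar.
Qed.

Lemma dpar_plus U ds F G y : opn U -> smooth_on U F -> smooth_on U G -> U y ->
  dpar ds (fun z => Cplus (F z) (G z)) y = Cplus (dpar ds F y) (dpar ds G y).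
Proof.
move=> HU SF SG; elim: ds y => [|i ds IH] y Uy //=.
by rewrite (partial_extU i HU Uy IH) (partial_plus (U := U)) //; apply: smooth_dpar.
Qed.

Lemma dpar_scal U ds c F y : opn U -> smooth_on U F -> U y ->
  dpar ds (fun z => Cmult c (F z)) y = Cmult c (dpar ds F y).
Proof.
move=> HU SF; elim: ds y => [|i ds IH] y Uy //=.
by rewrite (partial_extU i HU Uy IH) (partial_scal (U := U)) //; apply: smooth_dpar.
Qed.

Lemma cont2d (f : C -> R) (Hf : forall a b, Rabs (f a - f b) <= Cmod (Cminus a b)) G y i j u v :
  i != j -> cont_at G (upd (upd y i u) j v) ->
  continuity_2d_pt (fun u v => f (G (upd (upd y i u) j v))) u v.
Proof.
move=> Hij /cont_at_near H eps; have [d [Hd H']] := H eps (cond_pos eps).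
exists (mkposreal d Hd) => u' v' Hu Hv; apply: Rle_lt_trans (Hf _ _) _; apply: H'.
by move=> k; rewrite /upd; case: eqP => // _; case: eqP => // _; rewrite Rminus_diag_eq // Rabs_R0.
Qed.

(** Schwarz's theorem for real functions of two variables, applied in the plane through [y] spanned
    by the directions [i] and [j]. It is used twice, with [c] the real and the imaginary part. *)
Lemma partial_comm U i j F y : opn U -> smooth_on U F -> U y ->
  partial i (partial j F) y = partial j (partial i F) y.
Proof.
move=> HU SF Uy; case: (i =P j) => [->//|/eqP Hij].
have Hji : j != i by rewrite eq_sym.
have [d [Hd HUd]] := HU _ Uy.
have core (c : C -> R) : (forall a b, Rabs (c a - c b) <= Cmod (Cminus a b)) ->
    (forall g t, Cex_deriv g t -> ex_derive (fun s => c (g s)) t) ->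
    (forall g t, c (Cderiv g t) = Derive (fun s => c (g s)) t) ->
    c (partial i (partial j F) y) = c (partial j (partial i F) y).
  move=> c1 c2 c3; rewrite /partial !c3.
  pose f u v := c (F (upd (upd y i u) j v)).
  have Ej u v : c (partial j F (upd (upd y i u) j v)) = Derive (fun s => f u s) v.
    by rewrite /partial c3 upd_eq; apply: Derive_ext => s; rewrite /f upd_upd.
  have Ei u v : c (partial i F (upd (upd y i u) j v)) = Derive (fun s => f s v) u.
    rewrite /partial c3 upd_neq // upd_eq; apply: Derive_ext => s; rewrite /f.
    by rewrite upd_comm // upd_upd.
  have Eij u v : c (partial i (partial j F) (upd (upd y i u) j v)) = Derive (fun s => Derive (fun s0 => f s s0) v) u.
    rewrite {1}/partial c3 upd_neq // upd_eq; apply: Derive_ext => s.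
    by rewrite upd_comm // upd_upd Ej.
  have Eji u v : c (partial j (partial i F) (upd (upd y i u) j v)) = Derive (fun s => Derive (fun s0 => f s0 s) u) v.
    by rewrite {1}/partial c3 upd_eq; apply: Derive_ext => s; rewrite upd_upd Ei.
  have UU u v : Rabs (u - y i) < d -> Rabs (v - y j) < d -> U (upd (upd y i u) j v).
    move=> Hu Hv; apply: HUd => k; rewrite /upd; case: eqP => [->//|_]; case: eqP => [->//|_].
    by rewrite Rminus_diag_eq // Rabs_R0.
  have := @Schwarz f (y i) (y j).
  have -> : Derive (fun s => Derive [eta f s] (y j)) (y i) = c (partial i (partial j F) y) by rewrite -Eij !upd_id.
  have -> : Derive (fun s => Derive (f^~ s) (y i)) (y j) = c (partial j (partial i F) y) by rewrite -Eji !upd_id.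
  rewrite -!c3; apply.
  - exists (mkposreal d Hd) => u v Hu Hv; have U' := UU _ _ Hu Hv.
    split; [|split; [|split]].
    + apply: (ex_derive_ext (fun s => c (F (upd (upd (upd y i u) j v) i s)))).
        by move=> s; rewrite /f upd_comm // upd_upd.
      apply: c2; have := proj2 (SF [::]) i _ U'; by rewrite upd_neq // upd_eq.
    + apply: (ex_derive_ext (fun s => c (F (upd (upd (upd y i u) j v) j s)))).
        by move=> s; rewrite /f upd_upd.
      apply: c2; have := proj2 (SF [::]) j _ U'; by rewrite upd_eq.
    + apply: (ex_derive_ext (fun s => c (partial j F (upd (upd (upd y i u) j v) i s)))).
        by move=> s; rewrite upd_comm // upd_upd Ej.
      apply: c2; have := proj2 (SF [:: j]) i _ U'; by rewrite upd_neq // upd_eq.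
    + apply: (ex_derive_ext (fun s => c (partial i F (upd (upd (upd y i u) j v) j s)))).
        by move=> s; rewrite upd_upd Ei.
      apply: c2; have := proj2 (SF [:: i]) j _ U'; by rewrite upd_eq.
  - apply: (@continuity_2d_pt_ext (fun u v => c (partial i (partial j F) (upd (upd y i u) j v)))) => [u v|].
      exact: Eij.
    by apply: cont2d => //; rewrite !upd_id; apply: (proj1 (SF [:: i; j])).
  - apply: (@continuity_2d_pt_ext (fun u v => c (partial j (partial i F) (upd (upd y i u) j v)))) => [u v|].
      exact: Eji.
    by apply: cont2d => //; rewrite !upd_id; apply: (proj1 (SF [:: j; i])).
apply: injective_projections; apply: core => //.
- by move=> a b; apply: (Cmod_fst (Cminus a b)).
- by move=> g t [].
- by move=> a b; apply: (Cmod_snd (Cminus a b)).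
- by move=> g t [].
Qed.

End Points.

(** * Iterated improper integrals *)

Notation is_RIC f a b l := (@is_RInt C_R_NormedModule f a b l).
Notation ex_RIC f a b := (@ex_RInt C_R_NormedModule f a b).
Notation RIC f a b := (@RInt C_R_CompleteNormedModule f a b).
Notation Ig f := (@RInt_gen C_R_CompleteNormedModule f (Rbar_locally m_infty) (Rbar_locally p_infty)).

Lemma normC (x : C) : @norm _ C_R_NormedModule x = Cmod x.
Proof.
by rewrite /norm /= /prod_norm /Cmod /norm /= /abs /= !Rmult_1_r -!(Rabs_mult) !Rabs_pos_eq //; apply: Rle_0_sqr.
Qed.

Lemma ball_C (x y : C) e : 0 < e -> @ball C_UniformSpace x e y -> Cmod (Cminus y x) < 2 * e.
Proof.
move=> He [H1 H2]; apply: Rle_lt_trans (Cmod_sum _) _.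
have A : Rabs (y.1 - x.1) < e by exact: H1.
have B : Rabs (y.2 - x.2) < e by exact: H2.
by change (Rabs (y.1 - x.1) + Rabs (y.2 - x.2) < 2 * e); lra.
Qed.

Lemma C_ball (x y : C) e : Cmod (Cminus y x) < e -> @ball C_UniformSpace x e y.
Proof. exact: C_NormedModule_mixin_compat1. Qed.

(** Convergence with explicit thresholds at both ends, including integrability on every large
    interval; this form is easy to add, scale and shift. [gen_lim_Ig] turns it into the value of
    [RInt_gen]. *)
Definition gen_lim (f : R -> C) (l : C) := forall eps, 0 < eps -> exists T, forall a b, a < - T -> T < b ->
  exists I, is_RIC f a b I /\ Cmod (Cminus I l) < eps.

Lemma gen_lim_is f l : gen_lim f l -> @is_RInt_gen C_R_NormedModule f (Rbar_locally m_infty) (Rbar_locally p_infty) l.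
Proof.
move=> H P [eps HP]; have [T HT] := H _ (cond_pos eps).
apply: (Filter_prod _ _ _ (fun a => a < - T) (fun b => T < b)); [by exists (- T) | by exists T |].
move=> a b Ha Hb; have [I [HI HIl]] := HT a b Ha Hb.
by exists I; split=> //; apply: HP; apply: C_ball.
Qed.

Lemma gen_lim_Ig f l : gen_lim f l -> Ig f = l.
Proof.
move/gen_lim_is => H.
exact (@is_RInt_gen_unique C_R_CompleteNormedModule (Rbar_locally m_infty) (Rbar_locally p_infty)
  (Proper_StrongProper _ (Rbar_locally_filter m_infty)) (Proper_StrongProper _ (Rbar_locally_filter p_infty)) f l H).
Qed.

Lemma is_RIC_unique f a b I J : is_RIC f a b I -> is_RIC f a b J -> I = J.
Proof.
move=> H1 H2; rewrite -(@is_RInt_unique C_R_CompleteNormedModule f a b I H1).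
exact: (@is_RInt_unique C_R_CompleteNormedModule f a b J H2).
Qed.

Lemma RIC_ext_cont (f : R -> C) a b : (forall t, @continuous R_UniformSpace C_UniformSpace f t) -> ex_RIC f a b.
Proof. by move=> H; apply: (@ex_RInt_continuous C_R_CompleteNormedModule). Qed.

Lemma CminusK (u v : C) : v = Cminus u (Cminus u v). Proof. by ring. Qed.

(** The majorant has the primitive [K * atan], so tails are controlled by increments of [atan] and a
    full integral by [K * PI]. *)
Definition bdd K (f : R -> C) := forall t, Cmod (f t) <= K * / (1 + t ^ 2).

Lemma is_RInt_atan K a b : is_RInt (fun t => K * / (1 + t ^ 2)) a b (K * (atan b - atan a)).
Proof.
apply: (is_RInt_scal (V := R_NormedModule)).
apply: (is_RInt_derive (V := R_CompleteNormedModule)) => x _.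
  have -> : x ^ 2 = x² by rewrite Rsqr_pow2.
  exact: is_derive_atan.
apply: ex_derive_continuous; auto_derive; have := pow2_ge_0 x; lra.
Qed.

Lemma RIC_bound f K a b I : bdd K f -> is_RIC f a b I -> Cmod I <= K * Rabs (atan b - atan a).
Proof.
wlog Hab : a b I / a <= b.
  move=> W Hf HI; have [H|H] := Rle_or_lt a b; first exact: W.
  have := W b a (Copp I) (Rlt_le _ _ H) Hf.
  rewrite Cmod_opp -Rabs_Ropp Ropp_minus_distr; apply.
  exact: (@is_RInt_swap C_R_NormedModule).
move=> Hf HI; have : atan a <= atan b.
  by case: Hab => [/atan_increasing|->]; lra.
move=> Hat; rewrite Rabs_pos_eq; last lra.
have L := @norm_RInt_le C_R_NormedModule f (fun t => K * / (1 + t ^ 2)) a b I _ Hab _ HI (@is_RInt_atan K a b).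
by rewrite -normC; apply: L => x _; rewrite (normC (f x)).
Qed.

Lemma atan_large e : 0 < e -> exists T, 0 < T /\ forall t, T < t -> PI / 2 - e < atan t.
Proof.
move=> He; have HP := PI_RGT_0; have HP4 := PI_4.
pose e' := Rmin (e / 2) (PI / 4).
have H1 : 0 < e' by apply: Rmin_pos; lra.
have H2 : e' <= e / 2 by apply: Rmin_l.
have H3 : e' <= PI / 4 by apply: Rmin_r.
exists (tan (PI / 2 - e')); split; first by apply: tan_gt_0; lra.
by move=> t /atan_increasing; rewrite atan_tan; lra.
Qed.

Lemma RIg_ex f K : 0 <= K -> (forall a b, ex_RIC f a b) -> bdd K f ->
  exists l, gen_lim f l /\ Cmod l <= K * PI.
Proof.
move=> HK Hex Hb.
have cau e : 0 < e -> exists T, 0 < T /\ forall a b a' b' I I', a < - T -> T < b -> a' < - T -> T < b' ->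
    is_RIC f a b I -> is_RIC f a' b' I' -> Cmod (Cminus I I') < e.
  move=> He.
  (* The [+ 1] covers [K = 0]; each of the two tails then contributes at most [e / 4]. *)
  have Hd : 0 < e / (4 * (K + 1)) by apply: Rdiv_lt_0_compat; lra.
  have [T [HT HT']] := atan_large Hd; exists T; split=> // a b a' b' I I' Ha Hb1 Ha' Hb' HI HI'.
  have [J1 HJ1] := Hex a' a; have [J2 HJ2] := Hex b b'.
  have E : I' = Cplus (Cplus J1 I) J2.
    apply: (is_RIC_unique HI'); apply: (@is_RInt_Chasles C_R_NormedModule) HJ2.
    exact: (@is_RInt_Chasles C_R_NormedModule) HI.
  rewrite E; have -> : Cminus I (Cplus (Cplus J1 I) J2) = Copp (Cplus J1 J2) by ring.
  rewrite Cmod_opp; apply: Rle_lt_trans (Cmod_triangle _ _) _.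
  have B1 := RIC_bound Hb HJ1; have B2 := RIC_bound Hb HJ2.
  have := HT' b Hb1; have := HT' b' Hb'; have := HT' (- a); have := HT' (- a'); rewrite !atan_opp.
  move=> h1 h2 h3 h4; have := atan_bound a; have := atan_bound a'; have := atan_bound b; have := atan_bound b'.
  move=> k1 k2 k3 k4.
  have {}h1 : PI / 2 - e / (4 * (K + 1)) < - atan a' by apply: h1; lra.
  have {}h2 : PI / 2 - e / (4 * (K + 1)) < - atan a by apply: h2; lra.
  have X1 : Rabs (atan a - atan a') <= e / (4 * (K + 1)) by apply: Rabs_le; lra.
  have X2 : Rabs (atan b' - atan b) <= e / (4 * (K + 1)) by apply: Rabs_le; lra.
  have Y : K * (e / (4 * (K + 1))) <= e / 4.
    have -> : e / 4 = (K + 1) * (e / (4 * (K + 1))) by field; lra.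
    by apply: Rmult_le_compat_r; lra.
  have := Rmult_le_compat_l _ _ _ HK X1; have := Rmult_le_compat_l _ _ _ HK X2; lra.
have [l Hl] : exists l, @is_RInt_gen C_R_NormedModule f (Rbar_locally m_infty) (Rbar_locally p_infty) l.
  apply/(filterlimi_locally_cauchy (U := C_R_CompleteNormedModule)).
    exists (fun _ => True) (fun _ => True); try exact: filter_true.
    move=> a b _ _; split; first exact: Hex.
    by move=> y1 y2; exact: is_RIC_unique.
  move=> eps; have [T [HT H]] := cau _ (cond_pos eps).
  exists (fun ab => ab.1 < - T /\ T < ab.2); split.
    by apply: (Filter_prod _ _ _ (fun a => a < - T) (fun b => T < b)); [by exists (- T) | by exists T |].
  move=> [a b] [a' b'] [/= Ha Hb1] [/= Ha' Hb'] u v Hu Hv.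
  by apply: C_ball; apply: (H a' b' a b).
have G : gen_lim f l.
  move=> eps He; have Hl' := Hl (fun z => @ball C_UniformSpace l (eps / 2) z).
  have He2 : 0 < eps / 2 by lra.
  case: Hl'; first by exists (mkposreal _ He2).
  move=> P Q [M1 H1] [M2 H2] H; exists (Rmax (- M1) M2) => a b Ha Hb1.
  have [|| I [HI HIb]] := H a b.
  - by apply: H1; have := Rmax_l (- M1) M2; lra.
  - by apply: H2; have := Rmax_r (- M1) M2; lra.
  by exists I; split=> //; have := ball_C He2 HIb; lra.
exists l; split=> //; apply: le_epsilon => e He.
have [T HT] := G e He.
have [I [HI HIl]] := HT (- (Rabs T) - 1) (Rabs T + 1) ltac:(have := Rle_abs T; lra) ltac:(have := Rle_abs T; lra).
rewrite (CminusK I l).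
apply: Rle_trans (Cmod_triangle _ _) _; rewrite Cmod_opp.
have B := RIC_bound Hb HI.
have : Rabs (atan (Rabs T + 1) - atan (- Rabs T - 1)) <= PI.
  by have := atan_bound (Rabs T + 1); have := atan_bound (- Rabs T - 1) => ? ?; apply: Rabs_le; lra.
by move=> /(Rmult_le_compat_l _ _ _ HK); lra.
Qed.

Lemma is_RIC_scal c f a b l : is_RIC f a b l -> is_RIC (fun t => Cmult c (f t)) a b (Cmult c l).
Proof.
move=> H; have H1 := is_RInt_fct_extend_fst _ _ _ _ H; have H2 := is_RInt_fct_extend_snd _ _ _ _ H.
apply: (@is_RInt_fct_extend_pair R_NormedModule R_NormedModule); rewrite /=.
  apply: (is_RInt_minus (V := R_NormedModule)); exact: (is_RInt_scal (V := R_NormedModule)).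
apply: (is_RInt_plus (V := R_NormedModule)); exact: (is_RInt_scal (V := R_NormedModule)).
Qed.

Lemma gen_lim_plus f g l m : gen_lim f l -> gen_lim g m -> gen_lim (fun t => Cplus (f t) (g t)) (Cplus l m).
Proof.
move=> Hf Hg e He; have [T1 H1] := Hf (e / 2) ltac:(lra); have [T2 H2] := Hg (e / 2) ltac:(lra).
exists (Rmax T1 T2) => a b Ha Hb; have := Rmax_l T1 T2; have := Rmax_r T1 T2 => ? ?.
have [I [HI HI']] := H1 a b ltac:(lra) ltac:(lra); have [J [HJ HJ']] := H2 a b ltac:(lra) ltac:(lra).
exists (Cplus I J); split; first exact: (@is_RInt_plus C_R_NormedModule).
have -> : Cminus (Cplus I J) (Cplus l m) = Cplus (Cminus I l) (Cminus J m) by ring.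
by apply: Rle_lt_trans (Cmod_triangle _ _) _; lra.
Qed.

Lemma gen_lim_scal c f l : gen_lim f l -> gen_lim (fun t => Cmult c (f t)) (Cmult c l).
Proof.
move=> H e He; have HC := Cmod_ge_0 c.
have [T HT] := H (e / (Cmod c + 1)) ltac:(apply: Rdiv_lt_0_compat; lra).
exists T => a b Ha Hb; have [I [HI HI']] := HT a b Ha Hb.
exists (Cmult c I); split; first exact: is_RIC_scal.
have -> : Cminus (Cmult c I) (Cmult c l) = Cmult c (Cminus I l) by ring.
rewrite Cmod_mult; apply: (Rle_lt_trans _ (Cmod c * (e / (Cmod c + 1)))).
  by apply: Rmult_le_compat_l => //; lra.
have -> : Cmod c * (e / (Cmod c + 1)) = e - e / (Cmod c + 1) by field; lra.
have : 0 < e / (Cmod c + 1) by apply: Rdiv_lt_0_compat; lra.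
lra.
Qed.

Lemma gen_lim_shift f a l : gen_lim (fun t => f (t + a)) l -> gen_lim f l.
Proof.
move=> H e He; have [T HT] := H e He; exists (T + Rabs a) => x y Hx Hy.
have A1 := Rle_abs a; have A2 := Rle_abs (- a); rewrite Rabs_Ropp in A2.
have [I [HI HI']] := HT (x - a) (y - a) ltac:(lra) ltac:(lra); exists I; split=> //.
have := @is_RInt_comp_lin C_R_NormedModule (fun t => f (t + a)) 1 (- a) x y I.
have -> : 1 * x + - a = x - a by ring.
have -> : 1 * y + - a = y - a by ring.
move=> /(_ HI); apply: is_RInt_ext => t _.
by rewrite (@scal_one R_Ring); f_equal; ring.
Qed.

Lemma is_RIC_derive (f df : R -> C) a b : (forall t, is_Cderiv f t (df t)) ->
  (forall t, @continuous R_UniformSpace C_UniformSpace df t) -> is_RIC df a b (Cminus (f b) (f a)).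
Proof.
move=> H Hc.
have A : is_RInt (fun t => (df t).1) a b ((f b).1 - (f a).1).
  apply: (@is_RInt_derive R_CompleteNormedModule (fun t => (f t).1) (fun t => (df t).1)) => x _.
    by case: (H x).
  by apply: (continuous_comp df fst); [exact: Hc | exact: continuous_fst].
have B : is_RInt (fun t => (df t).2) a b ((f b).2 - (f a).2).
  apply: (@is_RInt_derive R_CompleteNormedModule (fun t => (f t).2) (fun t => (df t).2)) => x _.
    by case: (H x).
  by apply: (continuous_comp df snd); [exact: Hc | exact: continuous_snd].
exact: (@is_RInt_fct_extend_pair R_NormedModule R_NormedModule df a b _ _ A B).
Qed.

Lemma inv_small e K : 0 < e -> 0 <= K -> exists T, 0 < T /\ forall t, T < Rabs t -> K * / (1 + t ^ 2) < e.
Proof.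
move=> He HK; exists (K / e + 1); split.
  by have := Rdiv_le_0_compat _ _ HK He; lra.
move=> t Ht.
have H0 : 0 <= K / e by apply: Rdiv_le_0_compat.
have Ht2 : Rabs t <= 1 + t ^ 2 by rewrite -pow2_abs; have := Rabs_pos t; nra.
have P : 0 < 1 + t ^ 2 by have := pow2_ge_0 t; lra.
apply: (Rmult_lt_reg_r (1 + t ^ 2)) => //; rewrite Rmult_assoc Rinv_l; last lra.
have -> : K * 1 = e * (K / e) by field; lra.
by apply: Rmult_lt_compat_l => //; lra.
Qed.

(** The integral over a finite interval is a difference of boundary values of [f], both small far
    out by [bdd]. *)
Lemma gen_lim_derive f df K : 0 <= K -> (forall t, is_Cderiv f t (df t)) ->
  (forall t, @continuous R_UniformSpace C_UniformSpace df t) -> bdd K f -> gen_lim df (RtoC 0).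
Proof.
move=> HK Hd Hc Hb e He; have [T [HT H]] := @inv_small (e / 2) K ltac:(lra) HK.
exists T => a b Ha Hb'; exists (Cminus (f b) (f a)); split; first exact: is_RIC_derive.
have -> : Cminus (Cminus (f b) (f a)) (RtoC 0) = Cplus (f b) (Copp (f a)) by ring.
apply: Rle_lt_trans (Cmod_triangle _ _) _; rewrite Cmod_opp.
have := Hb a; have := Hb b; have := H a ltac:(rewrite Rabs_left; lra); have := H b ltac:(rewrite Rabs_pos_eq; lra).
lra.
Qed.

Lemma is_Cderiv_continuous f t l : is_Cderiv f t l -> @continuous R_UniformSpace C_UniformSpace f t.
Proof.
move=> [H1 H2].
have C1 : continuous (fun s => (f s).1) t by apply: ex_derive_continuous; eexists; exact: H1.
have C2 : continuous (fun s => (f s).2) t by apply: ex_derive_continuous; eexists; exact: H2.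
move=> P [e He]; have [d1 D1] := C1 (ball (f t).1 e) (locally_ball _ e); have [d2 D2] := C2 (ball (f t).2 e) (locally_ball _ e).
have Hd : 0 < Rmin d1 d2 by apply: Rmin_pos; apply: cond_pos.
exists (mkposreal _ Hd) => s Hs; apply: He; split; [apply: D1 | apply: D2]; apply: Rlt_le_trans Hs _; [exact: Rmin_l | exact: Rmin_r].
Qed.

(** With a remainder bound that is integrable in further variables, this criterion takes the place
    of dominated convergence when differentiating under the integral, see [intRN_deriv]. *)
Lemma is_Cderiv_of_quad (f : R -> C) s0 l M :
  (forall s, Rabs (s - s0) <= 1 -> Cmod (Cminus (Cminus (f s) (f s0)) (Cmult (RtoC (s - s0)) l)) <= M * (s - s0) ^ 2) ->
  is_Cderiv f s0 l.
Proof.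
move=> H.
have core (g : R -> R) (m : R) : (forall s, Rabs (s - s0) <= 1 -> Rabs (g s - g s0 - (s - s0) * m) <= M * (s - s0) ^ 2) -> is_derive g s0 m.
  move=> Hg; apply/is_derive_Reals => e He.
  have HM := Rabs_pos M.
  have Hd : 0 < Rmin 1 (e / (Rabs M + 1)) by apply: Rmin_pos; [lra | apply: Rdiv_lt_0_compat; lra].
  exists (mkposreal _ Hd) => h Hh0 /= Hh.
  have h1 : Rabs h < 1 by apply: Rlt_le_trans Hh (Rmin_l _ _).
  have h2 : Rabs h < e / (Rabs M + 1) by apply: Rlt_le_trans Hh (Rmin_r _ _).
  have := Hg (s0 + h); have -> : s0 + h - s0 = h by ring.
  move=> /(_ (Rlt_le _ _ h1)) B.
  have hp : 0 < Rabs h by apply: Rabs_pos_lt.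
  have -> : (g (s0 + h) - g s0) / h - m = (g (s0 + h) - g s0 - h * m) / h by field.
  rewrite Rabs_div //; apply: (Rmult_lt_reg_r (Rabs h)) => //.
  have -> : Rabs (g (s0 + h) - g s0 - h * m) / Rabs h * Rabs h = Rabs (g (s0 + h) - g s0 - h * m) by field; lra.
  apply: Rle_lt_trans B _; rewrite -pow2_abs.
  have A := Rle_abs M.
  have : (Rabs M + 1) * Rabs h < e.
    have -> : e = (Rabs M + 1) * (e / (Rabs M + 1)) by field; lra.
    by apply: Rmult_lt_compat_l; lra.
  nra.
split; apply: core => s /H; set z := Cminus _ _ => Hz.
  apply: Rle_trans Hz; have -> : (f s).1 - (f s0).1 - (s - s0) * l.1 = z.1 by rewrite /z /=; ring.
  exact: Cmod_fst.
apply: Rle_trans Hz; have -> : (f s).2 - (f s0).2 - (s - s0) * l.2 = z.2 by rewrite /z /=; ring.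
exact: Cmod_snd.
Qed.

(** [Cderiv_bound] is applied to [f1] and then to [f] minus its linear part; its two factors 2 give
    the constant 4. *)
Lemma Ctaylor2 (f f1 f2 : R -> C) s0 K : 
  (forall s, Rabs (s - s0) <= 1 -> is_Cderiv f s (f1 s) /\ is_Cderiv f1 s (f2 s) /\ Cmod (f2 s) <= K) ->
  forall s, Rabs (s - s0) <= 1 ->
  Cmod (Cminus (Cminus (f s) (f s0)) (Cmult (RtoC (s - s0)) (f1 s0))) <= 4 * K * (s - s0) ^ 2.
Proof.
move=> H s Hs.
have btw t u : Rmin s0 u <= t <= Rmax s0 u -> Rabs (t - s0) <= Rabs (u - s0).
  by rewrite /Rmin /Rmax /Rabs; case: Rle_dec; do 2 case: Rcase_abs; move=> *; lra.
have B t : Rmin s0 s <= t <= Rmax s0 s -> Cmod (Cminus (f1 t) (f1 s0)) <= 2 * K * Rabs (s - s0).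
  move=> /btw Ht; apply: Rle_trans (@Cderiv_bound f1 f2 s0 t K _) _.
    move=> u /btw Hu; have Hu1 : Rabs (u - s0) <= 1 by lra.
    by have [_ [? ?]] := H u Hu1.
  have [|_ [_ HK]] := H s0; first by rewrite Rminus_diag_eq // Rabs_R0; lra.
  by apply: Rmult_le_compat_l; [have := Cmod_ge_0 (f2 s0); lra | lra].
have := @Cderiv_bound (fun t => Cminus (f t) (Cmult (RtoC t) (f1 s0))) (fun t => Cminus (f1 t) (f1 s0)) s0 s (2 * K * Rabs (s - s0)).
have -> : Cminus (Cminus (f s) (Cmult (RtoC s) (f1 s0))) (Cminus (f s0) (Cmult (RtoC s0) (f1 s0))) =
  Cminus (Cminus (f s) (f s0)) (Cmult (RtoC (s - s0)) (f1 s0)) by rewrite RtoC_minus; ring.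
move=> X; apply: Rle_trans (X _) _.
  move=> t Ht; split; last exact: B.
  have [|D _] := H t; first by move/btw: Ht; lra.
  have := is_Cderiv_plus D (is_Cderiv_scal (Copp (f1 s0)) (is_Cderiv_RtoC (is_derive_id t))).
  rewrite /Cminus; congr is_Cderiv; last by rewrite Cmult_1_r.
  by apply: functional_extensionality => u; ring.
by rewrite -(pow2_abs (s - s0)); lra.
Qed.

Section Iterated.

(** A product over coordinates, not a power of the norm, so that it factors along iterated integrals
    ([W_ext]) and along [join] ([W_join]). The integral of [/ W] over the whole space is
    [PI ^ N]. *)
Definition W N (y : Pt N) : R := \big[Rmult/1]_(j < N) (1 + y j ^ 2).

Lemma one_sq (t : R) : 1 <= 1 + t ^ 2. Proof. by have := pow2_ge_0 t; lra. Qed.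

Lemma W_ge1 N (y : Pt N) : 1 <= W y.
Proof.
apply: (big_ind (fun x => 1 <= x)); [lra | move=> a b Ha Hb; nra | move=> j _; exact: one_sq].
Qed.

Lemma W_coord N (y : Pt N) j : 1 + y j ^ 2 <= W y.
Proof.
rewrite /W (bigD1 j) //=.
have H : 1 <= \big[Rmult/1]_(i < N | i != j) (1 + y i ^ 2).
  by apply: (big_ind (fun x => 1 <= x)); [lra | move=> a b Ha Hb; nra | move=> i _; exact: one_sq].
by apply: Rle_trans (Rmult_le_compat_l _ _ _ _ H); have := one_sq (y j); lra.
Qed.

Lemma ext_max k (y : Pt k) t : ext y t ord_max = t.
Proof. by rewrite /ext unlift_none. Qed.
Lemma ext_lift k (y : Pt k) t j : ext y t (lift ord_max j) = y j.
Proof. by rewrite /ext liftK. Qed.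

Lemma ext_surj k (y : Pt k.+1) : y = ext (fun j => y (lift ord_max j)) (y ord_max).
Proof. by apply: functional_extensionality => j; rewrite /ext; case: unliftP => [j' ->|->]. Qed.

Lemma upd_ext k (y : Pt k) t i s : ext (upd y i s) t = upd (ext y t) (lift ord_max i) s.
Proof.
apply: functional_extensionality => j; rewrite /ext /upd; case: unliftP => [j' ->|->].
  by rewrite (inj_eq (lift_inj (h := ord_max))).
by have := neq_lift ord_max i => /negbTE ->.
Qed.

Lemma upd_ext_max k (y : Pt k) t s : upd (ext y t) ord_max s = ext y s.
Proof.
apply: functional_extensionality => j; rewrite /ext /upd; case: unliftP => [j' ->|->].
  by rewrite eq_sym (negbTE (neq_lift _ _)).
by rewrite eqxx.
Qed.

Lemma big_ext T (idx : T) (op : Monoid.com_law idx) k (F : 'I_k.+1 -> T) :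
  \big[op/idx]_(j < k.+1) F j = op (\big[op/idx]_(j < k) F (lift ord_max j)) (F ord_max).
Proof.
rewrite big_ord_recr; congr (op _ _); apply: eq_bigr => j _; congr F.
by apply: val_inj; rewrite /= /bump leqNgt ltn_ord.
Qed.

Lemma W_ext k (y : Pt k) t : W (ext y t) = W y * (1 + t ^ 2).
Proof. by rewrite /W big_ext ext_max; congr (_ * _); apply: eq_bigr => j _; rewrite ext_lift. Qed.

(** [intRN] is built from the total operator [RInt_gen], so its linearity and bounds require
    integrability at every level of the iteration. Each level also carries a majorant of type [bdd],
    which makes its improper integral converge. *)
Fixpoint intble N : (Pt N -> C) -> Prop :=
  match N return (Pt N -> C) -> Prop with
  | 0 => fun _ => True
  | k.+1 => fun F => (forall t, intble (fun y : Pt k => F (ext y t))) /\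
      (forall a b, ex_RIC (fun t => intRN (fun y : Pt k => F (ext y t))) a b) /\
      exists K, 0 <= K /\ bdd K (fun t => intRN (fun y : Pt k => F (ext y t)))
  end.

Lemma intble_gen k (F : Pt k.+1 -> C) : intble F ->
  gen_lim (fun t => intRN (fun y : Pt k => F (ext y t))) (intRN F).
Proof.
move=> [_ [Hex [K [HK Hb]]]]; have [l [Hl _]] := RIg_ex HK Hex Hb.
by rewrite /= (gen_lim_Ig Hl).
Qed.

Lemma intRN_bound N (F : Pt N -> C) K : 0 <= K -> intble F -> (forall y, Cmod (F y) <= K * / W y) ->
  Cmod (intRN F) <= K * PI ^ N.
Proof.
elim: N F K => [|k IH] F K HK HF Hb.
  by have := Hb (fun _ => 0); rewrite /W big_ord0 /=; lra.
have [H1 [Hex _]] := HF; have HP := PI_RGT_0.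
have HPk : 0 <= PI ^ k by apply: pow_le; lra.
have B : bdd (K * PI ^ k) (fun t => intRN (fun y : Pt k => F (ext y t))).
  move=> t; have P := one_sq t.
  have -> : K * PI ^ k * / (1 + t ^ 2) = (K * / (1 + t ^ 2)) * PI ^ k by ring.
  apply: IH; [by apply: Rmult_le_pos => //; apply/Rlt_le/Rinv_0_lt_compat; lra | exact: H1 |].
  move=> y; apply: Rle_trans (Hb _) _; rewrite W_ext Rinv_mult; lra.
have [l [Hl Hlb]] := RIg_ex (Rmult_le_pos _ _ HK HPk) Hex B.
rewrite /= (gen_lim_Ig Hl); move: Hlb; rewrite Rmult_assoc (Rmult_comm PI) //.
Qed.

Lemma intRN_plus N (F G : Pt N -> C) : intble F -> intble G ->
  intble (fun y => Cplus (F y) (G y)) /\ intRN (fun y => Cplus (F y) (G y)) = Cplus (intRN F) (intRN G).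
Proof.
elim: N F G => [|k IH] F G // HF HG.
have GF := intble_gen HF; have GG := intble_gen HG.
have [F1 [F2 [KF [HKF F3]]]] := HF; have [G1 [G2 [KG [HKG G3]]]] := HG.
have E t := proj2 (IH _ _ (F1 t) (G1 t)).
have E' : (fun t => intRN (fun y : Pt k => Cplus (F (ext y t)) (G (ext y t)))) =
   fun t => Cplus (intRN (fun y : Pt k => F (ext y t))) (intRN (fun y : Pt k => G (ext y t))).
  by apply: functional_extensionality => t; rewrite E.
split; first split; [|split|].
- by move=> t; have [] := IH _ _ (F1 t) (G1 t).
- by move=> a b; rewrite E'; apply: (@ex_RInt_plus C_R_NormedModule).
- exists (KF + KG); split; first lra.
  by move=> t; rewrite E; apply: Rle_trans (Cmod_triangle _ _) _; have := F3 t; have := G3 t; lra.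
by rewrite {1}/intRN -/intRN E'; apply: gen_lim_Ig; apply: gen_lim_plus.
Qed.

Lemma intRN_scal N c (F : Pt N -> C) : intble F ->
  intble (fun y => Cmult c (F y)) /\ intRN (fun y => Cmult c (F y)) = Cmult c (intRN F).
Proof.
elim: N F => [|k IH] F // HF.
have GF := intble_gen HF; have [F1 [F2 [KF [HKF F3]]]] := HF.
have E t := proj2 (IH _ (F1 t)).
have E' : (fun t => intRN (fun y : Pt k => Cmult c (F (ext y t)))) =
   fun t => Cmult c (intRN (fun y : Pt k => F (ext y t))).
  by apply: functional_extensionality => t; rewrite E.
split; first split; [|split|].
- by move=> t; have [] := IH _ (F1 t).
- by move=> a b; rewrite E'; have [I HI] := F2 a b; eexists; apply: is_RIC_scal; exact: HI.
- exists (Cmod c * KF); split; first by apply: Rmult_le_pos => //; apply: Cmod_ge_0.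
  move=> t; rewrite E Cmod_mult Rmult_assoc; apply: Rmult_le_compat_l; [exact: Cmod_ge_0 | exact: F3].
by rewrite {1}/intRN -/intRN E'; apply: gen_lim_Ig; apply: gen_lim_scal.
Qed.

Lemma intRN_minus N (F G : Pt N -> C) : intble F -> intble G ->
  intble (fun y => Cminus (F y) (G y)) /\ intRN (fun y => Cminus (F y) (G y)) = Cminus (intRN F) (intRN G).
Proof.
move=> HF HG; have [S1 S2] := intRN_scal (RtoC (-1)) HG.
have E : (fun y => Cminus (F y) (G y)) = fun y => Cplus (F y) (Cmult (RtoC (-1)) (G y)).
  by apply: functional_extensionality => y; ring.
have [P1 P2] := intRN_plus HF S1; rewrite E; split=> //; rewrite P2 S2; ring.
Qed.

Lemma intRN_deriv N (F F1 : R -> Pt N -> C) s0 K : 0 <= K ->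
  (forall s, intble (F s)) -> intble (F1 s0) ->
  (forall s y, Rabs (s - s0) <= 1 ->
    Cmod (Cminus (Cminus (F s y) (F s0 y)) (Cmult (RtoC (s - s0)) (F1 s0 y))) <= K * (s - s0) ^ 2 * / W y) ->
  is_Cderiv (fun s => intRN (F s)) s0 (intRN (F1 s0)).
Proof.
move=> HK HF HF1 H; apply: (@is_Cderiv_of_quad _ _ _ (K * PI ^ N)) => s Hs.
have [A1 A2] := intRN_minus (HF s) (HF s0); have [B1 B2] := intRN_scal (RtoC (s - s0)) HF1.
have [C1 C2] := intRN_minus A1 B1.
rewrite -A2 -B2 -C2.
have -> : K * PI ^ N * (s - s0) ^ 2 = K * (s - s0) ^ 2 * PI ^ N by ring.
apply: intRN_bound => //; first by apply: Rmult_le_pos => //; apply: pow2_ge_0.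
by move=> y; apply: H.
Qed.

(** A class stable under slices and partial derivatives, with enough decay for the iterated
    integrals to exist and for boundary terms to vanish. *)
Definition tame N (F : Pt N -> C) := smooth F /\ forall ds, exists K, 0 <= K /\ forall y, Cmod (dpar ds F y) <= K * / W y.

Lemma dpar_ext k ds (F : Pt k.+1 -> C) t : 
  dpar ds (fun y : Pt k => F (ext y t)) = fun y => dpar [seq lift ord_max i | i <- ds] F (ext y t).
Proof.
elim: ds => //= i ds ->; apply: functional_extensionality => y; rewrite /partial ext_lift.
by congr Cderiv; apply: functional_extensionality => s; rewrite upd_ext.
Qed.

Lemma near_ext k d (y z : Pt k) t : 0 < d -> near d y z -> near d (ext y t) (ext z t).
Proof.
move=> Hd H j; rewrite /ext; case: unliftP => [j' _|_]; first exact: H.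
by rewrite Rminus_diag_eq // Rabs_R0.
Qed.

Lemma smooth_ext_slice k (F : Pt k.+1 -> C) t : smooth F -> smooth (fun y : Pt k => F (ext y t)).
Proof.
move=> H ds; have [H1 H2] := H [seq lift ord_max i | i <- ds]; split.
  move=> y _; rewrite dpar_ext; apply/cont_at_near => e He.
  have /cont_at_near /(_ e He) [d [Hd H']] := H1 (ext y t) I.
  by exists d; split=> // z Hz; apply: H'; apply: near_ext.
move=> i y _; rewrite dpar_ext; have := H2 (lift ord_max i) (ext y t) I; rewrite ext_lift.
by congr Cex_deriv; apply: functional_extensionality => s; rewrite upd_ext.
Qed.

Lemma tame_slice k (F : Pt k.+1 -> C) : tame F -> forall t, tame (fun y : Pt k => F (ext y t)).
Proof.
move=> [HS HB] t; split; first exact: smooth_ext_slice.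
move=> ds; have [K [HK H]] := HB [seq lift ord_max i | i <- ds].
have P := one_sq t.
exists (K * / (1 + t ^ 2)); split.
  by apply: Rmult_le_pos => //; apply/Rlt_le/Rinv_0_lt_compat; lra.
move=> y; rewrite dpar_ext; apply: Rle_trans (H _) _; rewrite W_ext Rinv_mult; lra.
Qed.

Lemma tame_partial N i (F : Pt N -> C) : tame F -> tame (partial i F).
Proof.
move=> [HS HB]; split; first exact: smooth_partial.
by move=> ds; rewrite -dpar_rcons; apply: HB.
Qed.

(** Integrability of tame functions of fewer variables enters as a hypothesis, since this lemma is
    used inside the induction that proves it, [tame_intble]. *)
Lemma tame_deriv_last k (F : Pt k.+1 -> C) : (forall G : Pt k -> C, tame G -> intble G) -> tame F ->
  forall t, is_Cderiv (fun s => intRN (fun y : Pt k => F (ext y s))) t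
    (intRN (fun y : Pt k => partial ord_max F (ext y t))).
Proof.
move=> IH HF t.
have [K [HK HB]] := proj2 (tame_partial ord_max (tame_partial ord_max HF)) [::].
apply: (@intRN_deriv k (fun s y => F (ext y s)) (fun s y => partial ord_max F (ext y s)) t (4 * K)); first lra.
- by move=> s; apply: IH; apply: tame_slice.
- by apply: IH; apply: (tame_slice (tame_partial ord_max HF)).
move=> s y Hs.
have := @Ctaylor2 (fun s => F (ext y s)) (fun s => partial ord_max F (ext y s))
   (fun s => partial ord_max (partial ord_max F) (ext y s)) t (K * / W y) _ s Hs.
have -> : 4 * (K * / W y) * (s - t) ^ 2 = 4 * K * (s - t) ^ 2 * / W y by ring.
apply=> u _.
have D G : tame G -> is_Cderiv (fun s0 => G (ext y s0)) u (partial ord_max G (ext y u)).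
  move=> [SG _]; have := smooth_is_partial ord_max SG (y := ext y u) I; rewrite /is_partial ext_max.
  by congr is_Cderiv; apply: functional_extensionality => v; rewrite upd_ext_max.
split; [exact: D | split; [apply: D; exact: tame_partial |]].
apply: Rle_trans (HB _) _; rewrite W_ext Rinv_mult; apply: Rmult_le_compat_l => //.
have WP := W_ge1 y; have P := one_sq u.
rewrite -[X in _ <= X]Rmult_1_r; apply: Rmult_le_compat_l; first by apply/Rlt_le/Rinv_0_lt_compat; lra.
by rewrite -Rinv_1; apply: Rinv_le_contravar; lra.
Qed.

Lemma tame_intble N (F : Pt N -> C) : tame F -> intble F.
Proof.
elim: N F => [//|k IH] F HF.
have D := tame_deriv_last IH HF.
split; [|split].
- by move=> t; apply: IH; apply: tame_slice.
- by move=> a b; apply: RIC_ext_cont => t; apply: is_Cderiv_continuous (D t).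
have [K [HK HB]] := proj2 HF [::]; have HP := PI_RGT_0.
have HPk : 0 <= PI ^ k by apply: pow_le; lra.
exists (K * PI ^ k); split; first exact: Rmult_le_pos.
move=> t; have P := one_sq t; have -> : K * PI ^ k * / (1 + t ^ 2) = (K * / (1 + t ^ 2)) * PI ^ k by ring.
apply: intRN_bound; first by apply: Rmult_le_pos => //; apply/Rlt_le/Rinv_0_lt_compat; lra.
  by apply: IH; apply: tame_slice.
by move=> y; apply: Rle_trans (HB _) _; rewrite W_ext Rinv_mult; lra.
Qed.

Lemma intRN_ext N (F G : Pt N -> C) : (forall y, F y = G y) -> intRN F = intRN G.
Proof. by move=> H; congr intRN; apply: functional_extensionality. Qed.

(** A derivative in an inner variable integrates to 0 on every slice, by induction. One in the
    outermost variable becomes the derivative of a function with a majorant of type [bdd], so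
    [gen_lim_derive] applies. *)
Lemma intRN_partial0 N i (F : Pt N -> C) : tame F -> intRN (partial i F) = RtoC 0.
Proof.
elim: N i F => [[]//|k IH] i F HF.
have D := tame_deriv_last (@tame_intble k) HF.
have D1 := tame_deriv_last (@tame_intble k) (tame_partial i HF).
case: (unliftP ord_max i) => [j Ej|Ej]; rewrite Ej in D1 *.
  rewrite /=; apply: gen_lim_Ig.
  have -> : (fun t => intRN (fun y : Pt k => partial (lift ord_max j) F (ext y t))) = fun _ => RtoC 0.
    apply: functional_extensionality => t.
    rewrite -(IH j (fun y => F (ext y t)) (tame_slice HF t)); apply: intRN_ext => y.
    by have := dpar_ext [:: j] F t => /= ->.
  move=> e He; exists 0 => a b _ _; exists (RtoC 0); split.
    have := @is_RInt_const C_R_NormedModule a b (RtoC 0).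
    by have -> : scal (b - a) (RtoC 0 : C_R_NormedModule) = RtoC 0 by exact: (@scal_zero_r _ C_R_NormedModule).
  by rewrite /Cminus Cplus_opp_r Cmod_0.
rewrite /=; apply: gen_lim_Ig.
have [_ [_ [K [HK HB]]]] := tame_intble HF.
apply: (@gen_lim_derive _ _ K HK D) => // t.
by apply: is_Cderiv_continuous (D1 t).
Qed.

Definition vadd N (a z : Pt N) : Pt N := fun j => a j + z j.

Lemma vadd_ext k (a : Pt k.+1) (z : Pt k) t :
  vadd a (ext z t) = ext (vadd (fun j => a (lift ord_max j)) z) (t + a ord_max).
Proof.
apply: functional_extensionality => j; rewrite /vadd /ext; case: unliftP => [j' ->|->] //; exact: Rplus_comm.
Qed.

Lemma intRN_shift N (a : Pt N) (F : Pt N -> C) : intble (fun z => F (vadd a z)) ->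
  intRN (fun z => F (vadd a z)) = intRN F.
Proof.
elim: N a F => [|k IH] a F H.
  by rewrite /=; congr F; apply: functional_extensionality => -[].
have E t : intRN (fun y : Pt k => F (vadd a (ext y t))) = intRN (fun y : Pt k => F (ext y (t + a ord_max))).
  rewrite -(IH (fun j => a (lift ord_max j)) (fun y => F (ext y (t + a ord_max)))).
    by apply: intRN_ext => y; rewrite vadd_ext.
  have := proj1 H t; congr intble; apply: functional_extensionality => y.
  by rewrite vadd_ext.
have := intble_gen H; set l := intRN (fun z => F (vadd a z)) => Hl.
symmetry; apply: gen_lim_Ig; apply: (@gen_lim_shift _ (a ord_max)).
by move: Hl; congr gen_lim; apply: functional_extensionality => t; rewrite E.
Qed.

End Iterated.

(** * Weighted function classes *)

Section Classes.
Variables (Th : Type) (N : nat).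
Implicit Types (F G : Th -> Pt N -> C) (B : (Th -> Pt N -> C) -> Prop).

(* Families indexed by [th]; every bound is uniform in [th]. *)
Definition cls B F := (forall th, smooth (F th)) /\ forall ds, B (fun th => dpar ds (F th)).

Record lin_bound B : Prop := LinBound {
  lb_plus : forall F G, B F -> B G -> B (fun th y => Cplus (F th y) (G th y));
  lb_scal : forall c F, B F -> B (fun th y => Cmult c (F th y));
  lb_zero : B (fun _ _ => RtoC 0) }.

Lemma cls_partial B i F : cls B F -> cls B (fun th => partial i (F th)).
Proof.
move=> [H1 H2]; split; first by move=> th; exact: (smooth_partial i (H1 th)).
move=> ds; have := H2 (rcons ds i); congr B; apply: functional_extensionality => th; exact: dpar_rcons.
Qed.

Lemma cls_plus B F G : lin_bound B -> cls B F -> cls B G -> cls B (fun th y => Cplus (F th y) (G th y)).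
Proof.
move=> HB [F1 F2] [G1 G2]; split; first by move=> th; exact: (smooth_plus (@opn_true N) (F1 th) (G1 th)).
move=> ds; have := lb_plus HB (F2 ds) (G2 ds); congr B; apply: functional_extensionality => th.
apply: functional_extensionality => y; symmetry; exact: (dpar_plus ds (@opn_true N) (F1 th) (G1 th)).
Qed.

Lemma cls_scal B c F : lin_bound B -> cls B F -> cls B (fun th y => Cmult c (F th y)).
Proof.
move=> HB [F1 F2]; split; first by move=> th; exact: (smooth_scal c (@opn_true N) (F1 th)).
move=> ds; have := lb_scal HB c (F2 ds); congr B; apply: functional_extensionality => th.
apply: functional_extensionality => y; symmetry; exact: (dpar_scal ds c (@opn_true N) (F1 th)).
Qed.

Lemma cls_mult B1 B2 B3 F G : lin_bound B3 ->
  (forall F G, B1 F -> B2 G -> B3 (fun th y => Cmult (F th y) (G th y))) ->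
  cls B1 F -> cls B2 G -> cls B3 (fun th y => Cmult (F th y) (G th y)).
Proof.
move=> HB HM [F1 F2] [G1 G2]; split; first by move=> th; exact: (smooth_mult (@opn_true N) (F1 th) (G1 th)).
move=> ds.
have -> : (fun th => dpar ds (fun y => Cmult (F th y) (G th y))) =
   fun th y => lsum (splits ds) (fun p => Cmult (dpar p.1 (F th) y) (dpar p.2 (G th) y)).
  apply: functional_extensionality => th; apply: functional_extensionality => y.
  exact: (dpar_mult ds (@opn_true N) (F1 th) (G1 th)).
elim: (splits ds) => [|p s IH] /=; first exact: lb_zero.
by apply: lb_plus => //; apply: HM.
Qed.

Lemma cls_ext B F G : (forall th y, F th y = G th y) -> cls B F -> cls B G.
Proof. by move=> E; have -> : G = F by do 2 (apply: functional_extensionality => ?); rewrite E. Qed.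

Lemma cls_zero B : lin_bound B -> cls B (fun _ _ => RtoC 0).
Proof.
move=> HB; split; first by move=> th; apply: smooth_const; exact: opn_true.
move=> ds; have := lb_zero HB; congr B; apply: functional_extensionality => th; apply: functional_extensionality => y.
elim: ds y => [//|i ds IH] y /=; symmetry; apply: is_partial_unique.
have <- : (fun _ : Pt N => RtoC 0) = dpar ds (fun _ => RtoC 0) by apply: functional_extensionality.
exact: is_partial_const.
Qed.

Lemma cls_sum B m (F : 'I_m -> Th -> Pt N -> C) : lin_bound B -> (forall k, cls B (F k)) ->
  cls B (fun th y => sumC (fun k => F k th y)).
Proof.
move=> HB H; rewrite /sumC; elim: (index_enum _) => [|i r IH].
  by apply: (cls_ext _ (cls_zero HB)) => th y; rewrite big_nil.
by apply: (cls_ext _ (cls_plus HB (H i) IH)) => th y; rewrite big_cons.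
Qed.

Definition Brap F := forall k, exists K, forall th y, Cmod (F th y) * W y ^ k <= K.
Definition Bpol F := exists k K, forall th y, Cmod (F th y) <= K * W y ^ k.
Definition Btame F := exists K, forall th y, Cmod (F th y) * W y <= K.
Definition Bbdd F := exists K, forall th y, Cmod (F th y) <= K.

Lemma Wk_ge0 (y : Pt N) k : 0 <= W y ^ k.
Proof. by apply: pow_le; have := W_ge1 y; lra. Qed.

Lemma Wk_ge1 (y : Pt N) k : 1 <= W y ^ k.
Proof. by apply: pow_R1_Rle; apply: W_ge1. Qed.

Lemma Wk_mono (y : Pt N) k l : (k <= l)%N -> W y ^ k <= W y ^ l.
Proof. by move=> H; apply: Rle_pow; [apply: W_ge1 | apply/leP]. Qed.

Lemma lin_rap : lin_bound Brap.
Proof.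
split=> [F G HF HG k|c F HF k|k].
- have [K1 H1] := HF k; have [K2 H2] := HG k; exists (K1 + K2) => th y.
  have := H1 th y; have := H2 th y; have := Cmod_triangle (F th y) (G th y); have := Wk_ge0 y k; nra.
- have [K H] := HF k; exists (Cmod c * K) => th y; rewrite Cmod_mult Rmult_assoc.
  by apply: Rmult_le_compat_l => //; apply: Cmod_ge_0.
- by exists 0 => th y; rewrite Cmod_0; lra.
Qed.

Lemma lin_tame : lin_bound Btame.
Proof.
split=> [F G [K1 H1] [K2 H2]|c F [K H]|].
- exists (K1 + K2) => th y.
  have := H1 th y; have := H2 th y; have := Cmod_triangle (F th y) (G th y); have := W_ge1 y; nra.
- exists (Cmod c * K) => th y; rewrite Cmod_mult Rmult_assoc.
  by apply: Rmult_le_compat_l => //; apply: Cmod_ge_0.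
- by exists 0 => th y; rewrite Cmod_0; lra.
Qed.

Lemma lin_bdd : lin_bound Bbdd.
Proof.
split=> [F G [K1 H1] [K2 H2]|c F [K H]|].
- exists (K1 + K2) => th y.
  have := H1 th y; have := H2 th y; have := Cmod_triangle (F th y) (G th y); lra.
- exists (Cmod c * K) => th y; rewrite Cmod_mult.
  by apply: Rmult_le_compat_l => //; apply: Cmod_ge_0.
- by exists 0 => th y; rewrite Cmod_0; lra.
Qed.

Lemma lin_pol : lin_bound Bpol.
Proof.
split=> [F G [k1 [K1 H1]] [k2 [K2 H2]]|c F [k [K H]]|].
- exists (maxn k1 k2), (Rabs K1 + Rabs K2) => th y.
  apply: Rle_trans (Cmod_triangle _ _) _; rewrite Rmult_plus_distr_r.
  apply: Rplus_le_compat.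
    apply: Rle_trans (H1 th y) _; apply: Rle_trans (Rmult_le_compat_r _ _ _ (Wk_ge0 y k1) (Rle_abs K1)) _.
    by apply: Rmult_le_compat_l; [exact: Rabs_pos | apply: Wk_mono; exact: leq_maxl].
  apply: Rle_trans (H2 th y) _; apply: Rle_trans (Rmult_le_compat_r _ _ _ (Wk_ge0 y k2) (Rle_abs K2)) _.
  by apply: Rmult_le_compat_l; [exact: Rabs_pos | apply: Wk_mono; exact: leq_maxr].
- exists k, (Cmod c * K) => th y; rewrite Cmod_mult Rmult_assoc.
  by apply: Rmult_le_compat_l => //; apply: Cmod_ge_0.
- by exists 0%N, 0 => th y; rewrite Cmod_0 /=; lra.
Qed.

Lemma Bpol_rap F G : Bpol F -> Brap G -> Brap (fun th y => Cmult (F th y) (G th y)).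
Proof.
move=> [m [K HF]] HG k; have [L HL] := HG (m + k)%N.
exists (Rabs K * L) => th y; rewrite Cmod_mult.
apply: Rle_trans (_ : Rabs K * W y ^ m * Cmod (G th y) * W y ^ k <= _).
  apply: Rmult_le_compat_r; first exact: Wk_ge0.
  apply: Rmult_le_compat_r; first exact: Cmod_ge_0.
  apply: Rle_trans (HF th y) _; apply: Rmult_le_compat_r (Rle_abs _); exact: Wk_ge0.
have -> : Rabs K * W y ^ m * Cmod (G th y) * W y ^ k = Rabs K * (Cmod (G th y) * W y ^ (m + k)) by rewrite pow_add; ring.
by apply: Rmult_le_compat_l => //; apply: Rabs_pos.
Qed.

(** Schwartz functions with seminorms bounded uniformly in [th]. With [th] a phase-space point, this
    uniformity is what makes remainders scale like powers of [lam th]. *)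
Definition RS F := cls Brap F.

Lemma RS_mult F G : cls Bpol F -> RS G -> RS (fun th y => Cmult (F th y) (G th y)).
Proof. by move=> HF HG; apply: (cls_mult lin_rap Bpol_rap HF HG). Qed.

Lemma cls_tame F th : cls Btame F -> tame (F th).
Proof.
move=> [H1 H2]; split=> // ds; have [K H] := H2 ds.
have HK (y : Pt N) : 0 <= K.
  by have := H th y; have := Cmod_ge_0 (dpar ds (F th) y); have := W_ge1 y; nra.
exists K; split; first by apply: (HK (fun _ => 0)).
move=> y; have WP := W_ge1 y; apply: (Rmult_le_reg_r (W y)); first lra.
rewrite Rmult_assoc Rinv_l; last lra.
by rewrite Rmult_1_r.
Qed.

Lemma RS_cls_tame F : RS F -> cls Btame F.
Proof. by move=> [H1 H2]; split=> // ds; have [K H] := H2 ds 1%N; exists K => th y; have := H th y; rewrite pow_1. Qed.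

Lemma RS_tame F th : RS F -> tame (F th).
Proof. by move/RS_cls_tame; apply: cls_tame. Qed.

Lemma RS_intble F th : RS F -> intble (F th).
Proof. by move/(RS_tame th); apply: tame_intble. Qed.

Lemma Bbdd_tame F G : Bbdd F -> Btame G -> Btame (fun th y => Cmult (F th y) (G th y)).
Proof.
move=> [K HF] [L HG]; exists (Rabs K * L) => th y; rewrite Cmod_mult Rmult_assoc.
have A := HF th y; have B := HG th y; have := Cmod_ge_0 (G th y); have := W_ge1 y => w c.
have D := Cmod_ge_0 (F th y); have E := Rle_abs K.
apply: Rmult_le_compat; try lra; nra.
Qed.

Lemma cls_bdd_tame F G : cls Bbdd F -> cls Btame G -> cls Btame (fun th y => Cmult (F th y) (G th y)).
Proof. by apply: cls_mult; [exact: lin_tame | exact: Bbdd_tame]. Qed.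

Lemma smooth_dpar_class (K : (Pt N -> C) -> Prop) f :
  (forall f, K f -> (forall y, lbd f y) /\ forall i, exists g, K g /\ forall y, is_partial i f y (g y)) ->
  K f -> smooth f /\ forall ds, K (dpar ds f).
Proof.
move=> H Kf; have [|S D] := @smooth_intro_dpar N (fun _ => True) K (opn_true (N := N)) _ f Kf.
  by move=> g /H [L P]; split=> [y _|i]; [exact: L | have [g' [? ?]] := P i; exists g'].
split=> // ds; have [g [Kg E]] := D ds.
by have -> : dpar ds f = g by apply: functional_extensionality => y; apply: E.
Qed.

Lemma cls_coord j : cls Bpol (fun _ y => RtoC (y j)).
Proof.
have [S D] : smooth (fun y : Pt N => RtoC (y j)) /\ forall ds, (exists c, dpar ds (fun y : Pt N => RtoC (y j)) = fun _ => c) \/ dpar ds (fun y : Pt N => RtoC (y j)) = (fun y => RtoC (y j)).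
  apply: (@smooth_dpar_class (fun h => (exists c, h = fun _ => c) \/ h = fun y => RtoC (y j))); last by right.
  move=> h [[c ->]|->]; split=> [y|i].
  - by exists 1; split; [lra | exists (Cmod c) => *; lra].
  - by exists (fun _ => RtoC 0); split=> [|y]; [left; exists (RtoC 0) | exact: is_partial_const].
  - apply: (smooth_lbd (U := fun _ => True)) => //; apply: smooth_coord; exact: opn_true.
  - exists (fun _ => RtoC (if j == i then 1 else 0)); split; first by left; eexists.
    by move=> y; apply: is_partial_coord.
split=> // ds; case: (D ds) => [[c ->]|->].
  by exists 0%N, (Cmod c) => th y /=; lra.
exists 1%N, 1 => th y; rewrite Cmod_R pow_1 Rmult_1_l; apply: Rle_trans (W_coord y j).
by rewrite -pow2_abs; have := Rabs_pos (y j); nra.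
Qed.

End Classes.
Arguments lin_rap {Th N}. Arguments lin_pol {Th N}. Arguments lin_tame {Th N}. Arguments lin_bdd {Th N}.

Section Join.
Variable n : nat.
Implicit Types (z e : Pt n) (Y : Pt (n + n)).

Definition pr1 Y : Pt n := fun j => Y (lshift n j).
Definition pr2 Y : Pt n := fun j => Y (rshift n j).

Lemma join_l z e j : join z e (lshift n j) = z j.
Proof. by rewrite /join; have -> : split (lshift n j) = inl j by exact: (unsplitK (inl j)). Qed.
Lemma join_r z e j : join z e (rshift n j) = e j.
Proof. by rewrite /join; have -> : split (rshift n j) = inr j by exact: (unsplitK (inr j)). Qed.

Lemma join_pr Y : join (pr1 Y) (pr2 Y) = Y.
Proof.
apply: functional_extensionality => i; rewrite -(splitK i).
by case: (split i) => j /=; rewrite ?join_l ?join_r.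
Qed.
Lemma pr1_join z e : pr1 (join z e) = z.
Proof. by apply: functional_extensionality => j; rewrite /pr1 join_l. Qed.
Lemma pr2_join z e : pr2 (join z e) = e.
Proof. by apply: functional_extensionality => j; rewrite /pr2 join_r. Qed.

Lemma pr_inj Y Y' : pr1 Y = pr1 Y' -> pr2 Y = pr2 Y' -> Y = Y'.
Proof. by move=> E1 E2; rewrite -(join_pr Y) -(join_pr Y') E1 E2. Qed.

Lemma lr_neq (i j : 'I_n) : (lshift n i == rshift n j :> 'I_(n + n)) = false.
Proof. by apply/eqP => H; have := congr1 split H; rewrite (unsplitK (inl i)) (unsplitK (inr j)). Qed.
Lemma ll_eq (i j : 'I_n) : (lshift n i == lshift n j :> 'I_(n + n)) = (i == j).
Proof. by apply/eqP/eqP => [H|->//]; have := congr1 split H; rewrite (unsplitK (inl i)) (unsplitK (inl j)) => -[]. Qed.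
Lemma rr_eq (i j : 'I_n) : (rshift n i == rshift n j :> 'I_(n + n)) = (i == j).
Proof. by apply/eqP/eqP => [H|->//]; have := congr1 split H; rewrite (unsplitK (inr i)) (unsplitK (inr j)) => -[]. Qed.

Lemma upd_join_l z e j t : join (upd z j t) e = upd (join z e) (lshift n j) t.
Proof.
apply: pr_inj; rewrite ?pr1_join ?pr2_join; apply: functional_extensionality => k; rewrite /pr1 /pr2 /upd.
  by rewrite ll_eq join_l.
by rewrite eq_sym lr_neq join_r.
Qed.
Lemma upd_join_r z e j t : join z (upd e j t) = upd (join z e) (rshift n j) t.
Proof.
apply: pr_inj; rewrite ?pr1_join ?pr2_join; apply: functional_extensionality => k; rewrite /pr1 /pr2 /upd.
  by rewrite lr_neq join_l.
by rewrite rr_eq join_r.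
Qed.
Lemma is_partial_slice_l (A : Pt (n + n) -> C) z e j l :
  is_partial (lshift n j) A (join z e) l <-> is_partial j (fun z => A (join z e)) z l.
Proof.
rewrite /is_partial join_l.
by have -> : (fun t => A (upd (join z e) (lshift n j) t)) = fun t => A (join (upd z j t) e) by
  apply: functional_extensionality => t; rewrite upd_join_l.
Qed.
Lemma is_partial_slice_r (A : Pt (n + n) -> C) z e j l :
  is_partial (rshift n j) A (join z e) l <-> is_partial j (fun e => A (join z e)) e l.
Proof.
rewrite /is_partial join_r.
by have -> : (fun t => A (upd (join z e) (rshift n j) t)) = fun t => A (join z (upd e j t)) by
  apply: functional_extensionality => t; rewrite upd_join_r.
Qed.

Lemma W_join z e : W (join z e) = W z * W e.
Proof. by rewrite /W big_split_ord; congr (_ * _); apply: eq_bigr => j _; rewrite ?join_l ?join_r. Qed.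

Lemma near_join_r d z e e' : 0 < d -> near d e e' -> near d (join z e) (join z e').
Proof.
move=> Hd H i; rewrite -(splitK i); case: (split i) => j /=; rewrite ?join_l ?join_r //.
by rewrite Rminus_diag_eq // Rabs_R0.
Qed.
Lemma near_pr2 d Y Y' : near d Y Y' -> near d (pr2 Y) (pr2 Y').
Proof. by move=> H j; apply: H. Qed.

Lemma dpar_slice_r ds (A : Pt (n + n) -> C) z : smooth A ->
  dpar ds (fun e => A (join z e)) = fun e => dpar [seq rshift n j | j <- ds] A (join z e).
Proof.
move=> SA; elim: ds => //= j ds ->; apply: functional_extensionality => e.
apply: is_partial_unique; apply/is_partial_slice_r.
by apply: (smooth_is_partial (U := fun _ => True)) => //; apply: smooth_dpar.
Qed.

Lemma smooth_slice_r (A : Pt (n + n) -> C) z : smooth A -> smooth (fun e => A (join z e)).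
Proof.
move=> SA; apply: (@smooth_intro n (fun _ => True) (fun h => exists A, smooth A /\ h = fun e => A (join z e))); last by exists A.
  exact: opn_true.
move=> h [B [SB ->]]; split=> [y _|j].
  have [d [Hd [M HM]]] := smooth_lbd SB (y := join z y) I.
  by exists d; split=> //; exists M => e He; apply: HM; apply: near_join_r.
exists (fun e => partial (rshift n j) B (join z e)); split.
  by exists (partial (rshift n j) B); split=> //; apply: smooth_partial.
by move=> e _; apply/is_partial_slice_r; apply: (smooth_is_partial (U := fun _ => True)).
Qed.

Lemma is_partial_pr2_r (f : Pt n -> C) Y j l : is_partial j f (pr2 Y) l -> is_partial (rshift n j) (fun Y => f (pr2 Y)) Y l.
Proof.
rewrite -{2}(join_pr Y) => H; apply/is_partial_slice_r; move: H; congr is_partial.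
by apply: functional_extensionality => e; rewrite pr2_join.
Qed.
Lemma is_partial_pr2_l (f : Pt n -> C) Y j : is_partial (lshift n j) (fun Y => f (pr2 Y)) Y (RtoC 0).
Proof.
rewrite -{1}(join_pr Y); apply/is_partial_slice_l.
have -> : (fun z => f (pr2 (join z (pr2 Y)))) = fun _ => f (pr2 Y) by apply: functional_extensionality => e; rewrite pr2_join.
exact: is_partial_const.
Qed.

Lemma smooth_pr2 (f : Pt n -> C) : smooth f -> smooth (fun Y => f (pr2 Y)).
Proof.
move=> Sf; apply: (@smooth_intro _ (fun _ => True) (fun h => exists g, smooth g /\ h = fun Y => g (pr2 Y))); last by exists f.
  exact: opn_true.
move=> h [g [Sg ->]]; split=> [y _|i].
  have [d [Hd [M HM]]] := smooth_lbd Sg (y := pr2 y) I.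
  by exists d; split=> //; exists M => e He; apply: HM; apply: near_pr2.
rewrite -(splitK i); case: (split i) => j /=.
  exists (fun _ => RtoC 0); split; last by move=> y _; apply: is_partial_pr2_l.
  by exists (fun _ => RtoC 0); split=> //; apply: smooth_const; exact: opn_true.
exists (fun Y => partial j g (pr2 Y)); split; first by exists (partial j g); split=> //; apply: smooth_partial.
by move=> y _; apply: is_partial_pr2_r; apply: (smooth_is_partial (U := fun _ => True)).
Qed.

(** The constant and the list depend on [ds] alone and not on [f], so bounds for a family of
    functions carry over uniformly. *)
Lemma dpar_pr2 ds : exists c ds', forall f : Pt n -> C, smooth f ->
  dpar ds (fun Y => f (pr2 Y)) = fun Y => Cmult c (dpar ds' f (pr2 Y)).
Proof.
elim: ds => [|i ds [c [ds' IH]]].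
  by exists (RtoC 1), [::] => f _; apply: functional_extensionality => Y /=; ring.
rewrite -(splitK i); case: (split i) => j /=.
  exists (RtoC 0), [::] => f Sf; rewrite IH //; apply: functional_extensionality => Y.
  apply: is_partial_unique; rewrite Cmult_0_l.
  exact: (@is_partial_pr2_l (fun e => Cmult c (dpar ds' f e))).
exists c, (j :: ds') => f Sf; rewrite IH //; apply: functional_extensionality => Y /=.
apply: is_partial_unique; apply: (@is_partial_pr2_r (fun e => Cmult c (dpar ds' f e))).
by apply: is_partial_scal; apply: (smooth_is_partial (U := fun _ => True)) => //; apply: smooth_dpar.
Qed.

Variable Th : Type.

(** Amplitudes in variables [z] and [e], with [e] the integration variable: [BA] decays rapidly in
    [e], while [BP] may grow polynomially in [e], to an order that can depend on the derivative.
    Growth in [z] has one order [P] for all derivatives, which lets [osc_RS] compensate it once and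
    for all. *)
Definition BA P (A : Th -> Pt (n + n) -> C) := forall k, exists K, forall th z e,
  Cmod (A th (join z e)) * W e ^ k <= K * W z ^ P.
Definition BP P (A : Th -> Pt (n + n) -> C) := exists k K, forall th z e,
  Cmod (A th (join z e)) <= K * W z ^ P * W e ^ k.

Lemma lin_BA P : lin_bound (BA P).
Proof.
split=> [F G HF HG k|c F HF k|k].
- have [K1 H1] := HF k; have [K2 H2] := HG k; exists (K1 + K2) => th z e.
  have := H1 th z e; have := H2 th z e; have := Cmod_triangle (F th (join z e)) (G th (join z e)); have := Wk_ge0 e k.
  move=> w t a b; rewrite Rmult_plus_distr_r; apply: Rle_trans (Rmult_le_compat_r _ _ _ w t) _; lra.
- have [K H] := HF k; exists (Cmod c * K) => th z e; rewrite Cmod_mult !Rmult_assoc.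
  by apply: Rmult_le_compat_l => //; apply: Cmod_ge_0.
- by exists 0 => th z e; rewrite Cmod_0; lra.
Qed.

Lemma BP_BA P F G : BP P F -> BA 0 G -> BA P (fun th Y => Cmult (F th Y) (G th Y)).
Proof.
move=> [m [K HF]] HG k; have [L HL] := HG (m + k)%N.
exists (Rabs K * L) => th z e; have := HL th z e; have := HF th z e; rewrite Cmod_mult /= Rmult_1_r => A B.
apply: Rle_trans (_ : Rabs K * W z ^ P * W e ^ m * Cmod (G th (join z e)) * W e ^ k <= _).
  apply: Rmult_le_compat_r; first exact: Wk_ge0.
  apply: Rmult_le_compat_r; first exact: Cmod_ge_0.
  apply: Rle_trans A _; apply: Rmult_le_compat_r; first exact: Wk_ge0.
  apply: Rmult_le_compat_r; [exact: Wk_ge0 | exact: Rle_abs].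
have -> : Rabs K * W z ^ P * W e ^ m * Cmod (G th (join z e)) * W e ^ k = Rabs K * W z ^ P * (Cmod (G th (join z e)) * W e ^ (m + k)) by rewrite pow_add; ring.
have -> : Rabs K * L * W z ^ P = Rabs K * W z ^ P * L by ring.
by apply: Rmult_le_compat_l => //; apply: Rmult_le_pos; [exact: Rabs_pos | exact: Wk_ge0].
Qed.

Lemma RS_pr2 (f : Th -> Pt n -> C) : RS f -> cls (BA 0) (fun th Y => f th (pr2 Y)).
Proof.
move=> [S H]; split; first by move=> th; apply: smooth_pr2.
move=> ds; have [c [ds' E]] := dpar_pr2 ds => k; have [K HK] := H ds' k.
exists (Cmod c * K) => th z e; rewrite E // pr2_join Cmod_mult /= Rmult_1_r Rmult_assoc.
by apply: Rmult_le_compat_l => //; apply: Cmod_ge_0.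
Qed.

Lemma cls_coord2 j : cls (BP 0) (fun (_ : Th) Y => RtoC (Y (rshift n j))).
Proof.
have [S D] := @cls_coord Th n j; split.
  by move=> th; apply: smooth_coord; exact: opn_true.
move=> ds; have [c [ds' E]] := dpar_pr2 ds; have [k [K H]] := D ds'.
exists k, (Cmod c * K) => th z e.
have := E (fun e : Pt n => RtoC (e j)) (S th) => /(congr1 (fun h => h (join z e))) ->.
rewrite pr2_join Cmod_mult /= Rmult_1_r Rmult_assoc.
by apply: Rmult_le_compat_l; [apply: Cmod_ge_0 | apply: (H th e)].
Qed.

Lemma BA_weight P j A : cls (BA P) A -> cls (BA P) (fun th Y => Cmult (RtoC (Y (rshift n j))) (A th Y)).
Proof.
move=> HA; apply: (cls_mult (lin_BA P) _ (cls_coord2 j) HA) => F G [m [K HF]] HG k.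
have [L HL] := HG (m + k)%N.
exists (Rabs K * L) => th z e; have := HL th z e; have := HF th z e; rewrite Cmod_mult /= Rmult_1_r => a b.
apply: Rle_trans (_ : Rabs K * W e ^ m * Cmod (G th (join z e)) * W e ^ k <= _).
  apply: Rmult_le_compat_r; first exact: Wk_ge0.
  apply: Rmult_le_compat_r; first exact: Cmod_ge_0.
  apply: Rle_trans a _; apply: Rmult_le_compat_r; [exact: Wk_ge0 | exact: Rle_abs].
have -> : Rabs K * W e ^ m * Cmod (G th (join z e)) * W e ^ k = Rabs K * (Cmod (G th (join z e)) * W e ^ (m + k)) by rewrite pow_add; ring.
by rewrite Rmult_assoc; apply: Rmult_le_compat_l => //; exact: Rabs_pos.
Qed.

End Join.
Arguments lin_BA {n Th} P.

(** * Oscillatory integrals and Fourier inversion *)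

Lemma dotRC N (x y : Pt N) : dotR x y = dotR y x.
Proof. by apply: sumR_ext => j; ring. Qed.

Lemma dotR_upd_r N (z e : Pt N) j t : dotR z (upd e j t) = dotR z e + z j * (t - e j).
Proof.
rewrite /dotR /sumR (bigD1 j) //= [in RHS](bigD1 j) //= upd_eq.
rewrite (eq_bigr (fun i => z i * e i)); last by move=> i Hi; rewrite upd_neq.
have E (a b c d x : R) : a * t + x = a * b + x + a * (t - b) by ring.
exact: E.
Qed.

Lemma is_partial_cis_r N (s : R) (z e : Pt N) j :
  is_partial j (fun e => cis (s * dotR z e)) e (Cmult (Cmult Ci (RtoC (s * z j))) (cis (s * dotR z e))).
Proof.
rewrite /is_partial; have := @is_Cderiv_cis (fun t => s * dotR z (upd e j t)) (e j) (s * z j) _.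
rewrite upd_id; apply.
apply: (is_derive_ext (fun t => s * (dotR z e + z j * (t - e j)))) => [t|]; first by rewrite dotR_upd_r.
by auto_derive => //; ring.
Qed.

Lemma cis_bdd N (s : R) (z : Pt N) : cls (@Bbdd unit N) (fun _ e => cis (s * dotR z e)).
Proof.
have [S D] : smooth (fun e => cis (s * dotR z e)) /\ forall ds, exists c, dpar ds (fun e => cis (s * dotR z e)) = fun e => Cmult c (cis (s * dotR z e)).
  apply: (@smooth_dpar_class _ (fun h => exists c, h = fun e => Cmult c (cis (s * dotR z e)))).
    move=> h [c ->]; split=> [y|j].
      by exists 1; split; [lra | exists (Cmod c) => w _; rewrite Cmod_mult Cmod_cis; lra].
    exists (fun e => Cmult c (Cmult (Cmult Ci (RtoC (s * z j))) (cis (s * dotR z e)))); split.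
      by exists (Cmult c (Cmult Ci (RtoC (s * z j)))); apply: functional_extensionality => e; ring.
    by move=> e; apply: is_partial_scal; apply: is_partial_cis_r.
  by exists (RtoC 1); apply: functional_extensionality => e; ring.
split=> // ds; have [c ->] := D ds; exists (Cmod c) => _ y; rewrite Cmod_mult Cmod_cis; lra.
Qed.

Section Oscillatory.
Variable n : nat.
Implicit Types (A : Pt (n + n) -> C) (z e : Pt n).

(** Used with [s = -1] for the Fourier transform and with [s = 1] for its inverse and for operators;
    the condition [s * s = 1] treats both at once. *)
Definition osc (s : R) A z : C := intRN (fun e => Cmult (cis (s * dotR z e)) (A (join z e))).
Definition amp P A := cls (@BA n unit P) (fun _ => A).

Lemma cls_at Th P (A : Th -> Pt (n + n) -> C) th : cls (BA P) A -> amp P (A th).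
Proof. by move=> [S H]; split=> // ds k; have [K HK] := H ds k; exists K => _ z e; apply: HK. Qed.

Lemma slice_tame P A z : amp P A -> cls (@Btame unit n) (fun _ e => A (join z e)).
Proof.
move=> [S H]; split; first by move=> th; apply: smooth_slice_r; apply: (S tt).
move=> ds; have [K HK] := H [seq rshift n j | j <- ds] 1%N.
exists (K * W z ^ P) => th e; rewrite dpar_slice_r; last exact: (S tt).
by rewrite -[W e]pow_1; apply: (HK tt).
Qed.

Lemma osc_tame s P A z : amp P A -> tame (fun e => Cmult (cis (s * dotR z e)) (A (join z e))).
Proof. by move=> HA; apply: (cls_tame tt (cls_bdd_tame (cis_bdd s z) (slice_tame z HA))). Qed.

Lemma osc_intble s P A z : amp P A -> intble (fun e => Cmult (cis (s * dotR z e)) (A (join z e))).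
Proof. by move=> HA; apply: tame_intble; apply: osc_tame HA. Qed.

Lemma osc_plus s P A B z : amp P A -> amp P B -> osc s (fun Y => Cplus (A Y) (B Y)) z = Cplus (osc s A z) (osc s B z).
Proof.
move=> HA HB; rewrite /osc -(proj2 (intRN_plus (osc_intble s z HA) (osc_intble s z HB))).
by apply: intRN_ext => e; ring.
Qed.

Lemma osc_scal s P c A z : amp P A -> osc s (fun Y => Cmult c (A Y)) z = Cmult c (osc s A z).
Proof.
move=> HA; rewrite /osc -(proj2 (intRN_scal c (osc_intble s z HA))).
by apply: intRN_ext => e; ring.
Qed.

Lemma osc_bound Th s P (A : Th -> Pt (n + n) -> C) : cls (BA P) A ->
  exists K, forall th z, Cmod (osc s (A th) z) <= K * W z ^ P.
Proof.
move=> HA; have [K HK] := proj2 HA [::] 1%N; exists (Rabs K * PI ^ n) => th z.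
have -> : Rabs K * PI ^ n * W z ^ P = Rabs K * W z ^ P * PI ^ n by ring.
apply: intRN_bound.
- by apply: Rmult_le_pos; [exact: Rabs_pos | exact: Wk_ge0].
- by apply: osc_intble; apply: cls_at HA.
move=> e; rewrite Cmod_mult Cmod_cis Rmult_1_l; have WP := W_ge1 e.
apply: (Rmult_le_reg_r (W e)); first lra.
rewrite Rmult_assoc Rinv_l; last lra.
rewrite Rmult_1_r -{1}[W e]pow_1; apply: Rle_trans (HK th z e) _.
by apply: Rmult_le_compat_r; [exact: Wk_ge0 | exact: Rle_abs].
Qed.

(** The amplitude of the [z_j]-derivative of the oscillatory integral: the phase contributes the
    factor [i s e_j]. *)
Definition Dosc s j A : Pt (n + n) -> C := fun Y =>
  Cplus (Cmult (Cmult Ci (RtoC s)) (Cmult (RtoC (Y (rshift n j))) (A Y))) (partial (lshift n j) A Y).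

Lemma Dosc_cls Th s P j (A : Th -> Pt (n + n) -> C) : cls (BA P) A -> cls (BA P) (fun th => Dosc s j (A th)).
Proof.
move=> HA; apply: (cls_plus (lin_BA P)); last exact: cls_partial.
by apply: (cls_scal _ (lin_BA P)); apply: BA_weight.
Qed.

Lemma osc_integrand_partial s j A z e : smooth A ->
  is_partial j (fun z => Cmult (cis (s * dotR z e)) (A (join z e))) z
    (Cmult (cis (s * dotR z e)) (Dosc s j A (join z e))).
Proof.
move=> SA.
have -> : (fun z0 : Pt n => Cmult (cis (s * dotR z0 e)) (A (join z0 e))) = (fun z0 : Pt n => Cmult (cis (s * dotR e z0)) (A (join z0 e))).
  by apply: functional_extensionality => w; rewrite dotRC.
have H2 : is_partial j (fun z => A (join z e)) z (partial (lshift n j) A (join z e)).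
  by apply/is_partial_slice_l; apply: (smooth_is_partial (U := fun _ => True)).
have := is_partial_mult (is_partial_cis_r s e z j) H2; congr is_partial.
by rewrite /Dosc join_r dotRC RtoC_mult; ring.
Qed.

Lemma W_upd N (z : Pt N) j u : W (upd z j u) <= W z * (1 + u ^ 2).
Proof.
rewrite /W (bigD1 j) //= [X in _ <= X * _](bigD1 j) //= upd_eq.
rewrite (eq_bigr (fun i => 1 + z i ^ 2)); last by move=> i Hi; rewrite upd_neq.
have H : 1 <= \big[Rmult/1]_(i < N | i != j) (1 + z i ^ 2).
  by apply: (big_ind (fun x => 1 <= x)); [lra | move=> a b Ha Hb; nra | move=> i _; exact: one_sq].
have E (b a x : R) : 1 <= x -> 1 <= b -> 1 <= a -> a * x <= b * x * a.
  by move=> h1 h2 h3; have h4 : 0 <= a * x by [nra]; nra.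
by apply: E; [exact: H | exact: one_sq | exact: one_sq].
Qed.

Lemma osc_partial s P j A z : amp P A -> is_partial j (osc s A) z (osc s (Dosc s j A) z).
Proof.
move=> HA; have HD := Dosc_cls s j HA; have HDD := Dosc_cls s j HD.
have [K0 HK0] := proj2 HDD [::] 1%N.
(* For [|u - z_j| <= 1] one has [1 + u^2 <= 3 + 2 z_j^2], so by [W_upd] this [M] bounds [W ^ P]
   along the whole segment. *)
pose K := Rabs K0; pose M := (W z * (3 + 2 * z j ^ 2)) ^ P.
have HM : 0 <= M by apply: pow_le; apply: Rmult_le_pos; [have := W_ge1 z; lra | have := pow2_ge_0 (z j); lra].
have HK : 0 <= K by apply: Rabs_pos.
rewrite /is_partial -[X in osc _ _ X](upd_id z j).
apply: (@intRN_deriv n (fun t e => Cmult (cis (s * dotR (upd z j t) e)) (A (join (upd z j t) e)))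
  (fun t e => Cmult (cis (s * dotR (upd z j t) e)) (Dosc s j A (join (upd z j t) e))) (z j) (4 * (K * M))).
- by have : 0 <= K * M by [apply: Rmult_le_pos]; lra.
- by move=> t; apply: osc_intble HA.
- by apply: osc_intble HD.
move=> t e Ht.
have -> : 4 * (K * M) * (t - z j) ^ 2 * / W e = 4 * (K * M * / W e) * (t - z j) ^ 2 by ring.
apply: (@Ctaylor2 (fun t => Cmult (cis (s * dotR (upd z j t) e)) (A (join (upd z j t) e)))
  (fun t => Cmult (cis (s * dotR (upd z j t) e)) (Dosc s j A (join (upd z j t) e)))
  (fun t => Cmult (cis (s * dotR (upd z j t) e)) (Dosc s j (Dosc s j A) (join (upd z j t) e))) (z j)) => //.
move=> u Hu.
have D B : smooth B -> is_Cderiv (fun t => Cmult (cis (s * dotR (upd z j t) e)) (B (join (upd z j t) e))) u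
    (Cmult (cis (s * dotR (upd z j u) e)) (Dosc s j B (join (upd z j u) e))).
  move=> SB; have := osc_integrand_partial s j (upd z j u) e SB; rewrite /is_partial upd_eq.
  by congr is_Cderiv; apply: functional_extensionality => t'; rewrite upd_upd.
split; first by apply: D; apply: (proj1 HA tt).
split; first by apply: D; apply: (proj1 HD tt).
rewrite Cmod_mult Cmod_cis Rmult_1_l; have WP := W_ge1 e.
apply: (Rmult_le_reg_r (W e)); first lra.
rewrite Rmult_assoc Rinv_l; last lra.
rewrite Rmult_1_r -{1}[W e]pow_1; apply: Rle_trans (HK0 tt (upd z j u) e) _.
apply: Rle_trans (Rmult_le_compat_r _ _ _ _ (Rle_abs K0)) _; first exact: Wk_ge0.
apply: Rmult_le_compat_l => //; apply: pow_incr; split; first by have := W_ge1 (upd z j u); lra.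
apply: Rle_trans (W_upd z j u) _; apply: Rmult_le_compat_l; first by have := W_ge1 z; lra.
have : (u - z j) ^ 2 <= 1 by rewrite -pow2_abs; have := Rabs_pos (u - z j); nra.
have := pow2_ge_0 (u - 2 * z j); nra.
Qed.

(** Integration by parts: the [e_j]-derivative of the integrand has integral 0. Since [s * s = 1],
    the inverse of [s] is [s] itself. *)
Lemma osc_mulz s P j A z : s * s = 1 -> amp P A ->
  Cmult (RtoC (z j)) (osc s A z) = Cmult (Cmult Ci (RtoC s)) (osc s (partial (rshift n j) A) z).
Proof.
move=> Hs HA; have HdA := cls_partial (rshift n j) HA.
have := intRN_partial0 j (osc_tame s z HA).
have -> : partial j (fun e => Cmult (cis (s * dotR z e)) (A (join z e))) =
  fun e => Cplus (Cmult (Cmult Ci (RtoC (s * z j))) (Cmult (cis (s * dotR z e)) (A (join z e))))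
    (Cmult (cis (s * dotR z e)) (partial (rshift n j) A (join z e))).
  apply: functional_extensionality => e; apply: is_partial_unique.
  have H2 : is_partial j (fun e => A (join z e)) e (partial (rshift n j) A (join z e)).
    by apply/is_partial_slice_r; exact: (smooth_is_partial _ (proj1 HA tt)).
  have := is_partial_mult (is_partial_cis_r s z e j) H2; congr is_partial; ring.
have [S1 S2] := intRN_scal (Cmult Ci (RtoC (s * z j))) (osc_intble s z HA).
rewrite (proj2 (intRN_plus S1 (osc_intble s z HdA))) S2 -/(osc s A z) -/(osc s (partial (rshift n j) A) z) => H.
have E : osc s (partial (rshift n j) A) z = Copp (Cmult (Cmult Ci (RtoC (s * z j))) (osc s A z)).
  set a := Cmult (Cmult _ _) _ in H *; have -> : osc s (partial (rshift n j) A) z = Cminus (Cplus a (osc s (partial (rshift n j) A) z)) a by ring.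
  by rewrite H; ring.
rewrite E; have -> : Cmult (Cmult Ci (RtoC s)) (Copp (Cmult (Cmult Ci (RtoC (s * z j))) (osc s A z))) =
  Cmult (Copp (Cmult Ci Ci)) (Cmult (RtoC (s * s)) (Cmult (RtoC (z j)) (osc s A z))) by rewrite !RtoC_mult; ring.
rewrite Hs; have -> : Cmult Ci Ci = RtoC (-1) by apply: injective_projections; rewrite /=; ring.
by rewrite -RtoC_opp; apply: injective_projections; rewrite /=; ring.
Qed.

Variable Th : Type.
Implicit Types (F : Th -> Pt (n + n) -> C).

Lemma osc_dpar s P F ds : cls (BA P) F ->
  exists F', cls (BA P) F' /\ forall th, dpar ds (osc s (F th)) = osc s (F' th).
Proof.
move=> HF; elim: ds => [|j ds [F' [HF' E]]]; first by exists F.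
exists (fun th => Dosc s j (F' th)); split; first exact: Dosc_cls.
move=> th; apply: functional_extensionality => z /=; rewrite E; apply: is_partial_unique.
by apply: (@osc_partial s P); apply: cls_at HF'.
Qed.

(** Two applications of [osc_mulz] turn multiplication by [1 + z_j^2] into the operator
    [1 - (d/de_j)^2] on the amplitude; iterating over [j] produces [W]. *)
Lemma osc_W s P F : s * s = 1 -> cls (BA P) F ->
  exists F', cls (BA P) F' /\ forall th z, osc s (F' th) z = Cmult (RtoC (W z)) (osc s (F th) z).
Proof.
move=> Hs HF; rewrite /W; elim: (index_enum _) => [|j r [F' [HF' E]]].
  by exists F; split=> // th z; rewrite big_nil; ring.
have HdF := cls_partial (rshift n j) (cls_partial (rshift n j) HF').
exists (fun th Y => Cplus (F' th Y) (Cmult (RtoC (-1)) (partial (rshift n j) (partial (rshift n j) (F' th)) Y))); split.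
  by apply: (cls_plus (lin_BA P)) => //; apply: (cls_scal _ (lin_BA P)).
move=> th z.
rewrite (osc_plus s z (cls_at th HF') (cls_at th (cls_scal (RtoC (-1)) (lin_BA P) HdF))).
rewrite (osc_scal s (RtoC (-1)) z (cls_at th HdF)).
have A1 := osc_mulz j z Hs (cls_at th HF').
have A2 := osc_mulz j z Hs (cls_at th (cls_partial (rshift n j) HF')).
rewrite big_cons.
set b := \big[Rmult/1]_(j <- r) _ in E *; have Eb : b = b by [].
have E' := E th z; rewrite -/b in E'.
have X : Cmult (Cmult (RtoC (z j)) (RtoC (z j))) (osc s (F' th) z) = Copp (osc s (partial (rshift n j) (partial (rshift n j) (F' th))) z).
  rewrite -Cmult_assoc A1.
  have -> : Cmult (RtoC (z j)) (Cmult (Cmult Ci (RtoC s)) (osc s (partial (rshift n j) (F' th)) z)) =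
     Cmult (Cmult Ci (RtoC s)) (Cmult (RtoC (z j)) (osc s (partial (rshift n j) (F' th)) z)) by ring.
  rewrite A2; set o := osc s _ z.
  have -> : Cmult (Cmult Ci (RtoC s)) (Cmult (Cmult Ci (RtoC s)) o) = Cmult (Cmult Ci Ci) (Cmult (RtoC (s * s)) o) by rewrite RtoC_mult; ring.
  by rewrite Hs; apply: injective_projections; rewrite /=; ring.
have -> : Cmult (RtoC (-1)) (osc s (partial (rshift n j) (partial (rshift n j) (F' th))) z) = Cmult (Cmult (RtoC (z j)) (RtoC (z j))) (osc s (F' th) z).
  by rewrite X; apply: injective_projections; rewrite /=; ring.
rewrite E' /= Rmult_1_r RtoC_mult RtoC_plus RtoC_mult; ring.
Qed.

Lemma osc_Wk s P F k : s * s = 1 -> cls (BA P) F ->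
  exists F', cls (BA P) F' /\ forall th z, osc s (F' th) z = Cmult (RtoC (W z ^ k)) (osc s (F th) z).
Proof.
move=> Hs HF; elim: k => [|k [F' [HF' E]]].
  by exists F; split=> // th z /=; ring.
have [F'' [HF'' E']] := osc_W Hs HF'; exists F''; split=> // th z.
by rewrite E' E /= RtoC_mult; ring.
Qed.

Lemma osc_RS s P F : s * s = 1 -> cls (BA P) F -> RS (fun th => osc s (F th)).
Proof.
move=> Hs HF; split.
  move=> th; apply: (proj1 (@smooth_dpar_class _ (fun h => exists A, amp P A /\ h = osc s A) (osc s (F th)) _ _)).
    move=> h [A [HA ->]]; split=> [z|j].
      have HS : cont_at (osc s A) z; last exact: cont_lbd.
      have [K HK] : exists K, forall j w, Cmod (osc s (Dosc s j A) w) <= K * W w ^ P.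
        have H j : exists K, forall w, Cmod (osc s (Dosc s j A) w) <= K * W w ^ P.
          by have [K HK] := osc_bound s (Dosc_cls s j HA); exists K => w; apply: (HK tt).
        have [K HK] := fin_all_exists H; exists (sumR (fun j => Rabs (K j))) => j w.
        apply: Rle_trans (HK j w) _; apply: Rmult_le_compat_r; first exact: Wk_ge0.
        apply: Rle_trans (Rle_abs _) _; apply: (@sumR_ge1 _ (fun j => Rabs (K j))) => i; exact: Rabs_pos.
      have [M HM] : exists M, forall w, near 1 z w -> W w <= M.
        exists (\big[Rmult/1]_(j < n) (1 + (Rabs (z j) + 1) ^ 2)) => w Hw.
        have [] : 0 <= W w /\ W w <= \big[Rmult/1]_(j < n) (1 + (Rabs (z j) + 1) ^ 2) by
          [apply: (big_ind2 (fun a b => 0 <= a /\ a <= b)); [lra | move=> a b c d [? ?] [? ?]; split; [exact: Rmult_le_pos | exact: Rmult_le_compat] |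
          move=> j _; split; [have := pow2_ge_0 (w j); lra |]; apply: Rplus_le_compat_l; apply: pow_maj_Rabs; have := Hw j; have := Rabs_triang (w j - z j) (z j); have -> : w j - z j + z j = w j by [ring]; lra]] => //.
      apply: (@cont_of_partials _ _ (fun j => osc s (Dosc s j A)) z 1 (Rabs K * M ^ P)); first lra.
      move=> j w Hw; split; first exact: (osc_partial s j w HA).
      apply: Rle_trans (HK j w) _; apply: Rle_trans (Rmult_le_compat_r _ _ _ (Wk_ge0 w P) (Rle_abs K)) _.
      apply: Rmult_le_compat_l; first exact: Rabs_pos.
      by apply: pow_incr; split; [have := W_ge1 w; lra | apply: HM].
    exists (osc s (Dosc s j A)); split; last by move=> w; apply: osc_partial HA.
    by exists (Dosc s j A); split=> //; apply: (Dosc_cls s j HA).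
  by exists (F th); split=> //; apply: cls_at HF.
move=> ds k; have [F' [HF' E]] := osc_dpar s ds HF.
(* The extra [P] powers of [W] absorb the growth [W z ^ P] left by [osc_bound]. *)
have [F'' [HF'' E']] := osc_Wk (P + k) Hs HF'.
have [K HK] := osc_bound s HF''; exists K => th z; rewrite E.
have := HK th z; rewrite E' Cmod_mult Cmod_R Rabs_pos_eq; last exact: Wk_ge0.
rewrite pow_add => H; apply: (Rmult_le_reg_r (W z ^ P)); first by have := Wk_ge1 z P; lra.
lra.
Qed.

End Oscillatory.

Section Fourier.
Variable n : nat.

Definition FT (f : Pt n -> C) : Pt n -> C := fun xi => intRN (fun x => Cmult (cis (- dotR x xi)) (f x)).
Definition IFT (f : Pt n -> C) : Pt n -> C := fun z => intRN (fun e => Cmult (cis (dotR z e)) (f e)).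

Lemma FT_osc f xi : FT f xi = osc (-1) (fun Y => f (pr2 Y)) xi.
Proof. by apply: intRN_ext => x; rewrite pr2_join dotRC; do 2 f_equal; ring. Qed.
Lemma IFT_osc f z : IFT f z = osc 1 (fun Y => f (pr2 Y)) z.
Proof. by apply: intRN_ext => x; rewrite pr2_join; do 2 f_equal; ring. Qed.

Lemma sq_m1 : -1 * -1 = 1. Proof. ring. Qed.
Lemma sq_p1 : 1 * 1 = 1. Proof. ring. Qed.

Lemma FT_RS Th (f : Th -> Pt n -> C) : RS f -> RS (fun th => FT (f th)).
Proof.
move=> Hf; have := osc_RS sq_m1 (RS_pr2 Hf); apply: cls_ext => th y; by rewrite FT_osc.
Qed.

Definition S1 (f : Pt n -> C) := RS (fun _ : unit => f).

Lemma S1_at Th (f : Th -> Pt n -> C) th : RS f -> S1 (f th).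
Proof. by move=> [S H]; split=> // ds k; have [K HK] := H ds k; exists K => _ y; apply: HK. Qed.

Lemma S1_amp f : S1 f -> amp 0 (fun Y => f (pr2 Y)).
Proof. exact: RS_pr2. Qed.

Lemma S1_coord j f : S1 f -> S1 (fun z => Cmult (RtoC (z j)) (f z)).
Proof. by move=> Hf; apply: (RS_mult (cls_coord unit j) Hf). Qed.

Lemma FT_plus f g xi : S1 f -> S1 g -> FT (fun x => Cplus (f x) (g x)) xi = Cplus (FT f xi) (FT g xi).
Proof. by move=> Hf Hg; rewrite !FT_osc (osc_plus _ _ (S1_amp Hf) (S1_amp Hg)). Qed.
Lemma FT_scal c f xi : S1 f -> FT (fun x => Cmult c (f x)) xi = Cmult c (FT f xi).
Proof. by move=> Hf; rewrite !FT_osc (osc_scal _ _ _ (S1_amp Hf)). Qed.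
Lemma IFT_plus f g xi : S1 f -> S1 g -> IFT (fun x => Cplus (f x) (g x)) xi = Cplus (IFT f xi) (IFT g xi).
Proof. by move=> Hf Hg; rewrite !IFT_osc (osc_plus _ _ (S1_amp Hf) (S1_amp Hg)). Qed.
Lemma IFT_scal c f xi : S1 f -> IFT (fun x => Cmult c (f x)) xi = Cmult c (IFT f xi).
Proof. by move=> Hf; rewrite !IFT_osc (osc_scal _ _ _ (S1_amp Hf)). Qed.

Lemma partial_pr2 j f : smooth f -> partial (rshift n j) (fun Y => f (pr2 Y)) = fun Y => partial j f (pr2 Y).
Proof.
move=> Sf; apply: functional_extensionality => Y; apply: is_partial_unique; apply: is_partial_pr2_r.
by apply: (smooth_is_partial (U := fun _ => True)).
Qed.

Lemma FT_mul f j xi : S1 f -> FT (fun x => Cmult (Copp Ci) (partial j f x)) xi = Cmult (RtoC (xi j)) (FT f xi).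
Proof.
move=> Hf; rewrite FT_scal; last exact: (cls_partial j Hf).
rewrite !FT_osc (osc_mulz j xi sq_m1 (S1_amp Hf)) partial_pr2; last exact: (proj1 Hf tt).
by congr Cmult; apply: injective_projections; rewrite /=; ring.
Qed.

Lemma IFT_mul f j z : S1 f -> IFT (fun x => Cmult Ci (partial j f x)) z = Cmult (RtoC (z j)) (IFT f z).
Proof.
move=> Hf; rewrite IFT_scal; last exact: (cls_partial j Hf).
rewrite !IFT_osc (osc_mulz j z sq_p1 (S1_amp Hf)) partial_pr2; last exact: (proj1 Hf tt).
by congr Cmult; apply: injective_projections; rewrite /=; ring.
Qed.

Lemma Dosc_pr2 s j (f : Pt n -> C) Y : smooth f -> Dosc s j (fun Y => f (pr2 Y)) Y =
  Cmult (Cmult Ci (RtoC s)) (Cmult (RtoC (pr2 Y j)) (f (pr2 Y))).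
Proof.
move=> Sf; rewrite /Dosc (is_partial_unique (is_partial_pr2_l _ _ _)) /pr2; ring.
Qed.

Lemma FT_partial f j xi : S1 f -> partial j (FT f) xi = FT (fun x => Cmult (Copp Ci) (Cmult (RtoC (x j)) (f x))) xi.
Proof.
move=> Hf; have -> : FT f = osc (-1) (fun Y => f (pr2 Y)) by apply: functional_extensionality => w; exact: FT_osc.
rewrite (is_partial_unique (osc_partial (-1) j xi (S1_amp Hf))) FT_osc; congr (osc _ _ xi).
apply: functional_extensionality => Y; rewrite Dosc_pr2; last exact: (proj1 Hf tt).
by congr Cmult; apply: injective_projections; rewrite /=; ring.
Qed.

Definition gauss (y : Pt n) : C := RtoC (exp (- (sumR (fun j => y j ^ 2) / 2))).

(* On this class Fourier inversion propagates by induction from the Gaussian. *)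
Inductive Gc : (Pt n -> C) -> Prop :=
| Gc_gauss : Gc gauss
| Gc_mul j f : Gc f -> Gc (fun z => Cmult (RtoC (z j)) (f z))
| Gc_lin a b f g : Gc f -> Gc g -> Gc (fun z => Cplus (Cmult a (f z)) (Cmult b (g z))).

Lemma sumsq_upd (y : Pt n) i t : sumR (fun j => upd y i t j ^ 2) = sumR (fun j => y j ^ 2) + (t ^ 2 - y i ^ 2).
Proof.
rewrite /sumR (bigD1 i) //= [in RHS](bigD1 i) //= upd_eq.
rewrite (eq_bigr (fun j => y j * (y j * 1))); last by move=> j Hj; rewrite upd_neq.
have E (a b x : R) : a + x = b + x + (a - b) by ring.
exact: E.
Qed.

Lemma is_partial_gauss i y : is_partial i gauss y (Cmult (RtoC (- y i)) (gauss y)).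
Proof.
rewrite /is_partial /gauss -RtoC_mult; apply: is_Cderiv_RtoC.
apply: (is_derive_ext (fun t => exp (- ((sumR (fun j => y j ^ 2) + (t ^ 2 - y i ^ 2)) / 2)))) => [t|].
  by rewrite sumsq_upd.
auto_derive => //; have -> : y i * (y i * 1) = y i ^ 2 by ring.
set S := sumR _; have -> : S + (y i ^ 2 + - y i ^ 2) = S by ring.
change (S * / 2) with (S / 2); field.
Qed.

Lemma Gc_scal a f : Gc f -> Gc (fun z => Cmult a (f z)).
Proof.
move=> H; have := Gc_lin a (RtoC 0) H H; congr Gc; apply: functional_extensionality => z; ring.
Qed.
Lemma Gc_plus f g : Gc f -> Gc g -> Gc (fun z => Cplus (f z) (g z)).
Proof.
move=> H K; have := Gc_lin (RtoC 1) (RtoC 1) H K; congr Gc; apply: functional_extensionality => z; ring.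
Qed.
Lemma Gc_ext f g : (forall z, f z = g z) -> Gc f -> Gc g.
Proof. by move=> E; have -> : g = f by apply: functional_extensionality. Qed.
Lemma Gc_zero : Gc (fun _ => RtoC 0).
Proof. by apply: (Gc_ext _ (Gc_scal (RtoC 0) Gc_gauss)) => z; ring. Qed.
Lemma Gc_sum m (F : 'I_m -> Pt n -> C) : (forall k, Gc (F k)) -> Gc (fun z => sumC (fun k => F k z)).
Proof.
move=> H; rewrite /sumC; elim: (index_enum _) => [|i r IH].
  by apply: (Gc_ext _ Gc_zero) => z; rewrite big_nil.
by apply: (Gc_ext _ (Gc_plus (H i) IH)) => z; rewrite big_cons.
Qed.

Lemma Gc_is_partial f : Gc f -> forall i, exists g, Gc g /\ forall y, is_partial i f y (g y).
Proof.
elim=> {f} [|j f Gf IH|a b f g Gf IHf Gg IHg] i.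
- exists (fun y => Cmult (RtoC (- y i)) (gauss y)); split; last exact: is_partial_gauss.
  apply: (Gc_ext _ (Gc_scal (RtoC (-1)) (Gc_mul i Gc_gauss))) => z.
  by rewrite Cmult_assoc -RtoC_mult; do 2 f_equal; ring.
- have [g [Gg Hg]] := IH i.
  exists (fun y => Cplus (Cmult (RtoC (if j == i then 1 else 0)) (f y)) (Cmult (RtoC (y j)) (g y))); split.
    by apply: Gc_plus; [apply: Gc_scal | apply: Gc_mul].
  by move=> y; apply: is_partial_mult => //; apply: is_partial_coord.
- have [f' [Gf' Hf']] := IHf i; have [g' [Gg' Hg']] := IHg i.
  exists (fun z => Cplus (Cmult a (f' z)) (Cmult b (g' z))); split; first exact: Gc_lin.
  by move=> y; apply: is_partial_plus; apply: is_partial_scal.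
Qed.

(** Half of the rate [c] pays for one linear factor, and the induction hypothesis is used with the
    other half. *)
Lemma pow_exp m c : 0 < c -> exists K, 0 < K /\ forall x, 0 <= x -> (1 + x) ^ m <= K * exp (c * x).
Proof.
elim: m c => [|m IH] c Hc.
  exists 1; split; first lra; move=> x Hx /=; have := exp_ineq1_le (c * x); nra.
have [K [HK H]] := IH (c / 2) ltac:(lra).
pose M := 1 + 2 / c; have H2c : 0 < 2 / c by apply: Rdiv_lt_0_compat; lra.
exists (M * K); split; first by rewrite /M; nra.
move=> x Hx.
have -> : exp (c * x) = exp (c / 2 * x) * exp (c / 2 * x) by rewrite -exp_plus; f_equal; field.
have E := exp_ineq1_le (c / 2 * x); have Ep := exp_pos (c / 2 * x).
have A : 1 + x <= M * exp (c / 2 * x).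
  apply: Rle_trans (Rmult_le_compat_l M _ _ _ E); last by rewrite /M; lra.
  have -> : M * (1 + c / 2 * x) = 1 + x + 2 / c + c / 2 * x by rewrite /M; field; lra.
  have : 0 <= c / 2 * x by apply: Rmult_le_pos; lra.
  lra.
have B := H x Hx; have P : 0 <= (1 + x) ^ m by apply: pow_le; lra.
rewrite /=; have -> : M * K * (exp (c / 2 * x) * exp (c / 2 * x)) = (M * exp (c / 2 * x)) * (K * exp (c / 2 * x)) by ring.
by apply: Rmult_le_compat => //; lra.
Qed.

Lemma W_le_sumsq (y : Pt n) : W y <= (1 + sumR (fun j => y j ^ 2)) ^ n.
Proof.
set S := sumR _.
have HS j : y j ^ 2 <= S by apply: (@sumR_ge1 _ (fun j => y j ^ 2)) => i; exact: pow2_ge_0.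
have HS0 : 0 <= S by apply: sumR_ge0 => i; exact: pow2_ge_0.
have -> : (1 + S) ^ n = \big[Rmult/1]_(j < n) (1 + S).
  rewrite big_const card_ord; elim: n => //= k <- //.
have [] : 0 <= W y /\ W y <= \big[Rmult/1]_(j < n) (1 + S) => //.
apply: (big_ind2 (fun a b => 0 <= a /\ a <= b)); first lra.
  by move=> a b c d [? ?] [? ?]; split; [exact: Rmult_le_pos | exact: Rmult_le_compat].
by move=> j _; split; [have := pow2_ge_0 (y j); lra | have := HS j; lra].
Qed.

Lemma Gc_rap f : Gc f -> Brap (fun _ : unit => f).
Proof.
elim=> {f} [|j f _ IH|a b f g _ IHf _ IHg].
- move=> k; have [K [HK H]] := @pow_exp (n * k) (1 / 2) ltac:(lra).
  exists K => _ y; rewrite /gauss Cmod_R Rabs_pos_eq; last exact/Rlt_le/exp_pos.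
  set S := sumR _.
  have HS0 : 0 <= S by apply: sumR_ge0 => i; exact: pow2_ge_0.
  have A : W y ^ k <= (1 + S) ^ (n * k).
    by rewrite pow_mult; apply: pow_incr; split; [have := W_ge1 y; lra | exact: W_le_sumsq].
  have B := H S HS0; have Ep := exp_pos (- (S / 2)).
  apply: Rle_trans (Rmult_le_compat_l _ _ _ (Rlt_le _ _ Ep) (Rle_trans _ _ _ A B)) _.
  have -> : exp (- (S / 2)) * (K * exp (1 / 2 * S)) = K * (exp (- (S / 2)) * exp (1 / 2 * S)) by ring.
  rewrite -exp_plus; have -> : - (S / 2) + 1 / 2 * S = 0 by field.
  by rewrite exp_0; lra.
- apply: (Bpol_rap _ IH); exists 1%N, 1 => th y; rewrite Cmod_R pow_1 Rmult_1_l; apply: Rle_trans (W_coord y j).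
  by rewrite -pow2_abs; have := Rabs_pos (y j); nra.
- by apply: (lb_plus lin_rap); apply: (lb_scal lin_rap).
Qed.

Lemma Gc_class f : Gc f -> smooth f /\ forall ds, Gc (dpar ds f).
Proof.
apply: (@smooth_dpar_class _ Gc) => h Gh; split; last exact: Gc_is_partial.
move=> y; exists 1; split; first lra.
have [K HK] := Gc_rap Gh 0%N; exists K => z _; have := HK tt z; rewrite /= Rmult_1_r //.
Qed.

Lemma Gc_S1 f : Gc f -> S1 f.
Proof. by move=> /Gc_class [S D]; split=> // ds; apply: Gc_rap. Qed.

Lemma Gc_partial i f : Gc f -> Gc (partial i f).
Proof. by move=> /Gc_class [_ /(_ [:: i])]. Qed.

(** The transform [g] satisfies the differential equation [d_i g = - z_i g] of the Gaussian, because
    differentiation and multiplication by a coordinate are exchanged by [osc]. Hence [g] times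
    [exp (|z|^2 / 2)] has zero derivatives and is constant; its value at 0 is the integral of the
    Gaussian. *)
Lemma gauss_osc s z : s * s = 1 -> osc s (fun Y => gauss (pr2 Y)) z = Cmult (intRN gauss) (gauss z).
Proof.
move=> Hs; have HG := S1_amp (Gc_S1 Gc_gauss); have SG := proj1 (Gc_S1 Gc_gauss) tt.
set g := osc s _.
have D i w : is_partial i g w (Cmult (RtoC (- w i)) (g w)).
  have := osc_partial s i w HG; congr is_partial.
  rewrite RtoC_opp; have -> : Cmult (Copp (RtoC (w i))) (g w) = Copp (Cmult (RtoC (w i)) (g w)) by ring.
  rewrite /g (osc_mulz i w Hs HG) partial_pr2 //.
  have -> : Dosc s i (fun Y => gauss (pr2 Y)) = fun Y => Cmult (Copp (Cmult Ci (RtoC s))) (partial i gauss (pr2 Y)).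
    apply: functional_extensionality => Y; rewrite Dosc_pr2 // (is_partial_unique (is_partial_gauss _ _)) RtoC_opp; ring.
  rewrite (osc_scal _ _ _ (S1_amp (cls_partial i (Gc_S1 Gc_gauss)))).
  ring.
pose E (y : Pt n) : C := RtoC (exp (sumR (fun j => y j ^ 2) / 2)).
have DE i w : is_partial i E w (Cmult (RtoC (w i)) (E w)).
  rewrite /is_partial /E -RtoC_mult; apply: is_Cderiv_RtoC.
  apply: (is_derive_ext (fun t => exp ((sumR (fun j => w j ^ 2) + (t ^ 2 - w i ^ 2)) / 2))) => [t|].
    by rewrite sumsq_upd.
  auto_derive => //; have -> : w i * (w i * 1) = w i ^ 2 by ring.
  set S := sumR _; have -> : S + (w i ^ 2 + - w i ^ 2) = S by ring.
  change (S * / 2) with (S / 2); field.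
have GE w : Cmult (gauss w) (E w) = RtoC 1.
  rewrite /gauss /E -RtoC_mult -exp_plus; set S := sumR _.
  by have -> : - (S / 2) + S / 2 = 0 by [ring]; rewrite exp_0.
have H : Cmod (Cminus (Cmult (g z) (E z)) (Cmult (g (fun _ => 0)) (E (fun _ => 0)))) <= 0.
  apply: Rle_trans (@path_bound n (fun w => Cmult (g w) (E w)) (fun _ _ => RtoC 0) (fun _ => 0) z (fun _ => 0) _) _.
    move=> i w _; rewrite Cmod_0; split; last lra.
    by have := is_partial_mult (D i w) (DE i w); congr is_partial; rewrite RtoC_opp; ring.
  by rewrite (sumR_ext (g := fun _ => 0)) ?sumR_const; [lra | move=> i; ring].
have H0 : Cmult (g z) (E z) = Cmult (g (fun _ => 0)) (E (fun _ => 0)).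
  have : Cminus (Cmult (g z) (E z)) (Cmult (g (fun _ => 0)) (E (fun _ => 0))) = RtoC 0.
    by apply: Cmod_eq_0; have := Cmod_ge_0 (Cminus (Cmult (g z) (E z)) (Cmult (g (fun _ => 0)) (E (fun _ => 0)))); lra.
  move=> X; have -> : Cmult (g z) (E z) = Cplus (Cminus (Cmult (g z) (E z)) (Cmult (g (fun _ => 0)) (E (fun _ => 0)))) (Cmult (g (fun _ => 0)) (E (fun _ => 0))) by ring.
  by rewrite X; ring.
have E0 : E (fun _ => 0) = RtoC 1.
  rewrite /E (sumR_ext (g := fun _ => 0)) => [|i]; last by ring.
  by rewrite sumR_const; have -> : INR n * 0 / 2 = 0 by [field]; rewrite exp_0.
have g0 : g (fun _ => 0) = intRN gauss.
  apply: intRN_ext => e; rewrite pr2_join /dotR (sumR_ext (g := fun _ => 0)) => [|i]; last by ring.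
  by rewrite sumR_const; have -> : s * (INR n * 0) = 0 by [ring]; rewrite cis0; ring.
have -> : g z = Cmult (Cmult (g z) (E z)) (gauss z).
  have -> : Cmult (Cmult (g z) (E z)) (gauss z) = Cmult (g z) (Cmult (gauss z) (E z)) by ring.
  by rewrite GE; ring.
by rewrite H0 E0 g0; ring.
Qed.

End Fourier.

(** * The Gaussian integral *)

Section Gaussian.

Let g (t : R) := exp (- (t ^ 2 / 2)).
Let I0 (x : R) := RInt g 0 x.
(** The auxiliary integral [H] of this function is made so that [I0^2 + 2 H] has derivative 0. The
    constant is [PI / 2], its value at 0, and [H] tends to 0 at infinity, so [I0] tends to
    [sqrt (PI / 2)]. *)
Let f (x t : R) := exp (- (x ^ 2 * (1 + t ^ 2) / 2)) / (1 + t ^ 2).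
Let H (x : R) := RInt (f x) 0 1.

Lemma gauss1_cont x : continuous g x.
Proof. by apply: ex_derive_continuous; rewrite /g; auto_derive. Qed.

Lemma gauss1_RInt a b : ex_RInt g a b.
Proof. by apply: (ex_RInt_continuous (V := R_CompleteNormedModule)) => z _; apply: gauss1_cont. Qed.

Lemma I0_derive x : is_derive I0 x (g x).
Proof.
apply: (is_derive_RInt g I0 0 x); last exact: gauss1_cont.
by exists (mkposreal _ Rlt_0_1) => y _; apply: (RInt_correct (V := R_CompleteNormedModule)); apply: gauss1_RInt.
Qed.

Lemma f_derive x t : is_derive (fun u => f u t) x (- x * exp (- (x ^ 2 * (1 + t ^ 2) / 2))).
Proof.
have P := one_sq t; rewrite /f; auto_derive; first lra.
set E := exp _; field_simplify_eq; [ring | lra].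
Qed.

Lemma H_derive x : is_derive H x (- (I0 x * g x)).
Proof.
have -> : - (I0 x * g x) = RInt (fun t => Derive (fun u => f u t) x) 0 1.
  have E1 : forall t, Derive (fun u => f u t) x = (- g x) * (x * g (x * t + 0)).
    move=> t; rewrite (is_derive_unique _ _ _ (f_derive x t)) /g.
    have -> : - (x ^ 2 * (1 + t ^ 2) / 2) = - (x ^ 2 / 2) + - ((x * t + 0) ^ 2 / 2) by field.
    by rewrite exp_plus; ring.
  rewrite (RInt_ext _ (fun t => (- g x) * (x * g (x * t + 0)))); last by move=> t _; exact: E1.
  have -> : RInt (fun t => - g x * (x * g (x * t + 0))) 0 1 = - g x * RInt (fun t => x * g (x * t + 0)) 0 1.
    apply: (RInt_scal (V := R_CompleteNormedModule)).
    apply: (ex_RInt_continuous (V := R_CompleteNormedModule)) => z _.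
    by apply: ex_derive_continuous; rewrite /g; auto_derive.
  have -> : RInt (fun t => x * g (x * t + 0)) 0 1 = I0 x.
    rewrite (RInt_comp_lin (V := R_CompleteNormedModule) g x 0 0 1); last exact: gauss1_RInt.
    by rewrite /I0; f_equal; ring.
  ring.
apply: is_derive_RInt_param.
- by exists (mkposreal _ Rlt_0_1) => y _ t _; eexists; apply: f_derive.
- move=> t _; apply: (@continuity_2d_pt_ext (fun u v => - u * exp (- (u ^ 2 * (1 + v ^ 2) / 2)))) => [u v|].
    by rewrite (is_derive_unique _ _ _ (f_derive u v)).
  apply: continuity_2d_pt_mult; first by apply: continuity_2d_pt_opp; apply: continuity_2d_pt_id1.
  apply: (@continuity_1d_2d_pt_comp exp (fun u v => - (u ^ 2 * (1 + v ^ 2) / 2))).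
    by apply: derivable_continuous_pt; apply: derivable_pt_exp.
  apply: continuity_2d_pt_opp; apply: continuity_2d_pt_mult; last exact: continuity_2d_pt_const.
  apply: continuity_2d_pt_mult.
    apply: continuity_2d_pt_mult; first exact: continuity_2d_pt_id1.
    by apply: continuity_2d_pt_mult; [exact: continuity_2d_pt_id1 | exact: continuity_2d_pt_const].
  apply: continuity_2d_pt_plus; first exact: continuity_2d_pt_const.
  apply: continuity_2d_pt_mult; first exact: continuity_2d_pt_id2.
  by apply: continuity_2d_pt_mult; [exact: continuity_2d_pt_id2 | exact: continuity_2d_pt_const].
exists (mkposreal _ Rlt_0_1) => y _; apply: (ex_RInt_continuous (V := R_CompleteNormedModule)) => t _.
by apply: ex_derive_continuous; rewrite /f; auto_derive; have := one_sq t; lra.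
Qed.

Lemma I0H x : I0 x ^ 2 + 2 * H x = PI / 2.
Proof.
pose Q x := I0 x ^ 2 + 2 * H x.
have D y : is_derive Q y 0.
  have -> : 0 = (g y * I0 y + I0 y * g y) + 2 * (- (I0 y * g y)) by ring.
  apply: (is_derive_ext (fun y => I0 y * I0 y + 2 * H y)) => [t|]; first by change (I0 t * I0 t + 2 * H t = I0 t ^ 2 + 2 * H t); ring.
  apply: is_derive_plus_R; first by apply: is_derive_mult_R; exact: I0_derive.
  exact: (is_derive_scal H y 2 _ (H_derive y)).
have -> : I0 x ^ 2 + 2 * H x = Q 0.
  have [|y Hy|c [_ E]] := @MVT_gen Q 0 x (fun _ => 0).
  - by move=> y _; exact: D.
  - by apply/derivable_continuous_pt/ex_derive_Reals_0; eexists; apply: D.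
  by rewrite -/(Q x); lra.
rewrite /Q /I0 RInt_point /H.
have -> : RInt (f 0) 0 1 = atan 1 - atan 0.
  apply: is_RInt_unique; have := @is_RInt_atan 1 0 1; rewrite Rmult_1_l; apply: is_RInt_ext => t _.
  by rewrite /f; have -> : - (0 ^ 2 * (1 + t ^ 2) / 2) = 0 by [field]; rewrite exp_0.
by rewrite atan_1 atan_0 /zero /=; field.
Qed.

Lemma H_bound x : 0 <= H x <= g x.
Proof.
have X t : 0 <= f x t <= g x.
  have P := one_sq t; have G := exp_pos (- (x ^ 2 / 2)).
  have E : exp (- (x ^ 2 * (1 + t ^ 2) / 2)) <= g x.
    rewrite /g; have : - (x ^ 2 * (1 + t ^ 2) / 2) <= - (x ^ 2 / 2) by have := pow2_ge_0 (x * t); nra.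
    by case=> [/exp_increasing|->]; lra.
  have E0 := exp_pos (- (x ^ 2 * (1 + t ^ 2) / 2)).
  have I1 : 0 < / (1 + t ^ 2) by apply: Rinv_0_lt_compat; lra.
  have I2 : / (1 + t ^ 2) <= 1 by rewrite -Rinv_1; apply: Rinv_le_contravar; lra.
  rewrite /f /Rdiv; split; first by apply: Rmult_le_pos; lra.
  by rewrite -(Rmult_1_r (g x)); apply: Rmult_le_compat; lra.
have ex : ex_RInt (f x) 0 1.
  apply: (ex_RInt_continuous (V := R_CompleteNormedModule)) => t _.
  by apply: ex_derive_continuous; rewrite /f; auto_derive; have := one_sq t; lra.
split; first by apply: RInt_ge_0 => //; [lra | move=> t _; case: (X t)].
have -> : g x = RInt (fun _ => g x) 0 1 by rewrite RInt_const /scal /= /mult /=; ring.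
apply: RInt_le => //; [lra | exact: ex_RInt_const | by move=> t _; case: (X t)].
Qed.

Lemma g_le x : g x <= 2 * / (1 + x ^ 2).
Proof.
rewrite /g exp_Ropp; have E := exp_ineq1_le (x ^ 2 / 2); have P := one_sq x.
have -> : 2 * / (1 + x ^ 2) = / ((1 + x ^ 2) / 2) by field; lra.
apply: Rinv_le_contravar; lra.
Qed.

Lemma gauss_int1 : gen_lim (fun t => RtoC (g t)) (RtoC (sqrt (2 * PI))).
Proof.
move=> e He; have HP := PI_RGT_0.
have S2 : sqrt (2 * PI) = sqrt (PI / 2) + sqrt (PI / 2).
  have -> : 2 * PI = 2 * 2 * (PI / 2) by field.
  by rewrite sqrt_mult; [rewrite sqrt_square; lra | lra | lra].
set s := sqrt (PI / 2) in S2.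
have Hs : 0 < s by apply: sqrt_lt_R0; lra.
have ss : s ^ 2 = PI / 2 by rewrite /s pow2_sqrt; lra.
(* Since [(s - I0) s <= s^2 - I0^2 = 2 H] and [2 H <= 2 g <= 4 / (1 + x^2)], making the last
   quantity less than [e s / 2] brings [I0] within [e / 2] of its limit [s]. *)
have [T [HT HTb]] := @inv_small (e * s / 2) 4 ltac:(nra) ltac:(lra).
have I0b x : T < x -> Rabs (I0 x - s) < e / 2.
  move=> Hx; have := HTb x ltac:(rewrite Rabs_pos_eq; lra).
  have := g_le x; have := H_bound x; have := I0H x => h1 h2 h3 h4.
  have I0p : 0 <= I0 x by apply: RInt_ge_0; [lra | exact: gauss1_RInt | move=> t _; exact/Rlt_le/exp_pos].
  have B : s ^ 2 - I0 x ^ 2 < e * s / 2 by lra.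
  have C : I0 x ^ 2 <= s ^ 2 by lra.
  have D : I0 x <= s by nra.
  by rewrite Rabs_left1; nra.
have I0odd x : I0 (- x) = - I0 x.
  rewrite /I0; have := RInt_comp_lin (V := R_CompleteNormedModule) g (-1) 0 0 x (gauss1_RInt _ _).
  have -> : -1 * 0 + 0 = 0 by ring.
  have -> : -1 * x + 0 = - x by ring.
  move=> <-; change (RInt (fun y => scal (-1) (g (-1 * y + 0))) 0 x = opp (RInt g 0 x)); rewrite -(RInt_opp (V := R_CompleteNormedModule)); last exact: gauss1_RInt.
  apply: RInt_ext => t _; rewrite /scal /opp /= /mult /= /g.
  by have -> : (-1 * t + 0) ^ 2 = t ^ 2 by [ring]; ring.
exists T => a b Ha Hb; exists (RtoC (I0 b - I0 a)); split.
  apply: (@is_RInt_fct_extend_pair R_NormedModule R_NormedModule).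
    apply: (@is_RInt_ext R_NormedModule g) => [t _ //|].
    exact: (@is_RInt_derive R_CompleteNormedModule I0 g a b (fun x _ => @I0_derive x) (fun x _ => @gauss1_cont x)).
  have := @is_RInt_const R_NormedModule a b 0.
  by have -> : scal (b - a) 0 = 0 by rewrite /scal /= /mult /= Rmult_0_r.
have X1 := I0b b Hb; have X2 := I0b (- a) ltac:(lra); rewrite I0odd in X2.
rewrite S2 -RtoC_minus Cmod_R; have -> : I0 b - I0 a - (s + s) = (I0 b - s) + (- I0 a - s) by ring.
apply: Rle_lt_trans (Rabs_triang _ _) _; lra.
Qed.

Lemma gauss_int n : intRN (@gauss n) = RtoC (sqrt (2 * PI) ^ n).
Proof.
elim: n => [|n IH].
  rewrite /= /gauss; have -> : sumR (fun j : 'I_0 => 0 ^ 2) = 0 by rewrite /sumR big_ord0.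
  by have -> : - (0 / 2) = 0 by [field]; rewrite exp_0.
have E t : intRN (fun y : Pt n => gauss (ext y t)) = Cmult (RtoC (sqrt (2 * PI) ^ n)) (RtoC (g t)).
  rewrite -IH Cmult_comm -(proj2 (intRN_scal _ (RS_intble tt (Gc_S1 (@Gc_gauss n))))).
  apply: intRN_ext => y; rewrite /gauss -RtoC_mult -exp_plus; do 2 f_equal.
  rewrite /sumR big_ext ext_max; rewrite (eq_bigr (fun i => y i ^ 2)); last by move=> j _; rewrite ext_lift.
  by set S := \big[_/_]_(i < n) _; change (- ((S + t ^ 2) / 2) = - (t ^ 2 / 2) + - (S / 2)); field.
rewrite /=; apply: gen_lim_Ig.
have -> : (fun t => intRN (fun y : Pt n => gauss (ext y t))) = fun t => Cmult (RtoC (sqrt (2 * PI) ^ n)) (RtoC (g t)).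
  by apply: functional_extensionality.
have := gen_lim_scal (RtoC (sqrt (2 * PI) ^ n)) gauss_int1; congr gen_lim.
by rewrite -RtoC_mult /=; f_equal; ring.
Qed.

End Gaussian.

Section Inversion.
Variable n : nat.

Lemma FT_coord (f : Pt n -> C) j xi : S1 f ->
  FT (fun x => Cmult (RtoC (x j)) (f x)) xi = Cmult Ci (partial j (FT f) xi).
Proof.
move=> Hf; rewrite FT_partial // FT_scal; last exact: S1_coord.
rewrite Cmult_assoc; have -> : Cmult Ci (Copp Ci) = RtoC 1 by apply: injective_projections; rewrite /=; ring.
by rewrite Cmult_1_l.
Qed.

Lemma FT_S1 (f : Pt n -> C) : S1 f -> S1 (FT f).
Proof. exact: FT_RS. Qed.

(** [IFT] after [FT] commutes with multiplication by each coordinate, which is a derivative in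
    between. The identity therefore spreads from the Gaussian to all of [Gc] without any interchange
    of integrals. *)
Lemma Fourier_inversion (f : Pt n -> C) : Gc f -> forall z, IFT (FT f) z = Cmult (RtoC ((2 * PI) ^ n)) (f z).
Proof.
elim=> {f} [|j f Gf IH|a b f g Gf IHf Gg IHg] z.
- have -> : FT (@gauss n) = fun xi => Cmult (intRN (@gauss n)) (gauss xi).
    by apply: functional_extensionality => xi; rewrite FT_osc gauss_osc //; exact: sq_m1.
  rewrite IFT_scal; last exact/Gc_S1/Gc_gauss.
  rewrite IFT_osc gauss_osc; last exact: sq_p1.
  rewrite gauss_int Cmult_assoc -RtoC_mult -Rpow_mult_distr sqrt_sqrt //.
  by have := PI_RGT_0; lra.
- have S := Gc_S1 Gf; have -> : FT (fun z => Cmult (RtoC (z j)) (f z)) = fun xi => Cmult Ci (partial j (FT f) xi).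
    by apply: functional_extensionality => xi; apply: FT_coord.
  rewrite IFT_mul; last exact: FT_S1.
  by rewrite IH; ring.
- have Sf := Gc_S1 Gf; have Sg := Gc_S1 Gg; have Sf' := FT_S1 Sf; have Sg' := FT_S1 Sg.
  have aS := cls_scal a lin_rap Sf; have bS := cls_scal b lin_rap Sg.
  have -> : FT (fun z => Cplus (Cmult a (f z)) (Cmult b (g z))) = fun xi => Cplus (Cmult a (FT f xi)) (Cmult b (FT g xi)).
    by apply: functional_extensionality => xi; rewrite FT_plus // !FT_scal.
  rewrite IFT_plus; [| exact: (cls_scal a lin_rap Sf') | exact: (cls_scal b lin_rap Sg')].
  by rewrite !IFT_scal // IHf IHg; ring.
Qed.

End Inversion.

(** * Composition of pseudodifferential operators *)

(* Heine-Borel for cubes, phrased for an arbitrary ideal [Phi] of subsets. *)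
Lemma cube_ideal N (M : R) (Phi : (Pt N -> Prop) -> Prop) : 0 <= M ->
  (forall S S' : Pt N -> Prop, Phi S -> (forall y, S' y -> S y) -> Phi S') ->
  (forall S S' : Pt N -> Prop, Phi S -> Phi S' -> Phi (fun y => S y \/ S' y)) ->
  (forall y, (forall j, Rabs (y j) <= M) -> exists d, 0 < d /\ Phi (near d y)) ->
  Phi (fun y => forall j, Rabs (y j) <= M).
Proof.
move=> HM; elim: N Phi => [|k IH] Phi Hsub Hun Hloc.
  have [|d [Hd H]] := Hloc (fun _ => 0); first by case.
  by apply: (Hsub _ _ H) => y _ [].
pose low (y : Pt k.+1) : Pt k := fun j => y (lift ord_max j).
(* The induction hypothesis is applied to the ideal of cross-sections whose product with some
   interval around [t] belongs to [Phi]. *)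
have slab t : Rabs t <= M -> exists d, 0 < d /\ Phi (fun y => (forall j, Rabs (low y j) <= M) /\ Rabs (y ord_max - t) < d).
  move=> Ht; apply: (IH (fun S => exists d, 0 < d /\ Phi (fun y => S (low y) /\ Rabs (y ord_max - t) < d))).
  - move=> S S' [d [Hd H]] HS; exists d; split=> //; apply: (Hsub _ _ H) => y [A B]; split=> //; exact: HS.
  - move=> S S' [d [Hd H]] [d' [Hd' H']]; exists (Rmin d d'); split; first exact: Rmin_pos.
    apply: (Hsub _ _ (Hun _ _ H H')) => y [[A|A] B]; [left|right]; split=> //; apply: Rlt_le_trans B _; [exact: Rmin_l | exact: Rmin_r].
  - move=> y Hy; have [|d [Hd H]] := Hloc (ext y t).
      by move=> j; rewrite /ext; case: unliftP.
    exists d; split=> //; exists d; split=> //; apply: (Hsub _ _ H) => z [A B] j.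
    by rewrite {1}(ext_surj z) /ext; case: unliftP => [j' _|_]; [apply: A | apply: B].
(* Slabs are joined along the last coordinate by a supremum argument: if the supremum of reachable
   heights were below [M], the slab around it would extend beyond it. *)
pose P s := Phi (fun y => (forall j, Rabs (low y j) <= M) /\ - M <= y ord_max <= s).
have P0 : P (- M).
  have [|d [Hd H]] := slab (- M); first by rewrite Rabs_Ropp Rabs_pos_eq; lra.
  apply: (Hsub _ _ H) => y [A B]; split=> //; have -> : y ord_max = - M by lra.
  by rewrite Rminus_diag_eq // Rabs_R0.
pose E s := P s /\ s <= M.
have [s0 [ub lub]] : {s | is_lub E s}.
  by apply: completeness; [exists M => s [_ ?] | exists (- M); split=> //; lra].
have L1 : - M <= s0 by apply: ub; split=> //; lra.
have L2 : s0 <= M by apply: lub => s [_ ?].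
have [|d [Hd H]] := slab s0; first by apply: Rabs_le; lra.
have [s [Es Hs]] : exists s, E s /\ s0 - d < s.
  apply: NNPP => HN; have : s0 <= s0 - d; last lra.
  apply: lub => s Es; apply: Rnot_lt_le => Hlt; apply: HN; by exists s.
have P1 : P (Rmin M (s0 + d / 2)).
  apply: (Hsub _ _ (Hun _ _ (proj1 Es) H)) => y [A [B1 B2]].
  case: (Rle_or_lt (y ord_max) s) => Hc; [by left | right; split=> //].
  by have := Rmin_r M (s0 + d / 2) => ?; apply: Rabs_def1; lra.
have : Rmin M (s0 + d / 2) <= s0 by apply: ub; split=> //; exact: Rmin_l.
rewrite /Rmin; case: Rle_dec => Hc Hc'; last lra.
have E1 : s0 = M by lra.
apply: (Hsub _ _ P1) => y Hy; split; first by move=> j; apply: Hy.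
have := Hy ord_max; rewrite Rmin_left // => /Rabs_le_between; lra.
Qed.

Lemma cube_bounded N (F : Pt N -> C) M : 0 <= M ->
  (forall y, (forall j, Rabs (y j) <= M) -> lbd F y) ->
  exists K, 0 <= K /\ forall y, (forall j, Rabs (y j) <= M) -> Cmod (F y) <= K.
Proof.
move=> HM HF.
have [K HK] : exists K, forall y, (forall j, Rabs (y j) <= M) -> Cmod (F y) <= K.
  apply: (@cube_ideal N M (fun S => exists K, forall y, S y -> Cmod (F y) <= K)) => //.
  - by move=> S S' [K HK] HS; exists K => y /HS /HK.
  - move=> S S' [K HK] [K' HK']; exists (Rmax K K') => y [/HK|/HK'] H; apply: Rle_trans H _; [exact: Rmax_l | exact: Rmax_r].
exists (Rabs K); split; first exact: Rabs_pos.
by move=> y /HK H; apply: Rle_trans H (Rle_abs K).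
Qed.

Lemma enorm_W N (y : Pt N) : enorm y ^ 2 <= W y.
Proof.
rewrite enorm_sq; have [] : 1 <= W y /\ 1 + sumR (fun j => y j ^ 2) <= W y; last by lra.
rewrite /W /sumR; apply: (big_ind2 (fun a b => 1 <= b /\ 1 + a <= b)) => //; try lra.
  move=> a b c d [? ?] [? ?].
  suff H : forall a b c d, 1 <= b -> 1 + a <= b -> 1 <= d -> 1 + c <= d -> 1 <= b * d /\ 1 + (a + c) <= b * d by exact: H.
  by move=> *; nra.
by move=> j _; have := pow2_ge_0 (y j); lra.
Qed.

Lemma is_Cderiv_shift g a t l : is_Cderiv g (a + t) l -> is_Cderiv (fun s => g (a + s)) t l.
Proof.
move=> [H1 H2]; have D : is_derive (fun s => a + s) t 1 by auto_derive.
split.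
  by have := is_derive_comp (fun s => (g s).1) (fun s => a + s) t _ _ H1 D; rewrite /scal /= /mult /= Rmult_1_l.
by have := is_derive_comp (fun s => (g s).2) (fun s => a + s) t _ _ H2 D; rewrite /scal /= /mult /= Rmult_1_l.
Qed.

(** * Translations and Taylor remainders *)

Section Shift.
Variable N : nat.
Implicit Types (f : Pt N -> C) (th Y : Pt N).

Lemma is_partial_vadd f th Y j l : is_partial j f (vadd th Y) l -> is_partial j (fun Y => f (vadd th Y)) Y l.
Proof.
move=> H; rewrite /is_partial.
have -> : (fun t => f (vadd th (upd Y j t))) = fun t => f (upd (vadd th Y) j (th j + t)).
  apply: functional_extensionality => t; congr f; apply: functional_extensionality => k.
  by rewrite /vadd /upd; case: eqP => [->|].
exact: (@is_Cderiv_shift (fun s => f (upd (vadd th Y) j s)) (th j) (Y j)).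
Qed.

Lemma smooth_vadd f th : smooth f -> smooth (fun Y => f (vadd th Y)).
Proof.
move=> Sf; apply: (@smooth_intro _ (fun _ => True) (fun h => exists g, smooth g /\ h = fun Y => g (vadd th Y))); last by exists f.
  exact: opn_true.
move=> h [g [Sg ->]]; split=> [y _|i].
  have [d [Hd [M HM]]] := smooth_lbd Sg (y := vadd th y) I.
  exists d; split=> //; exists M => e He; apply: HM => j; have := He j; rewrite /vadd.
  by have -> : th j + e j - (th j + y j) = e j - y j by ring.
exists (fun Y => partial i g (vadd th Y)); split; first by exists (partial i g); split=> //; apply: smooth_partial.
by move=> y _; apply: is_partial_vadd; apply: (smooth_is_partial (U := fun _ => True)).
Qed.

Lemma dpar_vadd f th ds : smooth f -> dpar ds (fun Y => f (vadd th Y)) = fun Y => dpar ds f (vadd th Y).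
Proof.
move=> Sf; elim: ds => //= i ds ->; apply: functional_extensionality => Y.
apply: is_partial_unique; apply: is_partial_vadd.
by apply: (smooth_is_partial (U := fun _ => True)) => //; apply: smooth_dpar.
Qed.

Lemma vadd0 th : vadd th (fun _ => 0) = th.
Proof. by apply: functional_extensionality => j; rewrite /vadd Rplus_0_r. Qed.

Lemma sumC_delta (j : 'I_N) (F : 'I_N -> C) : sumC (fun k => Cmult (RtoC (if k == j then 1 else 0)) (F k)) = F j.
Proof.
rewrite /sumC (bigD1 j) //= eqxx big1 => [|k /negbTE ->]; last by ring.
ring.
Qed.

Lemma partial_comm_fun i j f : smooth f -> partial i (partial j f) = partial j (partial i f).
Proof. by move=> Sf; apply: functional_extensionality => y; apply: (partial_comm i j (@opn_true N) Sf). Qed.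

(** The [l]-th differential of [f] at [th] on [l] copies of [Y]: the Taylor term of degree [l]
    without its factor [1 / l!]. *)
Fixpoint TP l f th Y : C :=
  match l with
  | 0 => f th
  | l'.+1 => sumC (fun j => Cmult (RtoC (Y j)) (TP l' (partial j f) th Y))
  end.

(** The [l + 1] arguments of the differential contribute equally because partial derivatives
    commute. *)
Lemma TP_partial l f th Y j : smooth f ->
  is_partial j (TP l.+1 f th) Y (Cmult (RtoC (INR l.+1)) (TP l (partial j f) th Y)).
Proof.
elim: l f => [|l IH] f Sf.
  have -> : Cmult (RtoC (INR 1)) (TP 0 (partial j f) th Y) =
    sumC (fun k => Cplus (Cmult (RtoC (if k == j then 1 else 0)) (partial k f th)) (Cmult (RtoC (Y k)) (RtoC 0))).
    rewrite sumC_plus sumC_delta (sumC_ext (g := fun k => Cmult (RtoC 0) (RtoC (Y k)))) => [|k]; last by ring.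
    by rewrite sumC_scal /=; ring.
  apply: (@is_partial_sum N j N (fun k Y => Cmult (RtoC (Y k)) (partial k f th))) => k.
  by apply: is_partial_mult; [exact: is_partial_coord | exact: is_partial_const].
set R := Cmult _ _.
have -> : R = sumC (fun k => Cplus (Cmult (RtoC (if k == j then 1 else 0)) (TP l.+1 (partial k f) th Y))
    (Cmult (RtoC (Y k)) (Cmult (RtoC (INR l.+1)) (TP l (partial j (partial k f)) th Y)))).
  rewrite sumC_plus sumC_delta.
  rewrite (sumC_ext (f := fun k => Cmult (RtoC (Y k)) _) (g := fun k => Cmult (RtoC (INR l.+1)) (Cmult (RtoC (Y k)) (TP l (partial k (partial j f)) th Y)))).
    by rewrite sumC_scal /R S_INR RtoC_plus -/(TP l.+1 (partial j f) th Y) /=; ring.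
  by move=> k; rewrite (partial_comm_fun j k Sf); ring.
apply: (@is_partial_sum N j N (fun k Y => Cmult (RtoC (Y k)) (TP l.+1 (partial k f) th Y))) => k.
apply: is_partial_mult; first exact: is_partial_coord.
by apply: IH; apply: smooth_partial.
Qed.

Definition TT M f th Y : C := sumC (fun l : 'I_M => Cmult (RtoC (/ INR (fact l))) (TP l f th Y)).
Definition TR M f th Y : C := Cminus (f (vadd th Y)) (TT M f th Y).

Lemma TT_partial M f th Y j : smooth f -> is_partial j (TT M f th) Y (TT M.-1 (partial j f) th Y).
Proof.
move=> Sf; case: M => [|M].
  by rewrite /TT; have := is_partial_const j (RtoC 0) Y; congr is_partial; [apply: functional_extensionality => z|]; rewrite /sumC big_ord0.
have -> : TT M.+1.-1 (partial j f) th Y = sumC (fun l : 'I_M.+1 => Cmult (RtoC (/ INR (fact l)))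
   (match nat_of_ord l with 0%N => RtoC 0 | l'.+1 => Cmult (RtoC (INR l'.+1)) (TP l' (partial j f) th Y) end)).
  rewrite /TT /sumC big_ord_recl /= Cmult_0_r Cplus_0_l; apply: eq_bigr => l _.
  rewrite Cmult_assoc -RtoC_mult; do 2 f_equal; change (/ INR (fact l) = / INR (fact l.+1) * INR l.+1); rewrite fact_simpl mult_INR.
  by field; split; [exact: INR_fact_neq_0 | exact: not_0_INR].
apply: (@is_partial_sum N j M.+1 (fun l Y => Cmult (RtoC (/ INR (fact l))) (TP l f th Y))) => l.
apply: is_partial_scal; case: (nat_of_ord l) => [|l']; first exact: is_partial_const.
exact: TP_partial.
Qed.

Lemma TR_partial M f th Y j : smooth f -> is_partial j (TR M f th) Y (TR M.-1 (partial j f) th Y).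
Proof.
move=> Sf; rewrite /TR.
have H1 : is_partial j (fun Y => f (vadd th Y)) Y (partial j f (vadd th Y)).
  by apply: is_partial_vadd; apply: (smooth_is_partial (U := fun _ => True)).
have := is_partial_plus H1 (is_partial_scal (RtoC (-1)) (TT_partial M th Y j Sf)).
by congr is_partial; [apply: functional_extensionality => z|]; ring.
Qed.

Lemma TP_smooth l f th : smooth (TP l f th).
Proof.
elim: l f => [|l IH] f; first exact: (smooth_const _ (@opn_true N)).
apply: (smooth_sum (@opn_true N)) => k; apply: (smooth_mult (@opn_true N)); last exact: IH.
exact: (smooth_coord _ (@opn_true N)).
Qed.

Lemma TR_smooth M f th : smooth f -> smooth (TR M f th).
Proof.
move=> Sf; have H : smooth (TT M f th).
  by apply: (smooth_sum (@opn_true N)) => k; apply: (smooth_scal _ (@opn_true N)); exact: TP_smooth.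
have := smooth_plus (@opn_true N) (smooth_vadd th Sf) (smooth_scal (RtoC (-1)) (@opn_true N) H).
by apply: (smooth_ext (@opn_true N)) => y _; rewrite /TR; ring.
Qed.

(** The truncated subtraction is meant: after [M] or more derivatives the Taylor polynomial is gone
    and the derivative of [f] itself remains. *)
Lemma TR_dpar M f th ds : smooth f -> dpar ds (TR M f th) = TR (M - size ds) (dpar ds f) th.
Proof.
move=> Sf; elim: ds => [|i ds IH] /=; first by rewrite subn0.
rewrite IH; apply: functional_extensionality => Y; apply: is_partial_unique; rewrite subnS.
by apply: TR_partial; apply: smooth_dpar.
Qed.

Lemma TR_0 M f th : TR M.+1 f th (fun _ => 0) = RtoC 0.
Proof.
rewrite /TR vadd0 /TT /sumC big_ord_recl big1 => [|l _].
  by rewrite /= Rinv_1; ring.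
rewrite -[nat_of_ord (lift ord0 l)]/(l.+1) [TP _ _ _ _]/=.
by rewrite (sumC_ext (g := fun _ => Cmult (RtoC 0) (RtoC 0))) => [|j]; [rewrite sumC_scal; ring | ring].
Qed.

(** Each Taylor order costs one use of [path_bound] on the box between 0 and [Y], hence one factor
    twice the sum of the [|Y_j|]. A crude constant without [1 / M!] is good enough for asymptotics
    in [th]. *)
Lemma TR_bound M f th Y B : smooth f -> 0 <= B ->
  (forall ds Z, size ds = M -> (forall j, Rabs (Z j) <= Rabs (Y j)) -> Cmod (dpar ds f (vadd th Z)) <= B) ->
  Cmod (TR M f th Y) <= B * (2 * sumR (fun j => Rabs (Y j))) ^ M.
Proof.
move=> Sf HB; elim: M f Y Sf => [|M IH] f Y Sf H.
  rewrite /TR /TT /sumC big_ord0 /= Rmult_1_r.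
  have -> : Cminus (f (vadd th Y)) (RtoC 0) = dpar [::] f (vadd th Y) by rewrite /=; ring.
  by apply: H => // j; lra.
have S0 : 0 <= sumR (fun j => Rabs (Y j)) by apply: sumR_ge0 => j; exact: Rabs_pos.
have -> : TR M.+1 f th Y = Cminus (TR M.+1 f th Y) (TR M.+1 f th (fun _ => 0)) by rewrite TR_0; ring.
apply: Rle_trans (@path_bound N _ (fun j => TR M (partial j f) th) (fun _ => 0) Y (fun _ => B * (2 * sumR (fun j => Rabs (Y j))) ^ M) _) _.
  move=> i w Hw; split; first exact: (@TR_partial M.+1).
  have wY j : Rabs (w j) <= Rabs (Y j).
    by have := Hw j; rewrite /Rmin /Rmax /Rabs; case: Rle_dec => ?; do 2 case: Rcase_abs => ?; lra.
  apply: Rle_trans (IH (partial i f) w _ _) _.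
  - exact: smooth_partial.
  - move=> ds Z Hds HZ; rewrite -dpar_rcons; apply: H; first by rewrite size_rcons Hds.
    by move=> j; have := HZ j; have := wY j; lra.
  - apply: Rmult_le_compat_l => //; apply: pow_incr; split.
      by apply: Rmult_le_pos; [lra | apply: sumR_ge0 => j; exact: Rabs_pos].
    by apply: Rmult_le_compat_l; [lra | exact: sumR_le].
rewrite (sumR_ext (g := fun i => (2 * (B * (2 * sumR (fun j => Rabs (Y j))) ^ M)) * Rabs (Y i))) => [|i]; last by rewrite Rminus_0_r.
by rewrite sumR_scal /=; lra.
Qed.

End Shift.

Section Symbols.
Variable N : nat.
Variable lam : Pt N -> R.
Variables (L0 L1 : R).
Hypothesis lam_pos : forall y, 0 < lam y.
Hypothesis lam_le : forall y, lam y <= L0.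
Hypothesis L1_pos : 0 <= L1.
Hypothesis lam_peetre : forall th Z, lam (vadd th Z) <= L1 * W Z * lam th.

(** Symbols of order 0 in all variables jointly: each derivative gains a factor [lam], later
    instantiated by [/ br]. The hypothesis [lam_peetre] is Peetre's inequality. *)
Definition symb (b : Pt N -> C) := smooth b /\
  forall ds, exists K, forall y, Cmod (dpar ds b y) <= K * lam y ^ size ds.

(** One constant for all index lists of length [k], obtained as a maximum over the finite type of
    tuples. *)
Lemma symb_size b k : symb b -> exists K, 0 <= K /\ forall ds y, size ds = k -> Cmod (dpar ds b y) <= K * lam y ^ k.
Proof.
move=> [Sb H].
have [K HK] := @fin_all_exists (k.-tuple 'I_N) _ _ (fun ds : k.-tuple 'I_N => H (val ds)).
exists (\big[Rmax/0]_ds Rabs (K ds)); split.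
  apply: big_rec; first lra.
  by move=> i x _ Hx; apply: Rle_trans Hx _; exact: Rmax_r.
move=> ds y Hs; have Hs' : size ds == k by apply/eqP.
have /= := HK (Tuple Hs') y; rewrite Hs => H'.
apply: Rle_trans H' _; apply: Rmult_le_compat_r; first by apply: pow_le; have := lam_pos y; lra.
apply: Rle_trans (Rle_abs _) _.
have : Tuple Hs' \in index_enum (k.-tuple 'I_N : finType) by rewrite mem_index_enum.
elim: (index_enum _) => [//|t r IH]; rewrite big_cons in_cons => /orP [/eqP <-|/IH IH']; first exact: Rmax_l.
exact: Rle_trans IH' (Rmax_r _ _).
Qed.

Lemma L0_pos : 0 < L0.
Proof. by have := lam_pos (fun _ => 0); have := lam_le (fun _ => 0); lra. Qed.

Lemma symb_bdd b : symb b -> forall ds, exists K, forall y, Cmod (dpar ds b y) <= K.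
Proof.
move=> [_ H] ds; have [K HK] := H ds; exists (Rabs K * L0 ^ size ds) => y.
apply: Rle_trans (HK y) _; have := lam_pos y => lp.
apply: Rle_trans (Rmult_le_compat_r _ _ _ _ (Rle_abs K)) _; first by apply: pow_le; lra.
apply: Rmult_le_compat_l; first exact: Rabs_pos.
by apply: pow_incr; have := lam_le y; lra.
Qed.

Lemma W_mono (Y Z : Pt N) : (forall j, Rabs (Z j) <= Rabs (Y j)) -> W Z <= W Y.
Proof.
move=> H; have [] : 0 <= W Z /\ W Z <= W Y => //.
rewrite /W; apply: (big_ind2 (fun a b => 0 <= a /\ a <= b)); first lra.
  by move=> a b c d [? ?] [? ?]; split; [exact: Rmult_le_pos | exact: Rmult_le_compat].
move=> j _; split; first by have := pow2_ge_0 (Z j); lra.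
by apply: Rplus_le_compat_l; rewrite -(pow2_abs (Z j)) -(pow2_abs (Y j)); apply: pow_incr; split; [exact: Rabs_pos | exact: H].
Qed.

Lemma sum_abs_W (Y : Pt N) : sumR (fun j => Rabs (Y j)) <= INR N * W Y.
Proof.
rewrite -sumR_const; apply: sumR_le => j; apply: Rle_trans (W_coord Y j).
by rewrite -pow2_abs; have := Rabs_pos (Y j); nra.
Qed.

(** Derivatives of the remainder lose no decay in [th]: the derivatives taken and the Taylor order
    still left add up to [q >= M]. Peetre's inequality moves [lam] from a nearby point back to [th]
    at the price [W Y ^ M], and the powers of [Y] cost at most another [W Y ^ M]. *)
Lemma TR_symb M b ds : symb b -> exists K, forall th Y,
  Cmod (dpar ds (TR M b th) Y) <= K * lam th ^ M * W Y ^ (2 * M).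
Proof.
move=> Hb; pose m := (M - size ds)%N; pose q := (size ds + m)%N.
have [K [HK0 HK]] := symb_size q Hb.
have HMq : (M <= q)%N by rewrite /q /m -leq_subLR.
have HN := pos_INR N.
exists (K * L0 ^ (q - M) * L1 ^ M * (2 * INR N) ^ m) => th Y.
have W1 := W_ge1 Y; have L0p := L0_pos; have lp := lam_pos th.
rewrite TR_dpar; last exact: (proj1 Hb).
apply: Rle_trans (@TR_bound N m (dpar ds b) th Y (K * L0 ^ (q - M) * L1 ^ M * lam th ^ M * W Y ^ M) _ _ _) _.
- exact: (smooth_dpar ds (proj1 Hb)).
- by repeat apply: Rmult_le_pos; rewrite //; apply: pow_le; lra.
- move=> ds' Z Hs HZ; rewrite -dpar_cat; apply: Rle_trans (HK _ _ _) _.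
    by rewrite size_cat Hs addnC.
  have lz := lam_pos (vadd th Z); have WZ := W_ge1 Z; have WZY := W_mono HZ.
  rewrite -{1}(subnK HMq) pow_add !Rmult_assoc; apply: Rmult_le_compat_l => //.
  apply: Rmult_le_compat; try (by apply: pow_le; lra); first by apply: pow_incr; have := lam_le (vadd th Z); lra.
  rewrite -!Rpow_mult_distr; apply: pow_incr; split; first lra.
  apply: Rle_trans (lam_peetre th Z) _.
  have -> : L1 * W Z * lam th = L1 * (W Z * lam th) by ring.
  by apply: Rmult_le_compat_l => //; rewrite (Rmult_comm (lam th)); apply: Rmult_le_compat_r; lra.
have A : (2 * sumR (fun j => Rabs (Y j))) ^ m <= (2 * INR N) ^ m * W Y ^ M.
  apply: Rle_trans (_ : (2 * INR N * W Y) ^ m <= _).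
    apply: pow_incr; split; first by apply: Rmult_le_pos; [lra | apply: sumR_ge0 => j; exact: Rabs_pos].
    by have := sum_abs_W Y; lra.
  rewrite Rpow_mult_distr; apply: Rmult_le_compat_l; first by apply: pow_le; lra.
  by apply: Wk_mono; exact: leq_subr.
have E : W Y ^ (2 * M) = W Y ^ M * W Y ^ M by rewrite -pow_add mul2n -addnn.
rewrite E.
apply: Rle_trans (Rmult_le_compat_l _ _ _ _ A) _; last by right; ring.
by repeat apply: Rmult_le_pos; rewrite //; apply: pow_le; lra.
Qed.

End Symbols.

(** * Quantized Taylor polynomials as differential operators *)

Section Quantization.
Variable n : nat.
Implicit Types (A b : Pt (n + n) -> C) (f : Pt n -> C) (z : Pt n).

Definition dvar j f : Pt n -> C := fun x => Cmult (Copp Ci) (partial j f x).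

Lemma dvar_Gc j f : Gc f -> Gc (dvar j f).
Proof. by move=> H; apply: Gc_scal; apply: Gc_partial. Qed.

Lemma lin_BP Th P : lin_bound (@BP n Th P).
Proof.
split=> [F G [k1 [K1 H1]] [k2 [K2 H2]]|c F [k [K H]]|].
- exists (maxn k1 k2), (Rabs K1 + Rabs K2) => th z e.
  apply: Rle_trans (Cmod_triangle _ _) _; rewrite !Rmult_plus_distr_r.
  have Wz := Wk_ge0 z P.
  apply: Rplus_le_compat.
    apply: Rle_trans (H1 th z e) _; apply: Rle_trans (_ : Rabs K1 * W z ^ P * W e ^ k1 <= _).
      apply: Rmult_le_compat_r; first exact: Wk_ge0.
      by apply: Rmult_le_compat_r => //; exact: Rle_abs.
    by apply: Rmult_le_compat_l; [apply: Rmult_le_pos => //; exact: Rabs_pos | apply: Wk_mono; exact: leq_maxl].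
  apply: Rle_trans (H2 th z e) _; apply: Rle_trans (_ : Rabs K2 * W z ^ P * W e ^ k2 <= _).
    apply: Rmult_le_compat_r; first exact: Wk_ge0.
    by apply: Rmult_le_compat_r => //; exact: Rle_abs.
  by apply: Rmult_le_compat_l; [apply: Rmult_le_pos => //; exact: Rabs_pos | apply: Wk_mono; exact: leq_maxr].
- exists k, (Cmod c * K) => th z e; rewrite Cmod_mult !Rmult_assoc.
  by apply: Rmult_le_compat_l; [apply: Cmod_ge_0 | rewrite -Rmult_assoc].
- by exists 0%N, 0 => th z e; rewrite Cmod_0 /=; lra.
Qed.

Lemma BP_mult Th P Q (F G : Th -> Pt (n + n) -> C) : BP P F -> BP Q G -> BP (P + Q) (fun th y => Cmult (F th y) (G th y)).
Proof.
move=> [k1 [K1 H1]] [k2 [K2 H2]]; exists (k1 + k2)%N, (K1 * K2) => th z e.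
rewrite Cmod_mult !pow_add.
have -> : K1 * K2 * (W z ^ P * W z ^ Q) * (W e ^ k1 * W e ^ k2) = (K1 * W z ^ P * W e ^ k1) * (K2 * W z ^ Q * W e ^ k2) by ring.
by apply: Rmult_le_compat; [exact: Cmod_ge_0 | exact: Cmod_ge_0 | exact: H1 | exact: H2].
Qed.

Lemma cls_cst N Th B (c : Th -> C) : (exists K, forall th, Cmod (c th) <= K) -> lin_bound B ->
  B (fun th _ => c th) -> cls (N := N) B (fun th _ => c th).
Proof.
move=> _ HB Hc; split; first by move=> th; apply: (smooth_const _ (@opn_true N)).
case=> [//|i ds].
have -> : (fun th => dpar (i :: ds) (fun _ : Pt N => c th)) = fun _ _ => RtoC 0; last exact: (lb_zero HB).
apply: functional_extensionality => th; elim: ds i => [|k ds IH] i.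
  by apply: functional_extensionality => y; apply: is_partial_unique; exact: is_partial_const.
have /= := IH k => E; rewrite /= E; apply: functional_extensionality => y; apply: is_partial_unique; exact: is_partial_const.
Qed.

Lemma cls_coord_any Th i : cls (@BP n Th 1) (fun _ Y => RtoC (Y i)).
Proof.
have [S D] := cls_coord Th i; split=> // ds.
suff [K HK] : exists K, forall y : Pt (n + n), Cmod (dpar ds (fun Y : Pt (n + n) => RtoC (Y i)) y) <= K * W y ^ 1.
  by exists 1%N, K => th z e; have := HK (join z e); rewrite W_join !pow_1 Rmult_assoc.
case: ds {D} => [|j ds].
  exists 1 => y; rewrite /= Cmod_R Rmult_1_l Rmult_1_r; apply: Rle_trans (W_coord y i).
  by rewrite -pow2_abs; have := Rabs_pos (y i); nra.
have [c Hc] : exists c, forall y, dpar (j :: ds) (fun Y : Pt (n + n) => RtoC (Y i)) y = c.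
  elim: ds j => [|k ds IH] j.
    exists (RtoC (if i == j then 1 else 0)) => y; apply: is_partial_unique; exact: is_partial_coord.
  have [c Hc] := IH k; exists (RtoC 0) => y.
  rewrite [dpar _ _]/= (_ : partial k (dpar ds (fun Y : Pt (n + n) => RtoC (Y i))) = fun _ => c); last by apply: functional_extensionality.
  by apply: is_partial_unique; exact: is_partial_const.
exists (Cmod c) => y; rewrite Hc pow_1; have := W_ge1 y; have := Cmod_ge_0 c; nra.
Qed.

Lemma TP_BP l b th : cls (@BP n unit l) (fun _ => TP l b th).
Proof.
elim: l b => [|l IH] b.
  apply: (cls_cst (c := fun _ => b th)); [by exists (Cmod (b th)) => _; lra | exact: lin_BP |].
  by exists 0%N, (Cmod (b th)) => _ z e /=; lra.
apply: (@cls_sum unit (n + n) _ (n + n) (fun k _ Y => Cmult (RtoC (Y k)) (TP l (partial k b) th Y)) (lin_BP unit l.+1)) => k.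
rewrite -(add1n l); apply: (cls_mult (lin_BP unit _) _ (cls_coord_any unit k) (IH _)) => F G.
exact: BP_mult.
Qed.

Definition cn : C := RtoC (/ (2 * PI) ^ n).

(** The scalar operator underlying [op], for arbitrary polynomially growing amplitudes, so that it
    applies to translated symbols, Taylor polynomials and remainders alike. *)
Definition Opq A f z : C := Cmult cn (osc 1 (fun Y => Cmult (A Y) (FT f (pr2 Y))) z).

Lemma Opq_amp Th P (A : Th -> Pt (n + n) -> C) (f : Th -> Pt n -> C) : cls (BP P) A -> RS f ->
  cls (BA P) (fun th Y => Cmult (A th Y) (FT (f th) (pr2 Y))).
Proof.
move=> HA Hf; apply: (cls_mult (lin_BA P) _ HA (RS_pr2 (FT_RS Hf))) => F G; exact: BP_BA.
Qed.

Lemma Opq_RS Th P (A : Th -> Pt (n + n) -> C) (f : Th -> Pt n -> C) : cls (BP P) A -> RS f ->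
  RS (fun th => Opq (A th) (f th)).
Proof. by move=> HA Hf; apply: (cls_scal cn lin_rap); apply: (osc_RS sq_p1 (Opq_amp HA Hf)). Qed.

Lemma Opq_amp1 P A f : cls (@BP n unit P) (fun _ => A) -> S1 f -> amp P (fun Y => Cmult (A Y) (FT f (pr2 Y))).
Proof. by move=> HA Hf; apply: (@Opq_amp unit P (fun _ => A) (fun _ => f)). Qed.

Lemma Opq_plusA P A A' f z : cls (@BP n unit P) (fun _ => A) -> cls (@BP n unit P) (fun _ => A') -> S1 f ->
  Opq (fun Y => Cplus (A Y) (A' Y)) f z = Cplus (Opq A f z) (Opq A' f z).
Proof.
move=> HA HA' Hf; rewrite /Opq -Cmult_plus_distr_l -(osc_plus 1 z (Opq_amp1 HA Hf) (Opq_amp1 HA' Hf)).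
by congr Cmult; congr (osc _ _ z); apply: functional_extensionality => Y; ring.
Qed.

Lemma Opq_scalA P c A f z : cls (@BP n unit P) (fun _ => A) -> S1 f ->
  Opq (fun Y => Cmult c (A Y)) f z = Cmult c (Opq A f z).
Proof.
move=> HA Hf; rewrite /Opq; have -> : (fun Y => Cmult (Cmult c (A Y)) (FT f (pr2 Y))) = fun Y => Cmult c (Cmult (A Y) (FT f (pr2 Y))).
  by apply: functional_extensionality => Y; ring.
by rewrite (osc_scal _ _ _ (Opq_amp1 HA Hf)); ring.
Qed.

Lemma Opq_sumA P m (A : 'I_m -> Pt (n + n) -> C) f z : (forall k, cls (@BP n unit P) (fun _ => A k)) -> S1 f ->
  Opq (fun Y => sumC (fun k => A k Y)) f z = sumC (fun k => Opq (A k) f z).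
Proof.
move=> HA Hf; rewrite /sumC.
suff [] : cls (@BP n unit P) (fun _ Y => \big[Cplus/RtoC 0]_(k < m) A k Y) /\ Opq (fun Y => \big[Cplus/RtoC 0]_(k < m) A k Y) f z = \big[Cplus/RtoC 0]_(k < m) Opq (A k) f z by [].
elim: (index_enum _) => [|i r [IH1 IH2]].
  rewrite big_nil; have -> : (fun Y => \big[Cplus/RtoC 0]_(k <- [::]) A k Y) = fun Y => RtoC 0.
    by apply: functional_extensionality => Y; rewrite big_nil.
  have Z := cls_zero (lin_BP unit P); split=> //.
  have E : (fun _ : Pt (n + n) => RtoC 0) = fun Y => Cmult (RtoC 0) (RtoC 0) by apply: functional_extensionality => Y; ring.
  by rewrite E (Opq_scalA (RtoC 0) z Z Hf); ring.
rewrite big_cons; have -> : (fun Y => \big[Cplus/RtoC 0]_(k <- i :: r) A k Y) = fun Y => Cplus (A i Y) (\big[Cplus/RtoC 0]_(k <- r) A k Y).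
  by apply: functional_extensionality => Y; rewrite big_cons.
split; first exact: (cls_plus (lin_BP unit P) (HA i) IH1).
by rewrite (Opq_plusA z (HA i) IH1 Hf) IH2.
Qed.

(** In this quantization position variables multiply last, and by [Opq_pr2] frequency variables act
    first, as [dvar]. Polynomial amplitudes thus become differential operators. *)
Lemma Opq_pr1 P A f z j : cls (@BP n unit P) (fun _ => A) -> S1 f ->
  Opq (fun Y => Cmult (RtoC (Y (lshift n j))) (A Y)) f z = Cmult (RtoC (z j)) (Opq A f z).
Proof.
move=> HA Hf; rewrite /Opq /osc.
have := proj2 (intRN_scal (RtoC (z j)) (osc_intble 1 z (Opq_amp1 HA Hf))).
rewrite (intRN_ext (G := fun e => Cmult (cis (1 * dotR z e)) (Cmult (Cmult (RtoC (join z e (lshift n j))) (A (join z e))) (FT f (pr2 (join z e)))))) => [->|e].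
  by ring.
by rewrite join_l; ring.
Qed.

Lemma Opq_pr2 A f z j : S1 f ->
  Opq (fun Y => Cmult (RtoC (Y (rshift n j))) (A Y)) f z = Opq A (dvar j f) z.
Proof.
move=> Hf; rewrite /Opq; congr Cmult; congr (osc _ _ z); apply: functional_extensionality => Y.
by rewrite FT_mul // /pr2; ring.
Qed.

(* [OpP l b th] is [l!] times the quantization of the degree [l] part of the Taylor expansion of [b] at [th]. *)
Fixpoint OpP l b th f z : C :=
  match l with
  | 0 => Cmult (b th) (f z)
  | l'.+1 => Cplus (sumC (fun j => Cmult (RtoC (z j)) (OpP l' (partial (lshift n j) b) th f z)))
                   (sumC (fun j => OpP l' (partial (rshift n j) b) th (dvar j f) z))
  end.

Lemma BP_le Th P Q (F : Th -> Pt (n + n) -> C) : (P <= Q)%N -> BP P F -> BP Q F.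
Proof.
move=> H [k [K HK]]; exists k, (Rabs K) => th z e; apply: Rle_trans (HK th z e) _.
apply: Rmult_le_compat_r; first exact: Wk_ge0.
apply: Rle_trans (Rmult_le_compat_r _ _ _ (Wk_ge0 z P) (Rle_abs K)) _.
by apply: Rmult_le_compat_l; [exact: Rabs_pos | exact: Wk_mono].
Qed.

Lemma cls_BP_le Th P Q (F : Th -> Pt (n + n) -> C) : (P <= Q)%N -> cls (BP P) F -> cls (BP Q) F.
Proof. by move=> H [S B]; split=> // ds; apply: BP_le H (B ds). Qed.

Lemma sumC_split (F : 'I_(n + n) -> C) : sumC F = Cplus (sumC (fun j => F (lshift n j))) (sumC (fun j => F (rshift n j))).
Proof. by rewrite /sumC big_split_ord. Qed.

(** Fourier inversion enters the composition formula here, for a constant amplitude; coordinates are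
    then pulled out one by one with [Opq_pr1] and [Opq_pr2]. *)
Lemma Opq_TP l b th f z : Gc f -> Opq (TP l b th) f z = OpP l b th f z.
Proof.
elim: l b f => [|l IH] b f Gf.
  rewrite /Opq -[TP 0 b th]/(fun _ => b th) (osc_scal 1 (b th) z (S1_amp (FT_S1 (Gc_S1 Gf)))) -IFT_osc Fourier_inversion //=.
  have -> : Cmult cn (Cmult (b th) (Cmult (RtoC ((2 * PI) ^ n)) (f z))) = Cmult (Cmult cn (RtoC ((2 * PI) ^ n))) (Cmult (b th) (f z)) by ring.
  rewrite /cn -RtoC_mult Rinv_l; first by ring.
  by apply: pow_nonzero; have := PI_RGT_0; lra.
have Sf := Gc_S1 Gf.
have HB i : cls (@BP n unit l.+1) (fun _ Y => Cmult (RtoC (Y i)) (TP l (partial i b) th Y)).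
  rewrite -(add1n l); apply: (cls_mult (lin_BP unit _) _ (cls_coord_any unit i) (TP_BP l (partial i b) th)) => F G.
  exact: BP_mult.
rewrite [OpP _ _ _ _ _]/= -[TP l.+1 b th]/(fun Y => sumC (fun i => Cmult (RtoC (Y i)) (TP l (partial i b) th Y))).
rewrite (@Opq_sumA l.+1 (n + n) (fun i Y => Cmult (RtoC (Y i)) (TP l (partial i b) th Y)) f z HB Sf) sumC_split.
congr Cplus; apply: sumC_ext => j.
  by rewrite (Opq_pr1 z j (TP_BP l (partial (lshift n j) b) th) Sf) IH.
by rewrite Opq_pr2 // IH //; apply: dvar_Gc.
Qed.

Lemma OpP_Gc l b th f : Gc f -> Gc (OpP l b th f).
Proof.
elim: l b f => [|l IH] b f Gf; first exact: Gc_scal.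
apply: Gc_plus; apply: (Gc_sum (F := fun j z => _)) => j; last by apply: IH; apply: dvar_Gc.
by apply: Gc_mul; apply: IH.
Qed.

(** The point [th] enters only through values of derivatives of [b], which are bounded; hence the
    uniformity. *)
Lemma OpP_RS l b f : (forall ds, exists K, forall y, Cmod (dpar ds b y) <= K) -> Gc f -> RS (fun th => OpP l b th f).
Proof.
elim: l b f => [|l IH] b f Hb Gf.
  have [K HK] := Hb [::].
  apply: (RS_mult (F := fun th _ => b th) (G := fun _ => f)).
    by apply: cls_cst; [exists K | exact: lin_pol | exists 0%N, K => th y /=; have := HK th => /= ?; lra].
  have [S H] := Gc_S1 Gf; split; first by move=> th; exact: (S tt).
  by move=> ds k; have [K' HK'] := H ds k; exists K' => _; apply: (HK' tt).
have Hp i ds : exists K, forall y, Cmod (dpar ds (partial i b) y) <= K.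
  by have [K HK] := Hb (rcons ds i); exists K => y; rewrite -dpar_rcons.
apply: (cls_plus lin_rap); apply: (cls_sum (F := fun j th z => _) lin_rap) => j; last by apply: IH => //; apply: dvar_Gc.
by apply: (RS_mult (cls_coord _ j)); apply: IH.
Qed.

Lemma dvar_comm i j f : smooth f -> dvar j (partial i f) = partial i (dvar j f).
Proof.
move=> Sf; apply: functional_extensionality => y; symmetry; apply: is_partial_unique.
rewrite /dvar; apply: is_partial_scal.
rewrite (partial_comm_fun j i Sf); apply: (smooth_is_partial (U := fun _ => True)) => //; exact: smooth_partial.
Qed.

(** Commuting a derivative past the operator differentiates its polynomial symbol in [x_i]; the
    factor [l] reflects the omitted [1 / l!]. For [l = 0] the term with [l.-1] has coefficient 0. *)
Lemma OpP_partial l b th f z i : smooth b -> Gc f ->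
  is_partial i (OpP l b th f) z
    (Cplus (Cmult (RtoC (INR l)) (OpP l.-1 (partial (lshift n i) b) th f z)) (OpP l b th (partial i f) z)).
Proof.
elim: l b f => [|l IH] b f Sb Gf.
  have := is_partial_scal (b th) (smooth_is_partial (U := fun _ => True) i (proj1 (Gc_S1 Gf) tt) (y := z) I).
  by congr is_partial; rewrite /=; ring.
set bi := partial (lshift n i) b.
have S1' := proj1 (Gc_S1 Gf) tt.
pose X j := Cplus (Cmult (RtoC (if j == i then 1 else 0)) (OpP l (partial (lshift n j) b) th f z))
   (Cmult (RtoC (z j)) (Cplus (Cmult (RtoC (INR l)) (OpP l.-1 (partial (lshift n i) (partial (lshift n j) b)) th f z)) (OpP l (partial (lshift n j) b) th (partial i f) z))).
pose X' j := Cplus (Cmult (RtoC (INR l)) (OpP l.-1 (partial (lshift n i) (partial (rshift n j) b)) th (dvar j f) z)) (OpP l (partial (rshift n j) b) th (partial i (dvar j f)) z).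
have -> : Cplus (Cmult (RtoC (INR l.+1)) (OpP l.+1.-1 bi th f z)) (OpP l.+1 b th (partial i f) z) = Cplus (sumC X) (sumC X').
  rewrite /X /X' !sumC_plus sumC_delta -/bi.
  have -> : sumC (fun k => Cmult (RtoC (z k)) (Cplus (Cmult (RtoC (INR l)) (OpP l.-1 (partial (lshift n i) (partial (lshift n k) b)) th f z)) (OpP l (partial (lshift n k) b) th (partial i f) z))) =
    Cplus (Cmult (RtoC (INR l)) (sumC (fun k => Cmult (RtoC (z k)) (OpP l.-1 (partial (lshift n k) bi) th f z))))
      (sumC (fun k => Cmult (RtoC (z k)) (OpP l (partial (lshift n k) b) th (partial i f) z))).
    rewrite -sumC_scal -sumC_plus; apply: sumC_ext => k; rewrite /bi (partial_comm_fun (lshift n k) (lshift n i) Sb); ring.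
  have -> : sumC (fun k => Cmult (RtoC (INR l)) (OpP l.-1 (partial (lshift n i) (partial (rshift n k) b)) th (dvar k f) z)) =
     Cmult (RtoC (INR l)) (sumC (fun k => OpP l.-1 (partial (rshift n k) bi) th (dvar k f) z)).
    by rewrite -sumC_scal; apply: sumC_ext => k; rewrite /bi (partial_comm_fun (rshift n k) (lshift n i) Sb).
  have -> : sumC (fun k => OpP l (partial (rshift n k) b) th (partial i (dvar k f)) z) = sumC (fun k => OpP l (partial (rshift n k) b) th (dvar k (partial i f)) z).
    by apply: sumC_ext => k; rewrite dvar_comm.
  have L : Cmult (RtoC (INR l)) (OpP l bi th f z) = Cmult (RtoC (INR l)) (Cplus (sumC (fun k => Cmult (RtoC (z k)) (OpP l.-1 (partial (lshift n k) bi) th f z))) (sumC (fun k => OpP l.-1 (partial (rshift n k) bi) th (dvar k f) z))).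
    by case: (l) => [|l'] //; rewrite /= !Cmult_0_l.
  rewrite S_INR RtoC_plus Cmult_plus_distr_r -[l.+1.-1]/l L [OpP l.+1 _ _ _ _]/=; ring.
apply: is_partial_plus.
  apply: (@is_partial_sum n i n (fun j z => Cmult (RtoC (z j)) (OpP l (partial (lshift n j) b) th f z))) => j.
  apply: is_partial_mult; first exact: is_partial_coord.
  by apply: IH => //; apply: smooth_partial.
apply: (@is_partial_sum n i n (fun j z => OpP l (partial (rshift n j) b) th (dvar j f) z)) => j.
by apply: IH; [apply: smooth_partial | apply: dvar_Gc].
Qed.

Definition dv ds f : C := dpar ds f (fun _ => 0).
Definition flat k f := forall ds, (size ds < k)%N -> dv ds f = RtoC 0.

Lemma dv_OpP_rcons ds i l b th f : smooth b -> Gc f ->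
  dv (rcons ds i) (OpP l b th f) = Cplus (Cmult (RtoC (INR l)) (dv ds (OpP l.-1 (partial (lshift n i) b) th f))) (dv ds (OpP l b th (partial i f))).
Proof.
move=> Sb Gf; rewrite /dv dpar_rcons.
have -> : partial i (OpP l b th f) = fun z => Cplus (Cmult (RtoC (INR l)) (OpP l.-1 (partial (lshift n i) b) th f z)) (OpP l b th (partial i f) z).
  by apply: functional_extensionality => z; apply: is_partial_unique; apply: OpP_partial.
have SO l' b' f' : Gc f' -> smooth (OpP l' b' th f') by move=> H; exact: (proj1 (Gc_S1 (OpP_Gc l' b' th H)) tt).
rewrite (dpar_plus ds (@opn_true n) _ _ I); [| exact: (smooth_scal _ (@opn_true n) (SO _ _ _ Gf)) | exact: (SO _ _ _ (Gc_partial i Gf))].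
by rewrite (dpar_scal ds _ (@opn_true n) (SO _ _ _ Gf) I).
Qed.

Lemma flat_partial k i f : flat k f -> flat k.-1 (partial i f).
Proof.
move=> H ds Hs; rewrite /dv -dpar_rcons; apply: H; rewrite size_rcons.
by case: k Hs.
Qed.

Lemma flat_scal k c f : smooth f -> flat k f -> flat k (fun z => Cmult c (f z)).
Proof. by move=> Sf H ds Hs; rewrite /dv (dpar_scal ds c (@opn_true n) Sf I) -/(dv ds f) H // Cmult_0_r. Qed.

Lemma OpP_at0 l b th f : OpP l.+1 b th f (fun _ => 0) = sumC (fun j => OpP l (partial (rshift n j) b) th (dvar j f) (fun _ => 0)).
Proof.
rewrite /= sumC_scal; ring.
Qed.

Lemma flat_OpP_at0 l b th f k : Gc f -> flat k f -> (l < k)%N -> OpP l b th f (fun _ => 0) = RtoC 0.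
Proof.
elim: l b f k => [|l IH] b f k Gf Hf Hk; first by have := Hf [::] Hk; rewrite /dv /= => ->; ring.
rewrite OpP_at0 (sumC_ext (g := fun _ => Cmult (RtoC 0) (RtoC 0))) => [|j]; first by rewrite sumC_scal; ring.
rewrite (IH _ _ k.-1); [ring | exact: dvar_Gc | | by case: k Hk {Hf}].
by apply: flat_scal; [exact: (smooth_partial j (proj1 (Gc_S1 Gf) tt)) | exact: flat_partial].
Qed.

(** An operator whose symbol is a polynomial of degree [l] lowers the order of vanishing at the
    origin by at most [l]. *)
Lemma flat_OpP ds l b th f k : smooth b -> Gc f -> flat k f -> (size ds + l < k)%N -> dv ds (OpP l b th f) = RtoC 0.
Proof.
elim/last_ind: ds l b f k => [|ds i IH] l b f k Sb Gf Hf Hk; first exact: (flat_OpP_at0 _ _ Gf Hf).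
rewrite dv_OpP_rcons // (IH l.-1 _ f k) //; last 2 first.
- exact: smooth_partial.
- by apply: leq_ltn_trans Hk; rewrite size_rcons leq_add // ?leq_pred.
rewrite (IH l b (partial i f) k.-1) //; [by ring | exact: Gc_partial | exact: flat_partial |].
by move: Hk; rewrite size_rcons; case: k {Hf}.
Qed.

(** Up to high order at the origin [f] is the constant 1, which every [dvar] annihilates. What
    remains of the operator is the part of the Taylor term depending on position alone, a
    homogeneous polynomial of degree [l], so a derivative at 0 is nonzero only if its order is
    [l]. *)
Lemma dv_OpP_flat ds l b th f k : smooth b -> Gc f -> f (fun _ => 0) = RtoC 1 -> (forall i, flat k (partial i f)) ->
  (size ds + l <= k)%N ->
  dv ds (OpP l b th f) = if size ds == l then Cmult (RtoC (INR (fact l))) (dpar [seq lshift n i | i <- ds] b th) else RtoC 0.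
Proof.
move=> Sb Gf f0 Hf; elim/last_ind: ds l b Sb => [|ds i IH] l b Sb Hk.
  case: l Hk => [|l] Hk; first by rewrite /dv /= f0; ring.
  rewrite /dv -[dpar [::] _]/(OpP l.+1 b th f) OpP_at0 (sumC_ext (g := fun _ => Cmult (RtoC 0) (RtoC 0))) => [|j]; first by rewrite sumC_scal ![Cmult (RtoC 0) _]Cmult_0_l.
  rewrite (@flat_OpP_at0 _ _ _ _ k) //; [ring | exact: dvar_Gc |].
  by apply: flat_scal => //; exact: (smooth_partial j (proj1 (Gc_S1 Gf) tt)).
rewrite dv_OpP_rcons // (@flat_OpP ds l b th (partial i f) k) //; last 2 first.
- exact: Gc_partial.
- by move: Hk; rewrite size_rcons.
rewrite size_rcons map_rcons dpar_rcons; case: l Hk => [|l] Hk.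
  by rewrite /=; ring.
rewrite [l.+1.-1]/= IH; last 2 first.
- exact: smooth_partial.
- by move: Hk; rewrite size_rcons addSn addnS => /ltnW /ltnW.
rewrite eqSS; case: eqP => _; last by ring.
by rewrite fact_simpl mult_INR RtoC_mult; ring.
Qed.

(** The term of order [m] in the composition formula without its coefficient. Summing over index
    sequences instead of multi-indices gives [m!] times the sum of
    [d_xi^alpha a d_x^alpha b / alpha!], hence the uniform coefficient [(-i)^m / m!] used later. *)
Fixpoint Wd m (a b : Pt (n + n) -> C) th : C :=
  match m with
  | 0 => Cmult (a th) (b th)
  | m'.+1 => sumC (fun j => Wd m' (partial (rshift n j) a) (partial (lshift n j) b) th)
  end.

Fixpoint mi (m : nat) : C := match m with 0 => RtoC 1 | m'.+1 => Cmult (Copp Ci) (mi m') end.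

Lemma OpP_scal l b th f z c : Gc f -> OpP l b th (fun x => Cmult c (f x)) z = Cmult c (OpP l b th f z).
Proof.
elim: l b f => [|l IH] b f Gf; first by rewrite /=; ring.
rewrite /= Cmult_plus_distr_l -!sumC_scal; congr Cplus; apply: sumC_ext => j.
  by rewrite IH //; ring.
rewrite -IH; last exact: dvar_Gc.
congr (OpP _ _ _ _ z); apply: functional_extensionality => x; rewrite /dvar.
rewrite (partial_scal j c (proj1 (Gc_S1 Gf) tt) I); ring.
Qed.

(** At the origin all position factors vanish, so the Taylor term of [a] merely differentiates [f];
    each [dvar] supplies a factor [-i]. *)
Lemma OpP_Wd m a b th f k : Gc f -> (forall ds, (size ds < k)%N -> dv ds f = dpar [seq lshift n i | i <- ds] b th) ->
  (m < k)%N -> OpP m a th f (fun _ => 0) = Cmult (mi m) (Wd m a b th).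
Proof.
elim: m a b f k => [|m IH] a b f k Gf Hf Hk.
  by have /= := Hf [::] Hk; rewrite /dv /= => ->; ring.
rewrite OpP_at0 /= -sumC_scal; apply: sumC_ext => j.
have SG := proj1 (Gc_S1 Gf) tt.
have -> : OpP m (partial (rshift n j) a) th (dvar j f) (fun _ => 0) = Cmult (Copp Ci) (OpP m (partial (rshift n j) a) th (partial j f) (fun _ => 0)).
  by rewrite /dvar OpP_scal //; exact: Gc_partial.
rewrite (IH _ (partial (lshift n j) b) _ k.-1) //; [by ring | exact: Gc_partial | | by case: k Hk {Hf}].
move=> ds Hs; rewrite /dv -dpar_rcons -/(dv (rcons ds j) f) Hf ?map_rcons ?dpar_rcons // size_rcons.
by case: k Hs {Hf Hk}.
Qed.

End Quantization.

(** * A test function equal to 1 to high order at the origin *)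

Section FlatGaussian.
Variable n : nat.
Let sq (z : Pt n) := sumR (fun j => z j ^ 2).

(** This is [|z|^(2M)] times the Gaussian, written through coordinate multiplications so that
    membership in [Gc] is immediate. *)
Fixpoint gp M (z : Pt n) : C :=
  match M with
  | 0 => gauss z
  | M'.+1 => sumC (fun k => Cmult (RtoC (z k)) (Cmult (RtoC (z k)) (gp M' z)))
  end.

Lemma gpE M z : gp M z = Cmult (RtoC (sq z ^ M)) (gauss z).
Proof.
elim: M => [|M IH]; first by rewrite /=; ring.
rewrite /= IH (sumC_ext (g := fun k => Cmult (Cmult (RtoC (sq z ^ M)) (gauss z)) (RtoC (z k ^ 2)))) => [|k].
  rewrite sumC_scal.
  have -> : sumC (fun k => RtoC (z k ^ 2)) = RtoC (sq z).
    by rewrite /sq /sumC /sumR; symmetry; apply: (big_morph RtoC) => // x y; rewrite RtoC_plus.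
  by rewrite RtoC_mult; ring.
by rewrite /= Rmult_1_r RtoC_mult; ring.
Qed.

Lemma gp_Gc M : Gc (gp M).
Proof.
elim: M => [|M IH]; first exact: Gc_gauss.
by apply: (Gc_sum (F := fun k z => _)) => k; do 2 apply: Gc_mul.
Qed.

Lemma gp_partial M i z : is_partial i (gp M) z
  (Cplus (Cmult (RtoC (2 * INR M * z i)) (gp M.-1 z)) (Cmult (RtoC (- z i)) (gp M z))).
Proof.
have -> : gp M = fun z => Cmult (RtoC (sq z ^ M)) (gauss z) by apply: functional_extensionality => w; exact: gpE.
have H : is_partial i (fun z => RtoC (sq z ^ M)) z (RtoC (INR M * (2 * z i) * sq z ^ M.-1)).
  apply: is_Cderiv_RtoC.
  apply: (is_derive_ext (fun t => (sq z + (t ^ 2 - z i ^ 2)) ^ M)) => [t|]; first by rewrite /sq sumsq_upd.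
  have := is_derive_pow (fun t => sq z + (t ^ 2 - z i ^ 2)) M (z i) (2 * z i).
  have -> : sq z + (z i ^ 2 - z i ^ 2) = sq z by ring.
  by apply; auto_derive => //; ring.
have := is_partial_mult H (is_partial_gauss i z); congr is_partial.
by rewrite gpE !RtoC_mult; ring.
Qed.

(** These are [1 / (2^j j!)], the Taylor coefficients of [exp (s / 2)] in [s]. *)
Fixpoint gcoef (j : nat) : R := match j with 0 => 1 | j'.+1 => gcoef j' / (2 * INR j) end.

(* The Gaussian times a Taylor polynomial of [exp(|z|^2/2)], hence [1 + O(|z|^(2M))]. *)
Fixpoint gflat M (z : Pt n) : C :=
  match M with 0 => RtoC 0 | M'.+1 => Cplus (gflat M' z) (Cmult (RtoC (gcoef M')) (gp M' z)) end.

Lemma gflat_Gc M : Gc (gflat M).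
Proof.
elim: M => [|M IH]; first exact: Gc_zero.
by apply: Gc_plus => //; apply: Gc_scal; exact: gp_Gc.
Qed.

(** In the derivative of a truncated exponential series times the Gaussian all terms cancel except
    the one of highest degree, which vanishes to high order at 0. *)
Lemma gflat_partial M i z : is_partial i (gflat M.+1) z (Cmult (RtoC (- gcoef M)) (Cmult (RtoC (z i)) (gp M z))).
Proof.
elim: M => [|M IH].
  have := is_partial_plus (is_partial_const i (RtoC 0) z) (is_partial_scal (RtoC 1) (is_partial_gauss i z)).
  by congr is_partial; rewrite /= !RtoC_opp; ring.
have := is_partial_plus IH (is_partial_scal (RtoC (gcoef M.+1)) (gp_partial M.+1 i z)); congr is_partial.
rewrite -[M.+1.-1]/M.
have -> : gcoef M = gcoef M.+1 * (2 * INR M.+1) by rewrite -[gcoef M.+1]/(gcoef M / (2 * INR M.+1)); field; exact: (not_0_INR M.+1).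
rewrite !RtoC_opp !RtoC_mult; ring.
Qed.

Lemma gflat_0 M : gflat M.+1 (fun _ => 0) = RtoC 1.
Proof.
have s0 : sq (fun _ => 0) = 0 by rewrite /sq (sumR_ext (g := fun _ => 0)) ?sumR_const => [|i]; ring.
have g0 : gauss (fun _ : 'I_n => 0) = RtoC 1.
  by rewrite /gauss -/(sq _) s0; have -> : - (0 / 2) = 0 by [field]; rewrite exp_0.
elim: M => [|M IH]; first by rewrite /= g0; ring.
by rewrite -[LHS]/(Cplus (gflat M.+1 (fun _ => 0)) (Cmult (RtoC (gcoef M.+1)) (gp M.+1 (fun _ => 0)))) IH gpE s0 /= Rmult_0_l; ring.
Qed.

Lemma flat_coord k j f : Gc f -> flat k f -> @flat n k.+1 (fun z => Cmult (RtoC (z j)) (f z)).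
Proof.
move=> Gf Hf ds; elim/last_ind: ds k f Gf Hf => [|ds i IH] k f Gf Hf Hs; first by rewrite /dv /= Cmult_0_l.
rewrite size_rcons ltnS in Hs; rewrite /dv dpar_rcons.
have Sf := proj1 (Gc_S1 Gf) tt; have Sp := proj1 (Gc_S1 (Gc_partial i Gf)) tt.
have -> : partial i (fun z => Cmult (RtoC (z j)) (f z)) = fun z => Cplus (Cmult (RtoC (if j == i then 1 else 0)) (f z)) (Cmult (RtoC (z j)) (partial i f z)).
  apply: functional_extensionality => z; apply: is_partial_unique; apply: is_partial_mult; first exact: is_partial_coord.
  exact: (smooth_is_partial (U := fun _ => True)).
rewrite (dpar_plus ds (@opn_true n) _ _ I); last 2 first.
- exact: (smooth_scal _ (@opn_true n) Sf).
- exact: (smooth_mult (@opn_true n) (smooth_coord _ (@opn_true n)) Sp).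
rewrite (dpar_scal ds _ (@opn_true n) Sf I).
have A := Hf ds Hs; have B := IH k.-1 _ (Gc_partial i Gf) (flat_partial i Hf).
rewrite /dv in A B; rewrite A B; last by case: k Hs {Hf B}.
ring.
Qed.

Lemma flat_gp M : flat M (gp M).
Proof.
elim: M => [//|M IH] ds Hs; rewrite /dv.
have H k : dpar ds (fun z : Pt n => Cmult (RtoC (z k)) (Cmult (RtoC (z k)) (gp M z))) (fun _ => 0) = RtoC 0.
  apply: (@flat_coord M.+1 k (fun z => Cmult (RtoC (z k)) (gp M z))); last exact: ltnW.
    by apply: Gc_mul; exact: gp_Gc.
  by apply: flat_coord => //; exact: gp_Gc.
have SK k : smooth (fun z : Pt n => Cmult (RtoC (z k)) (Cmult (RtoC (z k)) (gp M z))).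
  exact: (proj1 (Gc_S1 (Gc_mul k (Gc_mul k (gp_Gc M)))) tt).
rewrite -[gp M.+1]/(fun z => \big[Cplus/RtoC 0]_(k < n) Cmult (RtoC (z k)) (Cmult (RtoC (z k)) (gp M z))).
suff [] : smooth (fun z : Pt n => \big[Cplus/RtoC 0]_(k < n) Cmult (RtoC (z k)) (Cmult (RtoC (z k)) (gp M z))) /\
  dpar ds (fun z : Pt n => \big[Cplus/RtoC 0]_(k < n) Cmult (RtoC (z k)) (Cmult (RtoC (z k)) (gp M z))) (fun _ => 0) = RtoC 0 by [].
elim: (index_enum _) => [|k r [S0 E0]].
  have -> : (fun z : Pt n => \big[Cplus/RtoC 0]_(k <- [::]) Cmult (RtoC (z k)) (Cmult (RtoC (z k)) (gp M z))) = fun z => RtoC 0.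
    by apply: functional_extensionality => z; rewrite big_nil.
  split; first exact: (smooth_const _ (@opn_true n)).
  have -> : (fun _ : Pt n => RtoC 0) = fun z => Cmult (RtoC 0) (RtoC 0) by apply: functional_extensionality => z; ring.
  by rewrite (dpar_scal ds (RtoC 0) (@opn_true n) (smooth_const _ (@opn_true n)) I) Cmult_0_l.
have -> : (fun z : Pt n => \big[Cplus/RtoC 0]_(k <- k :: r) Cmult (RtoC (z k)) (Cmult (RtoC (z k)) (gp M z))) =
   fun z => Cplus (Cmult (RtoC (z k)) (Cmult (RtoC (z k)) (gp M z))) (\big[Cplus/RtoC 0]_(k <- r) Cmult (RtoC (z k)) (Cmult (RtoC (z k)) (gp M z))).
  by apply: functional_extensionality => z; rewrite big_cons.
split; first exact: (smooth_plus (@opn_true n) (SK k) S0).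
by rewrite (dpar_plus ds (@opn_true n) (SK k) S0 I) H E0; ring.
Qed.

Lemma gflat_flat M i : flat M.+1 (partial i (gflat M.+1)).
Proof.
have -> : partial i (gflat M.+1) = fun z => Cmult (RtoC (- gcoef M)) (Cmult (RtoC (z i)) (gp M z)).
  by apply: functional_extensionality => z; apply: is_partial_unique; exact: gflat_partial.
have GG := gp_Gc M; apply: flat_scal; first exact: (proj1 (Gc_S1 (Gc_mul i GG)) tt).
by apply: flat_coord => //; exact: flat_gp.
Qed.

End FlatGaussian.

(** * The weight [br] and Peetre's inequality *)

Section Bracket.
Variable N : nat.
Variable br : Pt N -> R.
Hypothesis Hbr : bracket_fn br.

Lemma br_pos y : 0 < br y. Proof. by case: Hbr => _ []. Qed.

Lemma br_eq y : 1 <= enorm y -> br y = enorm y. Proof. by case: Hbr => _ [_]; apply. Qed.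

Lemma br_cont y : forall e, 0 < e -> exists d, 0 < d /\ forall z, near d y z -> Rabs (br z - br y) < e.
Proof.
move=> e He; have /cont_at_near /(_ e He) [d [Hd H]] := proj1 (proj1 Hbr [::]) y I.
by exists d; split=> // z /H /=; rewrite -RtoC_minus Cmod_R.
Qed.

(** Outside the unit ball [br] is the norm. On the unit cube, which contains that ball, compactness
    bounds both [br] and its inverse. *)
Lemma br_cube : exists c C, 0 < c /\ forall y, (forall j, Rabs (y j) <= 1) -> c <= br y <= C.
Proof.
have H1 : exists K, 0 <= K /\ forall y, (forall j, Rabs (y j) <= 1) -> Cmod (RtoC (br y)) <= K.
  apply: (@cube_bounded N (fun y => RtoC (br y)) 1); first lra.
  by move=> y _; apply: (smooth_lbd (U := fun _ => True) (proj1 Hbr)).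
have H2 : exists K, 0 <= K /\ forall y, (forall j, Rabs (y j) <= 1) -> Cmod (RtoC (/ br y)) <= K.
  apply: (@cube_bounded N (fun y => RtoC (/ br y)) 1); first lra.
  move=> y _; have bp := br_pos y.
  have [d [Hd H]] := @br_cont y (br y / 2) ltac:(lra); exists d; split=> //; exists (/ (br y / 2)) => z /H Hz.
  have {}Hz : br y / 2 <= br z by move/Rabs_def2: Hz; lra.
  rewrite Cmod_R Rabs_pos_eq; last by apply/Rlt_le/Rinv_0_lt_compat/br_pos.
  by apply: Rinv_le_contravar; lra.
have [K1 [K1p H1']] := H1; have [K2 [K2p H2']] := H2.
exists (/ (K2 + 1)), K1; split; first by apply: Rinv_0_lt_compat; lra.
move=> y Hy; have bp := br_pos y; split.
  have := H2' y Hy; rewrite Cmod_R Rabs_pos_eq; last by apply/Rlt_le/Rinv_0_lt_compat.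
  move=> H; rewrite -(Rinv_inv (br y)); apply: Rinv_le_contravar; last lra.
  exact: Rinv_0_lt_compat.
by have := H1' y Hy; rewrite Cmod_R Rabs_pos_eq; lra.
Qed.

Lemma br_equiv : exists c C, 0 < c /\ 0 < C /\ forall y, c * (1 + enorm y) <= br y <= C * (1 + enorm y).
Proof.
have [c [C [Hc H]]] := br_cube.
exists (Rmin (c / 2) (1 / 2)), (Rmax C 1); split; first by apply: Rmin_pos; lra.
split; first by apply: Rlt_le_trans (Rmax_r _ _); lra.
move=> y; have e0 := enorm_ge0 y.
have m1 := Rmin_l (c / 2) (1 / 2); have m2 := Rmin_r (c / 2) (1 / 2).
have M1 := Rmax_l C 1; have M2 := Rmax_r C 1.
case: (Rle_or_lt 1 (enorm y)) => He.
  rewrite br_eq //; split; nra.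
have [|h1 h2] := H y; first by move=> j; have := coord_le_enorm y j; lra.
split; nra.
Qed.

Lemma enorm_triangle (y z : Pt N) : enorm (vadd y z) <= enorm y + enorm z.
Proof.
have cs : sumR (fun j => y j * z j) <= enorm y * enorm z.
  have P1 := enorm_ge0 y; have P2 := enorm_ge0 z.
  case: (Req_dec (enorm y) 0) => E1.
    have Z j : y j = 0.
      by have := coord_le_enorm y j; have := Rabs_pos (y j); rewrite E1 => ? ?; apply: NNPP => /Rabs_no_R0; lra.
    rewrite (sumR_ext (g := fun _ => 0)) => [|j]; last by rewrite Z; ring.
    by rewrite sumR_const E1; lra.
  case: (Req_dec (enorm z) 0) => E2.
    have Z j : z j = 0.
      by have := coord_le_enorm z j; have := Rabs_pos (z j); rewrite E2 => ? ?; apply: NNPP => /Rabs_no_R0; lra.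
    rewrite (sumR_ext (g := fun _ => 0)) => [|j]; last by rewrite Z; ring.
    by rewrite sumR_const E2; lra.
  set a := enorm y in P1 E1 *; set b := enorm z in P2 E2 *.
  have H : 0 <= sumR (fun j => (b * y j - a * z j) ^ 2) by apply: sumR_ge0 => j; exact: pow2_ge_0.
  have E : sumR (fun j => (b * y j - a * z j) ^ 2) = b ^ 2 * sumR (fun j => y j ^ 2) + a ^ 2 * sumR (fun j => z j ^ 2) + (- (2 * a * b)) * sumR (fun j => y j * z j).
    by rewrite -!sumR_scal -!sumR_plus; apply: sumR_ext => j; ring.
  have Ea : sumR (fun j => y j ^ 2) = a ^ 2 by rewrite -enorm_sq.
  have Eb : sumR (fun j => z j ^ 2) = b ^ 2 by rewrite -enorm_sq.
  rewrite Ea Eb in E.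
  have ab : 0 < a * b by apply: Rmult_lt_0_compat; lra.
  rewrite E in H; apply: (Rmult_le_reg_l (a * b)) => //; nra.
have P : 0 <= enorm y + enorm z by have := enorm_ge0 y; have := enorm_ge0 z; lra.
apply: Rsqr_incr_0_var P; rewrite !Rsqr_pow2 enorm_sq.
have -> : (enorm y + enorm z) ^ 2 = enorm y ^ 2 + enorm z ^ 2 + 2 * (enorm y * enorm z) by ring.
rewrite !enorm_sq (sumR_ext (g := fun j => y j ^ 2 + z j ^ 2 + 2 * (y j * z j))) => [|j]; last by rewrite /vadd; ring.
by rewrite !sumR_plus sumR_scal; lra.
Qed.

Definition lam (y : Pt N) := / br y.

Lemma lam_pos y : 0 < lam y. Proof. exact/Rinv_0_lt_compat/br_pos. Qed.

(** Peetre's inequality, from [1 + |th| <= (1 + |th + Z|) (1 + |Z|)] and [1 + |Z| <= 2 W Z],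
    translated to [br] by [br_equiv]. *)
Lemma lam_bounds : exists L0 L1, 0 <= L1 /\ (forall y, lam y <= L0) /\ forall th Z, lam (vadd th Z) <= L1 * W Z * lam th.
Proof.
have [c [C [Hc [HC H]]]] := br_equiv.
exists (/ c), (2 * C / c); split; first by apply: Rdiv_le_0_compat; lra.
split=> [y|th Z].
  apply: Rinv_le_contravar => //; have := H y; have := enorm_ge0 y; nra.
have b1 := br_pos th; have b2 := br_pos (vadd th Z).
have [h1 _] := H (vadd th Z); have [_ h2] := H th.
have t1 : 1 + enorm th <= (1 + enorm (vadd th Z)) * (1 + enorm Z).
  have := enorm_triangle (vadd th Z) (fun j => - Z j).
  have -> : vadd (vadd th Z) (fun j => - Z j) = th by apply: functional_extensionality => j; rewrite /vadd; ring.
  have -> : enorm (fun j => - Z j) = enorm Z by rewrite /enorm; congr sqrt; apply: sumR_ext => j; ring.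
  have := enorm_ge0 (vadd th Z); have := enorm_ge0 Z; nra.
have t2 : 1 + enorm Z <= 2 * W Z by have := enorm_W Z; have := W_ge1 Z; have := enorm_ge0 Z; nra.
have e1 := enorm_ge0 (vadd th Z); have e2 := enorm_ge0 Z; have w := W_ge1 Z.
have K : br th <= 2 * C / c * W Z * br (vadd th Z).
  apply: Rle_trans h2 _.
  apply: Rle_trans (_ : C * ((1 + enorm (vadd th Z)) * (2 * W Z)) <= _).
    by apply: Rmult_le_compat_l; [lra | apply: Rle_trans t1 _; apply: Rmult_le_compat_l; lra].
  have -> : 2 * C / c * W Z * br (vadd th Z) = (2 * C * W Z) * (br (vadd th Z) / c) by field; lra.
  have -> : C * ((1 + enorm (vadd th Z)) * (2 * W Z)) = 2 * C * W Z * (1 + enorm (vadd th Z)) by ring.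
  apply: Rmult_le_compat_l; first by apply: Rmult_le_pos; lra.
  apply: (Rmult_le_reg_l c) => //; have -> : c * (br (vadd th Z) / c) = br (vadd th Z) by field; lra.
  exact: h1.
rewrite /lam; apply: (Rmult_le_reg_r (br th)) => //; apply: (Rmult_le_reg_r (br (vadd th Z))) => //.
have -> : / br (vadd th Z) * br th * br (vadd th Z) = br th by field; lra.
have -> : 2 * C / c * W Z * / br th * br th * br (vadd th Z) = 2 * C / c * W Z * br (vadd th Z) by field; lra.
exact: K.
Qed.

End Bracket.

Section Composition.
Variable n : nat.
Variable br : Pt (n + n) -> R.
Hypothesis Hbr : bracket_fn br.
Notation lm := (lam br).

(** The polynomial part may have bounds that depend on [th], as it will be computed exactly; only
    the remainder is controlled uniformly. *)
Lemma Opq_minus_rem Th P (A T R : Th -> Pt (n + n) -> C) (f : Th -> Pt n -> C) (s : Th -> C) :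
  (forall th, exists Q, cls (@BP n unit Q) (fun _ => T th)) -> cls (BP P) R -> RS f ->
  (forall th Y, A th Y = Cplus (T th Y) (Cmult (s th) (R th Y))) ->
  forall th z, Opq (A th) (f th) z = Cplus (Opq (T th) (f th) z) (Cmult (s th) (Opq (R th) (f th) z)).
Proof.
move=> HT HR Hf E th z; have Hfth := S1_at th Hf.
have HRth : cls (@BP n unit P) (fun _ => R th).
  by have [S B] := HR; split=> // ds; have [k [K HK]] := B ds; exists k, K => _ ; apply: HK.
have [Q HQ] := HT th.
have H1 : cls (@BP n unit (Q + P)) (fun _ => T th) by apply: cls_BP_le HQ; exact: leq_addr.
have H2 : cls (@BP n unit (Q + P)) (fun _ => R th) by apply: cls_BP_le HRth; exact: leq_addl.
have -> : A th = fun Y => Cplus (T th Y) (Cmult (s th) (R th Y)) by apply: functional_extensionality => Y.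
rewrite (Opq_plusA z H1 (cls_scal (s th) (lin_BP n unit _) H2) Hfth).
by rewrite (Opq_scalA (s th) z H2 Hfth).
Qed.

Lemma TT_BP M (b : Pt (n + n) -> C) th : exists Q, cls (@BP n unit Q) (fun _ => TT M b th).
Proof.
exists M; apply: (cls_sum (F := fun (l : 'I_M) _ Y => Cmult (RtoC (/ INR (fact l))) (TP l b th Y)) (lin_BP n unit M)) => l.
apply: (cls_scal _ (lin_BP n unit M)); apply: cls_BP_le (TP_BP l b th); exact: ltnW.
Qed.

Lemma Opq_TT M (b : Pt (n + n) -> C) th (f : Pt n -> C) z : Gc f -> Opq (TT M b th) f z = sumC (fun l : 'I_M => Cmult (RtoC (/ INR (fact l))) (OpP l b th f z)).
Proof.
move=> Gf; have H (l : 'I_M) : cls (@BP n unit M) (fun _ Y => Cmult (RtoC (/ INR (fact l))) (TP l b th Y)).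
  apply: (cls_scal _ (lin_BP n unit M)); apply: cls_BP_le (TP_BP l b th); exact: ltnW.
rewrite -[TT M b th]/(fun Y => TT M b th Y) /TT (@Opq_sumA n M M _ f z H (Gc_S1 Gf)); apply: sumC_ext => l.
by rewrite (Opq_scalA _ z (TP_BP l b th) (Gc_S1 Gf)) Opq_TP.
Qed.

(** Divided by [lam th ^ M], the Taylor remainders at all points form one uniformly bounded family;
    this turns estimates in [th] into membership in a class. *)
Lemma rem_cls M (b : Pt (n + n) -> C) : symb lm b -> cls (BP (2 * M)) (fun th Y => Cmult (RtoC (/ lm th ^ M)) (TR M b th Y)).
Proof.
move=> Hb; have [L0 [L1 [L1p [H0 H1]]]] := lam_bounds Hbr.
split.
  by move=> th; apply: (smooth_scal _ (@opn_true (n + n))); apply: TR_smooth; exact: (proj1 Hb).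
move=> ds; have [K HK] := TR_symb (@lam_pos _ _ Hbr) H0 L1p H1 M ds Hb.
exists (2 * M)%N, K => th z e.
have lp : 0 < lm th ^ M by apply: pow_lt; exact: lam_pos.
rewrite (dpar_scal ds _ (@opn_true (n + n)) (TR_smooth M th (proj1 Hb)) I) Cmod_mult Cmod_R Rabs_pos_eq; last exact/Rlt_le/Rinv_0_lt_compat.
apply: (Rmult_le_reg_l (lm th ^ M)) => //.
rewrite -Rmult_assoc Rinv_r; last lra.
rewrite Rmult_1_l; apply: Rle_trans (HK th (join z e)) _; right.
by rewrite W_join Rpow_mult_distr; ring.
Qed.

Lemma vadd_split M b th Y : b (vadd th Y) = Cplus (TT M b th Y) (Cmult (RtoC (lm th ^ M)) (Cmult (RtoC (/ lm th ^ M)) (TR M b th Y))).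
Proof.
have lp : 0 < lm th ^ M by apply: pow_lt; exact: lam_pos.
rewrite Cmult_assoc -RtoC_mult Rinv_r; last lra.
by rewrite /TR; ring.
Qed.

Lemma shift_BP (b : Pt (n + n) -> C) : symb lm b -> cls (@BP n _ 0) (fun th Y => b (vadd th Y)).
Proof.
move=> Hb; have [L0 [L1 [L1p [H0 H1]]]] := lam_bounds Hbr.
split; first by move=> th; apply: smooth_vadd; exact: (proj1 Hb).
move=> ds; have [K HK] := symb_bdd (@lam_pos _ _ Hbr) H0 Hb ds; exists 0%N, K => th z e.
by rewrite dpar_vadd /= ?Rmult_1_r; [exact: HK | exact: (proj1 Hb)].
Qed.

Lemma RS_fix (f : Pt n -> C) Th : S1 f -> RS (fun _ : Th => f).
Proof.
move=> [S H]; split; first by move=> th; exact: (S tt).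
by move=> ds k; have [K HK] := H ds k; exists K => _; apply: (HK tt).
Qed.

(** The operator of [b] translated to [th] maps [phi] to a Taylor part, whose derivatives at 0 are
    position derivatives of [b] at [th], plus [lam th ^ M.+1] times a uniformly Schwartz error.
    Applying the operator of [a] and evaluating at 0 reads off the terms [Wd]. The test function is
    fixed before [a] and [b], so that one function serves all matrix entries. *)
Lemma composition_estimate M : exists phi : Pt n -> C, Gc phi /\ forall a b, symb lm a -> symb lm b -> exists K, forall th,
  Cmod (Cminus (Opq (fun Y => a (vadd th Y)) (Opq (fun Y => b (vadd th Y)) phi) (fun _ => 0))
     (sumC (fun m : 'I_M.+1 => Cmult (Cmult (RtoC (/ INR (fact m))) (mi m)) (Wd m a b th)))) <= K * lm th ^ M.+1 /\
  Cmod (Cminus (Opq (fun Y => b (vadd th Y)) phi (fun _ => 0)) (b th)) <= K * lm th ^ M.+1.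
Proof.
(* Up to [M] derivatives of Taylor terms of degree up to [M] are taken, and [dv_OpP_flat] allows a
   total of at most [k]. *)
set k := (M.+1 + M.+1)%N.
exists (gflat k.+1); split; first exact: gflat_Gc.
move=> a b Ha Hb; set phi := gflat k.+1; have Gphi : Gc phi := gflat_Gc n k.+1.
have Hflat i : flat k (partial i phi) by move=> ds Hs; apply: gflat_flat; exact: ltnW.
have Sb := proj1 Hb.
pose main th : Pt n -> C := Opq (TT M.+1 b th) phi.
have mainE th : main th = fun z => sumC (fun l : 'I_M.+1 => Cmult (RtoC (/ INR (fact l))) (OpP l b th phi z)).
  by apply: functional_extensionality => z; exact: Opq_TT.
have Gmain th : Gc (main th).
  by rewrite mainE; apply: (Gc_sum (F := fun l z => _)) => l; apply: Gc_scal; exact: OpP_Gc.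
have [L0 [L1 [L1p [H0 H1]]]] := lam_bounds Hbr.
have RSmain : RS main.
  have -> : main = fun th z => sumC (fun l : 'I_M.+1 => Cmult (RtoC (/ INR (fact l))) (OpP l b th phi z)).
    by apply: functional_extensionality => th; exact: mainE.
  apply: (cls_sum (F := fun (l : 'I_M.+1) th z => Cmult (RtoC (/ INR (fact l))) (OpP l b th phi z)) lin_rap) => l.
  apply: (cls_scal _ lin_rap); apply: OpP_RS => //.
  exact: (symb_bdd (@lam_pos _ _ Hbr) H0 Hb).
(* The [1 / l!] of Taylor's formula cancels the [l!] of [dv_OpP_flat], and only the term with
   [l = size ds] survives. *)
have dvmain th ds : (size ds < M.+1)%N -> dv ds (main th) = dpar [seq lshift n i | i <- ds] b th.
  move=> Hs; rewrite mainE /dv.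
  have SO l : smooth (fun z => Cmult (RtoC (/ INR (fact l))) (OpP l b th phi z)).
    exact: (proj1 (Gc_S1 (Gc_scal (RtoC (/ INR (fact l))) (OpP_Gc l b th Gphi))) tt).
  have E (l : 'I_M.+1) : dpar ds (fun z => Cmult (RtoC (/ INR (fact l))) (OpP l b th phi z)) (fun _ => 0) =
     if l == Ordinal Hs then dpar [seq lshift n i | i <- ds] b th else RtoC 0.
    have SO' : smooth (OpP l b th phi) := proj1 (Gc_S1 (OpP_Gc l b th Gphi)) tt.
    rewrite (dpar_scal ds _ (@opn_true n) SO' I) -/(dv ds _) (dv_OpP_flat th Sb Gphi (gflat_0 n k) Hflat); last first.
      by rewrite /k leq_add // ltnW.
    rewrite -val_eqE /= eq_sym; case: eqP => _; last by ring.
    rewrite Cmult_assoc -RtoC_mult Rinv_l; last exact: INR_fact_neq_0.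
    ring.
  rewrite /sumC.
  suff -> : dpar ds (fun z => \big[Cplus/RtoC 0]_(l < M.+1) Cmult (RtoC (/ INR (fact l))) (OpP l b th phi z)) (fun _ => 0) =
     \big[Cplus/RtoC 0]_(l < M.+1) (if l == Ordinal Hs then dpar [seq lshift n i | i <- ds] b th else RtoC 0).
    rewrite (bigD1 (Ordinal Hs)) //= eqxx big1 => [|l /negbTE ->] //; ring.
  suff [] : smooth (fun z => \big[Cplus/RtoC 0]_(l < M.+1) Cmult (RtoC (/ INR (fact l))) (OpP l b th phi z)) /\
     dpar ds (fun z => \big[Cplus/RtoC 0]_(l < M.+1) Cmult (RtoC (/ INR (fact l))) (OpP l b th phi z)) (fun _ => 0) =
     \big[Cplus/RtoC 0]_(l < M.+1) (if l == Ordinal Hs then dpar [seq lshift n i | i <- ds] b th else RtoC 0) by [].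
  elim: (index_enum _) => [|l r [S0 E0]].
    have -> : (fun z : Pt n => \big[Cplus/RtoC 0]_(l <- ([::] : seq 'I_M.+1)) Cmult (RtoC (/ INR (fact (nat_of_ord l)))) (OpP (nat_of_ord l) b th phi z)) = fun z => Cmult (RtoC 0) (RtoC 0).
      by apply: functional_extensionality => z; rewrite big_nil; ring.
    split; first exact: (smooth_const _ (@opn_true n)).
    by rewrite big_nil (dpar_scal ds (RtoC 0) (@opn_true n) (smooth_const _ (@opn_true n)) I) Cmult_0_l.
  have -> : (fun z : Pt n => \big[Cplus/RtoC 0]_(l <- l :: r) Cmult (RtoC (/ INR (fact (nat_of_ord l)))) (OpP (nat_of_ord l) b th phi z)) =
     fun z => Cplus (Cmult (RtoC (/ INR (fact l))) (OpP l b th phi z)) (\big[Cplus/RtoC 0]_(l <- r) Cmult (RtoC (/ INR (fact (nat_of_ord l)))) (OpP (nat_of_ord l) b th phi z)).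
    by apply: functional_extensionality => z; rewrite big_cons.
  split; first exact: (smooth_plus (@opn_true n) (SO l) S0).
  by rewrite (dpar_plus ds (@opn_true n) (SO l) S0 I) E E0 big_cons.
pose v th : Pt n -> C := Opq (fun Y => b (vadd th Y)) phi.
pose r th : Pt n -> C := Opq (fun Y => Cmult (RtoC (/ lm th ^ M.+1)) (TR M.+1 b th Y)) phi.
have RSphi : RS (fun _ : Pt (n + n) => phi) by apply: RS_fix; exact: Gc_S1.
have RSr : RS r by apply: (Opq_RS (rem_cls M.+1 Hb) RSphi).
have vE th z : v th z = Cplus (main th z) (Cmult (RtoC (lm th ^ M.+1)) (r th z)).
  exact: (@Opq_minus_rem _ _ (fun th Y => b (vadd th Y)) (fun th => TT M.+1 b th) _ (fun _ => phi)
    (fun th => RtoC (lm th ^ M.+1)) (fun th => TT_BP M.+1 b th) (rem_cls M.+1 Hb) RSphi (fun th Y => vadd_split M.+1 b th Y)).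
have RSar : RS (fun th => Opq (fun Y => a (vadd th Y)) (r th)) := Opq_RS (shift_BP Ha) RSr.
have RSam : RS (fun th => Opq (fun Y => Cmult (RtoC (/ lm th ^ M.+1)) (TR M.+1 a th Y)) (main th)) := Opq_RS (rem_cls M.+1 Ha) RSmain.
have bnd F : RS F -> exists K, forall th : Pt (n + n), Cmod (F th (fun _ => 0)) <= K.
  by move=> [_ /(_ [::] 0%N) [K HK]]; exists K => th; have := HK th (fun _ => 0); rewrite /= Rmult_1_r.
have [K1 HK1] := bnd _ _ RSr; have [K2 HK2] := bnd _ _ RSar; have [K3 HK3] := bnd _ _ RSam.
have lp th : 0 < lm th ^ M.+1 by apply: pow_lt; exact: lam_pos.
exists (Rabs K1 + (Rabs K2 + Rabs K3)) => th; split; last first.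
  rewrite -/(v th) vE.
  have -> : main th (fun _ => 0) = b th by apply: (dvmain th [::]).
  have -> : Cminus (Cplus (b th) (Cmult (RtoC (lm th ^ M.+1)) (r th (fun _ => 0)))) (b th) = Cmult (RtoC (lm th ^ M.+1)) (r th (fun _ => 0)) by ring.
  rewrite Cmod_mult Cmod_R Rabs_pos_eq; last exact: Rlt_le.
  rewrite Rmult_comm; apply: Rmult_le_compat_r; first exact: Rlt_le.
  by have := HK1 th; have := Rle_abs K1; have := Rabs_pos K2; have := Rabs_pos K3; lra.
have BPa : cls (@BP n unit 0) (fun _ Y => a (vadd th Y)).
  by have [S B] := shift_BP Ha; split=> // ds; have [k' [K HK]] := B ds; exists k', K => _; apply: HK.
have -> : Opq (fun Y => a (vadd th Y)) (Opq (fun Y => b (vadd th Y)) phi) (fun _ => 0) =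
   Cplus (Opq (fun Y => a (vadd th Y)) (main th) (fun _ => 0)) (Cmult (RtoC (lm th ^ M.+1)) (Opq (fun Y => a (vadd th Y)) (r th) (fun _ => 0))).
  have E1 : FT (v th) = fun xi => Cplus (FT (main th) xi) (Cmult (RtoC (lm th ^ M.+1)) (FT (r th) xi)).
    apply: functional_extensionality => xi.
    rewrite -(FT_scal _ _ (S1_at th RSr)) -(FT_plus _ (S1_at th RSmain) (cls_scal _ lin_rap (S1_at th RSr))).
    by congr (FT _ xi); apply: functional_extensionality => z; exact: vE.
  have A1 := Opq_amp1 BPa (S1_at th RSmain); have A2 := Opq_amp1 BPa (S1_at th RSr).
  rewrite /Opq -/(Opq (fun Y => b (vadd th Y)) phi) -/(v th).
  have -> : (fun Y => Cmult (a (vadd th Y)) (FT (v th) (pr2 Y))) = fun Y => Cplus (Cmult (a (vadd th Y)) (FT (main th) (pr2 Y))) (Cmult (RtoC (lm th ^ M.+1)) (Cmult (a (vadd th Y)) (FT (r th) (pr2 Y)))).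
    by apply: functional_extensionality => Y; rewrite E1; ring.
  rewrite (osc_plus _ _ A1 (cls_scal _ (lin_BA 0) A2)) (osc_scal _ _ _ A2); ring.
rewrite (@Opq_minus_rem _ _ (fun th Y => a (vadd th Y)) (fun th => TT M.+1 a th) _ main
    (fun th => RtoC (lm th ^ M.+1)) (fun th => TT_BP M.+1 a th) (rem_cls M.+1 Ha) RSmain (fun th Y => vadd_split M.+1 a th Y)).
rewrite Opq_TT //.
have -> : sumC (fun l : 'I_M.+1 => Cmult (RtoC (/ INR (fact l))) (OpP l a th (main th) (fun _ => 0))) =
  sumC (fun m : 'I_M.+1 => Cmult (Cmult (RtoC (/ INR (fact m))) (mi m)) (Wd m a b th)).
  by apply: sumC_ext => m; rewrite (@OpP_Wd n m a b th (main th) M.+1) // ?Cmult_assoc // => ds; exact: dvmain.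
set X := sumC _; set Y1 := Opq _ _ _; set Y2 := Opq _ _ _.
have -> : Cminus (Cplus (Cplus X (Cmult (RtoC (lm th ^ M.+1)) Y1)) (Cmult (RtoC (lm th ^ M.+1)) Y2)) X = Cmult (RtoC (lm th ^ M.+1)) (Cplus Y1 Y2) by ring.
rewrite Cmod_mult Cmod_R Rabs_pos_eq; last exact: Rlt_le.
rewrite Rmult_comm; apply: Rmult_le_compat_r; first exact: Rlt_le.
apply: Rle_trans (Cmod_triangle _ _) _.
by have := HK3 th; have := HK2 th; rewrite -/Y1 -/Y2; have := Rle_abs K2; have := Rle_abs K3; have := Rabs_pos K1; lra.
Qed.

End Composition.

(** * Phase-space translations *)

Section Packets.
Variable n : nat.

Definition vneg N (x : Pt N) : Pt N := fun j => - x j.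

Lemma vadd_neg N (x : Pt N) : vadd (vneg x) x = fun _ => 0.
Proof. by apply: functional_extensionality => j; rewrite /vadd /vneg; ring. Qed.
Lemma vneg_add N (x z : Pt N) : vadd (vneg x) (vadd x z) = z.
Proof. by apply: functional_extensionality => j; rewrite /vadd /vneg; ring. Qed.
Lemma dotR_vadd_l N (x y z : Pt N) : dotR (vadd x y) z = dotR x z + dotR y z.
Proof. by rewrite /dotR -sumR_plus; apply: sumR_ext => j; rewrite /vadd; ring. Qed.
Lemma dotR_vadd_r N (x y z : Pt N) : dotR z (vadd x y) = dotR z x + dotR z y.
Proof. by rewrite !(dotRC z) dotR_vadd_l. Qed.
Lemma dotR_vneg_l N (x z : Pt N) : dotR (vneg x) z = - dotR x z.
Proof.
have -> : - dotR x z = (-1) * dotR x z by ring.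
by rewrite /dotR -sumR_scal; apply: sumR_ext => j; rewrite /vneg; ring.
Qed.
Lemma dotR_vneg_r N (x z : Pt N) : dotR z (vneg x) = - dotR z x.
Proof. by rewrite !(dotRC z) dotR_vneg_l. Qed.

(** Translation by the position part of [th], followed by modulation with its frequency part. *)
Definition packet (th : Pt (n + n)) (f : Pt n -> C) : Pt n -> C :=
  fun x => Cmult (cis (dotR x (pr2 th))) (f (vadd (vneg (pr1 th)) x)).

Lemma packet_schwartz q th (f : 'I_q -> Pt n -> C) : (forall i, Gc (f i)) ->
  schwartz (fun x i => packet th (f i) x).
Proof.
move=> Gf i.
have bnd g k : Gc g -> exists K, forall x, (1 + enorm x) ^ k * Cmod (packet th g x) <= K.
  move=> Gg; have [K HK] := Gc_rap Gg k; set x0 := pr1 th.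
  have e0 := enorm_ge0 x0.
  exists ((2 * (1 + enorm x0)) ^ k * K) => x; rewrite /packet Cmod_mult Cmod_cis Rmult_1_l -/x0.
  set z := vadd (vneg x0) x; have Ez : x = vadd x0 z.
    by apply: functional_extensionality => j; rewrite /z /vadd /vneg; ring.
  have t := enorm_triangle x0 z; rewrite -Ez in t; have ez := enorm_ge0 z; have w := W_ge1 z.
  have tw : 1 + enorm z <= 2 * W z by have := enorm_W z; nra.
  have ex := enorm_ge0 x.
  have A : (1 + enorm x) ^ k <= (2 * (1 + enorm x0)) ^ k * W z ^ k.
    by rewrite -Rpow_mult_distr; apply: pow_incr; split; nra.
  apply: Rle_trans (Rmult_le_compat_r _ _ _ (Cmod_ge_0 _) A) _.
  rewrite Rmult_assoc; apply: Rmult_le_compat_l; first by apply: pow_le; lra.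
  by rewrite Rmult_comm; apply: (HK tt z).
have [S D] : smooth (packet th (f i)) /\ forall ds, exists g, Gc g /\ dpar ds (packet th (f i)) = packet th g.
  apply: (@smooth_dpar_class _ (fun h => exists g, Gc g /\ h = packet th g)); last by exists (f i).
  move=> h [g [Gg ->]]; split=> [y|j].
    exists 1; split; first lra.
    by have [K HK] := bnd g 0%N Gg; exists K => z _; have := HK z; rewrite /= Rmult_1_l.
  exists (packet th (fun z => Cplus (Cmult (Cmult Ci (RtoC (pr2 th j))) (g z)) (partial j g z))); split.
    eexists; split; last reflexivity.
    by apply: Gc_plus; [apply: Gc_scal | apply: Gc_partial].
  move=> y.
  have H1 : is_partial j (fun x => cis (dotR x (pr2 th))) y (Cmult (Cmult Ci (RtoC (pr2 th j))) (cis (dotR y (pr2 th)))).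
    have := is_partial_cis_r 1 (pr2 th) y j; rewrite !Rmult_1_l (dotRC (pr2 th)).
    by congr is_partial; apply: functional_extensionality => x; rewrite Rmult_1_l dotRC.
  have H2 : is_partial j (fun x => g (vadd (vneg (pr1 th)) x)) y (partial j g (vadd (vneg (pr1 th)) y)).
    by apply: is_partial_vadd; apply: (smooth_is_partial (U := fun _ => True) _ (proj1 (Gc_S1 Gg) tt)).
  by have := is_partial_mult H1 H2; congr is_partial; rewrite /packet; ring.
split=> // ds k; have [g [Gg E]] := D ds; have [K HK] := bnd g k Gg.
by exists K => x; change ((1 + enorm x) ^ k * Cmod (dpar ds (packet th (f i)) x) <= K); rewrite E.
Qed.

Lemma FT_packet th f xi : S1 f ->
  FT (packet th f) xi = Cmult (cis (- dotR (pr1 th) (vadd (vneg (pr2 th)) xi))) (FT f (vadd (vneg (pr2 th)) xi)).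
Proof.
move=> Hf; set x0 := pr1 th; set xi0 := pr2 th; set e := vadd (vneg xi0) xi.
have I1 : intble (fun z => Cmult (cis (- dotR z e)) (f z)).
  have := osc_intble (-1) e (S1_amp Hf); congr intble; apply: functional_extensionality => z.
  by rewrite pr2_join dotRC; do 2 f_equal; ring.
have [I2 E2] := intRN_scal (cis (- dotR x0 e)) I1.
have E z : Cmult (cis (- dotR (vadd x0 z) xi)) (packet th f (vadd x0 z)) = Cmult (cis (- dotR x0 e)) (Cmult (cis (- dotR z e)) (f z)).
  rewrite /packet -/x0 -/xi0 vneg_add !Cmult_assoc -!cis_add; congr (Cmult (cis _) _).
  by rewrite /e !dotR_vadd_l !dotR_vadd_r !dotR_vneg_r; ring.
rewrite /FT -(intRN_shift (a := x0)) -?E2; first exact: intRN_ext.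
by move: I2; congr intble; apply: functional_extensionality => z; rewrite E.
Qed.

(** Exact covariance: after the substitutions [x = x0 + z] and [xi = xi0 + e] the operator acts with
    the symbol translated by [th], without error term. The remaining phases recombine into the
    packet on the right. *)
Lemma op_packet q (p : Pt (n + n) -> Mat q) th (f : 'I_q -> Pt n -> C) x i P :
  (forall k, cls (@BP n unit P) (fun _ Y => p (vadd th Y) i k)) -> (forall k, S1 (f k)) ->
  op p (fun x k => packet th (f k) x) x i =
  packet th (fun z => sumC (fun k => Opq (fun Y => p (vadd th Y) i k) (f k) z)) x.
Proof.
move=> Hp Hf; set x0 := pr1 th; set xi0 := pr2 th; set z := vadd (vneg x0) x.
pose A k Y := Cmult (p (vadd th Y) i k) (FT (f k) (pr2 Y)).
have HA k : amp P (A k) := Opq_amp1 (Hp k) (Hf k).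
have Hs : amp P (fun Y => sumC (fun k => A k Y)) := cls_sum (F := fun k _ Y => A k Y) (lin_BA P) HA.
have Eo : osc 1 (fun Y => sumC (fun k => A k Y)) z = sumC (fun k => osc 1 (A k) z).
  rewrite /sumC.
  suff [] : amp P (fun Y => \big[Cplus/RtoC 0]_(k < q) A k Y) /\ osc 1 (fun Y => \big[Cplus/RtoC 0]_(k < q) A k Y) z = \big[Cplus/RtoC 0]_(k < q) osc 1 (A k) z by [].
  elim: (index_enum _) => [|k r [IH1 IH2]].
    have -> : (fun Y : Pt (n + n) => \big[Cplus/RtoC 0]_(k <- ([::] : seq 'I_q)) A k Y) = fun Y => Cmult (RtoC 0) (RtoC 0).
      by apply: functional_extensionality => Y; rewrite big_nil; ring.
    have Z : amp P (fun _ : Pt (n + n) => RtoC 0) := cls_zero (lin_BA P).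
    split; first exact: (cls_scal (RtoC 0) (lin_BA P) Z).
    by rewrite (osc_scal _ _ _ Z) big_nil Cmult_0_l.
  have -> : (fun Y : Pt (n + n) => \big[Cplus/RtoC 0]_(k <- k :: r) A k Y) = fun Y => Cplus (A k Y) (\big[Cplus/RtoC 0]_(k <- r) A k Y).
    by apply: functional_extensionality => Y; rewrite big_cons.
  split; first exact: (cls_plus (lin_BA P) (HA k) IH1).
  by rewrite (osc_plus _ _ (HA k) IH1) IH2 big_cons.
have I1 := osc_intble 1 z Hs.
have [I2 E2] := intRN_scal (cis (dotR x xi0)) I1.
have E e : Cmult (cis (dotR x (vadd xi0 e))) (sumC (fun k => Cmult (p (join x (vadd xi0 e)) i k) (fourier (fun x k => packet th (f k) x) (vadd xi0 e) k)))
   = Cmult (cis (dotR x xi0)) (Cmult (cis (1 * dotR z e)) (sumC (fun k => A k (join z e)))).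
  have -> : join x (vadd xi0 e) = vadd th (join z e).
    apply: pr_inj; rewrite ?pr1_join ?pr2_join; apply: functional_extensionality => j; rewrite /pr1 /pr2 /vadd ?join_l ?join_r //.
    by rewrite /z /x0 /vadd /vneg /pr1; ring.
  rewrite (sumC_ext (g := fun k => Cmult (cis (- dotR x0 e)) (A k (join z e)))) => [|k].
    rewrite sumC_scal !Cmult_assoc -!cis_add; congr (Cmult (cis _) _).
    by rewrite /z dotR_vadd_r dotR_vadd_l dotR_vneg_l; ring.
  rewrite -[fourier _ _ _]/(FT (packet th (f k)) (vadd xi0 e)) FT_packet // /A -/x0 -/xi0 vneg_add pr2_join; ring.
rewrite /op -(intRN_shift (a := xi0)); last first.
  by move: I2; congr intble; apply: functional_extensionality => e; rewrite E.
rewrite (intRN_ext (fun e => E e)) E2 -/(osc 1 (fun Y => sumC (fun k => A k Y)) z) Eo.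
rewrite /packet -/x0 -/xi0 -/z /Opq sumC_scal -/(cn n) /A; ring.
Qed.

End Packets.

Section StarEstimate.
Variables (n q : nat).
Variable br : Pt (n + n) -> R.
Variable p : Pt (n + n) -> Mat q.
Hypothesis Hbr : bracket_fn br.
Hypothesis Hp : GammaM br 0%Z p.
Hypothesis Hidem : forall u : Pt n -> 'I_q -> C, schwartz u ->
     forall (x : Pt n) (i : 'I_q), op p (op p u) x i = op p u x i.

Lemma powerRZ_lam N (b : Pt N -> R) m k y : 0 < b y -> powerRZ (b y) (- Z.of_nat m - Z.of_nat k)%Z = lam b y ^ (m + k).
Proof.
move=> H; have -> : (- Z.of_nat m - Z.of_nat k)%Z = (- Z.of_nat (m + k))%Z.
  by rewrite -plusE Nat2Z.inj_add; ring.
by rewrite powerRZ_neg' -pow_powerRZ /lam pow_inv.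
Qed.

Lemma entry_symb i j : symb (lam br) (fun y => p y i j).
Proof.
have [S E] := Hp i j; split=> // ds; have [K HK] := E ds; exists K => y.
have := HK y; have := @powerRZ_lam _ br 0 (size ds) y (br_pos Hbr y).
by rewrite /= => ->.
Qed.

(** [op p] is applied once and twice to a packet in the [k]-th vector component. Idempotency is
    evaluated at the centre of the packet, where [composition_estimate] computes both sides. *)
Lemma star_estimate M i k : exists K, forall th,
  Cmod (Cminus (sumC (fun l => sumC (fun m : 'I_M.+1 => Cmult (Cmult (RtoC (/ INR (fact m))) (mi m))
     (Wd m (fun y => p y i l) (fun y => p y l k) th)))) (p th i k)) <= K * lam br th ^ M.+1.
Proof.
have [phi [Gphi Hphi]] := composition_estimate Hbr M.
have HK l := Hphi _ _ (entry_symb i l) (entry_symb l k).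
have [K1 HK1] := fin_all_exists HK.
have [K2 HK2] := Hphi _ _ (entry_symb i k) (entry_symb i k).
exists (sumR K1 + K2) => th.
have lp : 0 <= lam br th ^ M.+1 by apply/Rlt_le/pow_lt; exact: lam_pos.
pose f k' : Pt n -> C := fun z => Cmult (RtoC (if k' == k then 1 else 0)) (phi z).
have Gf k' : Gc (f k') by apply: Gc_scal.
have Sf k' := Gc_S1 (Gf k').
have BPp a b : cls (@BP n unit 0) (fun _ Y => p (vadd th Y) a b).
  by have [S B] := shift_BP Hbr (entry_symb a b); split=> // ds; have [k' [K HK']] := B ds; exists k', K => _; apply: HK'.
have Of a k' z : Opq (fun Y => p (vadd th Y) a k') (f k') z = Cmult (RtoC (if k' == k then 1 else 0)) (Opq (fun Y => p (vadd th Y) a k') phi z).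
  rewrite /Opq; have -> : FT (f k') = fun xi => Cmult (RtoC (if k' == k then 1 else 0)) (FT phi xi).
    by apply: functional_extensionality => xi; rewrite FT_scal //; exact: Gc_S1.
  have -> : (fun Y => Cmult (p (vadd th Y) a k') (Cmult (RtoC (if k' == k then 1 else 0)) (FT phi (pr2 Y)))) =
     fun Y => Cmult (RtoC (if k' == k then 1 else 0)) (Cmult (p (vadd th Y) a k') (FT phi (pr2 Y))) by apply: functional_extensionality => Y; ring.
  by rewrite (osc_scal _ _ _ (Opq_amp1 (BPp a k') (Gc_S1 Gphi))); ring.
pose v a := Opq (fun Y => p (vadd th Y) a k) phi.
have Sv a : S1 (v a) := @Opq_RS n unit 0 (fun _ Y => p (vadd th Y) a k) (fun _ => phi) (BPp a k) (Gc_S1 Gphi).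
have E1 : op p (fun x k' => packet th (f k') x) = fun x a => packet th (v a) x.
  apply: functional_extensionality => x; apply: functional_extensionality => a.
  rewrite (op_packet x (BPp a) Sf); congr (packet _ _ x); apply: functional_extensionality => z.
  rewrite (sumC_ext (fun k' => Of a k' z)) /v.
  exact: (sumC_delta k (fun k' => Opq (fun Y => p (vadd th Y) a k') phi z)).
have := Hidem (packet_schwartz th Gf) (pr1 th) i.
rewrite E1 (op_packet (pr1 th) (BPp i) Sv) /packet vadd_neg => E.
(* Both sides carry the same phase of modulus 1 at the centre, which is divided out. *)
have {}E : sumC (fun l => Opq (fun Y => p (vadd th Y) i l) (v l) (fun _ => 0)) = v i (fun _ => 0).
  move: E; set c := cis _; set a := sumC _; set b := v i _ => E.
  have cc : Cmult (cis (- dotR (pr1 th) (pr2 th))) c = RtoC 1 by rewrite /c -cis_add Rplus_opp_l cis0.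
  have -> : a = Cmult (Cmult (cis (- dotR (pr1 th) (pr2 th))) c) a by rewrite cc; ring.
  by rewrite -Cmult_assoc E Cmult_assoc cc; ring.
set X := sumC _.
have -> : Cminus X (p th i k) = Cplus (Cminus (v i (fun _ => 0)) (p th i k)) (Copp (Cminus (sumC (fun l => Opq (fun Y => p (vadd th Y) i l) (v l) (fun _ => 0))) X)).
  by rewrite E; ring.
apply: Rle_trans (Cmod_triangle _ _) _; rewrite Cmod_opp Rmult_plus_distr_r Rplus_comm.
apply: Rplus_le_compat; last by case: (HK2 th).
have -> : Cminus (sumC (fun l => Opq (fun Y => p (vadd th Y) i l) (v l) (fun _ => 0))) X =
  sumC (fun l => Cplus (Opq (fun Y => p (vadd th Y) i l) (v l) (fun _ => 0)) (Cmult (RtoC (-1)) (sumC (fun m : 'I_M.+1 => Cmult (Cmult (RtoC (/ INR (fact m))) (mi m))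
     (Wd m (fun y => p y i l) (fun y => p y l k) th))))).
  by rewrite sumC_plus sumC_scal -/X; ring.
apply: Rle_trans (Cmod_sumC _) _; rewrite Rmult_comm -sumR_scal; apply: sumR_le => l.
have [H _] := HK1 l th; rewrite Rmult_comm; move: H; congr (Cmod _ <= _); rewrite /v; ring.
Qed.

End StarEstimate.

(** * Asymptotic expansions along rays *)

Section Step.

(** The functions [x^(-k) exp (-1/x)] continued by 0; as [k] varies, their linear combinations are
    closed under differentiation. *)
Definition bumpE (k : nat) (x : R) : R := if Rlt_dec 0 x then (/ x) ^ k * exp (- / x) else 0.

Lemma bumpE_pos k x : 0 < x -> bumpE k x = (/ x) ^ k * exp (- / x).
Proof. by rewrite /bumpE; case: Rlt_dec. Qed.
Lemma bumpE_neg k x : x <= 0 -> bumpE k x = 0.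
Proof. by rewrite /bumpE; case: Rlt_dec => // ? ?; lra. Qed.

Lemma bumpE_quad k : exists K, 0 < K /\ forall x, Rabs (bumpE k x) <= K * x ^ 2.
Proof.
have [K [HK H]] := @pow_exp (k + 2) 1 Rlt_0_1; exists K; split=> // x.
case: (Rlt_dec 0 x) => Hx; last first.
  by rewrite bumpE_neg; [rewrite Rabs_R0; have := pow2_ge_0 x; nra | lra].
have ix : 0 < / x by apply: Rinv_0_lt_compat.
rewrite bumpE_pos // Rabs_pos_eq; last first.
  by apply: Rmult_le_pos; [apply: pow_le; lra | exact/Rlt_le/exp_pos].
have {}H := H (/ x) (Rlt_le _ _ ix); rewrite Rmult_1_l in H.
have H2 : (/ x) ^ (k + 2) <= K * exp (/ x) by apply: Rle_trans H; apply: pow_incr; lra.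
have -> : (/ x) ^ k * exp (- / x) = x ^ 2 * ((/ x) ^ (k + 2) * exp (- / x)) by rewrite pow_add; field; lra.
rewrite (Rmult_comm K); apply: Rmult_le_compat_l; first exact: pow2_ge_0.
apply: Rle_trans (Rmult_le_compat_r _ _ _ (Rlt_le _ _ (exp_pos _)) H2) _.
by rewrite Rmult_assoc -exp_plus Rplus_opp_r exp_0; lra.
Qed.

Lemma bumpE_derive k x : is_derive (bumpE k) x (bumpE k.+2 x - INR k * bumpE k.+1 x).
Proof.
case: (Rtotal_order x 0) => [Hx|[->|Hx]].
- rewrite !bumpE_neg; try lra.
  apply: (is_derive_ext_loc (fun _ => 0)).
    exists (mkposreal _ (Ropp_0_gt_lt_contravar _ Hx)) => y Hy.
    have {}Hy : Rabs (y - x) < - x by exact: Hy.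
    by rewrite bumpE_neg //; move/Rabs_def2: Hy; lra.
  by have -> : 0 - INR k * 0 = 0 by [ring]; apply: is_derive_const.
(* At 0 the difference quotient is at most [K |h|], by [bumpE_quad]. *)
- rewrite !bumpE_neg; try lra.
  have [K [HK H]] := bumpE_quad k.
  have -> : 0 - INR k * 0 = 0 by ring.
  apply/is_derive_Reals => e He.
  have Hd : 0 < e / K by apply: Rdiv_lt_0_compat.
  exists (mkposreal _ Hd) => h Hh0 /= Hh.
  rewrite Rplus_0_l (bumpE_neg k (Rle_refl 0)) !Rminus_0_r Rabs_div //.
  have hp : 0 < Rabs h by apply: Rabs_pos_lt.
  apply: (Rmult_lt_reg_r (Rabs h)) => //.
  have -> : Rabs (bumpE k h) / Rabs h * Rabs h = Rabs (bumpE k h) by field; lra.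
  apply: Rle_lt_trans (H h) _; rewrite -pow2_abs.
  have : K * Rabs h < e.
    have -> : e = K * (e / K) by field; lra.
    exact: Rmult_lt_compat_l.
  nra.
- apply: (is_derive_ext_loc (fun y => (/ y) ^ k * exp (- / y))).
    exists (mkposreal _ Hx) => y Hy; have {}Hy : Rabs (y - x) < x by exact: Hy.
    by rewrite bumpE_pos //; move/Rabs_def2: Hy; lra.
  rewrite !bumpE_pos //; auto_derive; first by split; lra.
  case: k => [|k]; first by rewrite /=; field; lra.
  have -> : k.+1.-1 = k by [].
  rewrite -[INR k.+1]/(INR k.+1) /Init.Nat.pred; set c := INR k.+1.
  by rewrite /=; set p := (/ x) ^ k; field; lra.
Qed.

Definition stepD (x : R) := bumpE 0 x + bumpE 0 (1 - x).

Lemma stepD_pos x : 0 < stepD x.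
Proof.
have nn y : 0 <= bumpE 0 y.
  case: (Rlt_dec 0 y) => Hy; last by rewrite bumpE_neg; lra.
  by rewrite bumpE_pos //= Rmult_1_l; apply/Rlt_le/exp_pos.
have pp y : 0 < y -> 0 < bumpE 0 y by move=> Hy; rewrite bumpE_pos //= Rmult_1_l; exact: exp_pos.
rewrite /stepD; case: (Rlt_dec 0 x) => Hx.
  by have := pp x Hx; have := nn (1 - x); lra.
by have := pp (1 - x) ltac:(lra); have := nn x; lra.
Qed.

(** A class containing [step] and closed under derivatives; [/ stepD] is a generator since its
    derivative is again built from the generators by sums and products. *)
Inductive stepK : (R -> R) -> Prop :=
| stepK_E k : stepK (bumpE k)
| stepK_E' k : stepK (fun x => bumpE k (1 - x))
| stepK_inv : stepK (fun x => / stepD x)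
| stepK_const c : stepK (fun _ => c)
| stepK_plus f g : stepK f -> stepK g -> stepK (fun x => f x + g x)
| stepK_mult f g : stepK f -> stepK g -> stepK (fun x => f x * g x).

Lemma stepK_derive f : stepK f -> exists g, stepK g /\ forall x, is_derive f x (g x).
Proof.
have E' k x : is_derive (fun x => bumpE k (1 - x)) x ((-1) * bumpE k.+2 (1 - x) + INR k * bumpE k.+1 (1 - x)).
  have := is_derive_comp (bumpE k) (fun x => 1 - x) x _ (-1) (bumpE_derive k (1 - x)).
  rewrite /scal /= /mult /= => H.
  have -> : -1 * bumpE k.+2 (1 - x) + INR k * bumpE k.+1 (1 - x) = -1 * (bumpE k.+2 (1 - x) - INR k * bumpE k.+1 (1 - x)) by ring.
  by apply: H; auto_derive => //; ring.
elim=> {f} [k|k||c|f g _ [f' [Kf Hf]] _ [g' [Kg Hg]]|f g Kf0 [f' [Kf Hf]] Kg0 [g' [Kg Hg]]].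
- exists (fun x => bumpE k.+2 x + (- INR k) * bumpE k.+1 x); split.
    by apply: stepK_plus; [apply: stepK_E | apply: stepK_mult; [exact: stepK_const | exact: stepK_E]].
  move=> x; have -> : bumpE k.+2 x + - INR k * bumpE k.+1 x = bumpE k.+2 x - INR k * bumpE k.+1 x by ring.
  exact: bumpE_derive.
- exists (fun x => (-1) * bumpE k.+2 (1 - x) + INR k * bumpE k.+1 (1 - x)); split=> //.
  by apply: stepK_plus; apply: stepK_mult; try exact: stepK_const; exact: stepK_E'.
- exists (fun x => (-1) * ((bumpE 2 x + (-1) * bumpE 2 (1 - x)) * (/ stepD x * / stepD x))); split.
    apply: stepK_mult; first exact: stepK_const.
    apply: stepK_mult; last by apply: stepK_mult; exact: stepK_inv.
    by apply: stepK_plus; [exact: stepK_E | apply: stepK_mult; [exact: stepK_const | exact: stepK_E']].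
  move=> x; have D : is_derive stepD x (bumpE 2 x + (-1) * bumpE 2 (1 - x)).
    have := is_derive_plus_R (bumpE_derive 0 x) (E' 0%N x); rewrite /= !Rmult_0_l Rminus_0_r Rplus_0_r //.
  have := is_derive_inv stepD x _ D; have := stepD_pos x => P H.
  have {}H := H ltac:(lra).
  have -> : -1 * ((bumpE 2 x + -1 * bumpE 2 (1 - x)) * (/ stepD x * / stepD x)) = - (bumpE 2 x + -1 * bumpE 2 (1 - x)) / stepD x ^ 2 by field; lra.
  exact: H.
- by exists (fun _ => 0); split; [exact: stepK_const | move=> x; apply: is_derive_const].
- by exists (fun x => f' x + g' x); split; [exact: stepK_plus | move=> x; apply: is_derive_plus_R].
- exists (fun x => f' x * g x + f x * g' x); split; last by move=> x; apply: is_derive_mult_R.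
  by apply: stepK_plus; apply: stepK_mult.
Qed.

Definition step (x : R) := bumpE 0 x * / stepD x.

Lemma step_K : stepK step. Proof. by apply: stepK_mult; [exact: stepK_E | exact: stepK_inv]. Qed.
Lemma step_0 x : x <= 0 -> step x = 0. Proof. by move=> H; rewrite /step bumpE_neg // Rmult_0_l. Qed.
Lemma step_1 x : 1 <= x -> step x = 1.
Proof.
move=> H; have P := stepD_pos x; move: P; rewrite /step /stepD (bumpE_neg 0 (x := 1 - x)); last lra.
by rewrite Rplus_0_r => P; field; lra.
Qed.
Lemma step_bounds x : 0 <= step x <= 1.
Proof.
have nn y : 0 <= bumpE 0 y.
  case: (Rlt_dec 0 y) => Hy; last by rewrite bumpE_neg; lra.
  by rewrite bumpE_pos //= Rmult_1_l; apply/Rlt_le/exp_pos.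
have P := stepD_pos x; have n1 := nn x; have n2 := nn (1 - x).
have I := Rinv_0_lt_compat _ P; split; first by apply: Rmult_le_pos; lra.
rewrite /step; apply: (Rmult_le_reg_r (stepD x)) => //.
by rewrite Rmult_assoc Rinv_l; [rewrite /stepD; lra | lra].
Qed.

Inductive compK N (F : Pt N -> R) : (Pt N -> C) -> Prop :=
| compK_base g H : stepK g -> smooth H -> compK F (fun y => Cmult (RtoC (g (F y))) (H y))
| compK_plus f g : compK F f -> compK F g -> compK F (fun y => Cplus (f y) (g y)).

Lemma smooth_step N (F : Pt N -> R) : smooth (fun y => RtoC (F y)) -> smooth (fun y => RtoC (step (F y))).
Proof.
move=> SF; apply: (@smooth_ext _ _ (fun y => Cmult (RtoC (step (F y))) (RtoC 1))); first exact: opn_true.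
  by move=> y _; ring.
apply: (@smooth_intro _ _ (compK F)); first exact: opn_true; last first.
  by apply: compK_base; [exact: step_K | exact: (smooth_const _ (@opn_true N))].
move=> h; elim=> {h} [g H Kg SH|f g _ [Lf Pf] _ [Lg Pg]]; last first.
  split=> [y Uy|i]; first by apply: lbd_plus; auto.
  have [f' [Kf' Hf']] := Pf i; have [g' [Kg' Hg']] := Pg i.
  exists (fun z => Cplus (f' z) (g' z)); split; first exact: compK_plus.
  by move=> y Uy; apply: is_partial_plus; auto.
have [g' [Kg' Hg']] := stepK_derive Kg.
split=> [y Uy|i].
  apply: lbd_mult; last exact: (smooth_lbd SH).
  have cg : continuity_pt g (F y) by apply/derivable_continuous_pt/ex_derive_Reals_0; eexists; exact: Hg'.
  have [a [Ha Hca]] := cg 1 Rlt_0_1.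
  have /cont_at_near /(_ a Ha) [d [Hd Hz]] := proj1 (SF [::]) y I.
  exists d; split=> //; exists (Rabs (g (F y)) + 1) => z /Hz /=; rewrite -RtoC_minus Cmod_R => H1.
  rewrite Cmod_R; have H2 : Rabs (g (F z) - g (F y)) < 1.
    case: (Req_dec (F z) (F y)) => [->|Hne]; first by rewrite Rminus_diag_eq // Rabs_R0; lra.
    by apply: Hca; split=> //; split=> //; exact: not_eq_sym.
  by have := Rabs_triang (g (F z) - g (F y)) (g (F y)); have -> : g (F z) - g (F y) + g (F y) = g (F z) by [ring]; lra.
exists (fun y => Cplus (Cmult (RtoC (g' (F y))) (Cmult (partial i (fun y => RtoC (F y)) y) (H y))) (Cmult (RtoC (g (F y))) (partial i H y))); split.
  apply: compK_plus; apply: compK_base => //; last exact: smooth_partial.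
  by apply: smooth_mult => //; [exact: opn_true | exact: smooth_partial].
move=> y _.
have H1 : is_partial i (fun y => RtoC (g (F y))) y (Cmult (RtoC (g' (F y))) (partial i (fun y => RtoC (F y)) y)).
  have [D1 D2] := smooth_is_partial (U := fun _ => True) i SF (y := y) I.
  have E2 : (partial i (fun y => RtoC (F y)) y).2 = 0 by rewrite /partial /Cderiv /= Derive_const.
  have -> : partial i (fun y => RtoC (F y)) y = RtoC (partial i (fun y => RtoC (F y)) y).1.
    by apply: injective_projections.
  rewrite -RtoC_mult; apply: is_Cderiv_RtoC; rewrite Rmult_comm.
  apply: (is_derive_comp g (fun t => F (upd y i t))) D1; rewrite upd_id; exact: Hg'.
have := is_partial_mult H1 (smooth_is_partial (U := fun _ => True) i SH (y := y) I).
by congr is_partial; ring.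
Qed.

Lemma smooth_sumsq N : smooth (fun y : Pt N => RtoC (sumR (fun j => y j ^ 2))).
Proof.
have S : smooth (fun y : Pt N => sumC (fun j => Cmult (RtoC (y j)) (RtoC (y j)))).
  apply: (smooth_sum (@opn_true N)) => j; apply: (smooth_mult (@opn_true N)); exact: (smooth_coord _ (@opn_true N)).
apply: (smooth_ext (@opn_true N) _ S) => y _; rewrite /sumC /sumR; symmetry.
rewrite (big_morph RtoC RtoC_plus (erefl (RtoC 0))); apply: eq_bigr => j _.
by rewrite -RtoC_mult /= Rmult_1_r.
Qed.

Lemma smooth_affine_sumsq N a b : smooth (fun y : Pt N => RtoC (a * sumR (fun j => y j ^ 2) + b)).
Proof.
have := smooth_plus (@opn_true N) (smooth_scal (RtoC a) (@opn_true N) (@smooth_sumsq N)) (smooth_const (RtoC b) (@opn_true N)).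
by apply: (smooth_ext (@opn_true N)) => y _; rewrite RtoC_plus RtoC_mult.
Qed.

Lemma zero_excision_exists N : exists chi : Pt N -> R, zero_excision chi /\ forall y, 2 < enorm y -> chi y = 1.
Proof.
exists (fun y => step (1 * sumR (fun j => y j ^ 2) + (-1))).
have H2 y : 2 < enorm y -> step (1 * sumR (fun j : 'I_N => y j ^ 2) + (-1)) = 1.
  by move=> Hy; apply: step_1; rewrite -enorm_sq; nra.
split=> //; split; first by apply: smooth_step; exact: smooth_affine_sumsq.
split; last by exists 2.
exists 1; split; first lra.
by move=> y Hy; apply: step_0; rewrite -enorm_sq; have := enorm_ge0 y; nra.
Qed.

End Step.

(** * Expansions in inverse powers of the ray parameter *)

Section Asymptotics.

Definition shiftc (c : nat -> C) : nat -> C := fun k => c k.+1.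

(* [asy M f c]: f(t) = sum_(k < M) c_k t^-k + O(t^-M) as t tends to infinity. *)
Fixpoint asy (M : nat) (f : R -> C) (c : nat -> C) : Prop :=
  match M with
  | 0 => exists K T, forall t, T <= t -> Cmod (f t) <= K
  | M'.+1 => asy M' (fun t => Cmult (RtoC t) (Cminus (f t) (c 0%N))) (shiftc c)
  end.

Lemma asy_ext_ev M f g c T : (forall t, T <= t -> f t = g t) -> asy M f c -> asy M g c.
Proof.
elim: M f g c => [|M IH] f g c E.
  move=> [K [T' H]]; exists K, (Rmax T T') => t Ht.
  by rewrite -E; [apply: H; apply: Rle_trans Ht; exact: Rmax_r | apply: Rle_trans Ht; exact: Rmax_l].
by apply: IH => t Ht; rewrite E.
Qed.

Lemma asy_ext M f g c : (forall t, f t = g t) -> asy M f c -> asy M g c.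
Proof. by move=> E; apply: (@asy_ext_ev _ _ _ _ 0) => t _; exact: E. Qed.

Lemma asy_extc M f c d : (forall k, (k < M)%N -> c k = d k) -> asy M f c -> asy M f d.
Proof.
elim: M f c d => [//|M IH] f c d E /= H.
rewrite -E //; apply: IH H => k Hk; exact: E.
Qed.

Lemma asy_plus M f g c d : asy M f c -> asy M g d -> asy M (fun t => Cplus (f t) (g t)) (fun k => Cplus (c k) (d k)).
Proof.
elim: M f g c d => [|M IH] f g c d.
  move=> [K [T H]] [K' [T' H']]; exists (K + K'), (Rmax T T') => t Ht.
  apply: Rle_trans (Cmod_triangle _ _) _; apply: Rplus_le_compat.
    by apply: H; apply: Rle_trans Ht; exact: Rmax_l.
  by apply: H'; apply: Rle_trans Ht; exact: Rmax_r.
by move=> /= Hf Hg; apply: asy_ext (IH _ _ _ _ Hf Hg) => t; ring.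
Qed.

Lemma asy_scal M a f c : asy M f c -> asy M (fun t => Cmult a (f t)) (fun k => Cmult a (c k)).
Proof.
elim: M f c => [|M IH] f c.
  move=> [K [T H]]; exists (Cmod a * K), T => t Ht; rewrite Cmod_mult; apply: Rmult_le_compat_l; [exact: Cmod_ge_0 | exact: H].
by move=> /= Hf; apply: asy_ext (IH _ _ Hf) => t; ring.
Qed.

Lemma asy_zero M : asy M (fun _ => RtoC 0) (fun _ => RtoC 0).
Proof.
elim: M => [|M IH]; first by exists 0, 0 => t _; rewrite Cmod_0; lra.
by apply: asy_ext IH => t; ring.
Qed.

Lemma asy_sum M q (f : 'I_q -> R -> C) (c : 'I_q -> nat -> C) : (forall i, asy M (f i) (c i)) ->
  asy M (fun t => sumC (fun i => f i t)) (fun k => sumC (fun i => c i k)).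
Proof.
move=> H; rewrite /sumC; elim: (index_enum _) => [|i r IH].
  have -> : (fun t : R => \big[Cplus/RtoC 0]_(i <- ([::] : seq 'I_q)) f i t) = fun _ => RtoC 0 by apply: functional_extensionality => t; rewrite big_nil.
  have -> : (fun k : nat => \big[Cplus/RtoC 0]_(i <- ([::] : seq 'I_q)) c i k) = fun _ => RtoC 0 by apply: functional_extensionality => t; rewrite big_nil.
  exact: asy_zero.
have -> : (fun t : R => \big[Cplus/RtoC 0]_(i <- i :: r) f i t) = fun t => Cplus (f i t) (\big[Cplus/RtoC 0]_(i <- r) f i t) by apply: functional_extensionality => t; rewrite big_cons.
have -> : (fun k : nat => \big[Cplus/RtoC 0]_(i <- i :: r) c i k) = fun k => Cplus (c i k) (\big[Cplus/RtoC 0]_(i <- r) c i k) by apply: functional_extensionality => t; rewrite big_cons.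
exact: asy_plus.
Qed.

Lemma asy_le0 M f c : asy M f c -> asy 0 f c.
Proof.
elim: M f c => [//|M IH] f c /= /IH [K [T H]].
exists (Rabs K + Cmod (c 0%N)), (Rmax 1 T) => t Ht.
have t1 : 1 <= t by apply: Rle_trans Ht; exact: Rmax_l.
have := H t ltac:(apply: Rle_trans Ht; exact: Rmax_r); rewrite Cmod_mult Cmod_R Rabs_pos_eq; last lra.
have -> : f t = Cplus (Cminus (f t) (c 0%N)) (c 0%N) by ring.
have -> : Cminus (Cplus (Cminus (f t) (c 0%N)) (c 0%N)) (c 0%N) = Cminus (f t) (c 0%N) by ring.
have := Cmod_triangle (Cminus (f t) (c 0%N)) (c 0%N); have := Cmod_ge_0 (Cminus (f t) (c 0%N)); have := Rle_abs K.
nra.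
Qed.

Lemma asy_pred M f c : asy M.+1 f c -> asy M f c.
Proof.
elim: M f c => [|M IH] f c H; first exact: asy_le0 H.
exact: IH.
Qed.

Definition conv (c d : nat -> C) (k : nat) : C := \big[Cplus/RtoC 0]_(i < k.+1) Cmult (c i) (d (k - i)%N).

(** The recursion uses [f g - c0 d0 = (f - c0) g + c0 (g - d0)]. *)
Lemma asy_mult M f g c d : asy M f c -> asy M g d -> asy M (fun t => Cmult (f t) (g t)) (conv c d).
Proof.
elim: M f g c d => [|M IH] f g c d.
  move=> [K [T H]] [K' [T' H']]; exists (K * K'), (Rmax T T') => t Ht.
  rewrite Cmod_mult; apply: Rmult_le_compat; try exact: Cmod_ge_0.
    by apply: H; apply: Rle_trans Ht; exact: Rmax_l.
  by apply: H'; apply: Rle_trans Ht; exact: Rmax_r.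
move=> Hf Hg.
have A := asy_scal (c 0%N) (Hg : asy M _ _).
have B := IH _ _ _ _ (Hf : asy M _ _) (asy_pred Hg).
have := asy_plus A B => /= {A B}; set c' := (fun k : nat => _) => H.
have -> : shiftc (conv c d) = c'.
  apply: functional_extensionality => k; rewrite /c' /shiftc /conv big_ord_recl subn0; congr Cplus.
have c00 : conv c d 0%N = Cmult (c 0%N) (d 0%N) by rewrite /conv big_ord1.
by apply: asy_ext H => t; rewrite c00; ring.
Qed.

Lemma asy_inv_mul M f c : asy M f c ->
  asy M.+1 (fun t => Cmult (RtoC (/ t)) (f t)) (fun k => match k with 0 => RtoC 0 | k'.+1 => c k' end).
Proof.
move=> H; apply: (@asy_ext_ev M f _ _ 1) => [t Ht|]; last exact: H.
have -> : Cmult (RtoC t) (Cminus (Cmult (RtoC (/ t)) (f t)) (RtoC 0)) = Cmult (RtoC (t * / t)) (f t) by rewrite RtoC_mult; ring.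
rewrite Rinv_r; last lra.
ring.
Qed.

Lemma asy_intro M f (c : nat -> C) K T : (forall t, T <= t ->
  Cmod (Cminus (f t) (sumC (fun k : 'I_M => Cmult (RtoC ((/ t) ^ k)) (c k)))) <= K * (/ t) ^ M) -> asy M f c.
Proof.
elim: M f c T => [|M IH] f c T H.
  exists K, T => t /H; rewrite /sumC big_ord0 /= Rmult_1_r.
  by have -> : Cminus (f t) (RtoC 0) = f t by ring.
apply: (IH _ _ (Rmax 1 T)) => t Ht.
have t1 : 1 <= t by apply: Rle_trans Ht; exact: Rmax_l.
have := H t ltac:(apply: Rle_trans Ht; exact: Rmax_r).
have tt : t * / t = 1 by apply: Rinv_r; lra.
rewrite {1}/sumC big_ord_recl; set s := \big[_/_]_(i < M) _.
have -> : s = Cmult (RtoC (/ t)) (sumC (fun k : 'I_M => Cmult (RtoC ((/ t) ^ k)) (shiftc c k))).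
  rewrite -sumC_scal; apply: eq_bigr => i _; rewrite Cmult_assoc -RtoC_mult; congr (Cmult (RtoC _) _).
set S := sumC _ => H'.
have -> : Cminus (Cmult (RtoC t) (Cminus (f t) (c 0%N))) S =
  Cmult (RtoC t) (Cminus (f t) (Cplus (Cmult (RtoC ((/ t) ^ @ord0 M)) (c (@ord0 M))) (Cmult (RtoC (/ t)) S))).
  have -> : S = Cmult (RtoC (t * / t)) S by rewrite tt; ring.
  by rewrite RtoC_mult /=; have -> : Cmult (RtoC (/ t)) (Cmult (Cmult (RtoC t) (RtoC (/ t))) S) = Cmult (RtoC (/ t)) S by [rewrite -RtoC_mult tt; ring]; ring.
rewrite Cmod_mult Cmod_R Rabs_pos_eq; last lra.
apply: Rle_trans (Rmult_le_compat_l t _ _ ltac:(lra) H') _.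
have -> : t * (K * (/ t) ^ M.+1) = K * ((t * / t) * (/ t) ^ M) by rewrite /=; ring.
rewrite tt; lra.
Qed.

Lemma asy_unique M f c K T : asy M f c -> (forall t, T <= t -> Cmod (f t) <= K * (/ t) ^ M) ->
  forall k, (k < M)%N -> c k = RtoC 0.
Proof.
elim: M f c T => [//|M IH] f c T Hf HK.
have c0 : c 0%N = RtoC 0.
  have [K' [T' H']] := asy_le0 (Hf : asy M _ _).
  apply: Cmod_eq_0; apply: NNPP => Hc.
  have cp : 0 < Cmod (c 0%N) by have := Cmod_ge_0 (c 0%N); lra.
  (* For this [t] the bounds on [t |f|] and [t |f - c0|] add up to less than [t |c0|], a
     contradiction. *)
  pose t := Rmax (Rmax 1 (Rmax T T')) ((Rabs K + Rabs K' + 1) / Cmod (c 0%N)).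
  have t1 : 1 <= t by apply: Rle_trans (Rmax_l _ _); exact: Rmax_l.
  have tT : T <= t by apply: Rle_trans (Rmax_l _ _); apply: Rle_trans (Rmax_r _ _); exact: Rmax_l.
  have tT' : T' <= t by apply: Rle_trans (Rmax_l _ _); apply: Rle_trans (Rmax_r _ _); exact: Rmax_r.
  have tc : (Rabs K + Rabs K' + 1) / Cmod (c 0%N) <= t by exact: Rmax_r.
  have tc' : Rabs K + Rabs K' + 1 <= t * Cmod (c 0%N).
    by apply: (Rmult_le_reg_r (/ Cmod (c 0%N))); [exact: Rinv_0_lt_compat | rewrite Rmult_assoc Rinv_r; lra].
  have A := H' t tT'; rewrite Cmod_mult Cmod_R Rabs_pos_eq in A; last lra.
  have B := HK t tT.
  have it : 0 < / t <= 1 by split; [apply: Rinv_0_lt_compat; lra | rewrite -Rinv_1; apply: Rinv_le_contravar; lra].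
  have tt : t * / t = 1 by apply: Rinv_r; lra.
  have D : t * Cmod (f t) <= Rabs K.
    apply: Rle_trans (Rmult_le_compat_l t _ _ ltac:(lra) B) _.
    have -> : t * (K * (/ t) ^ M.+1) = K * ((t * / t) * (/ t) ^ M) by rewrite /=; ring.
    rewrite tt Rmult_1_l; have : 0 <= (/ t) ^ M <= 1.
      split; first by apply: pow_le; lra.
      by rewrite -(pow1 M); apply: pow_incr; lra.
    by have := Rle_abs K; have := Rabs_pos K; nra.
  have E : Cmod (c 0%N) <= Cmod (f t) + Cmod (Cminus (f t) (c 0%N)).
    have {1}-> : c 0%N = Cplus (f t) (Copp (Cminus (f t) (c 0%N))) by ring.
    by apply: Rle_trans (Cmod_triangle _ _) _; rewrite Cmod_opp; lra.
  by have := Rle_abs K'; nra.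
case=> [//|k] Hk; apply: (IH _ (shiftc c) (Rmax 1 T) (Hf : asy M _ _)) => // t Ht.
have t1 : 1 <= t by apply: Rle_trans Ht; exact: Rmax_l.
have tt : t * / t = 1 by apply: Rinv_r; lra.
rewrite c0; have -> : Cminus (f t) (RtoC 0) = f t by ring.
rewrite Cmod_mult Cmod_R Rabs_pos_eq; last lra.
apply: Rle_trans (Rmult_le_compat_l t _ _ ltac:(lra) (HK t ltac:(apply: Rle_trans Ht; exact: Rmax_r))) _.
have -> : t * (K * (/ t) ^ M.+1) = K * ((t * / t) * (/ t) ^ M) by rewrite /=; ring.
rewrite tt; lra.
Qed.

End Asymptotics.

Section Homogeneous.
Variable N : nat.

Definition homog1 (d : Z) (F : Pt N -> C) := forall t y, 0 < t -> nonzero y -> F (vscale t y) = Cmult (RtoC (powerRZ t d)) (F y).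

Lemma nonzero_scale t (y : Pt N) : 0 < t -> nonzero y -> nonzero (vscale t y).
Proof. by move=> Ht /nonzeroP [j Hj]; apply/nonzeroP; exists j; rewrite /vscale; nra. Qed.

Lemma is_Cderiv_scale_arg g a t l : is_Cderiv g (a * t) l -> is_Cderiv (fun s => g (a * s)) t (Cmult (RtoC a) l).
Proof.
move=> [H1 H2]; have D : is_derive (fun s => a * s) t a by auto_derive => //; ring.
split.
  have -> : (Cmult (RtoC a) l).1 = a * l.1 by rewrite /=; ring.
  exact: (is_derive_comp (fun s => (g s).1) (fun s => a * s) t _ _ H1 D).
have -> : (Cmult (RtoC a) l).2 = a * l.2 by rewrite /=; ring.
exact: (is_derive_comp (fun s => (g s).2) (fun s => a * s) t _ _ H2 D).
Qed.

Lemma homog1_partial d i F : smooth_on (@nonzero N) F -> homog1 d F -> homog1 (d - 1)%Z (partial i F).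
Proof.
move=> SF HF t y Ht Hy.
have A := smooth_is_partial i SF Hy.
have B := smooth_is_partial i SF (nonzero_scale Ht Hy).
have A' := is_partial_scal (RtoC (powerRZ t d)) A.
have B' : is_partial i (fun z => Cmult (RtoC (powerRZ t d)) (F z)) y (Cmult (RtoC t) (partial i F (vscale t y))).
  apply: (is_partial_extU (@opn_nonzero N) Hy (F := fun z => F (vscale t z))) => [z Hz|]; first exact: HF.
  have -> : is_partial i (fun z => F (vscale t z)) y = is_Cderiv (fun s => F (upd (vscale t y) i (t * s))) (y i).
    rewrite /is_partial; congr is_Cderiv; apply: functional_extensionality => s; congr F.
    by apply: functional_extensionality => j; rewrite /vscale /upd; case: eqP.
  exact: (@is_Cderiv_scale_arg (fun s => F (upd (vscale t y) i s)) t (y i)).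
have E := is_partial_unique A'; rewrite (is_partial_unique B') in E.
have tn : t <> 0 by lra.
have -> : powerRZ t (d - 1) = / t * powerRZ t d.
  by rewrite /Z.sub powerRZ_add //= Rmult_1_r; ring.
have -> : partial i F (vscale t y) = Cmult (RtoC (/ t * t)) (partial i F (vscale t y)).
  by rewrite Rinv_l //; ring.
by rewrite !RtoC_mult -!Cmult_assoc E.
Qed.

Lemma homog1_dpar d ds F : smooth_on (@nonzero N) F -> homog1 d F -> homog1 (d - Z.of_nat (size ds))%Z (dpar ds F).
Proof.
move=> SF HF; elim: ds => [|i ds IH]; first by rewrite /= Z.sub_0_r.
rewrite [size _]/= Nat2Z.inj_succ /Z.succ Z.sub_add_distr; apply: homog1_partial => //.
exact: smooth_dpar.
Qed.

End Homogeneous.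

Lemma asy_div M s f c : asy M (fun t => Cmult (RtoC (t ^ s)) (f t)) c ->
  asy M f (fun k => if (k < s)%N then RtoC 0 else c (k - s)%N).
Proof.
elim: s f c => [|s IH] f c H.
  apply: (@asy_extc _ _ c) => [k _|]; first by rewrite ltn0 subn0.
  by apply: asy_ext H => t /=; ring.
have H1 := asy_pred (asy_inv_mul H).
have {}H1 : asy M (fun t => Cmult (RtoC (t ^ s)) (f t)) (fun k => match k with 0 => RtoC 0 | k'.+1 => c k' end).
  apply: (asy_ext_ev (T := 1) _ H1) => t Ht.
  have tt : / t * t = 1 by rewrite Rinv_l; lra.
  by rewrite Cmult_assoc -RtoC_mult /= -Rmult_assoc tt Rmult_1_l.
apply: (asy_extc _ (IH _ _ H1)) => k _.
case: (ltngtP k s) => [Hk|Hk|->]; first by rewrite ltnW.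
  by rewrite ltnS leqNgt Hk /= -(subnSK Hk).
by rewrite subnn ltnS leqnn.
Qed.

Section OnU.
Variables (N : nat) (U : Pt N -> Prop).
Hypothesis HU : opn U.

Lemma dpar_sumC ds m (F : 'I_m -> Pt N -> C) y : (forall k, smooth_on U (F k)) -> U y ->
  dpar ds (fun z => sumC (fun k => F k z)) y = sumC (fun k => dpar ds (F k) y).
Proof.
move=> SF Uy; rewrite /sumC.
suff [] : smooth_on U (fun z => \big[Cplus/RtoC 0]_(k < m) F k z) /\
  dpar ds (fun z => \big[Cplus/RtoC 0]_(k < m) F k z) y = \big[Cplus/RtoC 0]_(k < m) dpar ds (F k) y by [].
elim: (index_enum _) => [|k r [S0 E0]].
  have -> : (fun z : Pt N => \big[Cplus/RtoC 0]_(k <- ([::] : seq 'I_m)) F k z) = fun z => Cmult (RtoC 0) (RtoC 0).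
    by apply: functional_extensionality => z; rewrite big_nil; ring.
  split; first exact: (smooth_const _ HU).
  by rewrite big_nil (dpar_scal ds (RtoC 0) HU (smooth_const _ HU) Uy) Cmult_0_l.
have -> : (fun z : Pt N => \big[Cplus/RtoC 0]_(k <- k :: r) F k z) = fun z => Cplus (F k z) (\big[Cplus/RtoC 0]_(k <- r) F k z).
  by apply: functional_extensionality => z; rewrite big_cons.
split; first exact: (smooth_plus HU (SF k) S0).
by rewrite (dpar_plus ds HU (SF k) S0 Uy) E0 big_cons.
Qed.

Lemma smooth_sub V F : (forall y, U y -> V y) -> smooth_on V F -> smooth_on U F.
Proof. by move=> H SF ds; have [A B] := SF ds; split=> [y /H /A //|i y /H]; exact: B. Qed.

End OnU.

Lemma enorm_scale N t (y : Pt N) : 0 <= t -> enorm (vscale t y) = t * enorm y.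
Proof.
move=> Ht; rewrite /enorm (sumR_ext (g := fun j => t ^ 2 * y j ^ 2)) => [|j]; last by rewrite /vscale; ring.
rewrite sumR_scal sqrt_mult; [by rewrite sqrt_pow2 | exact: pow2_ge_0 | apply: sumR_ge0 => j; exact: pow2_ge_0].
Qed.

Lemma opn_outside N r : opn (fun y : Pt N => r < enorm y).
Proof.
move=> y Hy; have HN := pos_INR N.
have Hd : 0 < (enorm y - r) / (INR N + 1) by apply: Rdiv_lt_0_compat; lra.
exists ((enorm y - r) / (INR N + 1)); split=> // z Hz.
have := enorm_near Hz.
have -> : INR N * ((enorm y - r) / (INR N + 1)) = (enorm y - r) - (enorm y - r) / (INR N + 1) by field; lra.
have := enorm_triangle z (vsub y z).
have -> : vadd z (vsub y z) = y by apply: functional_extensionality => j; rewrite /vadd /vsub; ring.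
have -> : enorm (vsub y z) = enorm (vsub z y) by rewrite /enorm; congr sqrt; apply: sumR_ext => j; rewrite /vsub; ring.
lra.
Qed.

Section Expansion.
Variables (n q : nat).
Variable br : Pt (n + n) -> R.
Variable p : Pt (n + n) -> Mat q.
Variable h : nat -> Pt (n + n) -> Mat q.
Hypothesis Hbr : bracket_fn br.
Hypothesis Hcl : classical_with br 0%Z p h.
Variable y : Pt (n + n).
Hypothesis Hy : nonzero y.

(** Along the ray through [y], derivatives of [a] expand with the corresponding derivatives of the
    [al k] as coefficients. The offset [s] counts derivatives already contained in [a], each of
    which lowers the degree by one. *)
Definition exp_rel (a : Pt (n + n) -> C) (al : nat -> Pt (n + n) -> C) s := forall ds M,
  asy M (fun t => Cmult (RtoC (t ^ (s + size ds))) (dpar ds a (vscale t y))) (fun k => dpar ds (al k) y).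

Lemma ey_pos : 0 < enorm y.
Proof. by have := enorm_ge0 y; have : enorm y <> 0 by [exact: Hy]; lra. Qed.

Lemma lam_ray t : 1 <= t * enorm y -> 0 <= t -> lam br (vscale t y) = / (t * enorm y).
Proof. by move=> H Ht; rewrite /lam (br_eq Hbr) enorm_scale. Qed.

Lemma symbol_expansion i j : exp_rel (fun z => p z i j) (fun k z => h k z i j) 0.
Proof.
move=> ds M; have ep := ey_pos; have [Hp [Hh Hrem]] := Hcl.
have [chi [Hchi chi1]] := zero_excision_exists (n + n).
have [SD ED] := Hrem M chi Hchi i j; have [K HK] := ED ds.
pose U (z : Pt (n + n)) := 2 < enorm z.
have HU : opn U := @opn_outside _ 2.
have SU F : smooth_on (@nonzero _) F -> smooth_on U F.
  by apply: smooth_sub => z Hz; rewrite /U in Hz; rewrite /nonzero; lra.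
have SUt F : smooth F -> smooth_on U F by apply: smooth_sub.
set s := size ds.
(* From this [t] on, [t |y| >= 3]: beyond radius 2, where the excision function is 1, and beyond
   radius 1, where [br] is the norm. *)
apply: (@asy_intro M _ (fun k => dpar ds (h k ^~ i ^~ j) y) (Rabs K * (/ enorm y) ^ (M + s)) (3 / enorm y)) => t Ht.
have te : 3 <= t * enorm y.
  have -> : 3 = (3 / enorm y) * enorm y by field; lra.
  by apply: Rmult_le_compat_r; lra.
have tp : 0 < t by nra.
have Uty : U (vscale t y) by rewrite /U enorm_scale; lra.
have Hk (k : nat) : smooth_on (@nonzero _) (fun z => h k z i j) := proj1 (Hh k) i j.
have Hd : dpar ds (fun z => Cminus (p z i j) (\big[Cplus/RtoC 0]_(k < M) Cmult (RtoC (chi z)) (h k z i j))) (vscale t y) =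
   Cplus (dpar ds (fun z => p z i j) (vscale t y)) (Cmult (RtoC (-1)) (sumC (fun k : 'I_M => dpar ds (fun z => h k z i j) (vscale t y)))).
  rewrite (@dpar_extU _ U ds _ (fun z => Cplus (p z i j) (Cmult (RtoC (-1)) (sumC (fun k : 'I_M => h k z i j)))) _ HU Uty).
    have SS : smooth_on U (fun z => sumC (fun k : 'I_M => h k z i j)) := smooth_sum (F := fun (k : 'I_M) z => h k z i j) HU (fun k : 'I_M => SU _ (Hk k)).
    rewrite (dpar_plus ds HU (SUt _ (proj1 (Hp i j))) (smooth_scal (RtoC (-1)) HU SS) Uty).
    by rewrite (dpar_scal ds (RtoC (-1)) HU SS Uty) (dpar_sumC HU ds (F := fun (k : 'I_M) z => h k z i j) (fun k : 'I_M => SU _ (Hk k)) Uty).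
  move=> z Hz; rewrite -[\big[_/_]_(k < M) _]/(sumC (fun k : 'I_M => Cmult (RtoC (chi z)) (h k z i j))).
  rewrite sumC_scal chi1 //; ring.
have := HK (vscale t y); rewrite Hd -/s.
have -> : powerRZ (br (vscale t y)) (0 - Z.of_nat M - Z.of_nat s) = lam br (vscale t y) ^ (M + s) by rewrite -(@powerRZ_lam _ br) //; exact: br_pos.
rewrite lam_ray; [|lra|lra].
have Hhk (k : 'I_M) : dpar ds (fun z => h k z i j) (vscale t y) = Cmult (RtoC ((/ t) ^ s)) (Cmult (RtoC ((/ t) ^ k)) (dpar ds (fun z => h k z i j) y)).
  have hom : homog1 (0 - Z.of_nat k)%Z (fun z => h k z i j) by move=> t' z Ht' Hz; exact: (proj2 (Hh k)).
  rewrite (homog1_dpar ds (Hk k) hom tp Hy) Cmult_assoc -RtoC_mult -pow_add; congr (Cmult (RtoC _) _).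
  have -> : (0 - Z.of_nat k - Z.of_nat (size ds))%Z = (- Z.of_nat (s + k))%Z by rewrite -/s -plusE Nat2Z.inj_add; ring.
  by rewrite powerRZ_neg' -pow_powerRZ pow_inv.
rewrite (sumC_ext Hhk) sumC_scal.
set P := dpar ds _ (vscale t y); set S := sumC _ => H.
have ts : t ^ s * (/ t) ^ s = 1 by rewrite -Rpow_mult_distr Rinv_r ?pow1 //; lra.
have -> : Cminus (Cmult (RtoC (t ^ (0 + s))) P) S = Cmult (RtoC (t ^ s)) (Cplus P (Cmult (RtoC (-1)) (Cmult (RtoC ((/ t) ^ s)) S))).
  have -> : S = Cmult (RtoC (t ^ s * (/ t) ^ s)) S by rewrite ts; ring.
  rewrite add0n RtoC_mult.
  have -> : Cmult (RtoC ((/ t) ^ s)) (Cmult (Cmult (RtoC (t ^ s)) (RtoC ((/ t) ^ s))) S) = Cmult (RtoC ((/ t) ^ s)) S by rewrite -RtoC_mult ts; ring.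
  ring.
have tsp : 0 < t ^ s by apply: pow_lt.
rewrite Cmod_mult Cmod_R Rabs_pos_eq; last lra.
apply: Rle_trans (Rmult_le_compat_l _ _ _ (Rlt_le _ _ tsp) H) _.
have ip : 0 <= (/ (t * enorm y)) ^ (M + s) by apply: pow_le; apply/Rlt_le/Rinv_0_lt_compat; lra.
apply: Rle_trans (_ : t ^ s * (Rabs K * (/ (t * enorm y)) ^ (M + s)) <= _).
  by apply: Rmult_le_compat_l; [lra | apply: Rmult_le_compat_r => //; exact: Rle_abs].
right; rewrite Rinv_mult Rpow_mult_distr (pow_add (/ t)).
have -> : t ^ s * (Rabs K * ((/ t) ^ M * (/ t) ^ s * (/ enorm y) ^ (M + s))) = (t ^ s * (/ t) ^ s) * (Rabs K * ((/ t) ^ M * (/ enorm y) ^ (M + s))) by ring.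
by rewrite ts; ring.
Qed.

Lemma exp_rel_partial a al s i : exp_rel a al s -> exp_rel (partial i a) (fun k => partial i (al k)) s.+1.
Proof.
move=> H ds M; have := H (rcons ds i) M; rewrite size_rcons addSnnS dpar_rcons.
by congr asy; apply: functional_extensionality => k; rewrite dpar_rcons.
Qed.

(** Order [m] puts [m] derivatives on each factor, which accounts for the weight [m.*2]. *)
Lemma Wd_expansion m a b al be s s' M : exp_rel a al s -> exp_rel b be s' ->
  asy M (fun t => Cmult (RtoC (t ^ (s + s' + m.*2))) (Wd m a b (vscale t y)))
    (fun k => \big[Cplus/RtoC 0]_(i < k.+1) Wd m (al i) (be (k - i)%N) y).
Proof.
elim: m a b al be s s' => [|m IH] a b al be s s' Ha Hb.
  have := asy_mult (Ha [::] M) (Hb [::] M); apply: asy_ext => t.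
  by rewrite /= !addn0 pow_add RtoC_mult; ring.
have H j := IH _ _ _ _ _ _ (exp_rel_partial (rshift n j) Ha) (exp_rel_partial (lshift n j) Hb).
have := asy_sum H => {H} H.
have -> : (fun k => \big[Cplus/RtoC 0]_(i < k.+1) Wd m.+1 (al i) (be (k - i)%N) y) =
  fun k => sumC (fun j => \big[Cplus/RtoC 0]_(i < k.+1) Wd m (partial (rshift n j) (al i)) (partial (lshift n j) (be (k - i)%N)) y).
  by apply: functional_extensionality => k; rewrite /= /sumC exchange_big.
apply: asy_ext H => t; rewrite -sumC_scal; apply: sumC_ext => j.
by congr (Cmult (RtoC (pow t _)) _); rewrite doubleS !addSn !addnS.
Qed.

(** The coefficient of [t^(-K)] in [star_estimate] along the ray through [y], isolated by
    [asy_unique]. Order [m] contributes only from [t^(-2m)] on, so bidifferential orders up to [K]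
    with an error [O(t^(-K-1))] determine it. *)
Lemma star_idempotent_coef (Hidem : forall u : Pt n -> 'I_q -> C, schwartz u ->
     forall (x : Pt n) (i : 'I_q), op p (op p u) x i = op p u x i) K i k :
  h K y i k = sumC (fun l => sumC (fun m : 'I_K.+1 => Cmult (Cmult (RtoC (/ INR (fact m))) (mi m))
    (if (K < m.*2)%N then RtoC 0 else
      \big[Cplus/RtoC 0]_(j < (K - m.*2).+1) Wd m (fun z => h j z i l) (fun z => h (K - m.*2 - j)%N z l k) y))).
Proof.
have ep := ey_pos.
have [C0 HC0] := star_estimate Hbr (proj1 Hcl) Hidem K i k.
pose E t := Cplus (sumC (fun l => sumC (fun m : 'I_K.+1 => Cmult (Cmult (RtoC (/ INR (fact m))) (mi m))
     (Wd m (fun y => p y i l) (fun y => p y l k) (vscale t y))))) (Cmult (RtoC (-1)) (p (vscale t y) i k)).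
have Hp := symbol_expansion i k [::] K.+1.
have HW l (m : 'I_K.+1) := asy_div (Wd_expansion m K.+1 (symbol_expansion i l) (symbol_expansion l k)).
have H1 := asy_sum (fun l => asy_sum (fun m : 'I_K.+1 => asy_scal (Cmult (RtoC (/ INR (fact m))) (mi m)) (HW l m))).
have H2 := asy_plus H1 (asy_scal (RtoC (-1)) Hp).
have HE := asy_unique (K := Rabs C0 * (/ enorm y) ^ K.+1) (T := 1 / enorm y) H2.
have {}HE := HE _ K (ltnSn K); rewrite /= in HE.
set L := h K y i k in HE *.
set R := sumC _.
suff X : Cplus R (Cmult (RtoC (-1)) L) = RtoC 0.
  have -> : L = Cminus R (Cplus R (Cmult (RtoC (-1)) L)) by ring.
  by rewrite X; ring.
rewrite -HE // => t Ht.
have te : 1 <= t * enorm y.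
  have -> : 1 = (1 / enorm y) * enorm y by field; lra.
  by apply: Rmult_le_compat_r; lra.
have tp : 0 < t by nra.
have := HC0 (vscale t y); rewrite lam_ray; [|lra|lra]; rewrite Rinv_mult Rpow_mult_distr => H.
apply: Rle_trans (_ : C0 * ((/ t) ^ K.+1 * (/ enorm y) ^ K.+1) <= _).
  apply: Rle_trans H; right; congr Cmod; rewrite /=; ring.
have -> : Rabs C0 * (/ enorm y) ^ K.+1 * (/ t) ^ K.+1 = Rabs C0 * ((/ t) ^ K.+1 * (/ enorm y) ^ K.+1) by ring.
apply: Rmult_le_compat_r; last exact: Rle_abs.
by apply: Rmult_le_pos; apply: pow_le; apply/Rlt_le/Rinv_0_lt_compat; lra.
Qed.

End Expansion.

(** * Spherical integrals of divergences *)

Section Euler.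
Variable N : nat.
Implicit Types (F : Pt N -> C) (y v : Pt N).

Lemma is_Cderiv_unique g t a b : is_Cderiv g t a -> is_Cderiv g t b -> a = b.
Proof. by move=> /Cderiv_unique <- /Cderiv_unique <-. Qed.

(** The partial derivatives of [F] minus its linearization are small near [y] by continuity, and
    [path_bound] turns this into a first-order estimate along the line. *)
Lemma dir_deriv U F y v : opn U -> smooth_on U F -> U y ->
  is_Cderiv (fun s => F (vadd y (vscale s v))) 0 (sumC (fun a => Cmult (RtoC (v a)) (partial a F y))).
Proof.
move=> HU SF Uy; set L := sumC _.
have y0 : vadd y (vscale 0 v) = y by apply: functional_extensionality => j; rewrite /vadd /vscale; ring.
have key e : 0 < e -> exists d, 0 < d /\ forall s, Rabs s < d ->
   Cmod (Cminus (Cminus (F (vadd y (vscale s v))) (F y)) (Cmult (RtoC s) L)) <= e * Rabs s.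
  move=> He; have [d1 [Hd1 HU1]] := HU _ Uy.
  pose V := sumR (fun a => Rabs (v a)); have V0 : 0 <= V by apply: sumR_ge0 => a; exact: Rabs_pos.
  pose e1 := e / (2 * (V + 1)); have He1 : 0 < e1 by apply: Rdiv_lt_0_compat; lra.
  have H a : exists d, 0 < d /\ forall z, near d y z -> Cmod (Cminus (partial a F z) (partial a F y)) < e1.
    by have /cont_at_near /(_ _ He1) := proj1 (SF [:: a]) y Uy.
  have [d Hd] := fin_all_exists H.
  pose d0 := \big[Rmin/d1]_(a < N) d a.
  have Hd0 : 0 < d0 by apply: (big_ind (fun x => 0 < x)) => //; [exact: Rmin_pos | move=> a _; case: (Hd a)].
  have d0a a : d0 <= d a.
    rewrite /d0; have : a \in index_enum 'I_N by rewrite mem_index_enum.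
    elim: (index_enum _) => [//|k r IH]; rewrite big_cons in_cons => /orP [/eqP <-|/IH IH']; first exact: Rmin_l.
    exact: Rle_trans (Rmin_r _ _) IH'.
  have d01 : d0 <= d1.
    rewrite /d0; elim: (index_enum _) => [|k r IH]; first by rewrite big_nil; lra.
    by rewrite big_cons; apply: Rle_trans (Rmin_r _ _) IH.
  exists (d0 / (V + 1)); split; first by apply: Rdiv_lt_0_compat; lra.
  move=> s Hs; set z := vadd y (vscale s v).
  have Hz w : (forall j, Rmin (y j) (z j) <= w j <= Rmax (y j) (z j)) -> near d0 y w.
    move=> Hw j; apply: Rle_lt_trans (_ : Rabs (s * v j) < d0).
      have := Hw j; rewrite /z /vadd /vscale /Rmin /Rmax /Rabs; case: Rle_dec => ?; do 2 case: Rcase_abs => ?; lra.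
    rewrite Rabs_mult; have : Rabs (v j) <= V by apply: (@sumR_ge1 _ (fun a => Rabs (v a))) => i; exact: Rabs_pos.
    move=> vV; apply: Rle_lt_trans (_ : Rabs s * (V + 1) < d0).
      by apply: Rmult_le_compat_l; [exact: Rabs_pos | lra].
    have -> : d0 = d0 / (V + 1) * (V + 1) by field; lra.
    by apply: Rmult_lt_compat_r; lra.
  pose G (w : Pt N) := Cplus (F w) (Cmult (RtoC (-1)) (sumC (fun a => Cmult (partial a F y) (RtoC (w a))))).
  have := @path_bound N G (fun a w => Cminus (partial a F w) (partial a F y)) y z (fun _ => e1).
  have -> : Cminus (G z) (G y) = Cminus (Cminus (F z) (F y)) (Cmult (RtoC s) L).
    rewrite /G /L -(sumC_scal (RtoC s)).
    have -> : sumC (fun a => Cmult (partial a F y) (RtoC (z a))) = Cplus (sumC (fun a => Cmult (partial a F y) (RtoC (y a)))) (sumC (fun a => Cmult (RtoC s) (Cmult (RtoC (v a)) (partial a F y)))).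
      by rewrite -sumC_plus; apply: sumC_ext => a; rewrite /z /vadd /vscale RtoC_plus RtoC_mult; ring.
    ring.
  move=> X; apply: Rle_trans (X _) _.
    move=> a w /Hz Hw; split; last by apply/Rlt_le; apply: (proj2 (Hd a)) => j; apply: Rlt_le_trans (Hw j) (d0a a).
    have Uw : U w by apply: HU1 => j; apply: Rlt_le_trans (Hw j) d01.
    have := is_partial_plus (smooth_is_partial a SF Uw) (is_partial_scal (RtoC (-1)) (@is_partial_sum N a N (fun b z => Cmult (partial b F y) (RtoC (z b))) w (fun b => Cmult (partial b F y) (RtoC (if b == a then 1 else 0))) _)).
    move=> X1; have {}X1 := X1 (fun b => is_partial_scal (partial b F y) (is_partial_coord a b w)); move: X1; congr is_partial.
    rewrite (sumC_ext (g := fun b => Cmult (RtoC (if b == a then 1 else 0)) (partial b F y))) => [|b]; last by ring.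
    by rewrite sumC_delta; ring.
  rewrite (sumR_ext (g := fun a => (2 * e1 * Rabs s) * Rabs (v a))) => [|a].
    rewrite sumR_scal -/V; apply: Rle_trans (_ : 2 * e1 * Rabs s * (V + 1) <= _).
      apply: Rmult_le_compat_l; last lra.
      by apply: Rmult_le_pos; [lra | exact: Rabs_pos].
    by right; rewrite /e1; field; lra.
  have -> : z a - y a = s * v a by rewrite /z /vadd /vscale; ring.
  by rewrite Rabs_mult; ring.
have core (c : C -> R) (c1 : forall z, Rabs (c z) <= Cmod z) (c2 : forall a b, c (Cminus a b) = c a - c b) (c3 : forall r a, c (Cmult (RtoC r) a) = r * c a) :
    is_derive (fun s => c (F (vadd y (vscale s v)))) 0 (c L).
  apply/is_derive_Reals => e He; have [d [Hd H]] := key (e / 2) ltac:(lra).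
  exists (mkposreal d Hd) => h Hh0 /= Hh; rewrite Rplus_0_l y0.
  have hp : 0 < Rabs h by apply: Rabs_pos_lt.
  have := Rle_trans _ _ _ (c1 _) (H h Hh); rewrite !c2 c3 => B.
  have -> : (c (F (vadd y (vscale h v))) - c (F y)) / h - c L = (c (F (vadd y (vscale h v))) - c (F y) - h * c L) / h by field.
  rewrite Rabs_div //; apply: (Rmult_lt_reg_r (Rabs h)) => //.
  have -> : Rabs (c (F (vadd y (vscale h v))) - c (F y) - h * c L) / Rabs h * Rabs h = Rabs (c (F (vadd y (vscale h v))) - c (F y) - h * c L) by field; lra.
  apply: Rle_lt_trans B _; nra.
split.
  by apply: (core fst) => [|//|r a]; [exact: Cmod_fst | rewrite /=; ring].
by apply: (core snd) => [|//|r a]; [exact: Cmod_snd | rewrite /=; ring].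
Qed.

Lemma is_derive_powerRZ_1 d : is_derive (fun s => powerRZ (1 + s) d) 0 (IZR d).
Proof.
case: d => [|k|k] /=.
- exact: is_derive_const.
- auto_derive => //; rewrite Rplus_0_r pow1 Rmult_1_r Rmult_1_l INR_IPR //.
- auto_derive; first by rewrite Rplus_0_r pow1; lra.
  rewrite Rplus_0_r !pow1 !Rmult_1_r INR_IPR; change (- (1 * IPR k) * / 1 = - IPR k); field.
Qed.

(** Both sides are the derivative of [F ((1 + s) y)] at [s = 0], once by the chain rule and once by
    homogeneity. *)
Lemma euler d F y : smooth_on (@nonzero N) F -> homog1 d F -> nonzero y ->
  sumC (fun a => Cmult (RtoC (y a)) (partial a F y)) = Cmult (RtoC (IZR d)) (F y).
Proof.
move=> SF HF Hy.
apply: (is_Cderiv_unique (dir_deriv y (@opn_nonzero N) SF Hy)).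
apply: (@is_Cderiv_ext_loc (fun s => Cmult (RtoC (powerRZ (1 + s) d)) (F y)) _ _ _ 1); first lra.
  move=> s; rewrite Rminus_0_r => /Rabs_def2 Hs; rewrite -HF //; last lra.
  by congr F; apply: functional_extensionality => j; rewrite /vadd /vscale; ring.
have := is_Cderiv_mult (is_Cderiv_RtoC (is_derive_powerRZ_1 d)) (is_Cderiv_const (F y) 0).
by congr is_Cderiv; ring.
Qed.

End Euler.

Section CompactSupport.
Variable N : nat.

Lemma compact_tame (F : Pt N -> C) R0 : 0 <= R0 -> smooth F -> (forall y, R0 < enorm y -> F y = RtoC 0) -> tame F.
Proof.
move=> HR SF HF; apply: (cls_tame (F := fun _ : unit => F) tt); split=> // ds.
have Z y : R0 < enorm y -> dpar ds F y = RtoC 0.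
  move=> Hy; rewrite (dpar_extU (G := fun _ => Cmult (RtoC 0) (RtoC 0)) ds (@opn_outside N R0) Hy) => [|z Hz]; last by rewrite HF //; ring.
  by rewrite (dpar_scal ds (RtoC 0) (@opn_true N) (smooth_const _ (@opn_true N)) I) Cmult_0_l.
have [K [HK H]] : exists K, 0 <= K /\ forall y, (forall j, Rabs (y j) <= R0) -> Cmod (dpar ds F y) <= K.
  apply: cube_bounded => // y _; exact: (smooth_lbd (U := fun _ => True) (smooth_dpar ds SF)).
exists (K * (1 + R0 ^ 2) ^ N) => _ y.
case: (Rlt_le_dec R0 (enorm y)) => Hy.
  by rewrite Z // Cmod_0 Rmult_0_l; apply: Rmult_le_pos => //; apply: pow_le; have := pow2_ge_0 R0; lra.
apply: Rmult_le_compat; [exact: Cmod_ge_0 | have := W_ge1 y; lra | |].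
  by apply: H => j; have := coord_le_enorm y j; lra.
have -> : (1 + R0 ^ 2) ^ N = \big[Rmult/1]_(j < N) (1 + R0 ^ 2).
  by rewrite big_const card_ord; elim: (N) => //= k <-.
have [] : 0 <= W y /\ W y <= \big[Rmult/1]_(j < N) (1 + R0 ^ 2) => //.
apply: (big_ind2 (fun a b => 0 <= a /\ a <= b)); first lra.
  by move=> a b c d [? ?] [? ?]; split; [exact: Rmult_le_pos | exact: Rmult_le_compat].
move=> j _; split; first by have := pow2_ge_0 (y j); lra.
apply: Rplus_le_compat_l; rewrite -pow2_abs; apply: pow_incr; split; first exact: Rabs_pos.
by have := coord_le_enorm y j; lra.
Qed.

End CompactSupport.

(** * Iterated integrals of functions with jumps *)

Section SliceApproximation.

Definition cubic N (F : Pt N -> C) := forall y, (exists j, 1 < Rabs (y j)) -> F y = RtoC 0.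

Lemma gen_lim_supp f : (forall t, 1 < Rabs t -> f t = RtoC 0) -> (forall a b, ex_RIC f a b) ->
  gen_lim f (RIC f (-1) 1).
Proof.
move=> H0 Hex e He; exists 1 => a b Ha Hb; exists (RIC f (-1) 1); split; last first.
  by rewrite /Cminus Cplus_opp_r Cmod_0.
have Z u v : u <= v -> (forall t, u < t < v -> 1 < Rabs t) -> is_RIC f u v (RtoC 0).
  move=> Huv Ht; have C0 := @is_RInt_const C_R_NormedModule u v (RtoC 0).
  have E : scal (v - u) (RtoC 0 : C_R_NormedModule) = RtoC 0 by exact: (@scal_zero_r _ C_R_NormedModule).
  rewrite E in C0; apply: is_RInt_ext C0 => t; rewrite Rmin_left ?Rmax_right // => /Ht /H0 -> //.
have A := Z a (-1) ltac:(lra) ltac:(move=> t Ht; rewrite Rabs_left; lra).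
have B := Z 1 b ltac:(lra) ltac:(move=> t Ht; rewrite Rabs_pos_eq; lra).
have M : is_RIC f (-1) 1 (RIC f (-1) 1) by apply: (@RInt_correct C_R_CompleteNormedModule).
have := @is_RInt_Chasles C_R_NormedModule f a 1 b _ _ (@is_RInt_Chasles C_R_NormedModule f a (-1) 1 _ _ A M) B.
have E : @plus C_R_NormedModule (@plus C_R_NormedModule (RtoC 0) (RIC f (-1) 1)) (RtoC 0) = RIC f (-1) 1.
  exact: (eq_trans (@plus_zero_r C_R_NormedModule _) (@plus_zero_l C_R_NormedModule _)).
by rewrite E.
Qed.

Lemma Ig_supp f : (forall t, 1 < Rabs t -> f t = RtoC 0) -> (forall a b, ex_RIC f a b) -> Ig f = RIC f (-1) 1.
Proof. by move=> H0 Hex; apply: gen_lim_Ig; apply: gen_lim_supp. Qed.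

Lemma RIC_le f K : 0 <= K -> (forall t, Cmod (f t) <= K) -> ex_RIC f (-1) 1 -> Cmod (RIC f (-1) 1) <= 2 * K.
Proof.
move=> HK Hf Hex; have M : is_RIC f (-1) 1 (RIC f (-1) 1) by apply: (@RInt_correct C_R_CompleteNormedModule).
have G : is_RInt (fun _ => K) (-1) 1 (2 * K).
  have := @is_RInt_const R_NormedModule (-1) 1 K.
  by have -> : scal (1 - -1) K = 2 * K by rewrite /scal /= /mult /=; ring.
rewrite -normC; apply: (@norm_RInt_le C_R_NormedModule f (fun _ => K) (-1) 1 _ _ _ _ M G); first lra.
by move=> t _; rewrite (normC (f t)).
Qed.

Lemma RIC_minus f g a b : ex_RIC f a b -> ex_RIC g a b ->
  ex_RIC (fun t => Cminus (f t) (g t)) a b /\ RIC (fun t => Cminus (f t) (g t)) a b = Cminus (RIC f a b) (RIC g a b).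
Proof.
move=> Hf Hg; split; first exact: (@ex_RInt_minus C_R_NormedModule).
exact: (@RInt_minus C_R_CompleteNormedModule f g a b Hf Hg).
Qed.

Lemma cubic_slice k (F : Pt k.+1 -> C) t : cubic F -> cubic (fun y : Pt k => F (ext y t)).
Proof. by move=> H y [j Hj]; apply: H; exists (lift ord_max j); rewrite ext_lift. Qed.

Lemma intRN_zero N : intRN (fun _ : Pt N => RtoC 0) = RtoC 0.
Proof.
elim: N => [//|N IH] /=.
have -> : (fun t : R => intRN (fun _ : Pt N => RtoC 0)) = fun _ => RtoC 0 by apply: functional_extensionality.
apply: gen_lim_Ig => e He; exists 0 => a b _ _; exists (RtoC 0); split.
  have := @is_RInt_const C_R_NormedModule a b (RtoC 0).
  by have -> : scal (b - a) (RtoC 0 : C_R_NormedModule) = RtoC 0 by exact: (@scal_zero_r _ C_R_NormedModule).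
by rewrite /Cminus Cplus_opp_r Cmod_0.
Qed.

(** Only integrals along coordinate 0, the innermost variable of [intRN], are compared. A function
    with jumps is not a uniform limit of smooth ones, but its integrals in one variable can be
    approximated uniformly in the others. *)
Definition apx k (F G : Pt k.+1 -> C) e := forall y,
  Cmod (RIC (fun t => Cminus (F (upd y ord0 t)) (G (upd y ord0 t))) (-1) 1) <= e.

Definition sliceable k (F : Pt k.+1 -> C) := cubic F /\ (forall y a b, ex_RIC (fun t => F (upd y ord0 t)) a b) /\
  forall e, 0 < e -> exists G, tame G /\ cubic G /\ apx F G e.

Lemma slice_apx k (F G : Pt k.+2 -> C) e t : apx F G e -> apx (fun y : Pt k.+1 => F (ext y t)) (fun y => G (ext y t)) e.
Proof.
move=> H y; have := H (ext y t).
have E s : upd (ext y t) ord0 s = ext (upd y ord0 s) t.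
  by rewrite upd_ext; congr (upd _ _ s); apply: val_inj.
have -> : (fun t0 => Cminus (F (upd (ext y t) ord0 t0)) (G (upd (ext y t) ord0 t0))) = fun t0 => Cminus (F (ext (upd y ord0 t0) t)) (G (ext (upd y ord0 t0) t)).
  by apply: functional_extensionality => s; rewrite E.
by [].
Qed.

(* Only the innermost integral of a sliceable function sees its discontinuities; the others integrate uniform limits of continuous functions. *)
Lemma sliceable_int k (F : Pt k.+1 -> C) : sliceable F -> 
  (forall a b, ex_RIC (fun t => intRN (fun y : Pt k => F (ext y t))) a b) /\
  forall G e, 0 < e -> tame G -> cubic G -> apx F G e -> Cmod (Cminus (intRN F) (intRN G)) <= 2 ^ k * e.
Proof.
elim: k F => [|k IH] F [Fc [Fs Fa]].
  have E0 t : ext (fun _ : 'I_0 => 0) t = upd (fun _ : 'I_1 => 0) ord0 t.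
    apply: functional_extensionality => j; rewrite /ext /upd !ord1 eqxx.
    by have -> : ord0 = ord_max :> 'I_1 by [apply: val_inj]; rewrite unlift_none.
  have ex1 a b : ex_RIC (fun t => intRN (fun y : Pt 0 => F (ext y t))) a b.
    rewrite /=; have := Fs (fun _ => 0) a b; congr ex_RInt; apply: functional_extensionality => t.
    by rewrite -E0; congr F.
  split=> // G e He HG Gc Ha.
  have exG a b := (proj1 (proj2 (tame_intble HG))) a b.
  have S1 (H : Pt 1 -> C) : cubic H -> forall t, 1 < Rabs t -> intRN (fun y : Pt 0 => H (ext y t)) = RtoC 0.
    by move=> Hc t Ht /=; apply: Hc; exists ord_max; rewrite ext_max.
  rewrite -[intRN F]/(Ig (fun t => intRN (fun y : Pt 0 => F (ext y t)))) -[intRN G]/(Ig (fun t => intRN (fun y : Pt 0 => G (ext y t)))).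
  rewrite (Ig_supp (S1 _ Fc) ex1) (Ig_supp (S1 _ Gc) exG) -(proj2 (RIC_minus (ex1 _ _) (exG _ _))).
  rewrite pow_O Rmult_1_l; have := Ha (fun _ => 0); congr (Cmod (RIC _ _ _) <= _).
  by apply: functional_extensionality => t; rewrite -E0.
have E s y t : upd (ext y t) ord0 s = ext (upd y ord0 s) t :> Pt k.+2.
  by rewrite upd_ext; congr (upd _ _ s); apply: val_inj.
have Sl t : sliceable (fun y : Pt k.+1 => F (ext y t)).
  split; first exact: cubic_slice.
  split=> [y a b|e He].
    by have := Fs (ext y t) a b; congr ex_RInt; apply: functional_extensionality => s; rewrite E.
  have [G [HG [Gc Ha]]] := Fa e He; exists (fun y => G (ext y t)); split; first exact: tame_slice.
  by split; [exact: cubic_slice | exact: slice_apx].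
pose JF t := intRN (fun y : Pt k.+1 => F (ext y t)).
have close G e t : 0 < e -> tame G -> cubic G -> apx F G e -> Cmod (Cminus (JF t) (intRN (fun y : Pt k.+1 => G (ext y t)))) <= 2 ^ k * e.
  move=> He HG Gc Ha; apply: (proj2 (IH _ (Sl t))) => //; [exact: tame_slice | exact: cubic_slice | exact: slice_apx].
have contJF t : @continuous R_UniformSpace C_UniformSpace JF t.
  move=> P [e HP]; have e4 : 0 < e / 4 / 2 ^ k by apply: Rdiv_lt_0_compat; [have := cond_pos e; lra | apply: pow_lt; lra].
  have [G [HG [Gc Ha]]] := Fa _ e4.
  have cG := is_Cderiv_continuous (tame_deriv_last (@tame_intble k.+1) HG t).
  have e8 : 0 < e / 8 by have := cond_pos e; lra.
  have [d Hd] := cG (fun z => @ball C_UniformSpace (intRN (fun y : Pt k.+1 => G (ext y t))) (mkposreal _ e8) z) (locally_ball _ _).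
  exists d => s Hs; apply: HP; apply: C_ball.
  have A := close _ _ t e4 HG Gc Ha; have B := close _ _ s e4 HG Gc Ha; have D := ball_C e8 (Hd s Hs).
  have ee : 2 ^ k * (e / 4 / 2 ^ k) = e / 4 by field; apply: pow_nonzero; lra.
  rewrite ee in A B.
  set u := intRN (fun y : Pt k.+1 => G (ext y t)) in A D; set v := intRN (fun y : Pt k.+1 => G (ext y s)) in B D.
  have -> : Cminus (JF s) (JF t) = Cplus (Cminus (JF s) v) (Cplus (Cminus v u) (Copp (Cminus (JF t) u))) by ring.
  have T1 := Cmod_triangle (Cminus (JF s) v) (Cplus (Cminus v u) (Copp (Cminus (JF t) u))).
  have T2 := Cmod_triangle (Cminus v u) (Copp (Cminus (JF t) u)); rewrite Cmod_opp in T2.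
  have := cond_pos e; lra.
have exF a b : ex_RIC JF a b by apply: RIC_ext_cont.
split=> // G e He HG Gc Ha.
have exG a b := (proj1 (proj2 (tame_intble HG))) a b.
have S1 (H : Pt k.+2 -> C) : cubic H -> forall t, 1 < Rabs t -> intRN (fun y : Pt k.+1 => H (ext y t)) = RtoC 0.
  move=> Hc t Ht; rewrite -(intRN_zero k.+1); apply: intRN_ext => y; apply: Hc; exists ord_max; by rewrite ext_max.
rewrite -[intRN F]/(Ig JF) -[intRN G]/(Ig (fun t => intRN (fun y : Pt k.+1 => G (ext y t)))).
rewrite (Ig_supp (S1 _ Fc) exF) (Ig_supp (S1 _ Gc) exG).
have [M1 M2] := RIC_minus (exF (-1) 1) (exG (-1) 1); rewrite -M2.
(* Every outer integration runs over an interval of length 2 and doubles the error. *)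
have -> : 2 ^ k.+1 * e = 2 * (2 ^ k * e) by rewrite /=; ring.
apply: RIC_le M1; first by apply: Rmult_le_pos; [apply: pow_le; lra | lra].
by move=> t; apply: close.
Qed.

End SliceApproximation.

Section Cutoff.
Variable d : R.
Hypothesis Hd : 0 < d.

(** To be evaluated at [s = |y|^2]: it removes a neighbourhood of the origin and everything beyond
    the unit sphere, and is 1 for [2 d <= s <= 1 - d]. *)
Definition rho (s : R) := step (s / d - 1) * step ((1 - s) / d).

Lemma rho_derive : exists r' : R -> R, forall s, is_derive rho s (r' s).
Proof.
have [g [_ Hg]] := stepK_derive step_K.
exists (fun s => g (s / d - 1) * / d * step ((1 - s) / d) + step (s / d - 1) * (g ((1 - s) / d) * (- / d))) => s.
apply: is_derive_mult_R.
  have := is_derive_comp step (fun s => s / d - 1) s _ (/ d) (Hg _); rewrite /scal /= /mult /= Rmult_comm; apply.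
  by auto_derive => //; field; lra.
have := is_derive_comp step (fun s => (1 - s) / d) s _ (- / d) (Hg _); rewrite /scal /= /mult /= Rmult_comm; apply.
by auto_derive => //; field; lra.
Qed.

Lemma rho_small s : s <= d -> rho s = 0.
Proof.
move=> H; rewrite /rho step_0 ?Rmult_0_l //.
have : s / d <= 1; last lra.
by apply: (Rmult_le_reg_r d) => //; have -> : s / d * d = s by [field; lra]; lra.
Qed.
Lemma rho_large s : 1 <= s -> rho s = 0.
Proof.
move=> H; rewrite /rho (step_0 (x := (1 - s) / d)) ?Rmult_0_r //.
by apply: (Rmult_le_reg_r d) => //; have -> : (1 - s) / d * d = 1 - s by [field; lra]; lra.
Qed.
Lemma rho_1 s : 2 * d <= s -> s <= 1 - d -> rho s = 1.
Proof.
move=> H1 H2; rewrite /rho !step_1 ?Rmult_1_l //.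
  by apply: (Rmult_le_reg_r d) => //; have -> : (1 - s) / d * d = 1 - s by [field; lra]; lra.
have : 2 <= s / d; last lra.
by apply: (Rmult_le_reg_r d) => //; have -> : s / d * d = s by [field; lra]; lra.
Qed.
Lemma rho_bounds s : 0 <= rho s <= 1.
Proof.
have A := step_bounds (s / d - 1); have B := step_bounds ((1 - s) / d); rewrite /rho; split; first by apply: Rmult_le_pos; lra.
by nra.
Qed.

End Cutoff.

Section Indicator.

Definition ind (a b t : R) : R := if Rle_dec a t then if Rle_dec t b then 1 else 0 else 0.

Lemma ind_in a b t : a <= t <= b -> ind a b t = 1.
Proof. by rewrite /ind => -[A B]; case: Rle_dec => //; case: Rle_dec. Qed.
Lemma ind_ge0 a b t : 0 <= ind a b t.
Proof. by rewrite /ind; case: (Rle_dec a t) => H1; [case: (Rle_dec t b) => H2|]; (exact: Rle_refl || exact: Rle_0_1). Qed.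

Lemma ind_int a b : -1 <= a -> a <= b -> b <= 1 -> is_RInt (ind a b) (-1) 1 (b - a).
Proof.
move=> H1 H2 H3.
have C0 u v : u <= v -> (forall t, u < t < v -> ind a b t = 0) -> is_RInt (ind a b) u v 0.
  move=> Huv E; have := @is_RInt_const R_NormedModule u v 0.
  have -> : scal (v - u) 0 = 0 by rewrite /scal /= /mult /=; ring.
  by apply: is_RInt_ext => t; rewrite Rmin_left ?Rmax_right // => /E ->.
have A := C0 (-1) a H1 ltac:(by move=> t Ht; rewrite /ind; case: Rle_dec => // ?; lra).
have B := C0 b 1 H3 ltac:(by move=> t Ht; rewrite /ind; case: Rle_dec => // ?; case: Rle_dec => // ?; lra).
have M : is_RInt (ind a b) a b (b - a).
  have := @is_RInt_const R_NormedModule a b 1.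
  have -> : scal (b - a) 1 = b - a by rewrite /scal /= /mult /=; ring.
  by apply: is_RInt_ext => t; rewrite Rmin_left ?Rmax_right // => Ht; rewrite ind_in; lra.
have := is_RInt_Chasles _ _ _ _ _ _ (is_RInt_Chasles _ _ _ _ _ _ A M) B.
by rewrite /plus /= Rplus_0_l Rplus_0_r.
Qed.

End Indicator.

Section Piecewise.

(** Made for lines meeting the unit ball: the integrand jumps at the two points of the sphere, and
    at 0 if the line passes through the origin. *)
Lemma ex_RIC_piecewise (f c1 c2 : R -> C) a : 0 <= a ->
  (forall t, -a < t < 0 -> f t = c1 t) -> (forall t, 0 < t < a -> f t = c2 t) -> (forall t, a < Rabs t -> f t = RtoC 0) ->
  (forall t, @continuous R_UniformSpace C_UniformSpace c1 t) -> (forall t, @continuous R_UniformSpace C_UniformSpace c2 t) ->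
  forall u v, ex_RIC f u v.
Proof.
move=> Ha E1 E2 E0 K1 K2 u v.
have piece (c : R -> C) x y : x <= y -> (forall t, @continuous R_UniformSpace C_UniformSpace c t) -> (forall t, x < t < y -> f t = c t) -> ex_RIC f x y.
  move=> Hxy Hc E; apply: (@ex_RInt_ext C_R_NormedModule c); last exact: RIC_ext_cont.
  by move=> t; rewrite Rmin_left ?Rmax_right // => /E ->.
have K0 : forall t, @continuous R_UniformSpace C_UniformSpace (fun _ => RtoC 0) t by move=> t; apply: continuous_const.
pose M := Rmax (Rabs u) (Rabs v) + a.
have Mu := Rmax_l (Rabs u) (Rabs v); have Mv := Rmax_r (Rabs u) (Rabs v).
have P1 : ex_RIC f (- M) (- a).
  apply: (piece (fun _ => RtoC 0)) => //; first by rewrite /M; have := Rabs_pos u; lra.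
  by move=> t Ht; apply: E0; rewrite Rabs_left1; lra.
have P2 : ex_RIC f (- a) 0 by apply: (piece c1) => //; lra.
have P3 : ex_RIC f 0 a by apply: (piece c2).
have P4 : ex_RIC f a M.
  apply: (piece (fun _ => RtoC 0)) => //; first by rewrite /M; have := Rabs_pos u; lra.
  by move=> t Ht; apply: E0; rewrite Rabs_pos_eq; lra.
have P : ex_RIC f (- M) M.
  apply: (@ex_RInt_Chasles C_R_NormedModule f _ a) P4; apply: (@ex_RInt_Chasles C_R_NormedModule f _ 0) P3.
  exact: (@ex_RInt_Chasles C_R_NormedModule f _ (- a)) P2.
have bd w : Rabs w <= Rmax (Rabs u) (Rabs v) -> - M <= w <= M.
  by move=> /Rabs_le_between; rewrite /M; lra.
have Q w : Rabs w <= Rmax (Rabs u) (Rabs v) -> ex_RIC f (- M) w.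
  by move=> /bd Hw; apply: (@ex_RInt_Chasles_1 C_R_CompleteNormedModule f (- M) w M Hw P).
apply: (@ex_RInt_Chasles C_R_NormedModule f u (- M)); last exact: Q.
by apply: (@ex_RInt_swap C_R_NormedModule); apply: Q.
Qed.

End Piecewise.

Section Sphere.
Variables (k m : nat).
(** Even dimension makes [|y|^N] the polynomial [S y ^ m.+1], so that no fractional power of [S] has
    to be differentiated. *)
Hypothesis Hkm : k.+1 = m.+1.*2.
Notation N := (k.+1).
Variables (f : 'I_N -> Pt N -> C) (g : Pt N -> C).
Hypothesis Sf : forall a, smooth_on (@nonzero N) (f a).
Hypothesis Hf : forall a, homog1 (- Z.of_nat k)%Z (f a).
Hypothesis Eg : forall y, nonzero y -> g y = sumC (fun a => partial a (f a) y).

Let S (y : Pt N) := sumR (fun j => y j ^ 2).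
Let nz := @opn_nonzero N.

Lemma S_ge0 y : 0 <= S y. Proof. by apply: sumR_ge0 => j; exact: pow2_ge_0. Qed.
Lemma S_enorm y : S y = enorm y ^ 2. Proof. by rewrite enorm_sq. Qed.
Lemma S_upd y i t : S (upd y i t) = S y + (t ^ 2 - y i ^ 2). Proof. exact: sumsq_upd. Qed.

Lemma S_comp_partial (r r' : R -> R) i y : (forall s, is_derive r s (r' s)) ->
  is_partial i (fun y => RtoC (r (S y))) y (RtoC (r' (S y) * (2 * y i))).
Proof.
move=> Hr; apply: is_Cderiv_RtoC.
apply: (is_derive_ext (fun t => r (S y + (t ^ 2 - y i ^ 2)))) => [t|]; first by rewrite S_upd.
have := is_derive_comp r (fun t => S y + (t ^ 2 - y i ^ 2)) (y i) (r' (S y)) (2 * y i).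
have -> : S y + (y i ^ 2 - y i ^ 2) = S y by ring.
rewrite (Rmult_comm (r' (S y))); apply; first exact: Hr.
by auto_derive => //; ring.
Qed.

Lemma S_pow_partial e i y : is_partial i (fun y => RtoC (S y ^ e)) y (RtoC (INR e * S y ^ e.-1 * (2 * y i))).
Proof.
apply: (@S_comp_partial (fun s => s ^ e) (fun s => INR e * s ^ e.-1)) => s.
by have := is_derive_pow (fun s => s) e s 1 (is_derive_id s); rewrite Rmult_1_r.
Qed.

Lemma S_pow_smooth e : smooth (fun y => RtoC (S y ^ e)).
Proof.
elim: e => [|e IH]; first exact: (smooth_const (RtoC 1) (@opn_true N)).
have := smooth_mult (@opn_true N) (@smooth_sumsq N) IH; apply: (smooth_ext (@opn_true N)) => y _.
by rewrite -RtoC_mult.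
Qed.

Let Q (y : Pt N) := sumC (fun b => Cmult (RtoC (y b)) (f b y)).

Lemma Q_smooth : smooth_on (@nonzero N) Q.
Proof. by apply: (smooth_sum nz) => b; apply: (smooth_mult nz) => //; apply: smooth_coord. Qed.

Lemma Q_homog : homog1 (1 - Z.of_nat k)%Z Q.
Proof.
move=> t y Ht Hy; rewrite /Q -sumC_scal; apply: sumC_ext => b; rewrite Hf // /vscale.
rewrite /Z.sub powerRZ_add; last lra.
by rewrite powerRZ_1 !RtoC_mult; ring.
Qed.

(* [V] is [|y|^(k+1)] times the component of [f] tangential to spheres; its divergence is [|y|^(k+1)] times that of [f]. *)
Let V a (y : Pt N) := Cplus (Cmult (RtoC (S y ^ m.+1)) (f a y)) (Cmult (RtoC (-1)) (Cmult (Cmult (RtoC (S y ^ m)) (Q y)) (RtoC (y a)))).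

Lemma V_smooth a : smooth_on (@nonzero N) (V a).
Proof.
have SS e : smooth_on (@nonzero N) (fun y => RtoC (S y ^ e)) by apply: (smooth_sub (V := fun _ => True)); last exact: S_pow_smooth.
apply: (smooth_plus nz); first exact: (smooth_mult nz (SS _) (Sf a)).
apply: (smooth_scal _ nz); apply: (smooth_mult nz (smooth_mult nz (SS _) Q_smooth)); exact: smooth_coord.
Qed.

Lemma V_tangential y : sumC (fun a => Cmult (RtoC (y a)) (V a y)) = RtoC 0.
Proof.
have -> : sumC (fun a => Cmult (RtoC (y a)) (V a y)) = sumC (fun a => Cplus (Cmult (RtoC (S y ^ m.+1)) (Cmult (RtoC (y a)) (f a y)))
    (Cmult (Cmult (RtoC (-1)) (Cmult (RtoC (S y ^ m)) (Q y))) (RtoC (y a ^ 2)))).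
  by apply: sumC_ext => a; rewrite /V /= Rmult_1_r !RtoC_mult; ring.
rewrite sumC_plus !sumC_scal -/(Q y).
have -> : sumC (fun a => RtoC (y a ^ 2)) = RtoC (S y).
  by rewrite /S /sumC /sumR; symmetry; apply: (big_morph RtoC RtoC_plus).
by rewrite -tech_pow_Rmult RtoC_mult; ring.
Qed.

(** By Euler's identity for [Q], of degree [1 - k = 2 - N], the radial field [S^m Q y] has
    divergence [(2m + (2 - N) + N) S^m Q]. This cancels the term [2 (m + 1) S^m Q] coming from the
    derivative of [S^(m+1)]. *)
Lemma V_div y : nonzero y -> sumC (fun a => partial a (V a) y) = Cmult (RtoC (S y ^ m.+1)) (g y).
Proof.
move=> Hy.
have D a : partial a (V a) y = Cplus (Cplus (Cmult (RtoC (2 * INR m.+1 * S y ^ m)) (Cmult (RtoC (y a)) (f a y))) (Cmult (RtoC (S y ^ m.+1)) (partial a (f a) y)))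
   (Cplus (Cmult (Cmult (RtoC (- (2 * INR m * S y ^ m.-1))) (Q y)) (RtoC (y a ^ 2)))
     (Cplus (Cmult (RtoC (- (S y ^ m))) (Cmult (RtoC (y a)) (partial a Q y))) (Cmult (RtoC (- (S y ^ m))) (Q y)))).
  apply: is_partial_unique.
  have H1 := is_partial_mult (S_pow_partial m.+1 a y) (smooth_is_partial a (Sf a) Hy).
  have H2 := is_partial_mult (is_partial_mult (S_pow_partial m a y) (smooth_is_partial a Q_smooth Hy)) (is_partial_coord a a y).
  have := is_partial_plus H1 (is_partial_scal (RtoC (-1)) H2); congr is_partial.
  have N1 : RtoC (-1) = Copp (RtoC 1) by rewrite -RtoC_opp.
  rewrite eqxx N1 -[m.+1.-1]/m -(tech_pow_Rmult (y a) 1) pow_1; move: (S y ^ m.+1) => s1; rewrite !RtoC_opp !RtoC_mult; ring.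
rewrite (sumC_ext D) !sumC_plus !sumC_scal -/(Q y) -Eg // (euler Q_smooth Q_homog Hy).
have -> : sumC (fun a => RtoC (y a ^ 2)) = RtoC (S y).
  by rewrite /S /sumC /sumR; symmetry; apply: (big_morph RtoC RtoC_plus).
have -> : sumC (fun _ : 'I_N => Q y) = Cmult (RtoC (INR N)) (Q y).
  rewrite /sumC big_const card_ord; elim: (N) => [|j IH]; first by rewrite /= Cmult_0_l.
  by rewrite iterS IH S_INR RtoC_plus; ring.
have EN : INR N = 2 * INR m.+1 by rewrite Hkm -mul2n mult_INR.
have Ek : IZR (1 - Z.of_nat k) = 2 - INR N by rewrite minus_IZR -INR_IZR_INZ S_INR; ring.
have Em : INR m * S y ^ m.-1 * S y = INR m * S y ^ m.
  by case: (m) => [|j]; [rewrite /=; ring | rewrite -[j.+1.-1]/j -tech_pow_Rmult; ring].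
have X : RtoC (- (2 * INR m * S y ^ m.-1) * S y) = RtoC (- (2 * (INR m * S y ^ m))) by rewrite -Em; f_equal; ring.
have -> : Cmult (Cmult (RtoC (- (2 * INR m * S y ^ m.-1))) (Q y)) (RtoC (S y)) = Cmult (RtoC (- (2 * INR m * S y ^ m.-1) * S y)) (Q y) by rewrite RtoC_mult; ring.
rewrite X Ek EN S_INR; move: (S y ^ m) (S y ^ m.+1) (INR m) => s s1 j.
by rewrite ?(RtoC_opp, RtoC_mult, RtoC_minus, RtoC_plus); ring.
Qed.

Section WithCutoff.
Variable d : R.
Hypothesis Hd : 0 < d.

Let Wc a (y : Pt N) := Cmult (RtoC (rho d (S y))) (V a y).

Lemma Wc_inner a y : enorm y ^ 2 < d -> Wc a y = RtoC 0.
Proof. by move=> H; rewrite /Wc rho_small ?Cmult_0_l // S_enorm; lra. Qed.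
Lemma Wc_outer a y : 1 < enorm y -> Wc a y = RtoC 0.
Proof. by move=> H; rewrite /Wc rho_large ?Cmult_0_l // S_enorm; nra. Qed.

Lemma opn_inside r : opn (fun y : Pt N => enorm y < r).
Proof.
move=> y Hy; have HN := pos_INR N.
have Hd' : 0 < (r - enorm y) / (INR N + 1) by apply: Rdiv_lt_0_compat; lra.
exists ((r - enorm y) / (INR N + 1)); split=> // z Hz.
have := enorm_near Hz.
have -> : INR N * ((r - enorm y) / (INR N + 1)) = (r - enorm y) - (r - enorm y) / (INR N + 1) by field; lra.
have := enorm_triangle y (vsub z y).
have -> : vadd y (vsub z y) = z by apply: functional_extensionality => j; rewrite /vadd /vsub; ring.
lra.
Qed.

Lemma Wc_smooth a : smooth (Wc a).
Proof.
have A : smooth_on (@nonzero N) (Wc a).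
  apply: (smooth_mult nz); last exact: V_smooth.
  apply: (smooth_sub (V := fun _ => True)) => //.
  have H1 := smooth_step (@smooth_affine_sumsq N (/ d) (-1)); have H2 := smooth_step (@smooth_affine_sumsq N (- / d) (/ d)).
  have := smooth_mult (@opn_true N) H1 H2; apply: (smooth_ext (@opn_true N)) => y _.
  by rewrite -RtoC_mult /rho -/(S y); do 3 f_equal; field; lra.
have sd : 0 < sqrt d by apply: sqrt_lt_R0.
have B : smooth_on (fun y => enorm y < sqrt d) (Wc a).
  apply: (smooth_ext (opn_inside (r := sqrt d)) _ (smooth_const (RtoC 0) (opn_inside (r := sqrt d)))) => y Hy.
  rewrite Wc_inner //; have := enorm_ge0 y; have := pow2_sqrt d (Rlt_le _ _ Hd); nra.
move=> ds; have [A1 A2] := A ds; have [B1 B2] := B ds.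
have nzd (y : Pt N) : nonzero y \/ enorm y < sqrt d.
  by case: (Req_dec (enorm y) 0) => E; [right; rewrite E | left].
by split=> [y _|i y _]; case: (nzd y) => H; auto.
Qed.

Lemma Wc_tame a : tame (Wc a).
Proof. by apply: (@compact_tame _ _ 1); [lra | exact: Wc_smooth | move=> y; exact: Wc_outer]. Qed.

Let Gd (y : Pt N) := sumC (fun a => partial a (Wc a) y).

Lemma Gd_tame_int : tame Gd /\ intRN Gd = RtoC 0.
Proof.
rewrite /Gd /sumC; elim: (index_enum _) => [|a r [T I0]].
  have -> : (fun y : Pt N => \big[Cplus/RtoC 0]_(a <- ([::] : seq 'I_N)) partial a (Wc a) y) = fun _ => RtoC 0.
    by apply: functional_extensionality => y; rewrite big_nil.
  split; last exact: intRN_zero.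
  by apply: (cls_tame tt (cls_zero (@lin_tame unit N))).
have -> : (fun y : Pt N => \big[Cplus/RtoC 0]_(a <- a :: r) partial a (Wc a) y) = fun y => Cplus (partial a (Wc a) y) (\big[Cplus/RtoC 0]_(a <- r) partial a (Wc a) y).
  by apply: functional_extensionality => y; rewrite big_cons.
have Ta := tame_partial a (Wc_tame a).
have tc H : tame H -> cls (@Btame unit N) (fun _ => H).
  move=> [SH BH]; split=> // ds; have [K [HK HK']] := BH ds; exists K => _ y; have w := W_ge1 y.
  by apply: Rle_trans (Rmult_le_compat_r _ _ _ _ (HK' y)) _; [lra | rewrite Rmult_assoc Rinv_l; lra].
split; first exact: (cls_tame tt (cls_plus lin_tame (tc _ Ta) (tc _ T))).
rewrite (proj2 (intRN_plus (tame_intble Ta) (tame_intble T))) I0 intRN_partial0; [by ring | exact: Wc_tame].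
Qed.

Lemma Gd_zero y : 1 < enorm y -> Gd y = RtoC 0.
Proof.
move=> Hy; rewrite /Gd (sumC_ext (g := fun _ => Cmult (RtoC 0) (RtoC 0))) => [|a]; first by rewrite sumC_scal Cmult_0_l.
rewrite (partial_extU (G := fun _ => RtoC 0) a (@opn_outside N 1) Hy) => [|z]; last exact: Wc_outer.
by rewrite (is_partial_unique (is_partial_const a (RtoC 0) y)); ring.
Qed.

Lemma Gd_origin y : ~ nonzero y -> Gd y = RtoC 0.
Proof.
move=> Hy; have E : enorm y = 0 by apply: NNPP.
have sd : 0 < sqrt d by apply: sqrt_lt_R0.
rewrite /Gd (sumC_ext (g := fun _ => Cmult (RtoC 0) (RtoC 0))) => [|a]; first by rewrite sumC_scal Cmult_0_l.
rewrite (partial_extU (U := fun y => enorm y < sqrt d) (G := fun _ => RtoC 0) a (opn_inside (r := sqrt d))) => [||z Hz].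
- by rewrite (is_partial_unique (is_partial_const a (RtoC 0) y)); ring.
- by rewrite E.
- rewrite Wc_inner //; have := enorm_ge0 z; have := pow2_sqrt d (Rlt_le _ _ Hd); nra.
Qed.

(** Differentiating the radial cutoff gives a multiple of the sum of [y_a V_a], which vanishes
    because [V] is tangential to spheres. *)
Lemma Gd_val y : nonzero y -> Gd y = Cmult (RtoC (rho d (S y))) (Cmult (RtoC (S y ^ m.+1)) (g y)).
Proof.
move=> Hy; have [r' Hr'] := rho_derive Hd.
rewrite -(V_div Hy) /Gd (sumC_ext (g := fun a => Cplus (Cmult (RtoC (r' (S y) * 2)) (Cmult (RtoC (y a)) (V a y))) (Cmult (RtoC (rho d (S y))) (partial a (V a) y)))) => [|a].
  by rewrite sumC_plus !sumC_scal V_tangential; ring.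
apply: is_partial_unique.
have := is_partial_mult (S_comp_partial a y Hr') (smooth_is_partial a (V_smooth a) Hy); congr is_partial.
by rewrite !RtoC_mult; ring.
Qed.

End WithCutoff.

(** The extension of degree 0 of [g] from the sphere, as in [sphere_int]. Since [g] has degree [-N],
    it equals [|y|^N g], which [V_div] presents as a divergence. *)
Let gt (y : Pt N) := g (vscale (/ enorm y) y).

Lemma gt_val y : nonzero y -> gt y = Cmult (RtoC (S y ^ m.+1)) (g y).
Proof.
move=> Hy; have ep : 0 < enorm y by have := enorm_ge0 y; have : enorm y <> 0 by [exact: Hy]; lra.
have ip : 0 < / enorm y by apply: Rinv_0_lt_compat.
rewrite /gt !Eg //; last exact: nonzero_scale.
rewrite -sumC_scal; apply: sumC_ext => a; rewrite (homog1_partial a (Sf a) (@Hf a) ip Hy); congr (Cmult (RtoC _) _).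
have -> : (- Z.of_nat k - 1)%Z = (- Z.of_nat k.+1)%Z by rewrite Nat2Z.inj_succ; ring.
rewrite powerRZ_neg' -pow_powerRZ pow_inv Rinv_inv S_enorm -pow_mult; congr (_ ^ _).
by rewrite Hkm -mul2n.
Qed.

Lemma gt_bounded : exists K, 0 <= K /\ forall y, Cmod (gt y) <= K.
Proof.
(* Setting the function to 0 off the sphere reduces compactness of the sphere to that of the cube;
   near the origin, where [g] is not controlled, it is then identically 0. *)
have [K [HK H]] : exists K, 0 <= K /\ forall y : Pt N, (forall j, Rabs (y j) <= 1) -> Cmod (if Req_EM_T (enorm y) 1 then g y else RtoC 0) <= K.
  apply: (@cube_bounded N (fun y => if Req_EM_T (enorm y) 1 then g y else RtoC 0)); first lra.
  move=> y _; case: (Req_dec (enorm y) 0) => E.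
    exists (1 / (INR N + 1)); have HN := pos_INR N; split; first by apply: Rdiv_lt_0_compat; lra.
    exists 0 => z Hz; case: Req_EM_T => E1; last by rewrite Cmod_0; lra.
    have := enorm_near Hz; have := enorm_triangle y (vsub z y).
    have -> : vadd y (vsub z y) = z by apply: functional_extensionality => j; rewrite /vadd /vsub; ring.
    have -> : INR N * (1 / (INR N + 1)) = 1 - 1 / (INR N + 1) by field; lra.
    have : 0 < 1 / (INR N + 1) by apply: Rdiv_lt_0_compat; lra.
    lra.
  have [d [Hd [M HM]]] : lbd g y.
    have SG : smooth_on (@nonzero N) g.
      apply: (smooth_ext nz (F := fun y => sumC (fun a => partial a (f a) y))); first by move=> z Hz; rewrite Eg.
      by apply: (smooth_sum nz) => a; apply: smooth_partial.
    exact: smooth_lbd SG E.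
  exists d; split=> //; exists (Rabs M) => z /HM Hz; case: (Req_EM_T (enorm z) 1) => Hz1; last by rewrite Cmod_0; exact: Rabs_pos.
  exact: Rle_trans Hz (Rle_abs M).
exists (K + Cmod (gt (fun _ => 0))); split; first by have := Cmod_ge_0 (gt (fun _ => 0)); lra.
move=> y; case: (Req_dec (enorm y) 0) => E.
  have -> : y = fun _ => 0; last lra.
  apply: functional_extensionality => j; have := coord_le_enorm y j; have := Rabs_pos (y j); rewrite E => ? ?.
  by apply: NNPP => /Rabs_no_R0; lra.
have ep : 0 < enorm y by have := enorm_ge0 y; lra.
have e1 : enorm (vscale (/ enorm y) y) = 1.
  by rewrite enorm_scale; [field; lra | apply/Rlt_le/Rinv_0_lt_compat].
have := H (vscale (/ enorm y) y) ltac:(by move=> j; have := coord_le_enorm (vscale (/ enorm y) y) j; rewrite e1).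
case: (Req_EM_T (enorm (vscale (/ enorm y) y)) 1) => [E1 /= X|//]; rewrite -/(gt y) in X.
by have := Cmod_ge_0 (gt (fun _ => 0)); lra.
Qed.

Let Fb (y : Pt N) := if Rle_dec (enorm y) 1 then gt y else RtoC 0.

Lemma Fb_cubic : cubic Fb.
Proof. by move=> y [j Hj]; rewrite /Fb; case: Rle_dec => // ?; have := coord_le_enorm y j; lra. Qed.

Lemma slice_S y t : S (upd y ord0 t) = t ^ 2 + S (upd y ord0 0).
Proof. by rewrite !S_upd; ring. Qed.

(** A line misses the ball, meets it away from the origin, or passes through the origin. In the last
    case [gt], having degree 0, is constant on each half-line. *)
Lemma Fb_slice y a b : ex_RIC (fun t => Fb (upd y ord0 t)) a b.
Proof.
set sg := S (upd y ord0 0); have sg0 : 0 <= sg := S_ge0 _.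
have eS t : enorm (upd y ord0 t) ^ 2 = t ^ 2 + sg by rewrite -S_enorm slice_S.
have e0 t := enorm_ge0 (upd y ord0 t).
case: (Rlt_le_dec 1 sg) => H1.
  have c0 t : @continuous R_UniformSpace C_UniformSpace (fun _ => RtoC 0) t by apply: continuous_const.
  have Z t : Fb (upd y ord0 t) = RtoC 0.
    by rewrite /Fb; case: Rle_dec => // H; exfalso; have := eS t; have := e0 t; have := pow2_ge_0 t; nra.
  exact: (@ex_RIC_piecewise _ (fun _ => RtoC 0) (fun _ => RtoC 0) 0 (Rle_refl 0)).
pose r := sqrt (1 - sg); have r0 : 0 <= r by exact: sqrt_pos.
have r2 : r ^ 2 = 1 - sg by rewrite /r pow2_sqrt; lra.
have inb t : Rabs t <= r -> enorm (upd y ord0 t) <= 1.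
  move=> Ht; have := eS t; have := e0 t; rewrite -(pow2_abs t); have := Rabs_pos t; nra.
have outb t : r < Rabs t -> Fb (upd y ord0 t) = RtoC 0.
  move=> Ht; rewrite /Fb; case: Rle_dec => // H; exfalso.
  have := eS t; have := e0 t; rewrite -(pow2_abs t); nra.
have inFb t : Rabs t <= r -> Fb (upd y ord0 t) = gt (upd y ord0 t) by move=> /inb H; rewrite /Fb; case: Rle_dec.
case: (Rlt_le_dec 0 sg) => H2.
  have nzs t : nonzero (upd y ord0 t) by move=> E; have := eS t; rewrite E; have := pow2_ge_0 t; lra.
  have cg t : @continuous R_UniformSpace C_UniformSpace (fun t => gt (upd y ord0 t)) t.
    have SG : smooth_on (@nonzero N) gt.
      apply: (smooth_ext nz (F := fun y => sumC (fun a => partial a (V a) y))); first by move=> z Hz; rewrite gt_val // V_div.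
      by apply: (smooth_sum nz) => a'; apply: smooth_partial; exact: V_smooth.
    have := smooth_is_partial ord0 SG (nzs t); rewrite /is_partial upd_eq => /is_Cderiv_continuous.
    congr (@continuous R_UniformSpace C_UniformSpace _ t); apply: functional_extensionality => s.
    by rewrite upd_upd.
  apply: (@ex_RIC_piecewise _ (fun t => gt (upd y ord0 t)) (fun t => gt (upd y ord0 t)) r) => // t Ht; apply: inFb.
    by rewrite Rabs_left; lra.
  by rewrite Rabs_pos_eq; lra.
have Es : sg = 0 by lra.
have y00 j : upd y ord0 0 j = 0.
  have := coord_le_enorm (upd y ord0 0) j; have := Rabs_pos (upd y ord0 0 j).
  have -> : enorm (upd y ord0 0) = 0 by have := eS 0; have := e0 0; nra.
  by move=> ? ?; apply: NNPP => /Rabs_no_R0; lra.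
have sc s t : 0 < s -> t <> 0 -> gt (upd y ord0 (s * t)) = gt (upd y ord0 t).
  move=> Hs Ht; rewrite /gt; congr g.
  have -> : upd y ord0 (s * t) = vscale s (upd y ord0 t).
    apply: functional_extensionality => j; rewrite /vscale /upd; case: eqP => // /eqP Hj.
    by have := y00 j; rewrite upd_neq // => ->; ring.
  rewrite enorm_scale; last lra.
  have ep : 0 < enorm (upd y ord0 t) by have := eS t; have := e0 t; have : 0 < t ^ 2 by [exact: pow2_gt_0]; nra.
  by apply: functional_extensionality => j; rewrite /vscale; field; split; lra.
apply: (@ex_RIC_piecewise _ (fun _ => gt (upd y ord0 (-1))) (fun _ => gt (upd y ord0 1)) r) => //; try (by move=> t; apply: continuous_const).
  move=> t Ht; rewrite inFb; last by rewrite Rabs_left; lra.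
  by have -> : t = (- t) * (-1) by [ring]; rewrite sc //; lra.
move=> t Ht; rewrite inFb; last by rewrite Rabs_pos_eq; lra.
by rewrite -{1}(Rmult_1_r t) sc //; lra.
Qed.

(** The difference [(1 - rho) gt] is supported where [|y|^2 <= 2 d] or [1 - d <= |y|^2 <= 1]. On a
    line the first set lies in [|t| <= 2 sqrt d], and the second in two intervals of length
    [a - b <= sqrt d], a bound that holds for nearly tangential lines as well. The total length is
    at most [6 sqrt d]. *)
Lemma Fb_apx K d : 0 <= K -> (forall y, Cmod (gt y) <= K) -> 0 < d -> d <= 1 / 4 ->
  apx Fb (fun y => sumC (fun a => partial a (fun y => Cmult (RtoC (rho d (S y))) (V a y)) y)) (K * (6 * sqrt d)).
Proof.
move=> HK HgK Hd Hd4 y; set Gd := (fun y : Pt N => sumC (fun a => partial a (fun y => Cmult (RtoC (rho d (S y))) (V a y)) y)).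
set sg := S (upd y ord0 0); have sg0 : 0 <= sg := S_ge0 _.
have eS t : enorm (upd y ord0 t) ^ 2 = t ^ 2 + sg by rewrite -S_enorm slice_S.
have e0 t := enorm_ge0 (upd y ord0 t).
have sd : 0 < sqrt d by apply: sqrt_lt_R0.
have sd2 : sqrt d ^ 2 = d by rewrite pow2_sqrt; lra.
pose a := sqrt (1 - sg); pose b := sqrt (1 - d - sg).
have a0 : 0 <= a by exact: sqrt_pos. have b0 : 0 <= b by exact: sqrt_pos.
have ba : b <= a by apply: sqrt_le_1_alt; lra.
have a1 : a <= 1 by rewrite -sqrt_1; apply: sqrt_le_1_alt; lra.
have ab : a - b <= sqrt d.
  case: (Rle_lt_dec 1 sg) => H1; first by rewrite /a (sqrt_neg_0 (1 - sg)); lra.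
  have a2 : a ^ 2 = 1 - sg by rewrite /a pow2_sqrt; lra.
  case: (Rle_lt_dec (1 - d) sg) => H2.
    by rewrite /b (sqrt_neg_0 (1 - d - sg)); [rewrite Rminus_0_r; apply: sqrt_le_1_alt; lra | lra].
  have b2 : b ^ 2 = 1 - d - sg by rewrite /b pow2_sqrt; lra.
  nra.
pose B t := K * (ind (- (2 * sqrt d)) (2 * sqrt d) t + (ind b a t + ind (- a) (- b) t)).
have sd1 : 2 * sqrt d <= 1.
  have : sqrt d <= 1 / 2; last lra.
  have -> : 1 / 2 = sqrt (1 / 4) by rewrite -(sqrt_pow2 (1 / 2)); [f_equal; field | lra].
  exact: sqrt_le_1_alt.
have IB : is_RInt B (-1) 1 (K * (((2 * sqrt d) - - (2 * sqrt d)) + ((a - b) + (- b - - a)))).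
  apply: (is_RInt_scal (V := R_NormedModule)).
  apply: (is_RInt_plus (V := R_NormedModule)); first by apply: ind_int; lra.
  by apply: (is_RInt_plus (V := R_NormedModule)); apply: ind_int; lra.
have G1 (w : Pt N) : 1 < enorm w -> Gd w = RtoC 0 by exact: Gd_zero.
have G2 (w : Pt N) : ~ nonzero w -> Gd w = RtoC 0 by exact: Gd_origin.
have G3 (w : Pt N) : nonzero w -> Gd w = Cmult (RtoC (rho d (S w))) (Cmult (RtoC (S w ^ m.+1)) (g w)) by exact: Gd_val.
have Ht (t : R) : Cmod (Cminus (Fb (upd y ord0 t)) (Gd (upd y ord0 t))) <= B t.
  set z := upd y ord0 t.
  have i1 := ind_ge0 (- (2 * sqrt d)) (2 * sqrt d) t; have i2 := ind_ge0 b a t; have i3 := ind_ge0 (- a) (- b) t.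
  have B0 : 0 <= B t by apply: Rmult_le_pos => //; lra.
  have P := e0 t; have E := eS t; rewrite -/z in P E.
  have small : enorm z ^ 2 < 2 * d -> K <= B t.
    move=> H; rewrite /B ind_in; last first.
      have : Rabs t <= 2 * sqrt d by have := Rabs_pos t; rewrite -(pow2_abs t) in E; nra.
      by move/Rabs_le_between.
    nra.
  case: (Rlt_le_dec 1 (enorm z)) => H1.
    rewrite G1 // /Fb; case: Rle_dec => H2 /=; first lra.
    have -> : Cminus (RtoC 0) (RtoC 0) = RtoC 0 by ring.
    by rewrite Cmod_0.
  have -> : Fb z = gt z by rewrite /Fb; case: Rle_dec.
  case: (Req_dec (enorm z) 0) => Ez.
    rewrite G2; last by move=> H; apply: H.
    have -> : Cminus (gt z) (RtoC 0) = gt z by ring.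
    by apply: Rle_trans (HgK z) (small _); rewrite Ez; lra.
  rewrite G3 // -gt_val //.
  have -> : Cminus (gt z) (Cmult (RtoC (rho d (S z))) (gt z)) = Cmult (RtoC (1 - rho d (S z))) (gt z) by rewrite RtoC_minus; ring.
  have rb := rho_bounds d (S z).
  have Kz : Cmod (Cmult (RtoC (1 - rho d (S z))) (gt z)) <= K.
    rewrite Cmod_mult Cmod_R Rabs_pos_eq; last lra.
    by have := HgK z; have := Cmod_ge_0 (gt z); nra.
  case: (Rlt_le_dec (enorm z ^ 2) (2 * d)) => H2; first exact: Rle_trans Kz (small H2).
  case: (Rle_lt_dec (enorm z ^ 2) (1 - d)) => H3.
    rewrite rho_1 ?S_enorm // Rminus_diag_eq // Cmult_0_l Cmod_0 //.
  apply: Rle_trans Kz _.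
  have ta : Rabs t <= a.
    apply: Rsqr_incr_0_var a0; rewrite !Rsqr_pow2 pow2_abs /a pow2_sqrt; nra.
  have tb : b <= Rabs t.
    case: (Rle_lt_dec (1 - d) sg) => H4; first by rewrite /b sqrt_neg_0; [exact: Rabs_pos | lra].
    apply: Rsqr_incr_0_var (Rabs_pos t); rewrite !Rsqr_pow2 pow2_abs /b pow2_sqrt; nra.
  rewrite /B; case: (Rle_lt_dec 0 t) => Hs.
    rewrite Rabs_pos_eq // in ta tb; rewrite (ind_in (a := b) (b := a)); [nra | lra].
  rewrite Rabs_left // in ta tb; rewrite (ind_in (a := - a) (b := - b)); [nra | lra].
have TG : tame Gd := proj1 (Gd_tame_int Hd).
have exG : ex_RIC (fun t => Gd (upd y ord0 t)) (-1) 1.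
  apply: RIC_ext_cont => t; have := smooth_is_partial (U := fun _ => True) ord0 (proj1 TG) (y := upd y ord0 t) I.
  rewrite /is_partial upd_eq => /is_Cderiv_continuous; congr (@continuous R_UniformSpace C_UniformSpace _ t).
  by apply: functional_extensionality => s; rewrite upd_upd.
have exD := proj1 (RIC_minus (Fb_slice y (-1) 1) exG).
have M := @RInt_correct C_R_CompleteNormedModule _ _ _ exD.
apply: Rle_trans (_ : K * (((2 * sqrt d) - - (2 * sqrt d)) + ((a - b) + (- b - - a))) <= _); last first.
  by apply: Rmult_le_compat_l => //; lra.
rewrite -normC; apply: (@norm_RInt_le C_R_NormedModule _ B (-1) 1 _ _ _ _ M IB); first lra.
by move=> t _; rewrite (normC (Cminus _ _)); exact: Ht.
Qed.

(** Each smooth approximant is a sum of derivatives of compactly supported functions and integrates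
    to 0, while by [sliceable_int] its integral is arbitrarily close to that of [Fb]. *)
Theorem sphere_int_div : sphere_int g = RtoC 0.
Proof.
rewrite /sphere_int.
have -> : intRN (fun y : Pt N => if Rle_dec (enorm y) 1 then g (vscale (/ enorm y) y) else RtoC 0) = RtoC 0; last by ring.
rewrite -/(intRN Fb).
have [K [HK HgK]] := gt_bounded.
have apxG e : 0 < e -> exists d, 0 < d /\ d <= 1 / 4 /\ K * (6 * sqrt d) <= e.
  move=> He; pose s := Rmin (1 / 2) (e / (6 * (K + 1))).
  have s0 : 0 < s by apply: Rmin_pos; [lra | apply: Rdiv_lt_0_compat; lra].
  exists (s ^ 2); split; first by nra.
  have s1 : s <= 1 / 2 by exact: Rmin_l.
  split; first by nra.
  rewrite sqrt_pow2; last lra.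
  have s2 : s <= e / (6 * (K + 1)) by exact: Rmin_r.
  apply: Rle_trans (_ : (K + 1) * (6 * (e / (6 * (K + 1)))) <= _); last by right; field; lra.
  by apply: Rmult_le_compat; lra.
have SF : sliceable Fb.
  split; first exact: Fb_cubic.
  split; first exact: Fb_slice.
  move=> e He; have [d [Hd [Hd4 HdK]]] := apxG e He.
  exists (fun y => sumC (fun a => partial a (fun y => Cmult (RtoC (rho d (S y))) (V a y)) y)); split; first exact: (proj1 (Gd_tame_int Hd)).
  split; first by move=> y [j Hj]; apply: Gd_zero => //; have := coord_le_enorm y j; lra.
  by move=> y; apply: Rle_trans (Fb_apx HK HgK Hd Hd4 y) HdK.
apply: Cmod_eq_0; apply: Rle_antisym (Cmod_ge_0 _); apply: le_epsilon => e He; rewrite Rplus_0_l.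
have p2 : 0 < 2 ^ k by apply: pow_lt; lra.
have e2 : 0 < e / 2 ^ k by apply: Rdiv_lt_0_compat.
have [d [Hd [Hd4 HdK]]] := apxG _ e2.
have [TG IG] := Gd_tame_int Hd.
have := proj2 (sliceable_int SF) _ _ e2 TG _ (fun y => Rle_trans _ _ _ (Fb_apx HK HgK Hd Hd4 y) HdK).
rewrite IG; have -> : Cminus (intRN Fb) (RtoC 0) = intRN Fb by ring.
have -> : 2 ^ k * (e / 2 ^ k) = e by field; lra.
apply; move=> y [j Hj]; apply: Gd_zero => //; have := coord_le_enorm y j; lra.
Qed.

End Sphere.

Local Close Scope R_scope.
Import GRing.Theory.

(** * Alternating sums *)

Section AlternatingSums.
Variables (T : finType) (R : pzRingType).
Local Open Scope ring_scope.
Implicit Types (F : {perm T} -> R) (s : {perm T}).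

Definition altsum F := \sum_(s : {perm T}) (-1) ^+ (odd_perm s) * F s.

Lemma altsum_ext F G : (forall s, F s = G s) -> altsum F = altsum G.
Proof. by move=> E; apply: eq_bigr => s _; rewrite E. Qed.

Lemma altsumD F G : altsum (fun s => F s + G s) = altsum F + altsum G.
Proof. by rewrite -big_split; apply: eq_bigr => s _; rewrite mulrDr. Qed.

Lemma altsumN F : altsum (fun s => - F s) = - altsum F.
Proof. by rewrite -sumrN; apply: eq_bigr => s _; rewrite mulrN. Qed.

Lemma altsumB F G : altsum (fun s => F s - G s) = altsum F - altsum G.
Proof. by rewrite altsumD altsumN. Qed.

Lemma altsumMl c F : altsum (fun s => c * F s) = c * altsum F.
Proof. by rewrite mulr_sumr; apply: eq_bigr => s _; rewrite mulrA -(commr_sign c) mulrA. Qed.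

Lemma altsum_swap u v F : u != v -> altsum (fun s => F (tperm u v * s)%g) = - altsum F.
Proof.
move=> uv; rewrite -altsumN /altsum (reindex_inj (mulgI (tperm u v))); apply: eq_bigr => s _.
by rewrite mulgA tperm2 mul1g odd_permM odd_tperm uv mulrN -mulNr addTb signrN.
Qed.

Lemma altsum_sym_split (P : pred {perm T}) F (h : {perm T} -> {perm T}) : injective h ->
  (forall s, odd_perm (h s) = ~~ odd_perm s) -> (forall s, F (h s) = F s) -> altsum F = 0.
Proof.
move=> hi ho hF; rewrite /altsum (bigID (fun s => odd_perm s)) /= [X in _ + X](reindex_inj hi) /= -[RHS](subrr (\sum_(s | odd_perm s) - F s)).
congr (_ + _); first by apply: eq_bigr => s ->; rewrite expr1 mulN1r.
by rewrite -sumrN; apply: eq_big => s; rewrite ho negbK // => ->; rewrite expr0 mul1r hF opprK.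
Qed.

Lemma altsum_sym0 u v F : u != v -> (forall s, F (tperm u v * s)%g = F s) -> altsum F = 0.
Proof.
move=> uv; apply: (altsum_sym_split predT (mulgI _)) => s.
by rewrite odd_permM odd_tperm uv addTb.
Qed.

Lemma altsum_symr0 u v F : u != v -> (forall s, F (s * tperm u v)%g = F s) -> altsum F = 0.
Proof.
move=> uv; apply: (altsum_sym_split predT (mulIg _)) => s.
by rewrite odd_permM odd_tperm uv addbT.
Qed.

Section Dependent.
Variables (c X : T -> R).
Hypotheses (cC : forall t x, c t * x = x * c t) (cX : \sum_t c t * X t = 0).

Let M (Y : T -> R) w := altsum (fun s => \prod_(t <- w) Y (s t)).
Let put (Y : T -> R) t0 x := fun t => if t == t0 then x else Y t.

Lemma prod_put Y t0 x y z a b s w : (forall u, a * u = u * a) -> (forall u, b * u = u * b) -> uniq w -> s^-1%g t0 \in w ->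
  z = a * x + b * y ->
  \prod_(t <- w) put Y t0 z (s t) = a * \prod_(t <- w) put Y t0 x (s t) + b * \prod_(t <- w) put Y t0 y (s t).
Proof.
move=> aC bC Uw tw; case/path.splitPr: tw Uw => w1 w2; rewrite cat_uniq /= negb_or => /and3P [_ /andP [n1 _] /andP [n2 _]] ->.
have E w' v : s^-1%g t0 \notin w' -> \prod_(t <- w') put Y t0 v (s t) = \prod_(t <- w') Y (s t).
  move=> Hw; apply: eq_big_seq => t tw; rewrite /put; case: eqP => // Et.
  by move: Hw; rewrite -Et permK tw.
rewrite !big_cat !big_cons !E //= /put permKV eqxx mulrDl mulrDr !mulrA.
by rewrite (aC (\prod_(t <- w1) _)) (bC (\prod_(t <- w1) _)).
Qed.

(** The determinant argument for entries that need not commute: in the slot holding the label [t0],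
    the entry is replaced by the vanishing combination of the [X t]. Expanding, every term with
    [t != t0] carries the entry [X t] under two labels and cancels when these are exchanged. The
    scalars [c t] can be moved out because they are central. *)
Lemma altsum_dependent w t0 : uniq w -> (forall t, t \in w) -> c t0 * altsum (fun s => \prod_(t <- w) X (s t)) = 0.
Proof.
move=> Uw Hw.
have L r : M (put X t0 (\sum_(t <- r) c t * X t)) w = \sum_(t <- r) c t * M (put X t0 (X t)) w.
  elim: r => [|t r IH].
    rewrite !big_nil /M /altsum big1 // => s _.
    by rewrite (@prod_put X t0 0 0 0 0 0) ?mul0r ?addr0 ?mulr0 // => u; rewrite mulr0 mul0r.
  rewrite !big_cons -IH -altsumMl -altsumD; apply: altsum_ext => s.
  rewrite -[X in _ = _ + X]mul1r; apply: prod_put => //; last by rewrite mul1r.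
  by move=> u; rewrite mulr1 mul1r.
have := L (index_enum T); rewrite cX (bigD1 t0) //= [X in _ + X]big1 => [|t Ht]; last first.
  rewrite /M (altsum_symr0 (u := t) (v := t0)) ?mulr0 // => s.
  apply: eq_bigr => u _; rewrite permM /put.
  case: tpermP => [->|->|/eqP/negPf a /eqP/negPf b]; first by rewrite eqxx (negPf Ht).
    by rewrite eqxx (negPf Ht).
  by rewrite b.
rewrite addr0 => E; have -> : altsum (fun s => \prod_(t <- w) X (s t)) = M (put X t0 (X t0)) w.
  by apply: altsum_ext => s; apply: eq_bigr => u _; rewrite /put; case: eqP => // ->.
rewrite -E /M /altsum big1 // => s _.
by rewrite (@prod_put X t0 0 0 0 0 0) ?mul0r ?addr0 ?mulr0 // => u; rewrite mulr0 mul0r.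
Qed.

End Dependent.
End AlternatingSums.

Section SymplecticSigns.
Variables (n : nat) (R : comPzRingType).
Local Open Scope ring_scope.
Notation T := ('I_n * bool)%type.
Implicit Types (s : {perm T}) (j : 'I_n).

(* The index [(j, false)] stands for [xi_j] and [(j, true)] for [x_j]. *)
Definition omega (t u : T) : R :=
  if (t.1 == u.1) && (t.2 != u.2) then (-1) ^+ t.2 else 0.

Definition paired s := [forall j, ((s (j, false)).1 == (s (j, true)).1) && ((s (j, false)).2 != (s (j, true)).2)].

(** [s] is the product of the permutation acting on the [false] copy alone and its conjugate by the
    flip [g], so its parity is even. *)
Lemma even_block s (q : 'I_n -> 'I_n) : (forall j b, s (j, b) = (q j, b)) -> odd_perm s = false.
Proof.
move=> Hs.
have fi : injective (fun t : T => if t.2 then t else s t).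
  move=> [j b] [k c] /=; case: b; case: c => //; rewrite ?Hs //.
  by rewrite -!Hs => /perm_inj.
have gi : injective (fun t : T => (t.1, ~~ t.2)) by move=> [j b] [k c] /= [-> /negb_inj ->].
pose s0 := perm fi; pose g := perm gi.
have -> : s = (s0 * (g * s0 * g))%g.
  apply/permP => -[j b]; rewrite !permM !permE /= !Hs.
  by case: b; rewrite ?Hs ?permE /= ?Hs.
by rewrite !odd_permM; case: (odd_perm s0); case: (odd_perm g).
Qed.

(** Induction on the number of reversed pairs: reversing one pair changes both the parity of the
    permutation and the sign of one factor. With no pair reversed, [even_block] applies. *)
Lemma sign_omega s : paired s -> (-1) ^+ odd_perm s * \prod_j omega (s (j, false)) (s (j, true)) = 1.
Proof.
move En : #|[pred j | (s (j, false)).2]| => m; elim: m s En => [|m IH] s En Ps.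
  have Z j : (s (j, false)).2 = false.
    by apply/negbTE/negP => Hj; have := card0_eq En j; rewrite inE Hj.
  have /forallP Pj := Ps.
  rewrite (@even_block s (fun j => (s (j, false)).1)) => [|j b].
    rewrite expr0 mul1r big1 // => j _; by rewrite /omega Pj Z.
  have /andP [/eqP E1 E2] := Pj j; have := Z j; case: b.
    by rewrite E1 => Zj; move: E2; rewrite Zj; case: (s (j, true)) => a [].
  by case: (s (j, false)) => a b /= ->.
have [j Hj] : exists j, (s (j, false)).2.
  by have /card_gt0P [j] : 0 < #|[pred j | (s (j, false)).2]| by [rewrite En]; exists j.
pose r := (tperm (j, false) (j, true) * s)%g.
have rj b : r (j, b) = s (j, ~~ b) by rewrite /r permM; case: b; rewrite ?tpermL ?tpermR.
have rk k b : k != j -> r (k, b) = s (k, b).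
  by move=> kj; rewrite /r permM tpermD //; apply: contraNneq kj => -[-> //].
have /forallP Pj := Ps.
have Pr : paired r.
  apply/forallP => k; have [->|kj] := eqVneq k j; last by rewrite !rk // Pj.
  by rewrite !rj /= [X in X && _]eq_sym [X in _ && ~~ X]eq_sym Pj.
have Er : #|[pred j | (r (j, false)).2]| = m.
  apply/eqP; rewrite -eqSS -En (cardD1 j [pred j | (s (j, false)).2]) inE Hj add1n eqSS; apply/eqP; apply: eq_card => k.
  rewrite !inE; have [->|kj] := eqVneq k j; last by rewrite rk.
  by rewrite rj /=; have /andP [_] := Pj j; rewrite Hj; case: (s (j, true)).2.
have -> : \prod_j omega (s (j, false)) (s (j, true)) = - \prod_j omega (r (j, false)) (r (j, true)).
  rewrite (bigD1 j) //= [in RHS](bigD1 j) //= -mulNr; congr (_ * _).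
    rewrite !rj /= /omega; move: (Pj j) Hj; case: (s (j, false)) => a b; case: (s (j, true)) => c d /=.
    by move=> /andP [/eqP -> bd] Hb; move: bd; rewrite Hb eqxx; case: d => //= _; rewrite expr0 expr1.
  by apply: eq_bigr => k kj; rewrite !rk.
have Or : odd_perm r = ~~ odd_perm s by rewrite odd_permM odd_tperm xpair_eqE eqxx.
by apply: etrans (IH r Er Pr); rewrite Or signrN mulNr mulrN.
Qed.

(** A sum of Pfaffian type in which every nonzero term is 1, so nothing cancels; the identity
    permutation makes it positive, and positivity is all that matters later. *)
Lemma altsum_omega : exists m, altsum (fun s => \prod_j omega (s (j, false)) (s (j, true))) = m.+1%:R.
Proof.
have E s : (-1) ^+ odd_perm s * \prod_j omega (s (j, false)) (s (j, true)) = (paired s : nat)%:R.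
  case P : (paired s); first by rewrite sign_omega.
  have /forallPn [j /negPf Hj] := negbT P.
  by rewrite (bigD1 j) //= /omega Hj mul0r mulr0.
have P1 : paired 1%g by apply/forallP => j; rewrite !perm1 eqxx.
exists (\sum_(s | s != 1%g) (paired s : nat))%N.
rewrite /altsum (eq_bigr _ (fun s _ => E s)) -natr_sum; congr (_%:R).
by rewrite (bigD1 1%g) //= P1.
Qed.

End SymplecticSigns.

(** * Splitting along an idempotent *)

Section DiagonalSplitting.
Variables (n : nat) (A : pzRingType).
Local Open Scope ring_scope.
Notation T := ('I_n * bool)%type.
Local Notation om := (@omega n int).
Implicit Types x y : A.

Variables (Z : T -> A) (kap p q : A).
Hypotheses (pp : p * p = p) (pDq : p + q = 1).
Hypothesis kapC : forall x, kap * x = x * kap.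
Hypothesis ZZ : forall t u, Z t * Z u - Z u * Z t = kap *~ om t u.

Definition grading := p - q.
Let A_ t := p * Z t * p + q * Z t * q.
Definition offdiag t := p * Z t * q + q * Z t * p.
Let B_ := offdiag.

Lemma qE : q = 1 - p. Proof. by rewrite -pDq [p + q]addrC addrK. Qed.
Lemma pq : p * q = 0. Proof. by rewrite qE mulrBr mulr1 pp subrr. Qed.
Lemma qp : q * p = 0. Proof. by rewrite qE mulrBl mul1r pp subrr. Qed.
Lemma qq : q * q = q. Proof. by rewrite {1}qE mulrBl mul1r pq subr0. Qed.
Lemma ZAB t : Z t = A_ t + B_ t.
Proof. by rewrite /A_ /B_ /offdiag addrACA [_ + q * Z t * p]addrC -!mulrDr pDq !mulr1 -mulrDl pDq mul1r. Qed.

Definition even x := p * x = x * p.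
Definition odd x := p * x = x * q.

Lemma even_q x : even x -> q * x = x * q. Proof. by rewrite /even qE mulrBl mulrBr mul1r mulr1 => ->. Qed.
Lemma odd_q x : odd x -> q * x = x * p. Proof. by rewrite /odd {2}qE mulrBl mul1r => ->; rewrite qE mulrBr mulr1 opprB addrC subrK. Qed.
Lemma even_even x y : even x -> even y -> even (x * y). Proof. by rewrite /even mulrA => -> ex; rewrite -mulrA ex mulrA. Qed.
Lemma odd_odd x y : odd x -> odd y -> even (x * y). Proof. by rewrite /even mulrA => -> /odd_q oy; rewrite -mulrA oy mulrA. Qed.
Lemma even_odd x y : even x -> odd y -> odd (x * y). Proof. by rewrite /odd mulrA => -> oy; rewrite -mulrA oy mulrA. Qed.
Lemma odd_even x y : odd x -> even y -> odd (x * y). Proof. by rewrite /odd mulrA => -> /even_q oy; rewrite -mulrA oy mulrA. Qed.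
Lemma evenB x y : even x -> even y -> even (x - y). Proof. by rewrite /even mulrBr mulrBl => -> ->. Qed.
Lemma oddB x y : odd x -> odd y -> odd (x - y). Proof. by rewrite /odd mulrBr mulrBl => -> ->. Qed.

Lemma even_A t : even (A_ t).
Proof. by rewrite /even /A_ mulrDr mulrDl !mulrA pp pq -!mulrA pp qp !mul0r !mulr0. Qed.
Lemma odd_B t : odd (B_ t).
Proof. by rewrite /odd /B_ /offdiag mulrDr mulrDl !mulrA pp pq -!mulrA qq pq !mul0r !mulr0. Qed.

Lemma grad_sq : grading * grading = 1.
Proof. by rewrite /grading mulrBl !mulrBr pp pq qp qq subr0 sub0r opprK. Qed.

(** The commutator with [p] kills the even part and turns [y] into [y * grading], and [grading] is
    an involution. This separates the parts without dividing by 2. *)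
Lemma even_add_odd x y : even x -> odd y -> x + y = 0 -> y = 0.
Proof.
move=> ex oy E; have := congr1 (fun z => z * p - p * z) E; rewrite /= mulr0 mul0r subr0 mulrDl mulrDr ex oy opprD addrACA subrr add0r -mulrBr -/grading => E2.
by rewrite -[y]mulr1 -grad_sq mulrA E2 mul0r.
Qed.

Let cm x y := x * y - y * x.
Lemma cmN x y : cm y x = - cm x y. Proof. by rewrite /cm opprB. Qed.

Lemma cmDl x y z : cm (x + y) z = cm x z + cm y z. Proof. by rewrite /cm mulrDl mulrDr opprD addrACA. Qed.
Lemma cmDr x y z : cm z (x + y) = cm z x + cm z y. Proof. by rewrite /cm mulrDl mulrDr opprD addrACA. Qed.

Lemma evenC x y : even x -> even y -> even (cm x y). Proof. by move=> ? ?; apply: evenB; apply: even_even. Qed.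

(** The canonical commutation relation of [Z t] and [Z u] is separated into its even part, which is
    the first identity, and its odd part, which is the second. *)
Lemma cm_split t u : cm (B_ t) (B_ u) = kap *~ om t u - cm (A_ t) (A_ u) /\ cm (A_ t) (B_ u) = cm (A_ u) (B_ t).
Proof.
have E : (cm (A_ t) (A_ u) + cm (B_ t) (B_ u) - kap *~ om t u) + (cm (A_ t) (B_ u) - cm (A_ u) (B_ t)) = 0.
  have -> : kap *~ om t u = cm (A_ t) (A_ u) + cm (A_ t) (B_ u) + (cm (B_ t) (B_ u) + cm (B_ t) (A_ u)).
    by rewrite -ZZ (ZAB t) (ZAB u) -/(cm (A_ t + B_ t) (A_ u + B_ u)) (cmDl (A_ t) (B_ t)) !(cmDr (A_ u) (B_ u)) (addrC (cm (B_ t) (A_ u))).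
  rewrite (cmN (A_ u) (B_ t)); move: (cm (A_ t) (A_ u)) (cm (B_ t) (B_ u)) (cm (A_ t) (B_ u)) (cm (A_ u) (B_ t)) => P Q R S.
  by rewrite (addrACA P); move: (P + Q) (R - S) => X Y; rewrite opprD addrA subrr add0r addNr.
have O0 : cm (A_ t) (B_ u) - cm (A_ u) (B_ t) = 0.
  apply: even_add_odd E; last first.
    by apply: oddB; apply: oddB; [apply: even_odd|apply: odd_even|apply: even_odd|apply: odd_even]; (exact: even_A || exact: odd_B).
  apply: evenB; last by rewrite /even mulrzAl mulrzAr kapC.
  rewrite -[cm (B_ t) _]opprK; apply: evenB; first by apply: evenC; exact: even_A.
  by rewrite -cmN; apply: evenB; apply: odd_odd; exact: odd_B.
split; last by apply/eqP; rewrite -subr_eq0 O0.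
by move: E; rewrite O0 addr0 => /eqP; rewrite subr_eq0 => /eqP <-; rewrite addrAC subrr add0r.
Qed.

End DiagonalSplitting.

(** * Contraction of the alternating product *)

Section AlternatingReduction.
Variables (n : nat) (A : pzRingType).
Local Open Scope ring_scope.
Notation T := ('I_n * bool)%type.
Local Notation om := (@omega n int).
Implicit Types (s : {perm T}) (r : seq 'I_n) (w : seq T) (x y : A).

Fixpoint pos r : seq T := if r is j :: r' then (j, false) :: (j, true) :: pos r' else [::].

Lemma pos_cat r1 r2 : pos (r1 ++ r2) = pos r1 ++ pos r2.
Proof. by elim: r1 => //= j r1 ->. Qed.

Lemma mem_pos r t : (t \in pos r) = (t.1 \in r).
Proof.
elim: r => //= j r IH; rewrite !in_cons IH; case: t {IH} => k b /=; rewrite !xpair_eqE.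
by case: b; rewrite /= ?andbF ?andbT.
Qed.

Lemma uniq_pos r : uniq r -> uniq (pos r).
Proof. by elim: r => //= j r IH /andP [jr /IH ->]; rewrite in_cons !mem_pos xpair_eqE /= andbF jr. Qed.

Variables (A_ B_ : T -> A) (kap gam : A).
Notation cm x y := (x * y - y * x).
Hypothesis kapC : forall x, kap * x = x * kap.
Hypothesis BB : forall t u, cm (B_ t) (B_ u) = kap *~ om t u - cm (A_ t) (A_ u).
Hypothesis AB : forall t u, cm (A_ t) (B_ u) = cm (A_ u) (B_ t).
Hypothesis gamA : forall t, gam * A_ t = A_ t * gam.

Let Om s r := \prod_(j <- r) om (s (j, false)) (s (j, true)).
Let Bs s w := \prod_(t <- w) B_ (s t).

Lemma Bs_swap a b w s : a \notin w -> b \notin w -> Bs (tperm a b * s)%g w = Bs s w.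
Proof. by move=> aw bw; apply: eq_big_seq => t tw; rewrite permM tpermD //; apply: contraTneq tw => <-. Qed.

Lemma Om_swap a b r s : a.1 \notin r -> b.1 \notin r -> Om (tperm a b * s)%g r = Om s r.
Proof.
move=> aw bw; apply: eq_big_seq => j jr; rewrite !permM !tpermD //; by apply: contraTneq jr => E; rewrite E in aw bw.
Qed.

(* The commutator of [A_a] with one factor [B_t] is symmetric in [a] and [t], so every term of the Leibniz expansion cancels under that transposition. *)
Lemma altsum_commutator0 a b r w1 w2 : a \notin w1 ++ w2 -> b \notin w1 ++ w2 -> a != b -> uniq (w1 ++ w2) ->
  a.1 \notin r -> (forall t, t \in w2 -> t.1 \notin r) -> forall g : A,
  altsum (fun s => (g * Bs s w1 * cm (A_ (s a)) (Bs s w2) * A_ (s b)) *~ Om s r) = 0.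
Proof.
elim: w2 w1 => [|t w2 IH] w1 Ha Hb ab U ar Hr g.
  by apply: big1 => s _; rewrite /Bs big_nil mulr1 mul1r subrr mulr0 mul0r mul0rz mulr0.
have E s : cm (A_ (s a)) (Bs s (t :: w2)) = cm (A_ (s a)) (B_ (s t)) * Bs s w2 + B_ (s t) * cm (A_ (s a)) (Bs s w2).
  rewrite /Bs !big_cons -/(Bs s w2); move: (A_ _) (B_ _) (Bs _ _) => x y z.
  by rewrite mulrBl mulrBr !mulrA addrA subrK.
rewrite (altsum_ext (G := fun s => (g * Bs s w1 * (cm (A_ (s a)) (B_ (s t)) * Bs s w2) * A_ (s b)) *~ Om s r + (g * Bs s (rcons w1 t) * cm (A_ (s a)) (Bs s w2) * A_ (s b)) *~ Om s r)) => [|s]; last first.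
  by rewrite E mulrDr mulrDl mulrzDl -cats1 /Bs big_cat big_seq1 !mulrA.
have wU := U; rewrite cat_uniq /= negb_or in wU; case/and3P: wU => U1 /andP [t1 U12] /andP [t2 U2].
rewrite mem_cat in_cons !negb_or in Ha; case/and3P: Ha => a1 at_ a2.
rewrite mem_cat in_cons !negb_or in Hb; case/and3P: Hb => b1 bt b2.
rewrite altsumD IH ?cat_rcons //; try (by rewrite mem_cat in_cons !negb_or ?a1 ?at_ ?a2 ?b1 ?bt ?b2).
  rewrite addr0; apply: (altsum_sym0 (u := a) (v := t)) => // s.
  rewrite !Bs_swap // Om_swap // ?Hr ?mem_head // !permM tpermL tpermR (tpermD ab) // 1?eq_sym //.
  by rewrite (AB (s t) (s a)).
by move=> u Hu; apply: Hr; rewrite in_cons Hu orbT.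
Qed.

(** In the application [Hom m] means homogeneous of degree [m], and [Null] that the trace of the
    critical term is a divergence. [NullC] is assumed for total degree [n.*2] only, so degrees are
    tracked through every product. *)
Variables (Null : A -> Prop) (Hom : nat -> A -> Prop).
Hypothesis Null0 : Null 0.
Hypothesis NullB : forall x y, Null x -> Null y -> Null (x - y).
Hypothesis Hom0 : forall m, Hom m 0.
Hypothesis HomB : forall m x y, Hom m x -> Hom m y -> Hom m (x - y).
Hypothesis HomM : forall l m x y, Hom l x -> Hom m y -> Hom (l + m) (x * y).
Hypothesis Hom1 : Hom 0 1.
Hypotheses (HomA : forall t, Hom 1 (A_ t)) (HomB_ : forall t, Hom 1 (B_ t)) (Homk : Hom 2 kap) (Homg : Hom 0 gam).
Hypothesis NullC : forall l m x y, Hom l x -> Hom m y -> (l + m = n.*2)%N -> Null (cm x y).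

Lemma NullN x : Null x -> Null (- x). Proof. by move=> H; rewrite -[- x]add0r; apply: NullB. Qed.
Lemma NullD x y : Null x -> Null y -> Null (x + y). Proof. by move=> Hx Hy; rewrite -[y]opprK; apply: NullB => //; exact: NullN. Qed.
Lemma Null_altsum (F : {perm T} -> A) : (forall s, Null (F s)) -> Null (altsum F).
Proof.
move=> H; apply: (big_ind Null) => // [|s _]; first exact: NullD.
by case: (odd_perm s); rewrite ?expr1 ?expr0 ?mul1r // mulN1r; apply: NullN.
Qed.
Lemma HomN m x : Hom m x -> Hom m (- x). Proof. by move=> H; rewrite -[- x]add0r; apply: HomB. Qed.
Lemma HomZ m x (k : int) : Hom m x -> Hom m (x *~ k).
Proof.
move=> H; have P i : Hom m (x *+ i).
  by elim: i => [|i IH]; rewrite ?mulr0n // mulrS -[x *+ i]opprK; apply: HomB => //; exact: HomN.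
by case: k => i; [exact: P | rewrite NegzE mulrNz; apply: HomN; exact: P].
Qed.
Lemma Hom_Bs w s : Hom (size w) (Bs s w).
Proof. by elim: w => [|t w IH]; rewrite /Bs ?big_nil // big_cons; exact: (@HomM 1). Qed.
Lemma Hom_kap m : Hom m.*2 (kap ^+ m).
Proof. by elim: m => [|m IH] //; rewrite exprS; exact: (@HomM 2). Qed.
Lemma size_pos r : size (pos r) = (size r).*2. Proof. by elim: r => //= j r ->. Qed.

(** An intermediate stage: pairs in [r2] are already contracted to [omega] and [kap], while pairs in
    [r1] still carry their two factors [B_]. *)
Let Sum r1 r2 := altsum (fun s => (kap ^+ size r2 * gam * Bs s (pos r1)) *~ Om s r2).

(* Antisymmetry in the pair [j] replaces [B_a B_b] by half their commutator; its part [[A_a, A_b]] contributes a commutator up to a sum that [altsum_commutator0] kills. *)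
Lemma reduction_step r1 j r2 : uniq (rcons r1 j ++ r2) -> size (rcons r1 j ++ r2) = n ->
  Null (Sum (rcons r1 j) r2 *+ 2 - Sum r1 (j :: r2)).
Proof.
rewrite cat_rcons cat_uniq /= negb_or => /and3P [U1 /andP [j1 U12] /andP [j2 U2]]; rewrite size_cat /= => Hn.
pose a := (j, false) : T; pose b := (j, true) : T; pose g := kap ^+ size r2 * gam.
have ab : a != b by rewrite xpair_eqE eqxx.
have a1 : a \notin pos r1 by rewrite mem_pos. have b1 : b \notin pos r1 by rewrite mem_pos.
have E1 : Sum (rcons r1 j) r2 = altsum (fun s => (g * Bs s (pos r1) * (B_ (s a) * B_ (s b))) *~ Om s r2).
  by apply: altsum_ext => s; rewrite -cats1 pos_cat /Bs big_cat /= !big_cons big_nil mulr1 !mulrA.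
have E2 : Sum (rcons r1 j) r2 = - altsum (fun s => (g * Bs s (pos r1) * (B_ (s b) * B_ (s a))) *~ Om s r2).
  rewrite E1 -(altsum_swap _ ab); apply: altsum_ext => s.
  by rewrite !permM tpermL tpermR Bs_swap // Om_swap.
have gA s : g * A_ (s a) = A_ (s a) * g.
  by rewrite /g -mulrA gamA !mulrA; congr (_ * _); apply: commr_sym; apply: commrX; exact: esym (kapC _).
have -> : Sum (rcons r1 j) r2 *+ 2 - Sum r1 (j :: r2) = - altsum (fun s => cm (A_ (s a)) ((g * Bs s (pos r1) * A_ (s b)) *~ Om s r2)).
  have Z0 := @altsum_commutator0 a b r2 [::] (pos r1) a1 b1 ab (uniq_pos U1) j2 _ g.
  rewrite mulr2n {1}E1 E2 -altsumB -altsumB -altsumN -[RHS]addr0 -[X in _ = _ + X]Z0; last first.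
    by move=> t; rewrite mem_pos => tr1; apply: contraNN U12 => tr2; apply/hasP; exists t.1.
  rewrite -altsumD; apply: altsum_ext => s; rewrite -mulrzBl -mulrBr BB /= exprS {2}/Om big_cons -/(Om s r2) /Bs big_nil mulr1 -/(Bs _ _).
  rewrite -/a -/b; move: (om (s a) (s b)) (Om s r2) (Bs s (pos r1)) (A_ (s a)) (A_ (s b)) (gA s) => W O P x y gx.
  have -> : kap * kap ^+ size r2 * gam * P = g * P * kap by rewrite -kapC /g !mulrA.
  rewrite mulrzA mulrBr mulrzBl -mulrzAr addrAC subrr add0r mulrzAr mulrzAl -mulrzBl -!mulNrz -mulrzDl; congr (_ *~ _).
  clearbody g; rewrite !mulrBr mulrBl !mulrA -gx !opprB addrA subrK //.
apply: NullN; apply: Null_altsum => s; apply: (NullC (HomA _) (HomZ _ (HomM (HomM (HomM (Hom_kap _) Homg) (Hom_Bs _ s)) (HomA _)))).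
by apply: etrans (congr1 double Hn); rewrite size_pos addn0 addn1 add1n doubleD doubleS !addnS addnC.
Qed.

(** Each contraction produces a factor 2, which is kept on the uncontracted side so that nothing is
    divided. *)
Lemma reduction r1 r2 : uniq (r1 ++ r2) -> size (r1 ++ r2) = n ->
  Null (Sum (r1 ++ r2) [::] *+ 2 ^ size r2 - Sum r1 r2).
Proof.
elim: r2 r1 => [|j r2 IH] r1; first by rewrite cats0 expn0 mulr1n subrr.
rewrite -cat_rcons => U Hn; have := reduction_step U Hn; have := IH _ U Hn.
set X := Sum (_ ++ _) _; set Y := Sum _ _ => H1 H2.
have := NullD (NullD H1 H1) H2.
by rewrite -mulr2n mulrnBl -mulrnA expnSr addrA subrK.
Qed.

(** Full contraction leaves [kap ^+ n * gam] times the sum of all sign products, which is the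
    positive integer of [altsum_omega]. *)
Theorem alternating_reduction : Null (altsum (fun s => gam * Bs s (pos (enum 'I_n)))) ->
  exists m, Null ((kap ^+ n * gam) *+ m.+1).
Proof.
have [m Em] := altsum_omega n int => H; exists m.
have := @reduction [::] (enum 'I_n) (enum_uniq _) (size_enum_ord n).
have -> : Sum ([::] ++ enum 'I_n) [::] = altsum (fun s => gam * Bs s (pos (enum 'I_n))).
  by apply: altsum_ext => s; rewrite /Om big_nil mulr1z expr0 mul1r.
have -> : Sum [::] (enum 'I_n) = (kap ^+ n * gam) *+ m.+1.
  rewrite pmulrn -natz -Em /altsum mulrz_sumr; apply: eq_bigr => s _.
  rewrite size_enum_ord /Bs big_nil mulr1 /Om big_enum /=.
  by case: (odd_perm s); rewrite ?expr1 ?expr0 ?mul1r // !mulN1r mulrNz.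
have N2 k x : Null x -> Null (x *+ k) by move=> Hx; elim: k => [|k IH]; rewrite ?mulr0n // mulrS; apply: NullD.
by move=> /(NullB (N2 (2 ^ size (enum 'I_n))%N _ H)); rewrite opprB addrC subrK.
Qed.

End AlternatingReduction.

(** * The star product *)

Section Bidifferential.
Variables (n : nat) (S : pzRingType) (dl : 'I_(n + n) -> S -> S).
Local Open Scope ring_scope.
Implicit Types (a b c : S) (m : nat).

Hypothesis dlD : forall i a b, dl i (a + b) = dl i a + dl i b.
Hypothesis dlM : forall i a b, dl i (a * b) = dl i a * b + a * dl i b.
Hypothesis dlC : forall i j a, dl i (dl j a) = dl j (dl i a).

Let D j := dl (rshift n j).
Let E j := dl (lshift n j).

Fixpoint bidiff m a b : S :=
  if m is m'.+1 then \sum_j bidiff m' (D j a) (E j b) else a * b.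

Lemma dl0 i : dl i 0 = 0.
Proof. by apply: (addrI (dl i 0)); rewrite -dlD !addr0. Qed.
Lemma dl_sum i (I : Type) (r : seq I) P (F : I -> S) : dl i (\sum_(x <- r | P x) F x) = \sum_(x <- r | P x) dl i (F x).
Proof. exact: (big_morph (dl i) (dlD i) (dl0 i)). Qed.
Lemma dl1 i : dl i 1 = 0.
Proof. by apply: (addrI (dl i 1)); have := dlM i 1 1; rewrite !mulr1 !mul1r addr0 => <-. Qed.

Lemma bidiffDl m a a' b : bidiff m (a + a') b = bidiff m a b + bidiff m a' b.
Proof.
elim: m a a' b => [|m IH] a a' b /=; first exact: mulrDl.
by rewrite -big_split; apply: eq_bigr => j _; rewrite /D dlD IH.
Qed.
Lemma bidiffDr m a b b' : bidiff m a (b + b') = bidiff m a b + bidiff m a b'.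
Proof.
elim: m a b b' => [|m IH] a b b' /=; first exact: mulrDr.
by rewrite -big_split; apply: eq_bigr => j _; rewrite /E dlD IH.
Qed.
Lemma bidiff0l m b : bidiff m 0 b = 0.
Proof. by apply: (addrI (bidiff m 0 b)); rewrite -bidiffDl !addr0. Qed.
Lemma bidiff0r m a : bidiff m a 0 = 0.
Proof. by apply: (addrI (bidiff m a 0)); rewrite -bidiffDr !addr0. Qed.
Lemma bidiff_suml m (I : Type) (r : seq I) P (F : I -> S) b : bidiff m (\sum_(x <- r | P x) F x) b = \sum_(x <- r | P x) bidiff m (F x) b.
Proof. exact: (big_morph (bidiff m ^~ b) (fun a a' => bidiffDl m a a' b) (bidiff0l m b)). Qed.
Lemma bidiff_sumr m (I : Type) (r : seq I) P (F : I -> S) a : bidiff m a (\sum_(x <- r | P x) F x) = \sum_(x <- r | P x) bidiff m a (F x).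
Proof. exact: (big_morph (bidiff m a) (bidiffDr m a) (bidiff0r m a)). Qed.

Definition const c := forall i, dl i c = 0.
Definition central c := forall a, c * a = a * c.

Lemma bidiff_constl m c b : const c -> bidiff m.+1 c b = 0.
Proof. by move=> Hc /=; rewrite big1 // => j _; rewrite /D Hc bidiff0l. Qed.
Lemma bidiff_constr m c a : const c -> bidiff m.+1 a c = 0.
Proof. by move=> Hc /=; rewrite big1 // => j _; rewrite /E Hc bidiff0r. Qed.
Lemma bidiffMl m c a b : const c -> bidiff m (c * a) b = c * bidiff m a b.
Proof.
move=> Hc; elim: m a b => [|m IH] a b /=; first by rewrite mulrA.
by rewrite mulr_sumr; apply: eq_bigr => j _; rewrite /D dlM Hc mul0r add0r IH.
Qed.
Lemma bidiffMr m c a b : const c -> central c -> bidiff m a (c * b) = c * bidiff m a b.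
Proof.
move=> Hc Cc; elim: m a b => [|m IH] a b /=; first by rewrite !mulrA Cc.
by rewrite mulr_sumr; apply: eq_bigr => j _; rewrite /E dlM Hc mul0r add0r IH.
Qed.

Lemma dl_bidiff m i a b : dl i (bidiff m a b) = bidiff m (dl i a) b + bidiff m a (dl i b).
Proof.
elim: m a b => [|m IH] a b /=; first exact: dlM.
by rewrite dl_sum -big_split; apply: eq_bigr => j _; rewrite IH /D /E !(dlC i).
Qed.

(** The operator [(D_1 E_2 + D_1 E_3 + D_2 E_3)^N] on the product [a b c], subscripts naming the
    factor acted upon and summed over [j]. Both bracketings of an iterated star product expand to it
    by the binomial formula, which is the source of associativity. *)
Fixpoint tridiff N a b c : S :=
  if N is N'.+1 then \sum_j (tridiff N' (D j a) (E j b) c + (tridiff N' (D j a) b (E j c) + tridiff N' a (D j b) (E j c)))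
  else a * b * c.

Lemma pascal (F : nat -> nat -> S) N :
  \sum_(m < N.+2) F m (N.+1 - m)%N *+ 'C(N.+1, m) = \sum_(m < N.+1) (F m (N - m).+1 + F m.+1 (N - m)%N) *+ 'C(N, m).
Proof.
rewrite big_ord_recl bin0 subn0 /=.
under eq_bigr => m _ do rewrite /bump /= add1n subSS binS mulrnDr.
rewrite big_split /= addrA.
under [RHS]eq_bigr => m _ do rewrite mulrnDl.
rewrite [RHS]big_split /=; congr (_ + _).
rewrite [in RHS]big_ord_recl /= subn0 bin0 big_ord_recr /= bin_small // mulr0n addr0; congr (_ + _).
by apply: eq_bigr => m _; rewrite /bump /= add1n subnSK.
Qed.

Lemma bidiff_triple_l N a b c : \sum_(m < N.+1) bidiff m (bidiff (N - m) a b) c *+ 'C(N, m) = tridiff N a b c.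
Proof.
elim: N a b c => [|N IH] a b c; first by rewrite big_ord1.
rewrite (pascal (fun m l => bidiff m (bidiff l a b) c)) /=.
under [RHS]eq_bigr => j _ do rewrite -!IH -!big_split /=.
rewrite exchange_big /=; apply: eq_bigr => m _.
rewrite bidiff_suml -big_split /= -sumrMnl; apply: eq_bigr => j _.
by rewrite /D /E dl_bidiff bidiffDl !mulrnDl.
Qed.

Lemma bidiff_triple_r N a b c : \sum_(m < N.+1) bidiff m a (bidiff (N - m) b c) *+ 'C(N, m) = tridiff N a b c.
Proof.
elim: N a b c => [|N IH] a b c; first by rewrite big_ord1 /= mulrA.
rewrite (pascal (fun m l => bidiff m a (bidiff l b c))) /=.
under [RHS]eq_bigr => j _ do rewrite -!IH -!big_split /=.
rewrite exchange_big /=; apply: eq_bigr => m _.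
rewrite bidiff_sumr -big_split /= -sumrMnl; apply: eq_bigr => j _.
by rewrite /D /E dl_bidiff bidiffDr !mulrnDl [LHS]addrC -[LHS]addrA.
Qed.

End Bidifferential.

(** [wk m] stands for [(-i)^m / m!]. The divided-power law [wkM] captures what is needed of
    factorials without dividing in the ring. *)
Record weylData := WeylData {
  wn : nat; wS :> pzRingType; wdl : 'I_(wn + wn) -> wS -> wS; wk : nat -> wS;
  wdlD : forall i (a b : wS), wdl i (a + b)%R = (wdl i a + wdl i b)%R;
  wdlM : forall i (a b : wS), wdl i (a * b)%R = (wdl i a * b + a * wdl i b)%R;
  wdlC : forall i j (a : wS), wdl i (wdl j a) = wdl j (wdl i a);
  wk0 : wk 0 = 1%R;
  wkM : forall m l, (wk m * wk l)%R = (wk (m + l)%N *+ 'C(m + l, m))%R;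
  wk_const : forall m, const wdl (wk m);
  wk_central : forall m, central (wk m) }.

Section Sums.
Variable S : pzRingType.
Local Open Scope ring_scope.

Lemma sum_cut K k (F : nat -> S) : (k < K)%N -> (forall i, (k < i)%N -> F i = 0) -> \sum_(i < K) F i = \sum_(i < k.+1) F i.
Proof.
move=> kK F0; rewrite [RHS](big_ord_widen K F) // [RHS]big_mkcond; apply: eq_bigr => i _.
by case: ltnP => // ki; apply: F0.
Qed.

Lemma sum_only K (F : nat -> S) i0 : (i0 < K)%N -> (forall i, i != i0 -> F i = 0) -> \sum_(i < K) F i = F i0.
Proof.
move=> iK F0; rewrite (bigD1 (Ordinal iK)) //= big1 ?addr0 // => i; rewrite -val_eqE /=; exact: F0.
Qed.

Lemma sum_diagonal (k t : nat) (H : nat -> nat -> S) :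
  \sum_(m < k.+1) \sum_(l < k.+1) (if ((m + l).*2 + t == k)%N then H m l else 0) =
  \sum_(N < k.+1) (if (N.*2 + t == k)%N then \sum_(m < N.+1) H m (N - m)%N else 0).
Proof.
have X (N : 'I_k.+1) : \sum_(m < N.+1) H m (N - m)%N = \sum_(m < k.+1) \sum_(l < k.+1) (if (m + l)%N == N then H m l else 0).
  transitivity (\sum_(m < k.+1) (if m <= N then H m (N - m)%N else 0)).
    rewrite (sum_cut (k := N) (F := fun m => if m <= N then H m (N - m)%N else 0)) // => [|i]; last by rewrite ltnNge => /negbTE ->.
    by apply: eq_bigr => m _; rewrite -ltnS ltn_ord.
  apply: eq_bigr => m _; case: leqP => mN.
    have lt : N - m < k.+1 by apply: leq_ltn_trans (leq_subr _ _) (ltn_ord N).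
    rewrite (sum_only (F := fun l => if (m + l)%N == N then H m l else 0) lt) ?subnKC ?eqxx // => l lN.
    by case: eqP => // Nl; case/eqP: lN; rewrite -Nl addKn.
  by rewrite big1 // => l _; case: eqP => // E; move: mN; rewrite -E ltnNge leq_addr.
under [RHS]eq_bigr => N _ do rewrite X.
transitivity (\sum_(m < k.+1) \sum_(l < k.+1) \sum_(N < k.+1) (if (N.*2 + t == k)%N then if (m + l)%N == N then H m l else 0 else 0)).
  apply: eq_bigr => m _; apply: eq_bigr => l _; case: eqP => E.
    have lt : (m + l < k.+1)%N.
      by rewrite ltnS -[leqRHS]E -addnn -(addnA (m + l)%N) leq_addr.
    rewrite (sum_only (F := fun N => if (N.*2 + t == k)%N then if (m + l)%N == N then H m l else 0 else 0) lt) ?E ?eqxx // => N NE.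
    by rewrite [_ == N]eq_sym (negPf NE); case: ifP.
  by rewrite big1 // => N _; case: ifP => // /eqP E'; case: eqP => // E2; case: E; rewrite E2.
under [LHS]eq_bigr => m _ do rewrite exchange_big /=.
rewrite [LHS]exchange_big /=; apply: eq_bigr => N _; case: ifP => // _.
by rewrite big1 // => m _; rewrite big1.
Qed.

End Sums.

(* Series in [eps] with [eps^2] the deformation parameter, so that the [eps^k] term of a classical symbol is its [k]-th homogeneous term. *)
Record fseries (X : weylData) := FSeries { coef : nat -> wS X }.

Section StarRing.
Variable X : weylData.
Local Open Scope ring_scope.
Notation S := (wS X).
Notation Wb := (@bidiff (wn X) S (@wdl X)).
Notation k_ := (wk X).
Implicit Types (a b c : fseries X).

Lemma fseries_eq a b : (forall k, coef a k = coef b k) -> a = b.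
Proof. by case: a b => [a] [b] /= E; congr FSeries; apply: funext. Qed.

HB.instance Definition _ := gen_eqMixin (fseries X).
HB.instance Definition _ := gen_choiceMixin (fseries X).

Definition fs0 : fseries X := FSeries (fun _ => 0).
Definition fs_add a b := FSeries (fun k => coef a k + coef b k).
Definition fs_opp a := FSeries (fun k => - coef a k).

Lemma fs_addA : associative fs_add. Proof. by move=> a b c; apply: fseries_eq => k /=; rewrite addrA. Qed.
Lemma fs_addC : commutative fs_add. Proof. by move=> a b; apply: fseries_eq => k /=; rewrite addrC. Qed.
Lemma fs_add0 : left_id fs0 fs_add. Proof. by move=> a; apply: fseries_eq => k /=; rewrite add0r. Qed.
Lemma fs_addN : left_inverse fs0 fs_opp fs_add. Proof. by move=> a; apply: fseries_eq => k /=; rewrite addNr. Qed.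
HB.instance Definition _ := GRing.isZmodule.Build (fseries X) fs_addA fs_addC fs_add0 fs_addN.

(** The summation range [K] is kept apart from the index [k]: enlarging it changes nothing, by
    [starE], and nested products need a common range for reindexing. *)
Definition star_coef (a b : fseries X) K k : S := \sum_(m < K) \sum_(i < K) \sum_(j < K) (if (m.*2 + i + j == k)%N then k_ m * Wb m (coef a i) (coef b j) else 0).
Definition star a b := FSeries (fun k => star_coef a b k.+1 k).
Definition monom e (c : S) : fseries X := FSeries (fun k => if k == e then c else 0).

Lemma starE a b k K : (k < K)%N -> coef (star a b) k = star_coef a b K k.
Proof.
move=> kK; rewrite /= /star_coef.
have Z m i j : (k < m.*2 + i + j)%N -> (if (m.*2 + i + j == k)%N then k_ m * Wb m (coef a i) (coef b j) else 0) = 0.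
  by move=> H; rewrite (gtn_eqF H).
rewrite -(@sum_cut _ K k (fun m => \sum_(i < k.+1) \sum_(j < k.+1) (if (m.*2 + i + j == k)%N then k_ m * Wb m (coef a i) (coef b j) else 0))) // => [|m km]; last first.
  rewrite big1 // => i _; rewrite big1 // => j _; apply: Z; apply: leq_trans km _.
  by rewrite -addnn -!addnA leq_addr.
apply: eq_bigr => m _.
rewrite -(@sum_cut _ K k (fun i => \sum_(j < k.+1) (if (m.*2 + i + j == k)%N then k_ m * Wb m (coef a i) (coef b j) else 0))) // => [|i ki]; last first.
  by rewrite big1 // => j _; apply: Z; apply: leq_trans ki _; rewrite addnAC leq_addl.
apply: eq_bigr => i _.
by rewrite -(@sum_cut _ K k (fun j => if (m.*2 + i + j == k)%N then k_ m * Wb m (coef a i) (coef b j) else 0)) // => j kj; apply: Z; apply: leq_trans kj _; rewrite leq_addl.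
Qed.

Lemma const0 : const (@wdl X) 0.
Proof. by move=> i; apply: (dl0 (wdlD (w:=X))). Qed.

Lemma star_monoml e (c : S) b k : const (@wdl X) c -> coef (star (monom e c) b) k = if (e <= k)%N then c * coef b (k - e)%N else 0.
Proof.
move=> Hc; rewrite /= /star_coef.
have Hi i : const (@wdl X) (coef (monom e c) i) by rewrite /=; case: eqP => // _; exact: const0.
rewrite (sum_only (i0 := 0%N) (F := fun m => \sum_(i < k.+1) \sum_(j < k.+1) (if (m.*2 + i + j == k)%N then k_ m * Wb m (coef (monom e c) i) (coef b j) else 0))) //; last first.
  move=> [//|m] _; rewrite big1 // => i _; rewrite big1 // => j _.
  by rewrite (bidiff_constl (wdlD (w := X)) m (coef b j) (Hi i)) mulr0 if_same.
rewrite wk0; case: leqP => ek; last first.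
  rewrite big1 // => i _; rewrite big1 // => j _ /=; case: (val i =P e) => [|_]; last by rewrite mul0r mulr0 if_same.
  by move=> Ei; have := ltn_ord i; rewrite Ei ltnS leqNgt ek.
rewrite (sum_only (i0 := e) (F := fun i => \sum_(j < k.+1) (if (0.*2 + i + j == k)%N then 1 * Wb 0 (coef (monom e c) i) (coef b j) else 0))) ?ltnS //; last first.
  by move=> i /negPf ie; rewrite big1 // => j _; rewrite /= ie mul0r mulr0 if_same.
rewrite (sum_only (i0 := (k - e)%N) (F := fun j => (if (0.*2 + e + j == k)%N then 1 * Wb 0 (coef (monom e c) e) (coef b j) else 0))) ?ltnS ?leq_subr //=; last first.
  by move=> j jk; rewrite add0n; case: eqP => // E; case/eqP: jk; rewrite -E addKn.
by rewrite add0n subnKC // !eqxx mul1r.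
Qed.

Lemma star_monomr e (c : S) a k : const (@wdl X) c -> coef (star a (monom e c)) k = if (e <= k)%N then coef a (k - e)%N * c else 0.
Proof.
move=> Hc; rewrite /= /star_coef.
have Hi i : const (@wdl X) (coef (monom e c) i) by rewrite /=; case: eqP => // _; exact: const0.
rewrite (sum_only (i0 := 0%N) (F := fun m => \sum_(i < k.+1) \sum_(j < k.+1) (if (m.*2 + i + j == k)%N then k_ m * Wb m (coef a i) (coef (monom e c) j) else 0))) //; last first.
  move=> [//|m] _; rewrite big1 // => i _; rewrite big1 // => j _.
  by rewrite (bidiff_constr (wdlD (w := X)) m (coef a i) (Hi j)) mulr0 if_same.
rewrite wk0; under eq_bigr => i _ do under eq_bigr => j _ do rewrite addnAC.
rewrite exchange_big /=; case: leqP => ek; last first.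
  rewrite big1 // => i _; rewrite big1 // => j _ /=; case: (val i =P e) => [|_]; last by rewrite !mulr0 if_same.
  by move=> Ei; have := ltn_ord i; rewrite Ei ltnS leqNgt ek.
rewrite (sum_only (i0 := e) (F := fun j => \sum_(i < k.+1) (if (0.*2 + j + i == k)%N then 1 * (coef a i * coef (monom e c) j) else 0))) ?ltnS //; last first.
  by move=> i /negPf ie; rewrite big1 // => j _; rewrite /= ie !mulr0 if_same.
rewrite (sum_only (i0 := (k - e)%N) (F := fun i => (if (0.*2 + e + i == k)%N then 1 * (coef a i * coef (monom e c) e) else 0))) ?ltnS ?leq_subr //=; last first.
  by move=> j jk; rewrite add0n; case: eqP => // E; case/eqP: jk; rewrite -E addKn.
by rewrite add0n subnKC // !eqxx mul1r.
Qed.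

Lemma star_addl a a' b : star (a + a') b = star a b + star a' b.
Proof.
apply: fseries_eq => k; rewrite /= /star_coef -big_split; apply: eq_bigr => m _.
rewrite -big_split; apply: eq_bigr => i _; rewrite -big_split; apply: eq_bigr => j _ /=.
by case: ifP => _; rewrite ?addr0 // (bidiffDl (wdlD (w := X))) mulrDr.
Qed.
Lemma star_addr a b b' : star a (b + b') = star a b + star a b'.
Proof.
apply: fseries_eq => k; rewrite /= /star_coef -big_split; apply: eq_bigr => m _.
rewrite -big_split; apply: eq_bigr => i _; rewrite -big_split; apply: eq_bigr => j _ /=.
by case: ifP => _; rewrite ?addr0 // (bidiffDr (wdlD (w := X))) mulrDr.
Qed.

(** Reindexing only: the index [e] of the inner product is eliminated, and the two bidifferential
    orders are collected by their sum [N]. *)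
Lemma starA_sum k (H : nat -> nat -> nat -> nat -> nat -> S) :
  \sum_(m < k.+1) \sum_(e < k.+1) \sum_(r < k.+1) (if (m.*2 + e + r == k)%N then
    \sum_(l < k.+1) \sum_(i < k.+1) \sum_(j < k.+1) (if (l.*2 + i + j == e)%N then H m l i j r else 0) else 0) =
  \sum_(i < k.+1) \sum_(j < k.+1) \sum_(r < k.+1) \sum_(N < k.+1) (if (N.*2 + (i + j + r) == k)%N then \sum_(m < N.+1) H m (N - m)%N i j r else 0).
Proof.
transitivity (\sum_(i < k.+1) \sum_(j < k.+1) \sum_(r < k.+1) \sum_(m < k.+1) \sum_(l < k.+1) (if ((m + l).*2 + (i + j + r) == k)%N then H m l i j r else 0)); last first.
  do 3 (apply: eq_bigr => ? _); exact: (sum_diagonal k _ (fun m l => H m l _ _ _)).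
pose G m l i j r := \sum_(e < k.+1) (if (m.*2 + e + r == k)%N then if (l.*2 + i + j == e)%N then H m l i j r else 0 else 0).
have EG (m l i j r : 'I_k.+1) : G m l i j r = if ((m + l).*2 + (i + j + r) == k)%N then H m l i j r else 0.
  rewrite /G; have -> : ((m + l).*2 + (i + j + r) = m.*2 + (l.*2 + i + j) + r)%N by rewrite doubleD !addnA.
  case: eqP => E.
    have lt : (l.*2 + i + j < k.+1)%N by rewrite ltnS -[leqRHS]E -(addnA _ (l.*2 + i + j)%N) (addnCA _ (l.*2 + i + j)%N) leq_addr.
    rewrite (sum_only (F := fun e => if (m.*2 + e + r == k)%N then if (l.*2 + i + j == e)%N then H m l i j r else 0 else 0) lt) ?E ?eqxx // => e ne.
    by rewrite [_ == e]eq_sym (negPf ne) if_same.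
  by rewrite big1 // => e _; case: ifP => // /eqP E'; case: eqP => // E2; case: E; rewrite E2.
transitivity (\sum_(m < k.+1) \sum_(r < k.+1) \sum_(l < k.+1) \sum_(i < k.+1) \sum_(j < k.+1) G m l i j r).
  apply: eq_bigr => m _; rewrite [LHS]exchange_big; apply: eq_bigr => r _.
  rewrite /G; under [RHS]eq_bigr => l _ do under eq_bigr => i _ do rewrite exchange_big /=.
  under [RHS]eq_bigr => l _ do rewrite exchange_big /=.
  rewrite [RHS]exchange_big /=; apply: eq_bigr => e _; case: ifP => // _.
  by rewrite big1 // => l _; rewrite big1 // => i _; rewrite big1.
transitivity (\sum_(i < k.+1) \sum_(j < k.+1) \sum_(r < k.+1) \sum_(m < k.+1) \sum_(l < k.+1) G m l i j r); last first.
  by do 5 (apply: eq_bigr => ? _); rewrite EG.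
under [LHS]eq_bigr => m _ do under eq_bigr => r _ do rewrite exchange_big /=.
under [LHS]eq_bigr => m _ do rewrite exchange_big /=.
rewrite [LHS]exchange_big; apply: eq_bigr => i _ /=.
under [LHS]eq_bigr => m _ do under eq_bigr => r _ do rewrite exchange_big /=.
under [LHS]eq_bigr => m _ do rewrite exchange_big /=.
rewrite [LHS]exchange_big; apply: eq_bigr => j _ /=.
by rewrite [LHS]exchange_big.
Qed.

(** Both bracketings become sums of [wk N] times [tridiff N]; the binomial coefficients produced by
    [wkM] are those that [bidiff_triple_l] and [bidiff_triple_r] absorb. *)
Lemma starA : associative star.
Proof.
move=> a b c; apply: fseries_eq => k.
pose T N (i j r : nat) := k_ N * @tridiff (wn X) S (@wdl X) N (coef a i) (coef b j) (coef c r).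
transitivity (\sum_(i < k.+1) \sum_(j < k.+1) \sum_(r < k.+1) \sum_(N < k.+1) (if (N.*2 + (i + j + r) == k)%N then T N i j r else 0)).
  transitivity (\sum_(m < k.+1) \sum_(e < k.+1) \sum_(i < k.+1) (if (m.*2 + e + i == k)%N then
    \sum_(l < k.+1) \sum_(j < k.+1) \sum_(r < k.+1) (if (l.*2 + j + r == e)%N then k_ m * k_ l * Wb m (coef a i) (Wb l (coef b j) (coef c r)) else 0) else 0)).
    apply: eq_bigr => m _; rewrite exchange_big; apply: eq_bigr => e _; apply: eq_bigr => i _; rewrite addnAC; case: ifP => // _.
    rewrite (starE b c (ltn_ord e)) /star_coef.
    do 3 (rewrite (bidiff_sumr (wdlD (w := X))) mulr_sumr; apply: eq_bigr => ? _).
    case: ifP => _; last by rewrite (bidiff0r (wdlD (w := X))) mulr0.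
    by rewrite (bidiffMr (wdlM (w := X))) ?mulrA //; [exact: wk_const | exact: wk_central].
  rewrite (starA_sum k (fun m l j r i => k_ m * k_ l * Wb m (coef a i) (Wb l (coef b j) (coef c r)))).
  under [LHS]eq_bigr => j _ do rewrite exchange_big /=.
  rewrite [LHS]exchange_big; apply: eq_bigr => i _; apply: eq_bigr => j _; apply: eq_bigr => r _; apply: eq_bigr => N _.
  rewrite -(addnA i) [(i + _)%N]addnC; case: ifP => // _.
  rewrite /T -(bidiff_triple_r (wdlD (w := X)) (wdlM (w := X)) (wdlC (w := X))) mulr_sumr; apply: eq_bigr => m _.
  by rewrite wkM subnKC ?mulrnAl ?mulrnAr // -ltnS ltn_ord.
symmetry; transitivity (\sum_(m < k.+1) \sum_(e < k.+1) \sum_(r < k.+1) (if (m.*2 + e + r == k)%N then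
    \sum_(l < k.+1) \sum_(i < k.+1) \sum_(j < k.+1) (if (l.*2 + i + j == e)%N then k_ m * k_ l * Wb m (Wb l (coef a i) (coef b j)) (coef c r) else 0) else 0)).
  apply: eq_bigr => m _; apply: eq_bigr => e _; apply: eq_bigr => r _; case: ifP => // _.
  rewrite (starE a b (ltn_ord e)) /star_coef.
  do 3 (rewrite (bidiff_suml (wdlD (w := X))) mulr_sumr; apply: eq_bigr => ? _).
  case: ifP => _; last by rewrite (bidiff0l (wdlD (w := X))) mulr0.
  by rewrite (bidiffMl (wdlM (w := X))) ?mulrA //; exact: wk_const.
rewrite (starA_sum k (fun m l i j r => k_ m * k_ l * Wb m (Wb l (coef a i) (coef b j)) (coef c r))).
do 4 (apply: eq_bigr => ? _); case: ifP => // _.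
rewrite /T -(bidiff_triple_l (wdlD (w := X)) (wdlM (w := X)) (wdlC (w := X))) mulr_sumr; apply: eq_bigr => m _.
by rewrite wkM subnKC ?mulrnAl ?mulrnAr // -ltnS ltn_ord.
Qed.

Lemma const1 : const (@wdl X) 1. Proof. by move=> i; exact: (dl1 (wdlM (w := X))). Qed.
Lemma star1l : left_id (monom 0 1) star.
Proof. by move=> a; apply: fseries_eq => k; rewrite (star_monoml _ _ _ const1) leq0n subn0 mul1r. Qed.
Lemma star1r : right_id (monom 0 1) star.
Proof. by move=> a; apply: fseries_eq => k; rewrite (star_monomr _ _ _ const1) leq0n subn0 mulr1. Qed.
HB.instance Definition _ := GRing.Zmodule_isPzRing.Build (fseries X) starA star1l star1r star_addl star_addr.

Lemma coefD a b k : coef (a + b) k = coef a k + coef b k. Proof. by []. Qed.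
Lemma coefN a k : coef (- a) k = - coef a k. Proof. by []. Qed.
Lemma coefB a b k : coef (a - b) k = coef a k - coef b k. Proof. by []. Qed.
Lemma coef0 k : coef (0 : fseries X) k = 0. Proof. by []. Qed.
Lemma coefMn a j k : coef (a *+ j) k = coef a k *+ j.
Proof. by elim: j => [|j IH] //; rewrite !mulrS coefD IH. Qed.
Lemma coef_sum (I : Type) (r : seq I) P (F : I -> fseries X) k : coef (\sum_(i <- r | P i) F i) k = \sum_(i <- r | P i) coef (F i) k.
Proof. exact: (big_morph (fun a => coef a k) (fun a b => coefD a b k) (coef0 k)). Qed.
Lemma coefM a b k : coef (a * b) k = \sum_(m < k.+1) \sum_(i < k.+1) \sum_(j < k.+1) (if (m.*2 + i + j == k)%N then k_ m * Wb m (coef a i) (coef b j) else 0).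
Proof. by []. Qed.

Definition order_ge d a := forall k, (k < d)%N -> coef a k = 0.

(** Bidifferential terms of positive order raise the index, so leading coefficients multiply as ring
    elements, without derivatives. *)
Lemma order_geM d e a b : order_ge d a -> order_ge e b -> order_ge (d + e) (a * b) /\ coef (a * b) (d + e) = coef a d * coef b e.
Proof.
move=> Ha Hb; have Z k m i j : (k <= d + e)%N -> (m.*2 + i + j == k)%N -> [|| (0 < m)%N, i != d | j != e] -> Wb m (coef a i) (coef b j) = 0.
  move=> kd /eqP E H; case: (ltnP i d) => [/Ha ->|di]; first exact: (bidiff0l (wdlD (w := X))).
  case: (ltnP j e) => [/Hb ->|ej]; first exact: (bidiff0r (wdlD (w := X))).
  by exfalso; move: E H; lia.
split=> [k kd|].
  rewrite coefM big1 // => m _; rewrite big1 // => i _; rewrite big1 // => j _; case: ifP => // E.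
  rewrite (Z k) ?mulr0 //; first exact: ltnW.
  by move: E; lia.
rewrite coefM (sum_only (i0 := 0%N) (F := fun m => \sum_(i < (d + e).+1) \sum_(j < (d + e).+1) (if (m.*2 + i + j == d + e)%N then k_ m * Wb m (coef a i) (coef b j) else 0))) //; last first.
  by move=> m m0; rewrite big1 // => i _; rewrite big1 // => j _; case: ifP => // E; rewrite (Z (d + e)%N) ?mulr0 // lt0n m0.
rewrite (sum_only (i0 := d) (F := fun i => \sum_(j < (d + e).+1) (if (0.*2 + i + j == d + e)%N then k_ 0%N * Wb 0 (coef a i) (coef b j) else 0))) ?ltnS ?leq_addr //; last first.
  by move=> i id; rewrite big1 // => j _; case: ifP => // E; rewrite (Z (d + e)%N) ?mulr0 // id orbT.
rewrite (sum_only (i0 := e) (F := fun j => (if (0.*2 + d + j == d + e)%N then k_ 0%N * Wb 0 (coef a d) (coef b j) else 0))) ?ltnS ?leq_addl //; last first.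
  by move=> j je; case: ifP => // E; rewrite (Z (d + e)%N) ?mulr0 // je !orbT.
by rewrite eqxx wk0 mul1r.
Qed.

End StarRing.

(** * The residue of a formal idempotent *)

Section FormalResidue.
Variable X : weylData.
Local Open Scope ring_scope.
Notation n := (wn X).
Notation S := (wS X).
Notation dl := (@wdl X).
Notation Wb := (@bidiff n S dl).
Notation k_ := (wk X).
Notation T := ('I_n * bool)%type.
Local Notation om := (@omega n int).
Let D j := dl (rshift n j).
Let E j := dl (lshift n j).

(* [Hs d k s] stands for homogeneity of degree [d - k]; [Dv s] says that the trace of [s] is a divergence. *)
Variables (Hs : nat -> nat -> S -> Prop) (Dv : S -> Prop).
Hypothesis Hs0 : forall d k, Hs d k 0.
Hypothesis HsB : forall d k a b, Hs d k a -> Hs d k b -> Hs d k (a - b).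
Hypothesis HsM : forall d k e l a b, Hs d k a -> Hs e l b -> Hs (d + e) (k + l) (a * b).
Hypothesis Hs_dl : forall d k i a, Hs d k a -> Hs d k.+1 (dl i a).
Hypothesis Hs_k : forall d m, Hs d d (k_ m).
Hypothesis Dv0 : Dv 0.
Hypothesis DvB : forall a b, Dv a -> Dv b -> Dv (a - b).
Hypothesis DvC : forall a b, Dv (a * b - b * a).
Hypothesis Dvk : forall m a, Dv a -> Dv (k_ m * a).
Hypothesis Dv_dl : forall d k i a, Hs d k a -> (d + n.*2 = k.+1)%N -> Dv (dl i a).

Lemma Dv_add a b : Dv a -> Dv b -> Dv (a + b).
Proof. by move=> Ha Hb; rewrite -[b]opprK; apply: DvB => //; rewrite -[- b]add0r; apply: DvB. Qed.
Lemma Dv_sum (I : Type) (r : seq I) (P : pred I) (F : I -> S) : (forall i, P i -> Dv (F i)) -> Dv (\sum_(i <- r | P i) F i).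
Proof. by move=> H; apply: (big_ind Dv) => //; exact: Dv_add. Qed.
Lemma Hs_add d k a b : Hs d k a -> Hs d k b -> Hs d k (a + b).
Proof. by move=> Ha Hb; rewrite -[b]opprK; apply: HsB => //; rewrite -[- b]add0r; apply: HsB. Qed.
Lemma Hs_sum d k (I : Type) (r : seq I) (P : pred I) (F : I -> S) : (forall i, P i -> Hs d k (F i)) -> Hs d k (\sum_(i <- r | P i) F i).
Proof. by move=> H; apply: (big_ind (Hs d k)) => //; exact: Hs_add. Qed.

Lemma Hs_bidiff m d i e j a b : Hs d i a -> Hs e j b -> Hs (d + e) (m.*2 + i + j) (Wb m a b).
Proof.
elim: m i j a b => [|m IH] i j a b Ha Hb; first exact: HsM.
apply: Hs_sum => l _; have := IH _ _ _ _ (Hs_dl (rshift n l) Ha) (Hs_dl (lshift n l) Hb).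
by have -> : (m.*2 + i.+1 + j.+1 = m.+1.*2 + i + j)%N by lia.
Qed.

(* Integration by parts: the two first-order terms differ by the divergence E_l W(b, D_l a) - D_l W(b, E_l a). *)
Lemma bidiff_trace m d i e j a b : Hs d i a -> Hs e j b -> (d + e = n.*2)%N -> (m.*2 + i + j = n.*2.*2)%N ->
  Dv (Wb m a b - Wb m b a).
Proof.
elim: m i j a b => [|m IH] i j a b Ha Hb Hde Hk; first exact: DvC.
rewrite /= -sumrB; apply: Dv_sum => l _; rewrite -/(D l a) -/(E l b) -/(D l b) -/(E l a).
have H1 : Dv (Wb m (D l a) (E l b) - Wb m (E l b) (D l a)).
  by apply: (IH i.+1 j.+1) => //; try (exact: Hs_dl); lia.
have P1 : E l (Wb m b (D l a)) = Wb m (E l b) (D l a) + Wb m b (E l (D l a)).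
  exact: (dl_bidiff (wdlD (w := X)) (wdlM (w := X)) (wdlC (w := X))).
have P2 : D l (Wb m b (E l a)) = Wb m (D l b) (E l a) + Wb m b (D l (E l a)).
  exact: (dl_bidiff (wdlD (w := X)) (wdlM (w := X)) (wdlC (w := X))).
have Hd u v : Hs (e + d) (m.*2 + j + i.+1) (Wb m b (dl u a)) /\ Dv (dl v (Wb m b (dl u a))).
  have H := Hs_bidiff m Hb (Hs_dl u Ha); split=> //; apply: (Dv_dl v H); lia.
have := Dv_add H1 (DvB (proj2 (Hd (rshift n l) (lshift n l))) (proj2 (Hd (lshift n l) (rshift n l)))).
rewrite -/(D l a) -/(E l a) -/(E l _) -/(D l _) P1 P2.
have -> : E l (D l a) = D l (E l a) by exact: wdlC.
move: (Wb m b (D l (E l a))) (Wb m (E l b) (D l a)) => u v.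
by move: (Wb m (D l b) (E l a)) => w; rewrite (addrC w) addrKA addrA subrK.
Qed.

Definition HomA d (x : fseries X) := forall k, Hs d k (coef x k).
(** In a series of degree [2n] the coefficient of index [4n] has degree [-2n], the critical degree
    for integrals over the sphere in dimension [2n]. *)
Definition NullA (x : fseries X) := Dv (coef x n.*2.*2).

Lemma HomA_M d e x y : HomA d x -> HomA e y -> HomA (d + e) (x * y).
Proof.
move=> Hx Hy k; rewrite coefM; apply: Hs_sum => m _; apply: Hs_sum => i _; apply: Hs_sum => j _; case: eqP => // Ek.
by have := HsM (Hs_k 0 m) (Hs_bidiff m (Hx i) (Hy j)); rewrite !add0n {1}Ek.
Qed.

Lemma NullA_C d e x y : HomA d x -> HomA e y -> (d + e = n.*2)%N -> NullA (x * y - y * x).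
Proof.
move=> Hx Hy Hde; rewrite /NullA coefB !coefM -sumrB; apply: Dv_sum => m _.
rewrite [X in _ - X]exchange_big -sumrB; apply: Dv_sum => i _; rewrite -sumrB; apply: Dv_sum => j _.
rewrite [(_ + j + i)%N]addnAC; case: eqP => H; last by rewrite subrr.
by rewrite -mulrBr; apply: Dvk; apply: bidiff_trace H.
Qed.

Variable z : 'I_(n + n) -> S.
Hypothesis z_dl : forall i j, dl i (z j) = (i == j)%:R.
Hypothesis zC : forall i, central (z i).
Hypothesis zreg : forall s, (forall i, z i * s = 0) -> s = 0.
Hypothesis Hs_z : forall i, Hs 1 0 (z i).

Let ix (t : T) := if t.2 then lshift n t.1 else rshift n t.1.
Let Z t : fseries X := monom 0 (z (ix t)).
Let kap : fseries X := monom 2 (k_ 1).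
(** The Hamiltonian derivation belonging to the coordinate [Z t], up to the factor [kap], see
    [comm_Z]. *)
Let dlt (t : T) a := if t.2 then - D t.1 a else E t.1 a.

Lemma const_nat c : const dl c%:R.
Proof. by move=> i; elim: c => [|c IH]; rewrite ?(dl0 (wdlD (w := X))) // mulrS wdlD IH (dl1 (wdlM (w := X))) addr0. Qed.

Lemma bidiff_const2l m c b : (forall i, const dl (dl i c)) -> Wb m.+2 c b = 0.
Proof. by move=> H; rewrite /= big1 // => j _; apply: (bidiff_constl (wdlD (w := X)) m _ (H _)). Qed.
Lemma bidiff_const2r m c b : (forall i, const dl (dl i c)) -> Wb m.+2 b c = 0.
Proof. by move=> H; rewrite /= big1 // => j _; apply: (bidiff_constr (wdlD (w := X)) m _ (H _)). Qed.

Lemma star_monom0l c b k : coef (monom 0 c * b) k = \sum_(m < k.+1) if (m.*2 <= k)%N then k_ m * Wb m c (coef b (k - m.*2)%N) else 0.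
Proof.
rewrite coefM; apply: eq_bigr => m _.
rewrite (sum_only (i0 := 0%N) (F := fun i => \sum_(j < k.+1) (if (m.*2 + i + j == k)%N then k_ m * Wb m (coef (monom 0 c) i) (coef b j) else 0))) //; last first.
  by move=> i /negPf i0; rewrite big1 // => j _; rewrite /= i0 (bidiff0l (wdlD (w := X))) mulr0 if_same.
rewrite addn0; case: leqP => mk; last by rewrite big1 // => j _; case: eqP => //; lia.
rewrite (sum_only (i0 := (k - m.*2)%N) (F := fun j => (if (m.*2 + j == k)%N then k_ m * Wb m (coef (monom 0 c) 0) (coef b j) else 0))) ?ltnS ?leq_subr // ?subnKC ?eqxx // => j jk.
by case: eqP => //; lia.
Qed.

Lemma star_monom0r c b k : coef (b * monom 0 c) k = \sum_(m < k.+1) if (m.*2 <= k)%N then k_ m * Wb m (coef b (k - m.*2)%N) c else 0.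
Proof.
rewrite coefM; apply: eq_bigr => m _.
rewrite exchange_big (sum_only (i0 := 0%N) (F := fun j => \sum_(i < k.+1) (if (m.*2 + i + j == k)%N then k_ m * Wb m (coef b i) (coef (monom 0 c) j) else 0))) //; last first.
  by move=> i /negPf i0; rewrite big1 // => j _; rewrite /= i0 (bidiff0r (wdlD (w := X))) mulr0 if_same.
case: leqP => mk; last by rewrite big1 // => j _; case: eqP => //; lia.
rewrite (sum_only (i0 := (k - m.*2)%N) (F := fun j => (if (m.*2 + j + 0 == k)%N then k_ m * Wb m (coef b j) (coef (monom 0 c) 0) else 0))) ?ltnS ?leq_subr // ?addn0 ?subnKC ?eqxx // => j jk.
by case: eqP => //; lia.
Qed.

(** The terms of order 0 cancel because coordinates are central, and those of order at least 2
    vanish because coordinates have constant first derivatives. What is left is exactly a Poisson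
    bracket. *)
Lemma comm_Z t b : Z t * b - b * Z t = kap * FSeries (fun k => dlt t (coef b k)).
Proof.
have C2 i : const dl (dl i (z (ix t))) by rewrite z_dl; exact: const_nat.
apply: fseries_eq => k; rewrite coefB star_monom0l star_monom0r (star_monoml _ _ _ (@wk_const X 1)) -sumrB.
case: k => [|[|k]].
- by rewrite big_ord1 /= wk0 zC subrr.
- by rewrite big_ord_recl big_ord1 /= wk0 zC subrr subrr addr0.
rewrite 2!big_ord_recl big1 ?addr0 => [|m _]; last first.
  by case: ifP => _; rewrite ?subrr // bidiff_const2l // bidiff_const2r // subrr.
rewrite /= wk0 zC subrr add0r subSS subSS subn0 -mulrBr; congr (_ * _).
rewrite /dlt /ix; case: t {C2} => j [] /=.
  rewrite big1 ?sub0r => [|i _]; last by rewrite z_dl eq_rlshift mul0r.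
  rewrite (bigD1 j) //= z_dl eqxx mulr1 big1 ?addr0 // => i /negPf ij.
  by rewrite z_dl (inj_eq (@lshift_inj _ _)) ij mulr0.
rewrite [X in _ - X]big1 ?subr0 => [|i _]; last by rewrite z_dl eq_lrshift mulr0.
rewrite (bigD1 j) //= z_dl eqxx mul1r big1 ?addr0 // => i /negPf ij.
by rewrite z_dl (inj_eq (@rshift_inj _ _)) ij mul0r.
Qed.

Lemma kap_central x : kap * x = x * kap.
Proof.
apply: fseries_eq => k; rewrite (star_monoml _ _ _ (@wk_const X 1)) (star_monomr _ _ _ (@wk_const X 1)).
by case: ifP => // _; rewrite wk_central.
Qed.

Lemma comm_ZZ t u : Z t * Z u - Z u * Z t = kap *~ om t u.
Proof.
rewrite comm_Z; have -> : FSeries (fun k => dlt t (coef (Z u) k)) = 1 *~ om t u; last by rewrite mulrzAr mulr1.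
have d0 : dlt t 0 = 0 by rewrite /dlt /D /E !(dl0 (wdlD (w := X))) oppr0 if_same.
have e1 : dlt t (z (ix u)) = 1 *~ om t u.
  rewrite /dlt /omega /D /E !z_dl /ix; case: t u {d0} => j [] [k []] /=; rewrite ?andbF ?andbT ?mulr0z.
  - by rewrite eq_rlshift oppr0.
  - by rewrite (inj_eq (@rshift_inj _ _)); case: (j == k); rewrite ?expr1 ?oppr0 ?mulr0z // mulrN1z.
  - by rewrite (inj_eq (@lshift_inj _ _)); case: (j == k); rewrite ?expr0 ?mulr0z.
  - by rewrite eq_lrshift.
have cz (w : int) k : coef ((1 : fseries X) *~ w) k = if (k == 0)%N then 1 *~ w else 0.
  by case: w => m; rewrite ?NegzE ?mulrNz -?pmulrn ?coefN coefMn /=; case: ifP; rewrite ?mul0rn ?oppr0.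
by apply: fseries_eq => k; rewrite cz /=; case: ifP.
Qed.

Variable p : fseries X.
Hypothesis pp : p * p = p.
Hypothesis Hp : HomA 0 p.
Hypothesis euler_p : \sum_i z i * dl i (coef p 0) = 0.
Hypothesis n_gt0 : (0 < n)%N.

Let q := 1 - p.
Let gam := p - q.
Let B t := p * Z t * q + q * Z t * p.
Let A t := p * Z t * p + q * Z t * q.
Let Xt t := - coef gam 0 * (k_ 1 * dlt t (coef p 0)).

(** Written through a commutator with [Z t], the off-diagonal part is seen by [comm_Z] to start at
    index 2 with first derivatives of [p]. *)
Lemma B_comm t : B t = - gam * (Z t * p - p * Z t).
Proof.
have qp0 : q * p = 0 by rewrite /q mulrBl mul1r pp subrr.
rewrite /B /gam {1}/q mulrBr mulr1 opprB [RHS]mulrBl !mulrBr !mulrA qp0 mul0r subr0 pp opprB.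
by rewrite addrC.
Qed.

Lemma B_order t : order_ge 2 (B t) /\ coef (B t) 2 = Xt t.
Proof.
pose Q := FSeries (fun k => dlt t (coef p k)).
have [oK _] : order_ge 2 kap /\ True by split=> // k /=; case: eqP => // ->.
have o0 (x : fseries X) : order_ge 0 x by [].
have [o1 c1] := order_geM oK (o0 Q); have [o2 c2] := order_geM (o0 (- gam)) o1.
by rewrite B_comm comm_Z; split=> //; apply: etrans c2 _; exact: (congr1 (fun x => - coef gam 0 * x) c1).
Qed.

(** Each index is paired with the coordinate along which its [dlt] differentiates, with matching
    sign, so the sum is a multiple of the Euler field applied to the degree 0 term. *)
Lemma Xt_dependent : \sum_t (let c := if t.2 then - z (rshift n t.1) else z (lshift n t.1) in c * Xt t) = 0.
Proof.
have F (t : T) : (let c := if t.2 then - z (rshift n t.1) else z (lshift n t.1) in c * Xt t) =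
    - coef gam 0 * (k_ 1 * (z (if t.2 then rshift n t.1 else lshift n t.1) * dl (if t.2 then rshift n t.1 else lshift n t.1) (coef p 0))).
  by rewrite /Xt /dlt /=; case: t => j [] /=; rewrite ?mulNr ?mulrN ?opprK ?mulrA zC -?mulrA ?[z _ * (k_ 1 * _)]mulrA ?[z _ * k_ 1]zC ?mulrA.
rewrite (eq_bigr _ (fun t _ => F t)) -!mulr_sumr.
have -> : \sum_(t : T) z (if t.2 then rshift n t.1 else lshift n t.1) * dl (if t.2 then rshift n t.1 else lshift n t.1) (coef p 0) = \sum_i z i * dl i (coef p 0).
  rewrite big_split_ord /= -(pair_big xpredT xpredT (fun j b => z (if b then rshift n j else lshift n j) * dl (if b then rshift n j else lshift n j) (coef p 0))) /= -big_split.
  by apply: eq_bigr => j _; rewrite big_bool /= addrC.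
by rewrite euler_p !mulr0.
Qed.

(** Each of the [2n] factors has order 2, so index [4n] sees just the product of leading
    coefficients. By [altsum_dependent] their alternating sum is killed by every coordinate, and
    [zreg] makes it 0. *)
Lemma altsum_offdiag_null : NullA (altsum (fun s => gam * \prod_(t <- pos (enum 'I_n)) B (s t))).
Proof.
have O (s : {perm T}) w : order_ge (size w).*2 (\prod_(t <- w) B (s t)) /\ coef (\prod_(t <- w) B (s t)) (size w).*2 = \prod_(t <- w) Xt (s t).
  elim: w => [|t w [o1 c1]]; first by rewrite !big_nil.
  rewrite !big_cons; have [o2 c2] := B_order (s t).
  by have [o3 c3] := order_geM o2 o1; rewrite /= doubleS -c2 -c1 -c3.
have O2 (s : {perm T}) : coef (gam * \prod_(t <- pos (enum 'I_n)) B (s t)) n.*2.*2 = coef gam 0 * \prod_(t <- pos (enum 'I_n)) Xt (s t).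
  have [o1 c1] := O s (pos (enum 'I_n)); have o0 : order_ge 0 gam by [].
  have [_ c2] := order_geM o0 o1; move: c1 c2; rewrite size_pos size_enum_ord add0n => <- //.
rewrite /NullA /altsum coef_sum.
have -> : \sum_(s : {perm T}) coef ((-1) ^+ odd_perm s * (gam * \prod_(t <- pos (enum 'I_n)) B (s t))) n.*2.*2 =
    coef gam 0 * altsum (fun s => \prod_(t <- pos (enum 'I_n)) Xt (s t)).
  rewrite -altsumMl; apply: eq_bigr => s _; rewrite -O2.
  by case: (odd_perm s); rewrite ?expr1 ?expr0 ?mul1r // !mulN1r coefN.
have -> : altsum (fun s => \prod_(t <- pos (enum 'I_n)) Xt (s t)) = 0; last by rewrite mulr0.
pose c (t : T) := if t.2 then - z (rshift n t.1) else z (lshift n t.1).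
have cC t x : c t * x = x * c t by rewrite /c; case: t.2; rewrite ?mulNr ?mulrN zC.
have H := altsum_dependent cC Xt_dependent (w := pos (enum 'I_n)) _ (uniq_pos (enum_uniq _)) (fun t => etrans (mem_pos _ t) (mem_enum _ _)).
apply: zreg => i; case: (split_ordP i) => j ->.
  by have := H (j, false).
by have := H (j, true); rewrite /c /= mulNr => /eqP; rewrite oppr_eq0 => /eqP.
Qed.

Theorem formal_residue : exists m, Dv ((k_ 1 ^+ n * (coef p n.*2 *+ 2)) *+ m.+1).
Proof.
have HB d x y : HomA d x -> HomA d y -> HomA d (x - y) by move=> Hx Hy k; rewrite coefB; apply: HsB.
have HD d x y : HomA d x -> HomA d y -> HomA d (x + y) by move=> Hx Hy k; rewrite coefD; apply: Hs_add.
have Hmon d e (c : S) : Hs d e c -> HomA d (monom e c) by move=> Hc k /=; case: eqP => // ->.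
have H1 : HomA 0 1 by apply: Hmon; rewrite -(wk0 X); exact: Hs_k.
have HZ t : HomA 1 (Z t) by apply: Hmon; exact: Hs_z.
have Hq : HomA 0 q by exact: HB.
have pDq : p + q = 1 by rewrite /q addrC subrK.
have M3 x y t : HomA 0 x -> HomA 0 y -> HomA 1 (x * Z t * y) by move=> Hx Hy; exact: (@HomA_M 1 0 _ _ (@HomA_M 0 1 _ _ Hx (HZ t)) Hy).
have HBt t : HomA 1 (B t) by apply: HD; exact: M3.
have HAt t : HomA 1 (A t) by apply: HD; exact: M3.
have gA t : gam * A t = A t * gam.
  have ev := even_A Z pp pDq t; have ev2 := even_q pDq ev.
  by rewrite /gam mulrBl mulrBr ev ev2.
have [] // := @alternating_reduction n (fseries X) A B kap gam kap_central _ _ gA NullA HomA _ _ _ HB HomA_M H1 HAt HBt _ _ NullA_C altsum_offdiag_null.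
- by move=> t u; exact: (proj1 (cm_split pp pDq kap_central comm_ZZ t u)).
- by move=> t u; exact: (proj2 (cm_split pp pDq kap_central comm_ZZ t u)).
- by move=> x y Hx Hy; rewrite /NullA coefB; apply: DvB.
- by apply: Hmon; exact: Hs_k.
- exact: HB.
move=> m; rewrite /NullA coefMn => Hm; exists m.
suff <- : coef (kap ^+ n * gam) n.*2.*2 = k_ 1 ^+ n * (coef p n.*2 *+ 2) by [].
(* [kap ^+ n] shifts the index by [2n], so index [4n] of the product shows index [2n] of
   [gam = 2 p - 1]; the constant has no such term because [n > 0]. *)
have E2 j (x : fseries X) k : coef (kap ^+ j * x) (j.*2 + k) = k_ 1 ^+ j * coef x k.
  elim: j => [|j IH]; first by rewrite !mul1r.
  rewrite !exprS -!mulrA doubleS !addSn (star_monoml _ _ _ (@wk_const X 1)).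
  by rewrite !subSS subn0 IH ltnS ltn0Sn.
rewrite -addnn E2; congr (_ * _); rewrite /gam /q !coefB /=.
by rewrite double_eq0 (gtn_eqF n_gt0) sub0r opprK.
Qed.

End FormalResidue.

Local Open Scope R_scope.

(** * Matrix-valued symbols *)

Lemma RtoC_N1 (x : C) : Cplus (Cmult (RtoC (-1)) x) x = RtoC 0.
Proof. by rewrite -[X in Cplus _ X]Cmult_1_l -Cmult_plus_distr_r -RtoC_plus Rplus_opp_l Cmult_0_l. Qed.

Lemma sumC_exchange m n (F : 'I_m -> 'I_n -> C) : sumC (fun i => sumC (fun j => F i j)) = sumC (fun j => sumC (fun i => F i j)).
Proof. by rewrite /sumC exchange_big. Qed.

Section Symbols.
Variables n q : nat.
Notation N := (n + n)%N.
Let nz := @opn_nonzero N.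
Implicit Types (y : Pt N).

(* Values at the origin are normalized to 0, so that equality is equality on the punctured space. *)
Record sym := Sym {
  sf : Pt N -> Mat q;
  sf_smooth : forall i j, smooth_on (@nonzero N) (fun y => sf y i j);
  sf_origin : forall y i j, ~ nonzero y -> sf y i j = RtoC 0 }.

Lemma sym_ext (a b : sym) : (forall y i j, nonzero y -> sf a y i j = sf b y i j) -> a = b.
Proof.
case: a b => [f Sf Of] [g Sg Og] /= E.
have fg : f = g.
  apply: functional_extensionality => y; apply: functional_extensionality => i; apply: functional_extensionality => j.
  by case: (classic (nonzero y)) => H; [exact: E | rewrite Of // Og].
by subst g; congr Sym; apply: Prop_irrelevance.
Qed.

Definition rst (f : Pt N -> Mat q) : Pt N -> Mat q := fun y i j => if excluded_middle_informative (nonzero y) then f y i j else RtoC 0.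
Lemma rstE f y i j : nonzero y -> rst f y i j = f y i j. Proof. by rewrite /rst => H; case: excluded_middle_informative. Qed.
Lemma rst_smooth f : (forall i j, smooth_on (@nonzero N) (fun y => f y i j)) -> forall i j, smooth_on (@nonzero N) (fun y => rst f y i j).
Proof. by move=> Sf i j; apply: (smooth_ext nz _ (Sf i j)) => y Hy; rewrite rstE. Qed.
Lemma rst_origin f y i j : ~ nonzero y -> rst f y i j = RtoC 0. Proof. by rewrite /rst => H; case: excluded_middle_informative. Qed.

Definition mk f (Sf : forall i j, smooth_on (@nonzero N) (fun y => f y i j)) : sym := Sym (rst_smooth Sf) (@rst_origin f).
Lemma mkE f Sf y i j : nonzero y -> sf (@mk f Sf) y i j = f y i j. Proof. exact: rstE. Qed.
Lemma partial_mk f Sf a y i j : nonzero y -> partial a (fun y => sf (@mk f Sf) y i j) y = partial a (fun y => f y i j) y.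
Proof. by move=> Hy; apply: (partial_extU a nz Hy) => z Hz; rewrite mkE. Qed.

Definition scalar_symbol (c : Pt N -> C) : Pt N -> Mat q := fun y i j => Cmult (c y) (RtoC (if i == j then 1 else 0)).
Lemma scalar_smooth c : smooth_on (@nonzero N) c -> forall i j, smooth_on (@nonzero N) (fun y => scalar_symbol c y i j).
Proof. by move=> Sc i j; apply: (smooth_mult nz Sc); exact: smooth_const. Qed.

Lemma add_smooth (a b : sym) i j : smooth_on (@nonzero N) (fun y => Cplus (sf a y i j) (sf b y i j)).
Proof. by apply: (smooth_plus nz); exact: sf_smooth. Qed.
Lemma opp_smooth (a : sym) i j : smooth_on (@nonzero N) (fun y => Cmult (RtoC (-1)) (sf a y i j)).
Proof. by apply: (smooth_scal _ nz); exact: sf_smooth. Qed.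
Lemma mul_smooth (a b : sym) i j : smooth_on (@nonzero N) (fun y => sumC (fun l => Cmult (sf a y i l) (sf b y l j))).
Proof. by apply: (smooth_sum nz) => l; apply: (smooth_mult nz); exact: sf_smooth. Qed.
Lemma dl_smooth k (a : sym) i j : smooth_on (@nonzero N) (partial k (fun y => sf a y i j)).
Proof. by apply: smooth_partial; exact: sf_smooth. Qed.

Definition sym0 : sym := mk (fun i j => smooth_const (RtoC 0) nz).
Definition sym_add a b : sym := mk (add_smooth a b).
Definition sym_opp a : sym := mk (opp_smooth a).
Definition sym_scalar c (Sc : smooth_on (@nonzero N) c) : sym := mk (scalar_smooth Sc).
Definition sym1 : sym := sym_scalar (smooth_const (RtoC 1) nz).
Definition sym_mul a b : sym := mk (mul_smooth a b).
Definition sym_dl k a : sym := mk (dl_smooth k a).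

Lemma dlE k (a : sym) y i j : nonzero y -> sf (sym_dl k a) y i j = partial k (fun y => sf a y i j) y. Proof. exact: mkE. Qed.

Lemma sym_addA : associative sym_add.
Proof. by move=> a b c; apply: sym_ext => y i j Hy; rewrite !mkE //; ring. Qed.
Lemma sym_addC : commutative sym_add.
Proof. by move=> a b; apply: sym_ext => y i j Hy; rewrite !mkE //; ring. Qed.
Lemma sym_add0 : left_id sym0 sym_add.
Proof. by move=> a; apply: sym_ext => y i j Hy; rewrite !mkE //; ring. Qed.
Lemma sym_addN : left_inverse sym0 sym_opp sym_add.
Proof. by move=> a; apply: sym_ext => y i j Hy; rewrite !mkE // RtoC_N1. Qed.

HB.instance Definition _ := gen_eqMixin sym.
HB.instance Definition _ := gen_choiceMixin sym.
HB.instance Definition _ := GRing.isZmodule.Build sym sym_addA sym_addC sym_add0 sym_addN.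

Lemma sym_mulA : associative sym_mul.
Proof.
move=> a b c; apply: sym_ext => y i j Hy; rewrite !mkE //.
rewrite (sumC_ext (g := fun l => sumC (fun k => Cmult (sf a y i l) (Cmult (sf b y l k) (sf c y k j))))) => [|l]; last by rewrite mkE // sumC_scal.
rewrite sumC_exchange; apply: sumC_ext => k; rewrite mkE // Cmult_comm -sumC_scal; apply: sumC_ext => l; ring.
Qed.
Lemma scalar_mull c Sc (b : sym) y i j : nonzero y -> sf (sym_mul (@sym_scalar c Sc) b) y i j = Cmult (c y) (sf b y i j).
Proof.
move=> Hy; rewrite mkE // -[sf b y i j](sumC_delta i (fun l => sf b y l j)) -sumC_scal; apply: sumC_ext => l.
by rewrite mkE // /scalar_symbol eq_sym; ring.
Qed.
Lemma scalar_mulr c Sc (b : sym) y i j : nonzero y -> sf (sym_mul b (@sym_scalar c Sc)) y i j = Cmult (c y) (sf b y i j).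
Proof.
move=> Hy; rewrite mkE // -[sf b y i j](sumC_delta j (fun l => sf b y i l)) -sumC_scal; apply: sumC_ext => l.
by rewrite mkE // /scalar_symbol; ring.
Qed.
Lemma sym_mul1 : left_id sym1 sym_mul.
Proof. by move=> a; apply: sym_ext => y i j Hy; rewrite scalar_mull // Cmult_1_l. Qed.
Lemma sym_mulr1 : right_id sym1 sym_mul.
Proof. by move=> a; apply: sym_ext => y i j Hy; rewrite scalar_mulr // Cmult_1_l. Qed.
Lemma sym_mulDl : left_distributive sym_mul sym_add.
Proof. by move=> a b c; apply: sym_ext => y i j Hy; rewrite !mkE // -sumC_plus; apply: sumC_ext => l; rewrite mkE //; ring. Qed.
Lemma sym_mulDr : right_distributive sym_mul sym_add.
Proof. by move=> a b c; apply: sym_ext => y i j Hy; rewrite !mkE // -sumC_plus; apply: sumC_ext => l; rewrite mkE //; ring. Qed.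
HB.instance Definition _ := GRing.Zmodule_isPzRing.Build sym sym_mulA sym_mul1 sym_mulr1 sym_mulDl sym_mulDr.

Local Notation "a +s b" := (GRing.add (a : sym) (b : sym)) (at level 50).
Local Notation "a *s b" := (GRing.mul (a : sym) (b : sym)) (at level 40).

Lemma sfD a b y i j : nonzero y -> sf (a +s b) y i j = Cplus (sf a y i j) (sf b y i j). Proof. exact: mkE. Qed.
Lemma sfN (a : sym) y i j : nonzero y -> sf (GRing.opp a) y i j = Cmult (RtoC (-1)) (sf a y i j). Proof. exact: mkE. Qed.
Lemma sf0 y i j : sf (GRing.zero : sym) y i j = RtoC 0.
Proof. by case: (classic (nonzero y)) => H; [rewrite mkE | rewrite sf_origin]. Qed.
Lemma sfM a b y i j : nonzero y -> sf (a *s b) y i j = sumC (fun l => Cmult (sf a y i l) (sf b y l j)). Proof. exact: mkE. Qed.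
Lemma sf_sum (I : Type) (r : seq I) (P : pred I) (F : I -> sym) y i j : nonzero y ->
  sf (\big[GRing.add/GRing.zero]_(x <- r | P x) F x) y i j = \big[Cplus/RtoC 0]_(x <- r | P x) sf (F x) y i j.
Proof. by move=> Hy; apply: (big_morph (fun a => sf a y i j)) => [a b|]; [exact: sfD | exact: sf0]. Qed.
Lemma sfMn (a : sym) m y i j : nonzero y -> sf (GRing.natmul a m) y i j = Cmult (RtoC (INR m)) (sf a y i j).
Proof.
move=> Hy; elim: m => [|m IH]; first by rewrite GRing.mulr0n sf0 Cmult_0_l.
by rewrite GRing.mulrS sfD // IH S_INR RtoC_plus; ring.
Qed.

Lemma sym_dlD k a b : sym_dl k (sym_add a b) = sym_add (sym_dl k a) (sym_dl k b).
Proof.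
apply: sym_ext => y i j Hy; rewrite /sym_add mkE // !dlE // partial_mk //.
by apply: is_partial_unique; apply: is_partial_plus; apply: (smooth_is_partial k _ Hy); exact: sf_smooth.
Qed.
Lemma sym_dlM k a b : sym_dl k (sym_mul a b) = sym_add (sym_mul (sym_dl k a) b) (sym_mul a (sym_dl k b)).
Proof.
apply: sym_ext => y i j Hy; rewrite /sym_mul dlE // partial_mk // mkE // ![sf (mk (mul_smooth _ _)) _ _ _]mkE // -sumC_plus; apply: is_partial_unique.
rewrite (sumC_ext (g := fun l => Cplus (Cmult (partial k (fun y => sf a y i l) y) (sf b y l j)) (Cmult (sf a y i l) (partial k (fun y => sf b y l j) y)))) => [|l]; last by rewrite !dlE.
apply: (@is_partial_sum N k q (fun l y => Cmult (sf a y i l) (sf b y l j))) => l.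
by apply: is_partial_mult; apply: (smooth_is_partial k _ Hy); exact: sf_smooth.
Qed.
Lemma sym_dlC k l a : sym_dl k (sym_dl l a) = sym_dl l (sym_dl k a).
Proof. by apply: sym_ext => y i j Hy; rewrite !dlE // /sym_dl !partial_mk // (partial_comm k l nz (sf_smooth a i j)). Qed.

Lemma dl_scalar k c (Sc : smooth_on (@nonzero N) c) y i j : nonzero y ->
  sf (sym_dl k (sym_scalar Sc)) y i j = Cmult (partial k c y) (RtoC (if i == j then 1 else 0)).
Proof.
move=> Hy; rewrite dlE // /sym_scalar partial_mk //; apply: is_partial_unique.
have := is_partial_mult (smooth_is_partial k Sc Hy) (is_partial_const k (RtoC (if i == j then 1 else 0)) y).
by congr is_partial; ring.
Qed.

(** The coefficient [(-i)^m / m!] of the composition formula, the concrete value of [wk m]. *)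
Definition kc (m : nat) : C := Cmult (RtoC (/ INR (fact m))) (mi m).
Definition sym_k m : sym := sym_scalar (smooth_const (kc m) nz).

Lemma sym_k0 : sym_k 0 = sym1.
Proof. by apply: sym_ext => y i j Hy; rewrite !mkE // /scalar_symbol /kc /= Rinv_1 Cmult_1_l. Qed.

Lemma mi_add m l : Cmult (mi m) (mi l) = mi (m + l).
Proof. by elim: m => [|m IH]; [rewrite Cmult_1_l | rewrite addSn /= -IH; ring]. Qed.

Lemma fact_factorial m : fact m = m`!. Proof. by elim: m => [|m IH] //; rewrite factS -IH. Qed.

Lemma kc_add m l : Cmult (kc m) (kc l) = Cmult (RtoC (INR 'C(m + l, m))) (kc (m + l)).
Proof.
rewrite /kc -mi_add.
have E : INR 'C(m + l, m) * (INR (fact m) * INR (fact l)) = INR (fact (m + l)).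
  rewrite -!mult_INR; congr INR; rewrite !fact_factorial.
  by have := bin_fact (leq_addr l m); rewrite addKn.
have R : / INR (fact m) * / INR (fact l) = INR 'C(m + l, m) * / INR (fact (m + l)).
  rewrite -E; field; split; last split; try exact: INR_fact_neq_0.
  by move=> H; move: E; rewrite H Rmult_0_l => E; case: (INR_fact_neq_0 (m + l)).
transitivity (Cmult (RtoC (/ INR (fact m) * / INR (fact l))) (Cmult (mi m) (mi l))); first by rewrite RtoC_mult; ring.
by rewrite R RtoC_mult; ring.
Qed.

Lemma sym_kM m l : sym_mul (sym_k m) (sym_k l) = GRing.natmul (sym_k (m + l)) 'C(m + l, m).
Proof. by apply: sym_ext => y i j Hy; rewrite scalar_mull // sfMn // !mkE // /scalar_symbol Cmult_assoc kc_add; ring. Qed.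

Lemma sym_k_const m : const sym_dl (sym_k m).
Proof.
move=> k; apply: sym_ext => y i j Hy; rewrite dl_scalar // sf0.
by rewrite (is_partial_unique (is_partial_const k (kc m) y)) Cmult_0_l.
Qed.
Lemma scalar_central c Sc : central (@sym_scalar c Sc).
Proof. by move=> a; apply: sym_ext => y i j Hy; rewrite scalar_mull // scalar_mulr. Qed.

Definition symW : weylData := @WeylData n sym sym_dl sym_k sym_dlD sym_dlM sym_dlC sym_k0 sym_kM sym_k_const (fun m => @scalar_central _ _).

End Symbols.

(** * Homogeneous functions and divergences *)

Section Homogeneity.
Variable N : nat.
Implicit Types (F G : Pt N -> C) (d e : Z).

Lemma homog1_ext d F G : (forall y, nonzero y -> F y = G y) -> homog1 d F -> homog1 d G.
Proof. by move=> E H t y Ht Hy; rewrite -!E //; [exact: H | exact: nonzero_scale]. Qed.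
Lemma homog1_zero d : homog1 d (fun _ : Pt N => RtoC 0).
Proof. by move=> t y Ht Hy; rewrite Cmult_0_r. Qed.
Lemma homog1_const c : homog1 0 (fun _ : Pt N => c).
Proof. by move=> t y Ht Hy; rewrite /= Cmult_1_l. Qed.
Lemma homog1_plus d F G : homog1 d F -> homog1 d G -> homog1 d (fun y => Cplus (F y) (G y)).
Proof. by move=> HF HG t y Ht Hy; rewrite HF // HG //; ring. Qed.
Lemma homog1_mult d e F G : homog1 d F -> homog1 e G -> homog1 (d + e) (fun y => Cmult (F y) (G y)).
Proof. by move=> HF HG t y Ht Hy; rewrite HF // HG // powerRZ_add ?RtoC_mult; [ring | lra]. Qed.
Lemma homog1_sum d m (F : 'I_m -> Pt N -> C) : (forall k, homog1 d (F k)) -> homog1 d (fun y => sumC (fun k => F k y)).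
Proof. by move=> H t y Ht Hy; rewrite -sumC_scal; apply: sumC_ext => k; apply: H. Qed.
Lemma homog1_scal d c F : homog1 d F -> homog1 d (fun y => Cmult c (F y)).
Proof. by move=> HF t y Ht Hy; rewrite HF //; ring. Qed.

(* Homogeneous divergences of the critical degree, whose spherical integrals vanish. *)
Definition divergence G := exists f : 'I_N -> Pt N -> C,
  (forall a, smooth_on (@nonzero N) (f a)) /\ (forall a, homog1 (1 - Z.of_nat N) (f a)) /\
  forall y, nonzero y -> G y = sumC (fun a => partial a (f a) y).

Lemma divergence_ext G H : (forall y, nonzero y -> G y = H y) -> divergence G -> divergence H.
Proof. by move=> E [f [Sf [Hf Ef]]]; exists f; do 2 split=> //; move=> y Hy; rewrite -E // Ef. Qed.
Lemma divergence_zero : divergence (fun _ => RtoC 0).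
Proof.
exists (fun _ _ => RtoC 0); split; first by move=> a; apply: smooth_const; exact: opn_nonzero.
split=> [a|y Hy]; first exact: homog1_zero.
rewrite (sumC_ext (g := fun _ => Cmult (RtoC 0) (RtoC 0))) ?sumC_scal ?Cmult_0_l // => a.
by rewrite (is_partial_unique (is_partial_const a (RtoC 0) y)); ring.
Qed.
Lemma divergence_plus G H : divergence G -> divergence H -> divergence (fun y => Cplus (G y) (H y)).
Proof.
move=> [f [Sf [Hf Ef]]] [g [Sg [Hg Eg]]]; exists (fun a y => Cplus (f a y) (g a y)); split=> [a|].
  by apply: smooth_plus => //; exact: opn_nonzero.
split=> [a|y Hy]; first exact: homog1_plus.
rewrite Ef // Eg // -sumC_plus; apply: sumC_ext => a; symmetry; apply: is_partial_unique.
by apply: is_partial_plus; exact: smooth_is_partial.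
Qed.
Lemma divergence_scal c G : divergence G -> divergence (fun y => Cmult c (G y)).
Proof.
move=> [f [Sf [Hf Ef]]]; exists (fun a y => Cmult c (f a y)); split=> [a|].
  by apply: smooth_scal => //; exact: opn_nonzero.
split=> [a|y Hy]; first exact: homog1_scal.
rewrite Ef // -sumC_scal; apply: sumC_ext => a; symmetry; apply: is_partial_unique.
by apply: is_partial_scal; exact: smooth_is_partial.
Qed.
Lemma divergence_partial i F : smooth_on (@nonzero N) F -> homog1 (1 - Z.of_nat N) F -> divergence (partial i F).
Proof.
move=> SF HF; exists (fun a y => Cmult (RtoC (if a == i then 1 else 0)) (F y)); split=> [a|].
  by apply: smooth_scal => //; exact: opn_nonzero.
split=> [a|y Hy]; first exact: homog1_scal.
rewrite -[LHS](sumC_delta i (fun a => partial a F y)); apply: sumC_ext => a; symmetry; apply: is_partial_unique.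
by apply: is_partial_scal; exact: smooth_is_partial.
Qed.

End Homogeneity.

Section Residue.
Variables n q : nat.
Notation N := (n + n)%N.
Let nz := @opn_nonzero N.
Notation S := (sym n q).

Definition Hs (d k : nat) (s : S) := forall i j, homog1 (Z.of_nat d - Z.of_nat k) (fun y => sf s y i j).
Definition trace (s : S) y := sumC (fun i => sf s y i i).
Definition Dv (s : S) := divergence (trace s).

Lemma trace_smooth s : smooth_on (@nonzero N) (trace s).
Proof. by apply: (smooth_sum nz) => i; exact: sf_smooth. Qed.

Lemma Hs0 d k : Hs d k (GRing.zero : S).
Proof. by move=> i j; apply: (homog1_ext (F := fun _ => RtoC 0)) (homog1_zero _) => y _; rewrite sf0. Qed.
Lemma HsB d k a b : Hs d k a -> Hs d k b -> Hs d k (GRing.add a (GRing.opp b)).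
Proof.
move=> Ha Hb i j; apply: homog1_ext (homog1_plus (Ha i j) (homog1_scal (RtoC (-1)) (Hb i j))) => y Hy.
by rewrite sfD // sfN.
Qed.
Lemma HsM d k e l a b : Hs d k a -> Hs e l b -> Hs (d + e) (k + l) (GRing.mul a b).
Proof.
move=> Ha Hb i j; have H m := homog1_mult (Ha i m) (Hb m j).
have := homog1_sum H.
have -> : (Z.of_nat d - Z.of_nat k + (Z.of_nat e - Z.of_nat l) = Z.of_nat (d + e) - Z.of_nat (k + l))%Z by lia.
by apply: homog1_ext => y Hy; rewrite sfM.
Qed.
Lemma Hs_dl d k i a : Hs d k a -> Hs d k.+1 (sym_dl i a).
Proof.
move=> Ha u v; have := homog1_partial i (sf_smooth a u v) (Ha u v).
have -> : (Z.of_nat d - Z.of_nat k - 1 = Z.of_nat d - Z.of_nat k.+1)%Z by lia.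
by apply: homog1_ext => y Hy; rewrite dlE.
Qed.
Lemma Hs_scalar d k c (Sc : smooth_on (@nonzero N) c) : homog1 (Z.of_nat d - Z.of_nat k) c -> Hs d k (sym_scalar q Sc).
Proof.
move=> Hc i j; apply: homog1_ext (homog1_scal (RtoC (if i == j then 1 else 0)) Hc) => y Hy.
by rewrite mkE // /scalar_symbol; ring.
Qed.
Lemma Hs_k d m : Hs d d (sym_k n q m).
Proof. by apply: Hs_scalar; rewrite Z.sub_diag; exact: homog1_const. Qed.

Lemma Dv0 : Dv (GRing.zero : S).
Proof.
apply: divergence_ext (divergence_zero _) => y _; rewrite /trace (sumC_ext (g := fun _ => Cmult (RtoC 0) (RtoC 0))) ?sumC_scal ?Cmult_0_l // => i.
by rewrite sf0; ring.
Qed.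
Lemma traceD (a b : S) y : nonzero y -> trace (GRing.add a b) y = Cplus (trace a y) (trace b y).
Proof. by move=> Hy; rewrite -sumC_plus; apply: sumC_ext => i; rewrite sfD. Qed.
Lemma traceN (a : S) y : nonzero y -> trace (GRing.opp a) y = Cmult (RtoC (-1)) (trace a y).
Proof. by move=> Hy; rewrite -sumC_scal; apply: sumC_ext => i; rewrite sfN. Qed.
Lemma DvB a b : Dv a -> Dv b -> Dv (GRing.add a (GRing.opp b)).
Proof.
move=> Ha Hb; apply: divergence_ext (divergence_plus Ha (divergence_scal (RtoC (-1)) Hb)) => y Hy.
by rewrite traceD // traceN.
Qed.
(** The matrix trace of a pointwise commutator vanishes, so the zero field serves as witness. *)
Lemma DvC (a b : S) : Dv (GRing.add (GRing.mul a b) (GRing.opp (GRing.mul b a))).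
Proof.
apply: divergence_ext (divergence_zero _) => y Hy; rewrite traceD // traceN //.
have -> : trace (GRing.mul a b) y = trace (GRing.mul b a) y; last by rewrite Cplus_comm RtoC_N1.
rewrite /trace (sumC_ext (g := fun i => sumC (fun l => Cmult (sf a y i l) (sf b y l i)))) => [|i]; last by rewrite sfM.
by rewrite sumC_exchange; apply: sumC_ext => l; rewrite sfM //; apply: sumC_ext => i; ring.
Qed.
Lemma trace_scalar c Sc (a : S) y : nonzero y -> trace (sym_mul (@sym_scalar n q c Sc) a) y = Cmult (c y) (trace a y).
Proof. by move=> Hy; rewrite -sumC_scal; apply: sumC_ext => i; rewrite scalar_mull. Qed.
Lemma Dvk m (a : S) : Dv a -> Dv (sym_mul (sym_k n q m) a).
Proof. by move=> Ha; apply: divergence_ext (divergence_scal (kc m) Ha) => y Hy; rewrite trace_scalar. Qed.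
(** The arithmetic condition says that [a] has degree [1 - 2n], as [divergence] requires of its
    fields. *)
Lemma Dv_dl d k i (a : S) : Hs d k a -> (d + n.*2 = k.+1)%N -> Dv (sym_dl i a).
Proof.
move=> Ha Hd; have HT : homog1 (1 - Z.of_nat N) (trace a).
  have -> : (1 - Z.of_nat N = Z.of_nat d - Z.of_nat k)%Z by lia.
  exact: (homog1_sum (F := fun i y => sf a y i i)).
apply: divergence_ext (divergence_partial i (trace_smooth a) HT) => y Hy; apply: is_partial_unique.
apply: (@is_partial_sum N i q (fun l y => sf a y l l)) => l; rewrite dlE //.
by apply: smooth_is_partial Hy; exact: sf_smooth.
Qed.

Definition coordinate (i : 'I_N) : S := sym_scalar q (smooth_coord i nz).

Lemma coordinate_dl i j : sym_dl i (coordinate j) = GRing.natmul (sym1 n q) (i == j).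
Proof.
apply: sym_ext => y u v Hy; rewrite dl_scalar // sfMn // (is_partial_unique (is_partial_coord i j y)).
by rewrite mkE // /scalar_symbol eq_sym; case: eqP => _ /=; ring.
Qed.
(** Off the origin some coordinate is nonzero and can be divided out; which one may vary with the
    point. *)
Lemma coordinate_reg (s : S) : (forall i, GRing.mul (coordinate i) s = GRing.zero) -> s = GRing.zero.
Proof.
move=> H; apply: sym_ext => y u v Hy; rewrite sf0.
have /nonzeroP [i Hi] := Hy.
have E : sf (GRing.mul (coordinate i) s) y u v = RtoC 0 by rewrite (H i) sf0.
rewrite scalar_mull // in E.
have -> : sf s y u v = Cmult (RtoC (/ y i)) (Cmult (RtoC (y i)) (sf s y u v)).
  by rewrite Cmult_assoc -RtoC_mult Rinv_l // Cmult_1_l.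
by rewrite E Cmult_0_r.
Qed.
Lemma Hs_coordinate i : Hs 1 0 (coordinate i).
Proof. by apply: Hs_scalar => t y Ht Hy; rewrite /= /vscale Rmult_1_r RtoC_mult. Qed.

Lemma Wd_ext m (a a' b b' : Pt N -> C) y : (forall z, nonzero z -> a z = a' z) -> (forall z, nonzero z -> b z = b' z) -> nonzero y ->
  Wd m a b y = Wd m a' b' y.
Proof.
move=> Ea Eb Hy; elim: m a a' b b' Ea Eb => [|m IH] a a' b b' Ea Eb /=; first by rewrite Ea // Eb.
by apply: sumC_ext => j; apply: IH => z Hz; apply: (partial_extU _ nz Hz).
Qed.

Lemma sf_bidiff m (a b : S) y i k : nonzero y ->
  sf (@bidiff n S (@sym_dl n q) m a b) y i k = sumC (fun l => Wd m (fun y => sf a y i l) (fun y => sf b y l k) y).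
Proof.
move=> Hy; elim: m a b => [|m IH] a b /=; first exact: sfM.
rewrite sf_sum // sumC_exchange; apply: eq_bigr => j _; rewrite IH; apply: sumC_ext => l.
by apply: Wd_ext => // z Hz; rewrite dlE.
Qed.

Lemma sum_pairs (R : pzRingType) K t (F : nat -> nat -> R) :
  (\sum_(i < K.+1) \sum_(j < K.+1) (if (t + i + j == K)%N then F i j else 0))%R =
  (if (K < t)%N then 0 else \sum_(i < (K - t).+1) F i (K - t - i)%N)%R.
Proof.
case: ltnP => Kt; first by rewrite big1 // => i _; rewrite big1 // => j _; case: eqP => //; lia.
have le : (K - t < K.+1)%N by lia.
rewrite (sum_cut (k := (K - t)%N) (F := fun i => (\sum_(j < K.+1) (if (t + i + j == K)%N then F i j else 0))%R)) //; last first.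
  by move=> i Hi; rewrite big1 // => j _; case: eqP => //; lia.
apply: eq_bigr => i _; have li : (K - t - i < K.+1)%N by lia.
have := ltn_ord i => Hi.
rewrite (sum_only (F := fun j => (if (t + i + j == K)%N then F i j else 0)%R) li) => [|j ji]; last by case: eqP => //; lia.
by case: eqP => //; lia.
Qed.

Section Idempotent.
Variables (br : Pt N -> R) (p : Pt N -> Mat q) (h : nat -> Pt N -> Mat q).
Hypotheses (Hbr : bracket_fn br) (Hcl : classical_with br 0%Z p h).
Hypothesis Hidem : forall u : Pt n -> 'I_q -> C, schwartz u -> forall (x : Pt n) (i : 'I_q), op p (op p u) x i = op p u x i.

Lemma term_smooth k i j : smooth_on (@nonzero N) (fun y => h k y i j).
Proof. by case: Hcl => _ [H _]; case: (H k) => Sk _. Qed.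
Lemma term_homog k i j : homog1 (0 - Z.of_nat k) (fun y => h k y i j).
Proof. by case: Hcl => _ [H _]; case: (H k) => _ Hk t y Ht Hy; apply: Hk. Qed.

Let P : fseries (symW n q) := FSeries (fun k => mk (term_smooth k) : wS (symW n q)).

(** [star_idempotent_coef] is this identity coefficient by coefficient; what remains is matching the
    summation ranges. *)
Lemma P_idempotent : (P * P)%R = P.
Proof.
apply: fseries_eq => K; rewrite coefM; apply: sym_ext => y i k Hy.
rewrite sf_sum // [RHS]mkE // (star_idempotent_coef Hbr Hcl Hy Hidem).
rewrite sumC_exchange; apply: eq_bigr => m _.
rewrite (sum_pairs K m.*2 (fun i j => sym_mul (sym_k n q m) (@bidiff n S (@sym_dl n q) m (coef P i) (coef P j)))).
case: ifP => _.
  by rewrite sf0 (sumC_ext (g := fun _ => Cmult (RtoC 0) (RtoC 0))) ?sumC_scal ?Cmult_0_l // => l; ring.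
rewrite sumC_scal sf_sum //.
rewrite (eq_bigr (fun j : 'I_(K - m.*2).+1 => Cmult (kc m) (sumC (fun l => Wd m (fun z => h j z i l) (fun z => h (K - m.*2 - j)%N z l k) y)))) => [|j _].
  rewrite -[LHS]/(sumC (fun j => Cmult (kc m) _)) sumC_scal; congr Cmult.
  exact: sumC_exchange.
rewrite scalar_mull // sf_bidiff //; congr Cmult; apply: sumC_ext => l.
by apply: Wd_ext => // z Hz; rewrite mkE.
Qed.

Lemma trace_term_divergence : (0 < n)%N -> divergence (fun y => sumC (fun i => h n.*2 y i i)).
Proof.
move=> n0.
have HP : @HomA (symW n q) Hs 0 P.
  by move=> k i j; apply: homog1_ext (term_homog k i j) => y Hy; rewrite mkE.
have EP : (\sum_i coordinate i * sym_dl i (coef P 0) = 0 :> S)%R.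
  apply: sym_ext => y i j Hy; rewrite sf_sum // sf0.
  have E := euler (term_smooth 0 i j) (term_homog 0 i j) Hy; rewrite Cmult_0_l in E; apply: etrans E.
  by apply: eq_bigr => a _; rewrite scalar_mull // dlE // partial_mk.
have [m Dm] := @formal_residue (symW n q) Hs Dv Hs0 HsB HsM Hs_dl Hs_k Dv0 DvB DvC Dvk Dv_dl coordinate coordinate_dl
  (fun i => @scalar_central _ _ _ _) coordinate_reg Hs_coordinate P P_idempotent HP EP n0.
have pw j (x : S) y : nonzero y -> trace (GRing.mul (GRing.exp (sym_k n q 1 : S) j) x) y = Cmult (Cpow (kc 1) j) (trace x y).
  move=> Hy; elim: j => [|j IH]; first by rewrite GRing.expr0 GRing.mul1r /= Cmult_1_l.
  by rewrite GRing.exprS -GRing.mulrA trace_scalar // IH /=; ring.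
have mn j (x : S) y : nonzero y -> trace (GRing.natmul x j) y = Cmult (RtoC (INR j)) (trace x y).
  by move=> Hy; rewrite -sumC_scal; apply: sumC_ext => i; rewrite sfMn.
have kc0 : kc 1 <> RtoC 0.
  rewrite /kc /= Rinv_1 Cmult_1_l Cmult_1_r => E; have := congr1 snd E; rewrite /=; lra.
(* The scalar left by [formal_residue]: the integer [m + 1], the power of [kc 1 = -i], and the 2
   from [gam = 2 p - 1]. It is nonzero and divided out. *)
pose c := Cmult (RtoC (INR m.+1)) (Cmult (Cpow (kc 1) n) (RtoC (INR 2))).
have IN j : RtoC (INR j.+1) <> RtoC 0 by move=> /RtoC_inj; exact: not_0_INR.
have c0 : c <> RtoC 0.
  apply: Cmult_neq_0; first exact: IN.
  by apply: Cmult_neq_0; [exact: Cpow_nz | exact: IN].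
apply: divergence_ext (divergence_scal (Cinv c) Dm) => y Hy.
rewrite mn // pw // mn //; set t := trace _ y.
have -> : Cmult (Cinv c) (Cmult (RtoC (INR m.+1)) (Cmult (Cpow (kc 1) n) (Cmult (RtoC (INR 2)) t))) = Cmult (Cmult (Cinv c) c) t by rewrite /c; ring.
rewrite Cinv_l // Cmult_1_l /t.
by apply: sumC_ext => i; rewrite mkE.
Qed.

End Idempotent.
End Residue.

Local Close Scope R_scope.

Theorem mainTheorem16 (n q : nat) (br : Pt (n + n) -> R) (p : Pt (n + n) -> Mat q)
    (h : nat -> Pt (n + n) -> Mat q) :
  bracket_fn br ->
  classical_with br 0%Z p h ->
  (forall u : Pt n -> 'I_q -> C, schwartz u ->
     forall (x : Pt n) (i : 'I_q), op p (op p u) x i = op p u x i) ->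
  Res h = RtoC 0.
Proof.
move=> Hbr Hcl Hidem; rewrite /Res; case: n br p h Hbr Hcl Hidem => [|n] br p h Hbr Hcl Hidem.
  (* In dimension 0 the factor [INR N] of [sphere_int] is 0. *)
  by rewrite /sphere_int /= Cmult_0_l Cmult_0_r.
have [f [Sf [Hf Ef]]] := trace_term_divergence Hbr Hcl Hidem (ltn0Sn n).
have -> : sphere_int (fun th => sumC (fun i => h (n.+1 + n.+1)%N th i i)) = RtoC 0; last by rewrite Cmult_0_r.
(* After the case split the half-dimension is [n.+1], so [k = n + n.+1] and [m = n] satisfy
   [k + 1 = 2 (m + 1)]. *)
apply: (@sphere_int_div (n + n.+1) n _ f _ Sf); first by rewrite -addSn addnn.
  by move=> a; have := Hf a; have -> : (1 - Z.of_nat (n.+1 + n.+1) = - Z.of_nat (n + n.+1))%Z by lia.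
by move=> y /Ef; rewrite -addnn.
Qed.
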